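(* In the operator setting, let $A\in\mathcal{W}(L(\mathcal{X},\mathcal{Y}))$ be invertible with $B=A^{-1}\in L(\mathcal{Y},\mathcal{X})$. Then $B\in\mathcal{W}(L(\mathcal{Y},\mathcal{X}))$ and \[\|B\|_{1,1}\le(2N+1)^d\|B\|_{1,N}\le\frac{\|B\|}{\epsilon_A}\Big(2\psi_A\Big(\frac{\epsilon_A}{\|B\|}\Big)+1\Big)^d,\qquad N=\psi_A\Big(\frac{\epsilon_A}{\|B\|}\Big),\] where $\varkappa(A)=\|A\|\|A^{-1}\|$, $\delta_A=\big(\frac{4\varkappa(A)+3}{4\varkappa(A)+2}\big)^{1/(3d)}$, $\epsilon_A=5^{-d}\Big(16\big(\frac{2\delta_A-1}{\delta_A-1}\big)^d-12\Big)^{-1}$, and $\psi_A:(0,\infty)\to\mathbb{N}$ is \[\psi_A(t)=\min\Big\{K\in\mathbb{N}:\ \Big\|A-\sum_{k\in\mathbb{Z}^d,\,|k|_\infty\le2}\phi^d_{K,k}A\Big\|_{1,K}\le t\Big\}.\]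
   Context: $|k|_\infty=\max_j|k_j|$. Fourier transform $\hat f(\lambda)=\int f(t)e^{-it\cdot\lambda}dt$. A Banach $L^1(\mathbb{R}^d)$-module structure on a Banach space $\mathcal{M}$ associated with a representation $\mathcal{T}:\mathbb{R}^d\to B(\mathcal{M})$ by invertible isometries is a bilinear map $(f,x)\mapsto fx$ with $(f*g)x=f(gx)$, $\|fx\|\le\|f\|_1\|x\|$, $\mathcal{T}(t)(fx)=(f(\cdot+t))x=f(\mathcal{T}(t)x)$, non-degenerate; for $\mathcal{T}$-continuous $x$, $fx=\int f(t)\mathcal{T}(-t)x\,dt$. Operator setting: $\mathcal{X},\mathcal{Y}$ complex Banach spaces; each of $L(\mathcal{X},\mathcal{Y}),L(\mathcal{Y},\mathcal{X}),B(\mathcal{X}),B(\mathcal{Y})$ carries such a module structure with representations $\mathcal{T}_{\mathcal{U}\mathcal{V}}$ satisfying $\mathcal{T}_{\mathcal{U}\mathcal{W}}(t)(BA)=(\mathcal{T}_{\mathcal{V}\mathcal{W}}(t)B)(\mathcal{T}_{\mathcal{U}\mathcal{V}}(t)A)$, and coupled: $A,B$ mutually inverse iff $\mathcal{T}_{\mathcal{X}\mathcal{Y}}(t)A$, $\mathcal{T}_{\mathcal{Y}\mathcal{X}}(t)B$ are, for all $t$. $\hat\phi(\lambda)=\max(1-|\lambda|,0)$; $\phi^d_{N,a}\in L^1(\mathbb{R}^d)$ has $\hat\phi^d_{N,a}(\lambda)=\prod_k\hat\phi((\lambda_k-Na_k)/N)$. $\|A\|_{\mathcal{W}}=\int_{\mathbb{R}^d}\|\phi^d_{1,a}A\|\,da$,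 $\|A\|_{1,N}=5^d\sum_{n\in\mathbb{Z}^d}\|\phi^d_{N,n}A\|$; $\mathcal{W}(L(\mathcal{U},\mathcal{V}))=\{A:\|A\|_{\mathcal{W}}<\infty\}$. $\|B\|$ is the operator norm. *)

(* Defs.v *)
From HB Require Import structures.
From mathcomp Require Import all_boot all_order all_algebra.
From mathcomp Require Import all_classical all_reals all_analysis.
From mathcomp Require Import complex.
From Stdlib Require Import ClassicalEpsilon.
Import Order.TTheory GRing.Theory Num.Theory.

Set Implicit Arguments.
Unset Strict Implicit.
Unset Printing Implicit Defensive.

Local Open Scope classical_set_scope.
Local Open Scope ring_scope.

(* R^d is modelled as d.-tuple R (with its product Borel sigma-algebra). *)
Section Rd.
Variable R : realType.

Definition tadd d (s t : d.-tuple R) : d.-tuple R :=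
  [tuple tnth s i + tnth t i | i < d].
Definition tsub d (s t : d.-tuple R) : d.-tuple R :=
  [tuple tnth s i - tnth t i | i < d].
Definition tdot d (s t : d.-tuple R) : R := \sum_(i < d) tnth s i * tnth t i.
Definition tzero d : d.-tuple R := [tuple (0 : R) | i < d].
Definition of_int_tuple d (n : d.-tuple int) : d.-tuple R :=
  [tuple (tnth n i)%:~R | i < d].

(* Lebesgue integral over R^d, as the iterated one-dimensional Lebesgue
   integral (Tonelli/Fubini: agrees with the d-dimensional Lebesgue
   integral for nonnegative measurable and for integrable functions). *)
Fixpoint intRd (n : nat) : (n.-tuple R -> \bar R) -> \bar R :=
  match n return (n.-tuple R -> \bar R) -> \bar R with
  | 0 => fun f => f [tuple]
  | n'.+1 => fun f =>
      (\int[@lebesgue_measure R]_x intRd (fun t : n'.-tuple R => f (cons_tuple x t)))%E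
  end.

Definition cintRd d (f : d.-tuple R -> R[i]) : R[i] :=
  (fine (intRd (fun t => (complex.Re (f t))%:E)) +i*
   fine (intRd (fun t => (complex.Im (f t))%:E)))%C.

Definition cabs (z : R[i]) : R := Num.sqrt (complex.Re z ^+ 2 + complex.Im z ^+ 2).

Definition L1 d (f : d.-tuple R -> R[i]) : Prop :=
  [/\ measurable_fun [set: d.-tuple R] (fun t => complex.Re (f t)),
      measurable_fun [set: d.-tuple R] (fun t => complex.Im (f t)) &
      (intRd (fun t => (cabs (f t))%:E) < +oo)%E].

Definition L1norm d (f : d.-tuple R -> R[i]) : R :=
  fine (intRd (fun t => (cabs (f t))%:E)).

Definition conv d (f g : d.-tuple R -> R[i]) : d.-tuple R -> R[i] :=
  fun t => cintRd (fun s => f s * g (tsub t s)).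

Definition expi (x : R) : R[i] := (cos x +i* sin x)%C.

Definition fourier d (f : d.-tuple R -> R[i]) (l : d.-tuple R) : R[i] :=
  cintRd (fun t => f t * expi (- tdot t l)).

Definition phi_hat (l : R) : R := Num.max (1 - `|l|) 0.

(* phi^d_{N,a}: the L^1 function whose Fourier transform is
   prod_k phi_hat ((l_k - N a_k)/N)  (unique up to a.e. equality). *)
Definition phid d (N : R) (a : d.-tuple R) : d.-tuple R -> R[i] :=
  epsilon (inhabits (fun _ => 0))
    (fun f => L1 f /\ forall l : d.-tuple R,
       fourier f l = ((\prod_(k < d) phi_hat ((tnth l k - N * tnth a k) / N))%:C)%C).

End Rd.

Section Operators.
Variable R : realType.

Definition rnorm (V : normedModType R[i]) (v : V) : R := complex.Re `|v|.

Definition bounded_linear (U V : normedModType R[i]) (A : U -> V) : Prop :=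
  (forall (c : R[i]) (x y : U), A (c *: x + y) = c *: A x + A y) /\
  exists M : R, forall x, rnorm (A x) <= M * rnorm x.

Definition opnorm (U V : normedModType R[i]) (A : U -> V) : R :=
  sup [set rnorm (A x) | x in [set x : U | rnorm x <= 1]].

(* A Banach L^1(R^d)-module structure  (f, A) |-> act f A  on L(U,V),
   associated with the representation T : R^d -> B(L(U,V)) by invertible
   isometries.  Both act and T are given on the ambient function space
   U -> V; only their behaviour on bounded linear operators matters. *)
Definition banach_module d (U V : normedModType R[i])
  (act : (d.-tuple R -> R[i]) -> (U -> V) -> (U -> V))
  (T : d.-tuple R -> (U -> V) -> (U -> V)) : Prop :=
  (
   (forall t A, bounded_linear A ->
      bounded_linear (T t A) /\ opnorm (T t A) = opnorm A
   ) /\ (forall t (c : R[i]) A B, bounded_linear A -> bounded_linear B ->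
      T t (c *: A + B) = c *: T t A + T t B
   ) /\ (forall A, bounded_linear A -> T (@tzero R d) A = A
   ) /\ (forall s t A, bounded_linear A -> T (tadd s t) A = T s (T t A)
   ) /\
   (forall f A, L1 f -> bounded_linear A -> bounded_linear (act f A)
   ) /\ (forall f g (c : R[i]) A, L1 f -> L1 g -> bounded_linear A ->
      act (fun t => c * f t + g t) A = c *: act f A + act g A
   ) /\ (forall f (c : R[i]) A B, L1 f -> bounded_linear A -> bounded_linear B ->
      act f (c *: A + B) = c *: act f A + act f B
   ) /\
   (forall f g A, L1 f -> L1 g -> bounded_linear A ->
      act (conv f g) A = act f (act g A)
   ) /\
   (forall f A, L1 f -> bounded_linear A ->
      opnorm (act f A) <= L1norm f * opnorm A
   ) /\
   (forall t f A, L1 f -> bounded_linear A ->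
      T t (act f A) = act (fun s => f (tadd s t)) A /\
      act (fun s => f (tadd s t)) A = act f (T t A)
   ) /\
   (forall A, bounded_linear A -> (forall f, L1 f -> act f A = 0) -> A = 0)).

Definition rep_compat d (U V W : normedModType R[i])
  (TUV : d.-tuple R -> (U -> V) -> (U -> V))
  (TVW : d.-tuple R -> (V -> W) -> (V -> W))
  (TUW : d.-tuple R -> (U -> W) -> (U -> W)) : Prop :=
  forall t (A : U -> V) (B : V -> W), bounded_linear A -> bounded_linear B ->
    TUW t (B \o A) = TVW t B \o TUV t A.

Definition mutually_inverse (X Y : normedModType R[i]) (A : X -> Y) (B : Y -> X) :=
  B \o A = id /\ A \o B = id.

Definition operator_setting d (X Y : completeNormedModType R[i])
  (actXY : (d.-tuple R -> R[i]) -> (X -> Y) -> (X -> Y)) TXY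
  (actYX : (d.-tuple R -> R[i]) -> (Y -> X) -> (Y -> X)) TYX
  (actXX : (d.-tuple R -> R[i]) -> (X -> X) -> (X -> X)) TXX
  (actYY : (d.-tuple R -> R[i]) -> (Y -> Y) -> (Y -> Y)) TYY : Prop :=
  [/\ banach_module actXY TXY /\ banach_module actYX TYX,
      banach_module actXX TXX /\ banach_module actYY TYY,
      (rep_compat TXX TXX TXX /\ rep_compat TXX TXY TXY /\
       rep_compat TXY TYX TXX /\ rep_compat TXY TYY TXY /\
       rep_compat TYX TXX TYX /\ rep_compat TYX TXY TYY /\
       rep_compat TYY TYX TYX /\ rep_compat TYY TYY TYY) &
      forall (A : X -> Y) (B : Y -> X), bounded_linear A -> bounded_linear B ->
        (mutually_inverse A B <->
         forall t, mutually_inverse (TXY t A) (TYX t B))].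

Definition Wnorm d (U V : normedModType R[i])
  (act : (d.-tuple R -> R[i]) -> (U -> V) -> (U -> V)) (A : U -> V) : \bar R :=
  intRd (fun a => (opnorm (act (phid 1 a) A))%:E).

Definition inW d (U V : normedModType R[i])
  (act : (d.-tuple R -> R[i]) -> (U -> V) -> (U -> V)) (A : U -> V) : Prop :=
  (Wnorm act A < +oo)%E.

Definition norm1N d (U V : normedModType R[i])
  (act : (d.-tuple R -> R[i]) -> (U -> V) -> (U -> V)) (N : nat) (A : U -> V)
  : \bar R :=
  ((5 ^+ d : R)%:E *
   \esum_(n in [set: d.-tuple int])
      (opnorm (act (phid N%:R (@of_int_tuple R d n)) A))%:E)%E.

(* the k in Z^d with |k|_oo <= 2 *)
Definition box2 d : seq (d.-tuple int) :=
  [seq [tuple ((nat_of_ord (tnth i j))%:Z - 2)%R | j < d] | i : d.-tuple 'I_5].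

(* the set whose minimum is psi_A(t) *)
Definition psi_set d (U V : normedModType R[i])
  (act : (d.-tuple R -> R[i]) -> (U -> V) -> (U -> V)) (A : U -> V) (t : R)
  : set nat :=
  [set K : nat | (0 < K)%N /\
     (norm1N act K (A - \sum_(k <- box2 d) act (phid K%:R (@of_int_tuple R d k)) A)%R
        <= t%:E)%E].

Definition kappa (X Y : normedModType R[i]) (A : X -> Y) (B : Y -> X) : R :=
  opnorm A * opnorm B.

Definition deltaA (d : nat) (kap : R) : R :=
  ((4 * kap + 3) / (4 * kap + 2)) `^ (1 / (3 * d%:R)).

Definition epsA (d : nat) (kap : R) : R :=
  (5 ^+ d)^-1 *
  (16 * ((2 * deltaA d kap - 1) / (deltaA d kap - 1)) ^+ d - 12)^-1.

End Operators.

(* Main.v *)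
Require Import Defs.
From HB Require Import structures.
From mathcomp Require Import all_boot all_order all_algebra.
From mathcomp Require Import all_classical all_reals all_analysis.
From mathcomp Require Import measurable_realfun complex ring lra zify.
From Stdlib Require ClassicalEpsilon.
Import Order.TTheory GRing.Theory Num.Theory.
Import numFieldNormedType.Exports.

(** The action of [L^1] depends on a kernel only through its Fourier transform, hence gives a calculus
    of multipliers by symbols.  Bernstein's inequality with Fejer kernels shows that the spectrum of a
    product lies in the sum of the spectra, so that [phi_{N,n} ((phi_{N,k} S) (phi_{N,l} T))] vanishes
    unless [|n - k - l|_oo <= 2]: the lattice norms are submultiplicative with constant [5^d].

    With [N = psi_A (eps_A / ||B||)], write [A = a + e] where [a = sum_{|k| <= 2} phi_{N,k} A] has its
    spectrum in a cube of half-side [3 N] and [e] is small in the lattice norm.  The inverse [b] of [a]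
    has Taylor coefficients, along each coordinate of the representation, given by the recursion
    [b_{k+1} = - b (sum_i a_{i+1} b_{k-i})]; they are summable against [H^k] with
    [exp (N H) = delta_A ^ d], and comparison with the Bernstein inequality from below gives
    [||phi_{N,n} b|| <= 2 ||b|| x^2 x^{-|n|_oo}], [x = delta_A ^ d].  Summing over the lattice and
    recovering [B] from [b] by the Neumann series of [B = b - b e B] yields the bound, and refining the
    scale from [N] to [1] costs the factor [(2 N + 1)^d]. *)

(** The representation need not be strongly continuous, so the generators [D_j] are used on
    band-limited elements and on inverses of such elements only; this is why the inverse is taken of
    the truncation [a] and not of [A].

    The constants come from three constraints. The spectrum of [a] has half-side [3 N], and
    Bernstein's inequality is used with twice the half-side as its constant, so the recursion for
    the inverse involves [exp (6 N H) = delta_A ^ (6 d) = rho ^ 2] with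
    [rho = (4 kappa + 3) / (4 kappa + 2)]; this [rho] keeps [kappa (rho ^ 2 - 1)] below [1 / 2],
    with room for the perturbation of [kappa]. The decay, summed over the lattice, gives at most
    [||B|| (8 G - 6)] where [G = ((2 delta_A - 1) / (delta_A - 1)) ^ d]; the Neumann series at most
    doubles this, whence [16 G - 12]. That series runs in the lattice norm, where its two products
    cost two factors [5 ^ d]: one is in [eps_A], the other in the definition of the norm that
    [psi_A] tests. *)

Set Implicit Arguments.
Unset Strict Implicit.
Unset Printing Implicit Defensive.

Local Open Scope classical_set_scope.
Local Open Scope ring_scope.

(** * Lebesgue measure on tuples *)

Section tuple_measure.
Variable R : realType.

Definition tcons n (p : measurableTypeR R * n.-tuple R) : n.+1.-tuple R :=
  cons_tuple p.1 p.2.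

Definition tuncons n (t : n.+1.-tuple R) : measurableTypeR R * n.-tuple R :=
  (thead t, [tuple of behead t]).

Lemma tconsK n : cancel (@tcons n) (@tuncons n).
Proof.
by move=> [x t]; rewrite /tuncons /tcons /= theadE; congr pair; exact/val_inj.
Qed.

Lemma measurable_tcons n : measurable_fun setT (@tcons n).
Proof. exact: (measurable_cons (f := fst) (g := snd)). Qed.

Lemma measurable_tuncons n : measurable_fun setT (@tuncons n).
Proof.
apply/measurable_fun_pairP; split; last exact: measurable_behead.
exact: (measurable_tnth (ord0 : 'I_n.+1)).
Qed.

Section cons_measure.
Variables (n : nat) (m : {sigma_finite_measure set (n.-tuple R) -> \bar R}).

Definition cons_measure : set (n.+1.-tuple R) -> \bar R :=
  fun A => (@lebesgue_measure R \x m)%E (@tcons n @^-1` A).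

Let mpre A : measurable A -> measurable (@tcons n @^-1` A).
Proof. by move=> mA; rewrite -[X in measurable X]setTI; exact: measurable_tcons. Qed.

Let cons_measure0 : cons_measure set0 = 0%E.
Proof. by rewrite /cons_measure preimage_set0 measure0. Qed.

Let cons_measure_ge0 A : (0 <= cons_measure A)%E.
Proof. exact: measure_ge0. Qed.

Let cons_measure_additive : semi_sigma_additive cons_measure.
Proof.
move=> F mF tF mUF; rewrite /cons_measure preimage_bigcup.
apply: measure_semi_sigma_additive.
- by move=> k; exact: mpre.
- apply/trivIsetP => /= i j _ _ ij; rewrite -preimage_setI.
  by move/trivIsetP : tF => /(_ _ _ _ _ ij) ->//; rewrite preimage_set0.
- by rewrite -preimage_bigcup; exact: mpre.
Qed.

HB.instance Definition _ := isMeasure.Build _ _ _ cons_measure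
  cons_measure0 cons_measure_ge0 cons_measure_additive.

Let cons_measure_sigma_finite : sigma_finite setT cons_measure.
Proof.
have /sigma_finiteP[F [TF ndF Foo]] := sigma_finiteT (@lebesgue_measure R).
have /sigma_finiteP[G [TG ndG Goo]] := sigma_finiteT m.
exists (fun k => @tuncons n @^-1` (F k `*` G k)).
  rewrite -preimage_bigcup (_ : \bigcup_k (F k `*` G k) = setT) ?preimage_setT //.
  rewrite -subTset => -[x t] _.
  have [i _ Fix] : (\bigcup_k F k) x by rewrite -TF.
  have [j _ Gjt] : (\bigcup_k G k) t by rewrite -TG.
  exists (maxn i j) => //; split.
  - by move: x Fix; exact/subsetPset/ndF/leq_maxl.
  - by move: t Gjt; exact/subsetPset/ndG/leq_maxr.
move=> k; have [mF Fk] := Foo k; have [mG Gk] := Goo k; split.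
  by rewrite -[X in measurable X]setTI; apply: measurable_tuncons => //; exact: measurableX.
rewrite /cons_measure -comp_preimage (_ : _ \o _ = id); last first.
  by apply/funext => p; exact: tconsK.
by rewrite product_measure1E// lte_mul_pinfty// ge0_fin_numE.
Qed.

HB.instance Definition _ := Measure_isSigmaFinite.Build _ _ _ cons_measure
  cons_measure_sigma_finite.

End cons_measure.

Fixpoint Rd_measure n : {sigma_finite_measure set (n.-tuple R) -> \bar R} :=
  match n with
  | 0 => [the {sigma_finite_measure set (0.-tuple R) -> \bar R} of \d_([tuple] : 0.-tuple R)]
  | n'.+1 => [the {sigma_finite_measure set (n'.+1.-tuple R) -> \bar R} of cons_measure (Rd_measure n')]
  end.

Lemma ge0_integral_tcons n (f : n.+1.-tuple R -> \bar R) :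
  measurable_fun setT f -> (forall t, 0 <= f t)%E ->
  (\int[Rd_measure n.+1]_t f t =
   \int[@lebesgue_measure R \x Rd_measure n]_p f (tcons p))%E.
Proof.
move=> mf f0.
have := @ge0_integral_pushforward _ _ _ _ R (@tcons n) (@measurable_tcons n)
  (@lebesgue_measure R \x Rd_measure n)%E setT f measurableT mf.
by move=> <- //; rewrite preimage_setT.
Qed.

Lemma integrable_tcons n (f : n.+1.-tuple R -> \bar R) :
  (Rd_measure n.+1).-integrable setT f ->
  (@lebesgue_measure R \x Rd_measure n)%E.-integrable setT (f \o @tcons n).
Proof.
move=> /integrableP[mf fi]; apply/integrableP; split.
  exact: measurableT_comp (@measurable_tcons n).
have mf' : measurable_fun setT (abse \o f) by exact: measurableT_comp.
have E := ge0_integral_tcons mf' (fun=> abse_ge0 _).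
exact: (eq_ind _ (fun z => (z < +oo)%E) fi _ E).
Qed.

Lemma integral_tcons n (f : n.+1.-tuple R -> \bar R) :
  (Rd_measure n.+1).-integrable setT f ->
  (\int[Rd_measure n.+1]_t f t =
   \int[@lebesgue_measure R \x Rd_measure n]_p f (tcons p))%E.
Proof.
move=> fi.
have := @integral_pushforward _ _ _ _ R (@tcons n) (@measurable_tcons n)
  (@lebesgue_measure R \x Rd_measure n)%E setT f.
move=> <- //; first exact: measurable_int fi.
by rewrite preimage_setT; exact: integrable_tcons.
Qed.

(** Holds without integrability: the outer integral is the difference of the integrals of the
    positive and negative parts, each measurable in the parameter by Tonelli. The parameter type is
    general so that the induction can absorb the coordinate just split off. *)
Lemma measurable_intRd_param d (T : measurableType d) n
    (h : T * n.-tuple R -> \bar R) : measurable_fun setT h ->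
  measurable_fun setT (fun x => intRd (fun t => h (x, t))).
Proof.
elim: n d T h => [|n IH] d T h mh /=.
  by apply: (measurableT_comp mh); apply: measurable_fun_pair.
pose G (p : T * measurableTypeR R) := intRd (fun t : n.-tuple R => h (p.1, cons_tuple p.2 t)).
have mG : measurable_fun setT G.
  apply: (IH _ _ (fun q : (T * measurableTypeR R) * n.-tuple R =>
    h (q.1.1, cons_tuple q.1.2 q.2))).
  apply: (measurableT_comp mh); apply: measurable_fun_pair => /=.
    exact: measurableT_comp.
  apply: (measurable_cons (f := fun q : (T * measurableTypeR R) * n.-tuple R => q.1.2)
     (g := snd)) => //.
  exact: measurableT_comp.
rewrite (_ : (fun _ => _) = fun x => (\int[@lebesgue_measure R]_y (G^\+ (x, y)) -
   \int[@lebesgue_measure R]_y (G^\- (x, y)))%E); last first.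
  apply/funext => x; rewrite [LHS]integralE.
  by congr (_ - _)%E; apply: eq_integral => y _; rewrite ?funeposE ?funenegE.
apply: emeasurable_funB.
- exact: (@measurable_fun_fubini_tonelli_F _ _ T _ R (@lebesgue_measure R) (G^\+)%E
    (measurable_funepos mG) (funepos_ge0 _)).
- exact: (@measurable_fun_fubini_tonelli_F _ _ T _ R (@lebesgue_measure R) (G^\-)%E
    (measurable_funeneg mG) (funeneg_ge0 _)).
Qed.

Lemma measurable_intRd_cons n (f : n.+1.-tuple R -> \bar R) : measurable_fun setT f ->
  measurable_fun setT (fun x : measurableTypeR R => intRd (fun t => f (cons_tuple x t))).
Proof.
move=> mf; apply: (@measurable_intRd_param _ _ _ (f \o @tcons n)).
exact: measurableT_comp (@measurable_tcons n).
Qed.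

Lemma measurable_cons_section n (f : n.+1.-tuple R -> \bar R) x : measurable_fun setT f ->
  measurable_fun setT (fun t : n.-tuple R => f (cons_tuple x t)).
Proof.
move=> mf; apply: (measurableT_comp mf).
by apply: (measurable_cons (f := cst x) (g := id)).
Qed.

Lemma ge0_intRdE n (f : n.-tuple R -> \bar R) :
  measurable_fun setT f -> (forall t, 0 <= f t)%E ->
  intRd f = (\int[Rd_measure n]_t f t)%E.
Proof.
elim: n f => [|n IH] f mf f0 /=.
  by rewrite integral_dirac // diracT mul1e.
rewrite ge0_integral_tcons // fubini_tonelli1 //; last first.
  exact: measurableT_comp (@measurable_tcons n).
by apply: eq_integral => x _; rewrite IH //; exact: measurable_cons_section.
Qed.

Lemma integrable_intRdE n (f : n.-tuple R -> \bar R) :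
  (Rd_measure n).-integrable setT f ->
  intRd f = (\int[Rd_measure n]_t f t)%E.
Proof.
elim: n f => [|n IH] f fi.
  by rewrite /= integral_dirac ?diracT ?mul1e //; exact: measurable_int fi.
have mf := measurable_int _ fi.
rewrite integral_tcons // -integral12_prod_meas1; last exact: integrable_tcons.
(* Sections of an integrable function are integrable only for almost every first coordinate, so the
   induction hypothesis identifies the inner integrals almost everywhere. *)
apply: ae_eq_integral => //.
- exact: measurable_intRd_cons.
- exact: measurable_fubini_F (integrable_tcons fi).
- apply: filterS (ae_integrable1 (integrable_tcons fi)) => x xi _.
  exact: IH.
Qed.

End tuple_measure.

(** * Affine changes of variable on the line *)

Section affine_change.
Variables (R : realType) (c a : R).
Hypothesis c0 : c != 0.

Definition affine_push (A : set (measurableTypeR R)) : \bar R :=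
  @lebesgue_measure R ((fun x : measurableTypeR R => (c * x + a : measurableTypeR R)) @^-1` A).

Let mg : measurable_fun [set: measurableTypeR R] (fun x : measurableTypeR R => (c * x + a : measurableTypeR R)).
Proof. by apply: measurable_funD => //; exact: measurable_funM. Qed.

Let mpre (A : set (measurableTypeR R)) : measurable A -> measurable ((fun x : measurableTypeR R => (c * x + a : measurableTypeR R)) @^-1` A).
Proof. by move=> mA; rewrite -[X in measurable X]setTI; exact: mg. Qed.

Let affine_push0 : affine_push set0 = 0%E.
Proof. by rewrite /affine_push preimage_set0 measure0. Qed.

Let affine_push_ge0 A : (0 <= affine_push A)%E.
Proof. exact: measure_ge0. Qed.

Let affine_push_additive : semi_sigma_additive affine_push.
Proof.
move=> F mF tF mUF; rewrite /affine_push preimage_bigcup.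
apply: measure_semi_sigma_additive.
- by move=> k; exact: mpre.
- apply/trivIsetP => /= i j _ _ ij; rewrite -preimage_setI.
  by move/trivIsetP : tF => /(_ _ _ _ _ ij) ->//; rewrite preimage_set0.
- by rewrite -preimage_bigcup; exact: mpre.
Qed.

HB.instance Definition _ := isMeasure.Build _ _ _ affine_push
  affine_push0 affine_push_ge0 affine_push_additive.

(** Uniqueness of Lebesgue measure reduces this to half-open intervals. For negative [c] the
    preimage changes the side on which it is open, but not its length. *)
Let affine_pushE (A : set (measurableTypeR R)) : measurable A ->
  @lebesgue_measure R A = mscale (NngNum (normr_ge0 c)) affine_push A.
Proof.
move=> mA; apply: lebesgue_measure_unique => //= _ [[u v]] _ <- /=.
rewrite /mscale /= /affine_push.
have [c_lt0|c_gt0|c_eq0] := ltgtP c 0; last by move: c0; rewrite c_eq0 eqxx.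
- rewrite (_ : _ @^-1` _ = `[((v - a) / c)%R, ((u - a) / c)%R[%classic); last first.
    apply/seteqP; split => x /=; rewrite !in_itv /= => /andP[h1 h2].
      by rewrite ler_ndivrMr // ltr_ndivlMr // ![x * c]mulrC; apply/andP; split; lra.
    move: h1 h2; rewrite ler_ndivrMr // ltr_ndivlMr // ![x * c]mulrC => h1 h2.
    by apply/andP; split; lra.
  rewrite !lebesgue_measure_itv /= !lte_fin ltr_ndivrMr // divfK //.
  rewrite ltrD2r; case: ifP => _; last by rewrite mule0.
  rewrite -!EFinD -EFinM; congr EFin.
  by rewrite ltr0_norm //; field.
- rewrite (_ : _ @^-1` _ = `]((u - a) / c)%R, ((v - a) / c)%R]%classic); last first.
    apply/seteqP; split => x /=; rewrite !in_itv /= => /andP[h1 h2].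
      by rewrite ltr_pdivrMr // ler_pdivlMr // ![x * c]mulrC; apply/andP; split; lra.
    move: h1 h2; rewrite ltr_pdivrMr // ler_pdivlMr // ![x * c]mulrC => h1 h2.
    by apply/andP; split; lra.
  rewrite !lebesgue_measure_itv /= !lte_fin ltr_pdivrMr // divfK //.
  rewrite ltrD2r; case: ifP => _; last by rewrite mule0.
  rewrite -!EFinD -EFinM; congr EFin.
  by rewrite gtr0_norm //; field.
Qed.

Lemma ge0_integral_affine (f : R -> \bar R) :
  measurable_fun [set: R] f -> (forall x, 0 <= f x)%E ->
  (\int[@lebesgue_measure R]_x f (c * x + a)%R =
   (`|c|^-1)%:E * \int[@lebesgue_measure R]_x f x)%E.
Proof.
move=> mf f0.
have -> : (\int[@lebesgue_measure R]_x f x =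
    `|c|%:E * \int[@lebesgue_measure R]_x f (c * x + a)%R)%E.
  rewrite (eq_measure_integral (mscale (NngNum (normr_ge0 c)) affine_push)); last first.
    by move=> A mA _; exact: affine_pushE.
  rewrite ge0_integral_mscale //=; congr (_ * _)%E.
  have := @ge0_integral_pushforward _ _ _ _ R _ mg (@lebesgue_measure R) setT f measurableT mf.
  by rewrite preimage_setT => <-.
by rewrite muleA -EFinM mulVf ?mul1e // normr_eq0.
Qed.

Lemma integrable_affine (f : R -> \bar R) :
  (@lebesgue_measure R).-integrable setT f ->
  (@lebesgue_measure R).-integrable setT (fun x => f (c * x + a)%R).
Proof.
move=> /integrableP[mf fi]; apply/integrableP; split.
  exact: (measurableT_comp mf mg).
rewrite (ge0_integral_affine (f := abse \o f));
  [|exact: measurableT_comp|by move=> ?; exact: abse_ge0].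
rewrite lte_mul_pinfty // ge0_fin_numE // ?integral_ge0 //.
Qed.

Lemma integral_affine (f : R -> \bar R) :
  (@lebesgue_measure R).-integrable setT f ->
  (\int[@lebesgue_measure R]_x f (c * x + a)%R =
   (`|c|^-1)%:E * \int[@lebesgue_measure R]_x f x)%E.
Proof.
move=> fi; have mf := measurable_int _ fi.
have p := ge0_integral_affine (measurable_funepos mf) (funepos_ge0 f).
have m := ge0_integral_affine (measurable_funeneg mf) (funeneg_ge0 f).
rewrite integralE [X in (_ = _ * X)%E]integralE muleBr //; first last.
  by rewrite fin_num_adde_defl // fin_numN integrable_neg_fin_num.
by rewrite -p -m; congr (_ - _)%E; apply: eq_integral => x _; rewrite ?funeposE ?funenegE.
Qed.

End affine_change.

(** * Complex-valued integrals *)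

Section cabs.
Variable R : realType.
Implicit Types z w : R[i].

Lemma cabsE z : `|z| = ((cabs z)%:C)%C. Proof. exact: normc_def. Qed.

Lemma cabs_Re z : complex.Re `|z| = cabs z. Proof. by rewrite cabsE. Qed.

Lemma cabs_ge0 z : 0 <= cabs z. Proof. exact: sqrtr_ge0. Qed.

Lemma cabs0 : cabs (0 : R[i]) = 0.
Proof. by rewrite -cabs_Re normr0. Qed.

Lemma cabs1 : cabs (1 : R[i]) = 1.
Proof. by rewrite -cabs_Re normr1. Qed.

Lemma cabsM z w : cabs (z * w) = cabs z * cabs w.
Proof. by rewrite -cabs_Re normrM !cabsE -rmorphM. Qed.

Lemma cabsN z : cabs (- z) = cabs z.
Proof. by rewrite -cabs_Re normrN cabsE. Qed.

Lemma cabsD z w : cabs (z + w) <= cabs z + cabs w.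
Proof. by have := ler_normD z w; rewrite !cabsE -rmorphD /= lecR. Qed.

Lemma cabs_real (x : R) : cabs (x%:C)%C = `|x|.
Proof. by rewrite /cabs /= expr0n addr0 sqrtr_sqr. Qed.

Lemma cabs_expi (x : R) : cabs (expi x) = 1.
Proof. by rewrite /cabs /= cos2Dsin2 sqrtr1. Qed.

Lemma cabs_ge_Re z : `|complex.Re z| <= cabs z.
Proof. by rewrite -sqrtr_sqr ler_wsqrtr // lerDl sqr_ge0. Qed.

Lemma cabs_ge_Im z : `|complex.Im z| <= cabs z.
Proof. by rewrite -sqrtr_sqr ler_wsqrtr // lerDr sqr_ge0. Qed.

Lemma cabs_leD z : cabs z <= `|complex.Re z| + `|complex.Im z|.
Proof.
rewrite -[leRHS]ger0_norm ?addr_ge0 // -sqrtr_sqr ler_wsqrtr // sqrrD !real_normK ?num_real //.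
by rewrite lerD2r lerDl mulrn_wge0 // mulr_ge0.
Qed.

Lemma ReM z w : complex.Re (z * w) = complex.Re z * complex.Re w - complex.Im z * complex.Im w.
Proof. by case: z => ? ?; case: w. Qed.

Lemma ImM z w : complex.Im (z * w) = complex.Re z * complex.Im w + complex.Im z * complex.Re w.
Proof. by case: z => ? ?; case: w. Qed.

Lemma ReD z w : complex.Re (z + w) = complex.Re z + complex.Re w.
Proof. by case: z => ? ?; case: w. Qed.

Lemma ImD z w : complex.Im (z + w) = complex.Im z + complex.Im w.
Proof. by case: z => ? ?; case: w. Qed.

Lemma expiD (x y : R) : expi (x + y) = expi x * expi y.
Proof. by rewrite /expi cosD sinD; congr Complex; rewrite addrC mulrC [X in _ + X]mulrC. Qed.

Lemma expi0 : expi (0 : R) = 1. Proof. by rewrite /expi cos0 sin0. Qed.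

End cabs.

Section cint.
Context d (T : measurableType d) (R : realType).
Implicit Types f g : T -> R[i].

Definition cmeas f := measurable_fun setT (fun x => complex.Re (f x)) /\
  measurable_fun setT (fun x => complex.Im (f x)).

Lemma cmeas_cst (c : R[i]) : cmeas (fun=> c). Proof. by split. Qed.

Lemma cmeasD f g : cmeas f -> cmeas g -> cmeas (fun x => f x + g x).
Proof.
by case=> f1 f2 [g1 g2]; split; under eq_fun do rewrite ?ReD ?ImD; exact: measurable_funD.
Qed.

Lemma cmeasM f g : cmeas f -> cmeas g -> cmeas (fun x => f x * g x).
Proof.
case=> f1 f2 [g1 g2]; split; under eq_fun do rewrite ?ReM ?ImM.
  by apply: measurable_funB; exact: measurable_funM.
by apply: measurable_funD; exact: measurable_funM.
Qed.

Lemma cmeas_real (h : T -> R) : measurable_fun setT h -> cmeas (fun x => ((h x)%:C)%C).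
Proof. by []. Qed.

Lemma cmeas_expi (h : T -> R) : measurable_fun setT h -> cmeas (fun x => expi (h x)).
Proof.
move=> mh; split => /=.
  by apply: (measurableT_comp _ mh); apply: continuous_measurable_fun; exact: continuous_cos.
by apply: (measurableT_comp _ mh); apply: continuous_measurable_fun; exact: continuous_sin.
Qed.

Lemma cmeas_prod (I : Type) (s : seq I) (F : I -> T -> R[i]) :
  (forall i, cmeas (F i)) -> cmeas (fun x => \prod_(i <- s) F i x).
Proof.
move=> mF; elim: s => [|i s IH].
  by under eq_fun do rewrite big_nil; exact: cmeas_cst.
by under eq_fun do rewrite big_cons; exact: cmeasM.
Qed.

Lemma cmeas_cabs f : cmeas f -> measurable_fun setT (fun x => cabs (f x)).
Proof.
move=> [f1 f2]; rewrite /cabs.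
apply: (measurableT_comp (f := @Num.sqrt R)).
  by apply: continuous_measurable_fun; exact: sqrt_continuous.
by apply: measurable_funD; exact: measurable_funX.
Qed.

Lemma cmeas_cabsE f : cmeas f -> measurable_fun setT (fun x => (cabs (f x))%:E).
Proof. by move=> mf; apply/measurable_EFinP; exact: cmeas_cabs. Qed.

Variable mu : {measure set T -> \bar R}.

Definition cintegrable f := cmeas f /\ (\int[mu]_x (cabs (f x))%:E < +oo)%E.

Definition cint f : R[i] := (\int[mu]_x complex.Re (f x) +i* \int[mu]_x complex.Im (f x))%C.

Lemma cintegrable_Re f : cintegrable f -> mu.-integrable setT (fun x => (complex.Re (f x))%:E).
Proof.
case=> -[f1 f2] fi; apply/integrableP; split; first exact/measurable_EFinP.
apply: le_lt_trans fi; apply: ge0_le_integral => //.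
- by apply/measurable_EFinP; apply: measurableT_comp.
- by apply: cmeas_cabsE.
- by move=> x _; rewrite lee_fin cabs_ge_Re.
Qed.

Lemma cintegrable_Im f : cintegrable f -> mu.-integrable setT (fun x => (complex.Im (f x))%:E).
Proof.
case=> -[f1 f2] fi; apply/integrableP; split; first exact/measurable_EFinP.
apply: le_lt_trans fi; apply: ge0_le_integral => //.
- by apply/measurable_EFinP; apply: measurableT_comp.
- by apply: cmeas_cabsE.
- by move=> x _; rewrite lee_fin cabs_ge_Im.
Qed.

Lemma cintegrable_le f (g : T -> R) : cmeas f -> (forall x, cabs (f x) <= g x) ->
  measurable_fun setT g -> (\int[mu]_x (g x)%:E < +oo)%E -> cintegrable f.
Proof.
move=> mf fg mg gi; split => //; apply: le_lt_trans gi; apply: ge0_le_integral => //.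
- by move=> x _; rewrite lee_fin cabs_ge0.
- exact: cmeas_cabsE.
- exact/measurable_EFinP.
- by move=> x _; rewrite lee_fin.
Qed.

Lemma cintegrableD f g : cintegrable f -> cintegrable g -> cintegrable (fun x => f x + g x).
Proof.
move=> [mf fi] [mg gi].
apply: (@cintegrable_le _ (fun x => cabs (f x) + cabs (g x))).
- exact: cmeasD.
- by move=> x; exact: cabsD.
- by apply: measurable_funD; exact: cmeas_cabs.
- under eq_integral do rewrite EFinD.
  rewrite ge0_integralD //; first exact: lte_add_pinfty.
  + by move=> x _; rewrite lee_fin cabs_ge0.
  + exact: cmeas_cabsE.
  + by move=> x _; rewrite lee_fin cabs_ge0.
  + exact: cmeas_cabsE.
Qed.

Lemma cintegrable_bM f g (M : R) : cintegrable f -> cmeas g -> (forall x, cabs (g x) <= M) ->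
  cintegrable (fun x => f x * g x).
Proof.
move=> [mf fi] mg gM.
apply: (@cintegrable_le _ (fun x => cabs (f x) * M)).
- exact: cmeasM.
- by move=> x; rewrite cabsM ler_wpM2l ?cabs_ge0.
- by apply: measurable_funM => //; exact: cmeas_cabs.
- under eq_integral do rewrite EFinM.
  have M0 : 0 <= M by apply: le_trans (cabs_ge0 _) (gM point).
  rewrite ge0_integralZr //; last by move=> x _; rewrite lee_fin cabs_ge0.
    by rewrite muleC lte_mul_pinfty ?lee_fin.
  exact: cmeas_cabsE.
Qed.

Lemma cintegrableZ (c : R[i]) f : cintegrable f -> cintegrable (fun x => c * f x).
Proof.
move=> fi; have -> : (fun x => c * f x) = (fun x => f x * (fun=> c) x).
  by apply/funext => x; rewrite mulrC.
by apply: (cintegrable_bM fi (cmeas_cst c)) => x; exact: lexx.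
Qed.

Lemma cintD f g : cintegrable f -> cintegrable g ->
  cint (fun x => f x + g x) = cint f + cint g.
Proof.
move=> fi gi; rewrite /cint; apply/eqP; rewrite eq_complex /=; apply/andP; split; apply/eqP.
  under eq_Rintegral do rewrite ReD.
  by rewrite RintegralD //; exact: cintegrable_Re.
under eq_Rintegral do rewrite ImD.
by rewrite RintegralD //; exact: cintegrable_Im.
Qed.

Lemma cintZ (c : R[i]) f : cintegrable f -> cint (fun x => c * f x) = c * cint f.
Proof.
move=> fi; have fr := cintegrable_Re fi; have fm := cintegrable_Im fi.
have Zl r h : mu.-integrable setT (EFin \o h) -> mu.-integrable setT (EFin \o (fun x => r * h x)).
  by move=> hi; apply: eq_integrable (integrableZl _ r hi).
apply/eqP; rewrite eq_complex ReM ImM /=; apply/andP; split; apply/eqP.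
  under eq_Rintegral do rewrite ReM.
  by rewrite RintegralB ?RintegralZl //; exact: Zl.
under eq_Rintegral do rewrite ImM.
by rewrite RintegralD ?RintegralZl //; exact: Zl.
Qed.

Lemma eq_cint f g : f =1 g -> cint f = cint g. Proof. by move=> /funext ->. Qed.

Lemma cint0 : cint (fun=> 0) = 0.
Proof. by rewrite /cint /= /Rintegral integral0. Qed.

End cint.

Section cfubini.
Context d1 d2 (T1 : measurableType d1) (T2 : measurableType d2) (R : realType).
Variable m1 : {sigma_finite_measure set T1 -> \bar R}.
Variable m2 : {sigma_finite_measure set T2 -> \bar R}.
Variable H : T1 * T2 -> R[i].

Lemma cintegrable_tonelli : cmeas H ->
  (\int[m1]_x \int[m2]_y (cabs (H (x, y)))%:E < +oo)%E ->
  cintegrable (m1 \x m2)%E H.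
Proof.
move=> mH Hi; split => //; rewrite fubini_tonelli1 //.
  exact: cmeas_cabsE.
by move=> x; rewrite lee_fin cabs_ge0.
Qed.

Hypothesis Hi : cintegrable (m1 \x m2)%E H.
Hypothesis Hx : forall x, cintegrable m2 (fun y => H (x, y)).
Hypothesis Hy : forall y, cintegrable m1 (fun x => H (x, y)).

Lemma cint_prod1 : cint m1 (fun x => cint m2 (fun y => H (x, y))) = cint (m1 \x m2)%E H.
Proof.
apply/eqP; rewrite eq_complex /=; apply/andP; split; apply/eqP; congr fine.
  rewrite -integral12_prod_meas1; last exact: cintegrable_Re.
  by apply: eq_integral => x _; rewrite fineK // integrable_fin_num //; exact: cintegrable_Re.
rewrite -integral12_prod_meas1; last exact: cintegrable_Im.
by apply: eq_integral => x _; rewrite fineK // integrable_fin_num //; exact: cintegrable_Im.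
Qed.

Lemma cint_prod2 : cint m2 (fun y => cint m1 (fun x => H (x, y))) = cint (m1 \x m2)%E H.
Proof.
apply/eqP; rewrite eq_complex /=; apply/andP; split; apply/eqP; congr fine.
  rewrite -integral21_prod_meas1; last exact: cintegrable_Re.
  by apply: eq_integral => x _; rewrite fineK // integrable_fin_num //; exact: cintegrable_Re.
rewrite -integral21_prod_meas1; last exact: cintegrable_Im.
by apply: eq_integral => x _; rewrite fineK // integrable_fin_num //; exact: cintegrable_Im.
Qed.

Lemma cmeas_cint2 : cmeas (fun y => cint m1 (fun x => H (x, y))).
Proof.
split => /=.
  have h := measurable_fubini_G (cintegrable_Re Hi).
  apply/measurable_EFinP; rewrite (_ : EFin \o _ = fubini_G m1 (fun p => (complex.Re (H p))%:E)) //.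
  by apply/funext => x /=; rewrite fineK // integrable_fin_num //; exact: cintegrable_Re.
have h := measurable_fubini_G (cintegrable_Im Hi).
apply/measurable_EFinP; rewrite (_ : EFin \o _ = fubini_G m1 (fun p => (complex.Im (H p))%:E)) //.
by apply/funext => x /=; rewrite fineK // integrable_fin_num //; exact: cintegrable_Im.
Qed.

End cfubini.

Section cint_more.
Context d (T : measurableType d) (R : realType) (mu : {measure set T -> \bar R}).

(** Bounding real and imaginary parts separately costs the factor 2; the lemma serves to establish
    finiteness and boundedness, where the constant is immaterial. *)
Lemma cabs_cint_le (f : T -> R[i]) : cintegrable mu f ->
  ((cabs (cint mu f))%:E <= 2%:E * \int[mu]_x (cabs (f x))%:E)%E.
Proof.
move=> fi; have [[f1 f2] _] := fi.
have key (h : T -> R) : measurable_fun setT h -> mu.-integrable setT (EFin \o h) ->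
    (forall x, `|h x| <= cabs (f x)) ->
    (`|\int[mu]_x h x|%:E <= \int[mu]_x (cabs (f x))%:E)%E.
  move=> mh hi hf; rewrite EFin_normr_Rintegral //.
  apply: le_trans (le_abse_integral mu _ _) _ => //; first exact/measurable_EFinP.
  apply: ge0_le_integral => //.
  - by apply: measurableT_comp => //; exact/measurable_EFinP.
  - by apply: cmeas_cabsE; case: fi.
  - by move=> x _; rewrite lee_fin.
apply: (@le_trans _ _ (`|\int[mu]_x complex.Re (f x)|%:E + `|\int[mu]_x complex.Im (f x)|%:E)%E).
  by rewrite -EFinD lee_fin; exact: cabs_leD.
rewrite (_ : 2%:E = 1 + 1)%E; last by rewrite -EFinD.
rewrite ge0_muleDl // mul1e leeD // key //.
- exact: cintegrable_Re.
- by move=> x; exact: cabs_ge_Re.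
- exact: cintegrable_Im.
- by move=> x; exact: cabs_ge_Im.
Qed.

Variable g : T -> T.
Hypothesis mg : measurable_fun setT g.
Hypothesis g_pres : forall f : T -> \bar R, measurable_fun setT f -> (forall x, 0 <= f x)%E ->
  (\int[mu]_x f (g x) = \int[mu]_x f x)%E.

Lemma integral_pres (f : T -> \bar R) : measurable_fun setT f ->
  (\int[mu]_x f (g x) = \int[mu]_x f x)%E.
Proof.
move=> mf; rewrite integralE [RHS]integralE.
rewrite -(g_pres (measurable_funepos mf)) // -(g_pres (measurable_funeneg mf)) //.
by congr (_ - _)%E; apply: eq_integral => x _; rewrite ?funeposE ?funenegE.
Qed.

Lemma cmeas_pres (f : T -> R[i]) : cmeas f -> cmeas (fun x => f (g x)).
Proof.
by case=> f1 f2; split; [exact: (measurableT_comp f1 mg)|exact: (measurableT_comp f2 mg)].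
Qed.

Lemma cintegrable_pres (f : T -> R[i]) : cintegrable mu f -> cintegrable mu (fun x => f (g x)).
Proof.
move=> [mf fi]; split; first exact: cmeas_pres.
rewrite (g_pres (f := fun x => (cabs (f x))%:E)) //; first exact: cmeas_cabsE.
by move=> x; rewrite lee_fin cabs_ge0.
Qed.

Lemma cint_pres (f : T -> R[i]) : cmeas f -> cint mu (fun x => f (g x)) = cint mu f.
Proof.
case=> f1 f2; rewrite /cint; congr Complex; congr fine.
  by rewrite (integral_pres (f := fun x => (complex.Re (f x))%:E)) //; exact/measurable_EFinP.
by rewrite (integral_pres (f := fun x => (complex.Im (f x))%:E)) //; exact/measurable_EFinP.
Qed.

End cint_more.

(** * Translations and reflections of R^d *)

Section Rd_affine.
Variable R : realType.

(** With [e = 1] and [e = -1], translations and the reflection [s |-> a - s] of convolutions share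
    one change of variables. *)
Definition taff d (e : R) (a t : d.-tuple R) : d.-tuple R :=
  [tuple e * tnth t i + tnth a i | i < d].

Lemma tsubE d (t s : d.-tuple R) : tsub t s = taff (-1) t s.
Proof. by apply: eq_from_tnth => i; rewrite !tnth_mktuple mulN1r addrC. Qed.

Lemma taddE d (t s : d.-tuple R) : tadd s t = taff 1 t s.
Proof. by apply: eq_from_tnth => i; rewrite !tnth_mktuple mul1r. Qed.

Lemma measurable_tuple_of d' (T : measurableType d') d (f : 'I_d -> T -> R) :
  (forall i, measurable_fun setT (f i)) ->
  measurable_fun setT (fun t => [tuple f i t | i < d]).
Proof.
move=> mf; apply/measurable_fun_tnthP => i.
rewrite (_ : _ \o _ = f i); first exact: mf.
by apply/funext => t /=; rewrite tnth_mktuple.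
Qed.

Lemma measurable_taff d e (a : d.-tuple R) : measurable_fun setT (taff e a).
Proof.
apply: measurable_tuple_of => i.
by apply: measurable_funD => //; apply: measurable_funM => //; exact: measurable_tnth.
Qed.

Lemma taff_cons n e (a : n.+1.-tuple R) x (t : n.-tuple R) :
  taff e a (tcons (x, t)) = tcons (e * x + thead a, taff e [tuple of behead a] t).
Proof.
apply: eq_from_tnth => i; rewrite tnth_mktuple /tcons /=.
have [->|i0] := eqVneq i ord0; first by rewrite !tnth0.
have [j ->] : exists j : 'I_n, i = lift ord0 j.
  by case: (unliftP ord0 i) i0 => [j ->|->]; [exists j|rewrite eqxx].
rewrite !tnthS tnth_mktuple.
by congr (_ + _); rewrite {1}(tuple_eta a) tnthS.
Qed.

Lemma ge0_integral_taff d e (a : d.-tuple R) (f : d.-tuple R -> \bar R) : `|e| = 1 ->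
  measurable_fun setT f -> (forall t, 0 <= f t)%E ->
  (\int[Rd_measure R d]_t f (taff e a t) = \int[Rd_measure R d]_t f t)%E.
Proof.
move=> e1; elim: d a f => [|n IH] a f mf f0.
  by apply: eq_integral => t _; congr f; apply: eq_from_tnth => -[].
have mfa : measurable_fun setT (f \o taff e a) by exact: measurableT_comp (measurable_taff e a).
have mfc : measurable_fun setT (f \o @tcons R n) by exact: measurableT_comp (@measurable_tcons R n).
apply: etrans (ge0_integral_tcons mfa (fun=> f0 _)) _.
apply: etrans _ (esym (ge0_integral_tcons mf f0)).
have mfac : measurable_fun setT ((f \o taff e a) \o @tcons R n).
  exact: measurableT_comp (@measurable_tcons R n).
apply: etrans (fubini_tonelli1 _ mfac (fun=> f0 _)) _.
apply: etrans _ (esym (fubini_tonelli1 _ mfc (fun=> f0 _))).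
have e0 : e != 0 by rewrite -normr_eq0 e1 oner_eq0.
have := ge0_integral_affine (thead a) e0 (f := fubini_F (Rd_measure R n) (f \o @tcons R n)).
rewrite e1 invr1 mul1e => <-; last 2 first.
- exact: (measurable_fun_fubini_tonelli_F _ mfc (fun=> f0 _)).
- by move=> x; apply: integral_ge0 => t _; exact: f0.
apply: eq_integral => x _; rewrite /fubini_F /=.
under eq_integral do rewrite taff_cons.
rewrite (IH [tuple of behead a] (fun t => f (tcons (e * x + thead a, t)))) //.
exact: measurable_cons_section.
Qed.

End Rd_affine.

(** * The convolution algebra *)

Section L1_space.
Variables (R : realType) (d : nat).
Local Notation mu := (Rd_measure R d).
Implicit Types (f g : d.-tuple R -> R[i]) (t s l : d.-tuple R).

Lemma intRd_cabs f : cmeas f -> intRd (fun t => (cabs (f t))%:E) = (\int[mu]_t (cabs (f t))%:E)%E.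
Proof.
move=> mf; rewrite ge0_intRdE //; first exact: cmeas_cabsE.
by move=> t; rewrite lee_fin cabs_ge0.
Qed.

Lemma L1P f : L1 f <-> cintegrable mu f.
Proof.
split=> [[f1 f2 fi]|[[f1 f2] fi]].
  have mf : cmeas f by split.
  by split=> //; rewrite -intRd_cabs.
by split => //; rewrite intRd_cabs.
Qed.

Lemma cintRdE f : L1 f -> cintRd f = cint mu f.
Proof.
move=> /L1P fi; rewrite /cintRd /cint.
by rewrite !integrable_intRdE //; [exact: cintegrable_Im|exact: cintegrable_Re].
Qed.

Lemma L1normE f : L1 f -> (L1norm f)%:E = (\int[mu]_t (cabs (f t))%:E)%E.
Proof.
move=> /L1P[mf fi]; rewrite /L1norm intRd_cabs // fineK // ge0_fin_numE //.
by apply: integral_ge0 => t _; rewrite lee_fin cabs_ge0.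
Qed.

Lemma L1norm_ge0 f : L1 f -> 0 <= L1norm f.
Proof.
move=> fi; rewrite -lee_fin L1normE //.
by apply: integral_ge0 => t _; rewrite lee_fin cabs_ge0.
Qed.

Lemma L1D f g : L1 f -> L1 g -> L1 (fun t => f t + g t).
Proof. by move=> /L1P fi /L1P gi; apply/L1P; exact: cintegrableD. Qed.

Lemma L1Z c f : L1 f -> L1 (fun t => c * f t).
Proof. by move=> /L1P fi; apply/L1P; exact: cintegrableZ. Qed.

Lemma L1_lin c f g : L1 f -> L1 g -> L1 (fun t => c * f t + g t).
Proof. by move=> fi gi; apply: L1D => //; exact: L1Z. Qed.

Lemma L1_cst0 : L1 (fun _ : d.-tuple R => (0 : R[i])).
Proof.
apply/L1P; split; first exact: cmeas_cst.
by under eq_integral do rewrite cabs0; rewrite integral0.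
Qed.

Lemma measurable_tdot l : measurable_fun setT (fun t => tdot t l).
Proof.
rewrite /tdot; apply: measurable_sum => i.
by apply: measurable_funM => //; exact: measurable_tnth.
Qed.

Lemma cmeas_mod l : cmeas (fun t => expi (- tdot t l)).
Proof. by apply: cmeas_expi; apply: measurableT_comp => //; exact: measurable_tdot. Qed.

Lemma L1_mod f l : L1 f -> L1 (fun t => f t * expi (- tdot t l)).
Proof.
move=> /L1P fi; apply/L1P; apply: (cintegrable_bM fi (M := 1)); first exact: cmeas_mod.
by move=> t; rewrite cabs_expi.
Qed.

Lemma fourierE f l : L1 f -> fourier f l = cint mu (fun t => f t * expi (- tdot t l)).
Proof. by move=> fi; rewrite /fourier cintRdE //; exact: L1_mod. Qed.

Lemma fourier_lin c f g l : L1 f -> L1 g ->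
  fourier (fun t => c * f t + g t) l = c * fourier f l + fourier g l.
Proof.
move=> fi gi; rewrite !fourierE //; last exact: L1_lin.
rewrite -cintZ; last exact/L1P/L1_mod.
rewrite -cintD; [|apply: cintegrableZ|]; try exact/L1P/L1_mod.
by apply: eq_cint => t; rewrite mulrDl mulrA.
Qed.

Lemma tdot_taff e (a t l : d.-tuple R) : tdot (taff e a t) l = e * tdot t l + tdot a l.
Proof.
rewrite /tdot mulr_sumr -big_split; apply: eq_bigr => i _ /=.
by rewrite tnth_mktuple mulrDl mulrA.
Qed.

Lemma cint_taff e a f : `|e| = 1 -> cmeas f -> cint mu (fun t => f (taff e a t)) = cint mu f.
Proof.
move=> e1 mf; apply: (@cint_pres _ _ _ mu (taff e a) _ f mf) => h mh h0.
exact: ge0_integral_taff.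
Qed.

Lemma L1_taff e a f : `|e| = 1 -> L1 f -> L1 (fun t => f (taff e a t)).
Proof.
move=> e1 /L1P fi; apply/L1P; apply: (cintegrable_pres (g := taff e a)) => //.
  exact: measurable_taff.
by move=> h mh h0; exact: ge0_integral_taff.
Qed.

Lemma L1_shift f a : L1 f -> L1 (fun s => f (tadd s a)).
Proof.
move=> fi; rewrite (_ : (fun _ => _) = fun s => f (taff 1 a s)).
  by apply: L1_taff => //; rewrite normr1.
by apply/funext => s; rewrite taddE.
Qed.

Lemma fourier_shift f a l : L1 f -> fourier (fun s => f (tadd s a)) l = expi (tdot a l) * fourier f l.
Proof.
move=> fi; rewrite !fourierE //; last exact: L1_shift.
have mfi := L1_mod l fi; have /L1P[mfm _] := mfi.
rewrite -(cint_taff a (normr1 _) mfm) -cintZ; last first.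
  by apply/L1P; apply: (L1_taff a _ mfi); rewrite normr1.
apply: eq_cint => s; rewrite -taddE mulrCA -expiD; congr (_ * expi _).
by rewrite taddE tdot_taff mul1r; ring.
Qed.

Lemma cmeas_tsub f : cmeas f -> cmeas (fun p : d.-tuple R * d.-tuple R => f (tsub p.2 p.1)).
Proof.
move=> [f1 f2].
have m : measurable_fun setT (fun p : d.-tuple R * d.-tuple R => tsub p.2 p.1).
  apply: measurable_tuple_of => i; apply: measurable_funB.
    exact: measurableT_comp (measurable_tnth i) _.
  exact: measurableT_comp (measurable_tnth i) _.
by split; [exact: (measurableT_comp f1 m)|exact: (measurableT_comp f2 m)].
Qed.

Lemma cmeas_fst f : cmeas f -> cmeas (fun p : d.-tuple R * d.-tuple R => f p.1).
Proof.
by move=> [f1 f2]; split; [exact: (measurableT_comp f1)|exact: (measurableT_comp f2)].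
Qed.

Lemma cmeas_snd f : cmeas f -> cmeas (fun p : d.-tuple R * d.-tuple R => f p.2).
Proof.
by move=> [f1 f2]; split; [exact: (measurableT_comp f1)|exact: (measurableT_comp f2)].
Qed.

Section conv.
Variables (f g : d.-tuple R -> R[i]) (Mg : R).
Hypotheses (fi : L1 f) (gi : L1 g) (gb : forall t, cabs (g t) <= Mg).

Let H (p : d.-tuple R * d.-tuple R) := f p.1 * g (tsub p.2 p.1).

Let mH : cmeas H.
Proof.
have /L1P[mf _] := fi; have /L1P[mg _] := gi.
by apply: cmeasM; [exact: cmeas_fst|exact: cmeas_tsub].
Qed.

Lemma L1_tsubl t : L1 (fun s => g (tsub t s)).
Proof.
rewrite (_ : (fun _ => _) = fun s => g (taff (-1) t s)).
  by apply: L1_taff => //; rewrite normrN normr1.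
by apply/funext => s; rewrite tsubE.
Qed.

Lemma L1_tsubr s : L1 (fun t => g (tsub t s)).
Proof.
pose ms : d.-tuple R := [tuple - tnth s i | i < d].
rewrite (_ : (fun _ => _) = fun t => g (taff 1 ms t)).
  by apply: L1_taff => //; rewrite normr1.
by apply/funext => t; congr g; apply: eq_from_tnth => i; rewrite !tnth_mktuple mul1r.
Qed.

Lemma integral_tsubr s : (\int[mu]_t (cabs (g (tsub t s)))%:E = (L1norm g)%:E)%E.
Proof.
have /L1P[mg _] := gi.
pose ms : d.-tuple R := [tuple - tnth s i | i < d].
rewrite L1normE // -(ge0_integral_taff ms (normr1 _) (f := fun t => (cabs (g t))%:E)) //; last 2 first.
- exact: cmeas_cabsE.
- by move=> t; rewrite lee_fin cabs_ge0.
apply: eq_integral => t _; congr (cabs (g _))%:E.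
by apply: eq_from_tnth => i; rewrite !tnth_mktuple mul1r.
Qed.

(** Boundedness of [g] makes every section of the convolution integrand integrable, not merely
    almost every one, so the convolution is an absolutely convergent integral at each point. *)
Lemma L1_conv_section t : L1 (fun s => f s * g (tsub t s)).
Proof.
apply/L1P; apply: (cintegrable_bM _ (M := Mg)); first exact/L1P.
- by have /L1P[] := L1_tsubl t.
- by move=> s; exact: gb.
Qed.

Lemma conv_cint t : Defs.conv f g t = cint mu (fun s => f s * g (tsub t s)).
Proof. by rewrite /Defs.conv cintRdE //; exact: L1_conv_section. Qed.

Let int_H : (\int[mu]_s \int[mu]_t (cabs (H (s, t)))%:E = (L1norm f * L1norm g)%:E)%E.
Proof.
have /L1P[mf _] := fi; have /L1P[mg _] := gi.
under eq_integral => s _.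
  under eq_integral do rewrite /H /= cabsM EFinM.
  rewrite ge0_integralZl //; first rewrite integral_tsubr; first over.
  - by apply: cmeas_cabsE; have /L1P[] := L1_tsubr s.
  - by move=> t _; rewrite lee_fin cabs_ge0.
  - by rewrite lee_fin cabs_ge0.
rewrite ge0_integralZr //; first by rewrite -L1normE.
- exact: cmeas_cabsE.
- by move=> t _; rewrite lee_fin cabs_ge0.
- by rewrite lee_fin L1norm_ge0.
Qed.

Let Hi : cintegrable (mu \x mu)%E H.
Proof. by apply: cintegrable_tonelli => //; rewrite int_H ltry. Qed.

Lemma L1_conv : L1 (Defs.conv f g).
Proof.
rewrite (_ : Defs.conv f g = fun t => cint mu (fun s => H (s, t))); last first.
  by apply/funext => t; rewrite conv_cint.
have Hy t : cintegrable mu (fun s => H (s, t)) by apply/L1P; exact: L1_conv_section.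
have mc : cmeas (fun t => cint mu (fun s => H (s, t))) by exact: (cmeas_cint2 Hi Hy).
apply/L1P; split => //.
have mHc : measurable_fun setT (fun p => (cabs (H p))%:E) by exact: cmeas_cabsE.
have H0 p : (0 <= (cabs (H p))%:E)%E by rewrite lee_fin cabs_ge0.
apply: (@le_lt_trans _ _ (\int[mu]_t (2%:E * \int[mu]_s (cabs (H (s, t)))%:E))%E).
  apply: ge0_le_integral => //.
  - by move=> t _; rewrite lee_fin cabs_ge0.
  - exact: cmeas_cabsE.
  - apply: measurable_funeM.
    exact: (@measurable_fun_fubini_tonelli_G _ _ _ _ R mu (fun p => (cabs (H p))%:E) mHc H0).
  - by move=> t _; apply: cabs_cint_le.
rewrite ge0_integralZl //; last 2 first.
- exact: (@measurable_fun_fubini_tonelli_G _ _ _ _ R mu (fun p => (cabs (H p))%:E) mHc H0).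
- by move=> t _; apply: integral_ge0.
have := @fubini_tonelli2 _ _ _ _ R mu mu (fun p => (cabs (H p))%:E) mHc H0.
rewrite /fubini_G /= => <-; rewrite fubini_tonelli1 // /fubini_F int_H.
by rewrite -EFinM ltry.
Qed.

Lemma conv_bounded t : cabs (Defs.conv f g t) <= 2 * (Mg * L1norm f).
Proof.
rewrite conv_cint -lee_fin.
apply: le_trans (cabs_cint_le _) _; first by apply/L1P; exact: L1_conv_section.
have /L1P[mf _] := fi; have M0 : 0 <= Mg by apply: le_trans (cabs_ge0 _) (gb t).
rewrite EFinM lee_wpmul2l // EFinM L1normE // -ge0_integralZl //; last 2 first.
- exact: cmeas_cabsE.
- by move=> s _; rewrite lee_fin cabs_ge0.
apply: ge0_le_integral => //.
- by move=> s _; rewrite lee_fin cabs_ge0.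
- by apply: cmeas_cabsE; have /L1P[] := L1_conv_section t.
- by apply: measurable_funeM; exact: cmeas_cabsE.
- by move=> s _; rewrite -EFinM lee_fin cabsM mulrC ler_wpM2r ?cabs_ge0.
Qed.

Lemma fourier_conv l : fourier (Defs.conv f g) l = fourier f l * fourier g l.
Proof.
rewrite !fourierE //; last exact: L1_conv.
have /L1P[mf _] := fi; have /L1P[mg _] := gi.
pose K (p : d.-tuple R * d.-tuple R) := H p * expi (- tdot p.2 l).
have Ki : cintegrable (mu \x mu)%E K.
  apply: (cintegrable_bM Hi (M := 1)).
    exact: (cmeas_snd (cmeas_mod l)).
  by move=> p; rewrite cabs_expi.
transitivity (cint mu (fun t => cint mu (fun s => K (s, t)))).
  apply: eq_cint => t; rewrite conv_cint mulrC -cintZ; last exact/L1P/L1_conv_section.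
  by apply: eq_cint => s; rewrite /K mulrC.
have E s t : K (s, t) = f s * expi (- tdot s l) * (g (tsub t s) * expi (- tdot (tsub t s) l)).
  rewrite /K /H /= mulrACA -expiD; congr (_ * expi _).
  by rewrite tsubE tdot_taff; ring.
have gml := L1_mod l gi.
have shl s : cint mu (fun t => g (tsub t s) * expi (- tdot (tsub t s) l)) =
    cint mu (fun t => g t * expi (- tdot t l)).
  pose ms : d.-tuple R := [tuple - tnth s i | i < d].
  have /L1P[mgm _] := gml; rewrite -(cint_taff ms (normr1 _) mgm).
  apply: eq_cint => t; suff -> : tsub t s = taff 1 ms t by [].
  by apply: eq_from_tnth => i; rewrite !tnth_mktuple mul1r.
have shi s : L1 (fun t => g (tsub t s) * expi (- tdot (tsub t s) l)).
  pose ms : d.-tuple R := [tuple - tnth s i | i < d].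
  have := L1_taff ms (normr1 _) gml; congr L1.
  apply/funext => t; suff -> : tsub t s = taff 1 ms t by [].
  by apply: eq_from_tnth => i; rewrite !tnth_mktuple mul1r.
rewrite cint_prod2 //; last first.
  move=> t; apply: (cintegrable_bM _ (M := 1)); last by move=> s; rewrite cabs_expi.
    by apply/L1P; exact: L1_conv_section.
  exact: (cmeas_cst _ (expi (- tdot t l))).
rewrite -cint_prod1 //; last first.
  move=> s; under eq_fun do rewrite E.
  by apply: cintegrableZ; exact/L1P.
rewrite [RHS]mulrC -cintZ; last exact/L1P/L1_mod.
apply: eq_cint => s; under eq_cint do rewrite E.
by rewrite cintZ ?shl 1?mulrC //; exact/L1P.
Qed.

End conv.

End L1_space.

(** * Fejer kernels *)

Section one_dim.
Variable R : realType.
Local Notation leb := (@lebesgue_measure R).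
Implicit Types (f g : R -> R[i]) (s r : R -> R[i]).

Lemma FTC_everywhere (F f : R -> R) (a b : R) : a < b ->
  (forall x : R, is_derive x (1 : R) F (f x)) -> continuous f ->
  (\int[leb]_(x in `[a, b]) (f x)%:E = (F b - F a)%:E)%E.
Proof.
move=> ab dF cf.
have cF x : {for x, continuous F}.
  by apply: differentiable_continuous; apply/derivable1_diffP; case: (dF x).
rewrite (continuous_FTC2 ab (F := F)) ?EFinB //.
- exact: continuous_subspaceT.
- split; first by move=> x _; case: (dF x).
  + by apply: cvg_at_right_filter; exact: cF.
  + by apply: cvg_at_left_filter; exact: cF.
- by move=> x _; rewrite derive1E; exact: derive_val.
Qed.

Definition four1 f (y : R) : R[i] := cint leb (fun x => f x * expi (- (x * y))).

(** Pointwise boundedness is recorded because it passes to tensor products and makes convolutions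
    with them converge at every point. *)
Definition kern1 f s (C : R) := [/\ cintegrable leb f,
  exists M, forall x, cabs (f x) <= M,
  (\int[leb]_x (cabs (f x))%:E <= C%:E)%E & forall y, four1 f y = s y].

Lemma cmeas_mod1 (y : R) : cmeas (fun x : R => expi (- (x * y))).
Proof.
by apply: cmeas_expi; apply: measurableT_comp => //; exact: measurable_funM.
Qed.

Lemma cintegrable_mod1 f y : cintegrable leb f -> cintegrable leb (fun x => f x * expi (- (x * y))).
Proof.
move=> fi; apply: (cintegrable_bM fi (M := 1)); first exact: cmeas_mod1.
by move=> x; rewrite cabs_expi.
Qed.

Lemma kern1_lin (a : R[i]) f g s r C D : kern1 f s C -> kern1 g r D ->
  kern1 (fun x => a * f x + g x) (fun y => a * s y + r y) (cabs a * C + D).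
Proof.
move=> [fi [M fM] fC fs] [gi [L gL] gD gr].
have afi := cintegrableZ a fi.
split.
- exact: cintegrableD.
- exists (cabs a * M + L) => x; apply: le_trans (cabsD _ _) _.
  by rewrite cabsM lerD // ler_wpM2l ?cabs_ge0.
- have [mf _] := fi; have [mg _] := gi.
  apply: (@le_trans _ _ (\int[leb]_x ((cabs a)%:E * (cabs (f x))%:E + (cabs (g x))%:E))%E).
    apply: ge0_le_integral => //.
    + by move=> x _; rewrite lee_fin cabs_ge0.
    + by apply: cmeas_cabsE; case: (cintegrableD afi gi).
    + apply: emeasurable_funD; last exact: cmeas_cabsE.
      by apply: measurable_funeM; exact: cmeas_cabsE.
    + by move=> x _; rewrite -EFinM -EFinD lee_fin -cabsM cabsD.
  rewrite ge0_integralD //; last 4 first.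
  + by move=> x _; rewrite -EFinM lee_fin mulr_ge0 ?cabs_ge0.
  + by apply: measurable_funeM; exact: cmeas_cabsE.
  + by move=> x _; rewrite lee_fin cabs_ge0.
  + exact: cmeas_cabsE.
  rewrite ge0_integralZl //; last 3 first.
  + exact: cmeas_cabsE.
  + by move=> x _; rewrite lee_fin cabs_ge0.
  + by rewrite lee_fin cabs_ge0.
  by rewrite EFinD EFinM leeD // lee_wpmul2l // lee_fin cabs_ge0.
- move=> y; rewrite -fs -gr /four1 -cintZ; last exact: cintegrable_mod1.
  rewrite -cintD; [|exact/cintegrableZ/cintegrable_mod1|exact: cintegrable_mod1].
  by apply: eq_cint => x; rewrite mulrDl mulrA.
Qed.

Lemma cint_affine (c a : R) f : c != 0 -> cintegrable leb f ->
  cint leb (fun x => f (c * x + a)) = ((`|c|^-1)%:C)%C * cint leb f.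
Proof.
move=> c0 fi; apply/eqP; rewrite eq_complex ReM ImM /= !mul0r subr0 addr0.
have h (u : R -> R) : leb.-integrable setT (EFin \o u) ->
    \int[leb]_x u (c * x + a) = `|c|^-1 * \int[leb]_x u x.
  move=> ui; rewrite /Rintegral (integral_affine a c0 (f := EFin \o u)) //.
  by rewrite fineM // integrable_fin_num.
rewrite (h (fun x => complex.Re (f x))); last exact: cintegrable_Re.
rewrite (h (fun x => complex.Im (f x))); last exact: cintegrable_Im.
by rewrite !eqxx.
Qed.

Lemma cintegrable_affine (c a : R) f : c != 0 -> cintegrable leb f ->
  cintegrable leb (fun x => f (c * x + a)).
Proof.
move=> c0 [[f1 f2] fi].
have mg : measurable_fun [set: R] (fun x : R => c * x + a).
  by apply: measurable_funD => //; exact: measurable_funM.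
have mf : cmeas f by split.
split; first by split; [exact: (measurableT_comp f1 mg)|exact: (measurableT_comp f2 mg)].
rewrite (ge0_integral_affine a c0 (f := fun x => (cabs (f x))%:E)); last 2 first.
- exact: cmeas_cabsE.
- by move=> x; rewrite lee_fin cabs_ge0.
by rewrite lte_mul_pinfty.
Qed.

Lemma kern1_dilate (N c : R) f s C : 0 < N -> kern1 f s C ->
  kern1 (fun x => (N%:C)%C * f (N * x) * expi (x * c)) (fun y => s ((y - c) / N)) C.
Proof.
move=> N0 [fi [M fM] fC fs]; have N0' : N != 0 by rewrite gt_eqF.
have fNi : cintegrable leb (fun x => f (N * x)).
  by have := cintegrable_affine 0 N0' fi; under eq_fun do rewrite addr0.
have [mf _] := fi.
have cabsN : forall x, cabs ((N%:C)%C * f (N * x) * expi (x * c)) = N * cabs (f (N * x)).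
  by move=> x; rewrite !cabsM cabs_expi mulr1 cabs_real gtr0_norm.
split.
- apply: (cintegrable_bM (M := 1)); first exact: cintegrableZ.
    by apply: cmeas_expi; exact: measurable_funM.
  by move=> x; rewrite cabs_expi.
- by exists (N * M) => x; rewrite cabsN ler_pM2l.
- under eq_integral do rewrite cabsN EFinM.
  rewrite ge0_integralZl //; last 3 first.
  + by apply: cmeas_cabsE; case: fNi.
  + by move=> x _; rewrite lee_fin cabs_ge0.
  + by rewrite lee_fin ltW.
  have -> : (\int[leb]_x (cabs (f (N * x)))%:E = (`|N|^-1)%:E * \int[leb]_x (cabs (f x))%:E)%E.
    rewrite -(ge0_integral_affine 0 N0' (f := fun x => (cabs (f x))%:E)); last 2 first.
    + exact: cmeas_cabsE.
    + by move=> x; rewrite lee_fin cabs_ge0.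
    by apply: eq_integral => x _; rewrite addr0.
  by rewrite muleA -EFinM gtr0_norm // divff // mul1e.
- move=> y; rewrite -fs /four1.
  pose h x := f x * expi (- (x * ((y - c) / N))).
  have hi : cintegrable leb h by exact: cintegrable_mod1.
  have -> : cint leb h = (N%:C)%C * cint leb (fun x => h (N * x + 0)).
    rewrite cint_affine // mulrA -rmorphM gtr0_norm // divff // mul1r //.
  rewrite -cintZ; last exact: cintegrable_affine.
  apply: eq_cint => x; rewrite /h addr0 -!mulrA; congr (_ * (_ * _)).
  by rewrite -expiD; congr expi; field.
Qed.

Lemma kern1_opp f s C : kern1 f s C -> kern1 (fun x => f (- x)) (fun y => s (- y)) C.
Proof.
move=> [fi [M fM] fC fs]; have N10 : (-1 : R) != 0 by rewrite oppr_eq0 oner_eq0.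
have E : (fun x => f (- x)) = fun x => f (-1 * x + 0).
  by apply/funext => x; rewrite addr0 mulN1r.
have [mf _] := fi.
split.
- by rewrite E; exact: cintegrable_affine.
- by exists M.
- under eq_integral do rewrite -[X in f X]mulN1r -[X in f X]addr0.
  rewrite (ge0_integral_affine 0 N10 (f := fun x => (cabs (f x))%:E)); last 2 first.
  + exact: cmeas_cabsE.
  + by move=> x; rewrite lee_fin cabs_ge0.
  by rewrite normrN normr1 invr1 mul1e.
- move=> y; rewrite -fs /four1.
  have hi := cintegrable_mod1 (- y) fi.
  have := cint_affine 0 N10 hi; rewrite normrN normr1 invr1 mul1r => <-.
  by apply: eq_cint => x; rewrite addr0 mulN1r mulrNN.
Qed.

Definition fejz (y : R) : R := if y == 0 then 1 / 2 else (1 - cos y) / y ^+ 2.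

(** At [y = 0] the convention [x / 0 = 0] yields the value of the continuous extension, so no case
    distinction is required, unlike in [fejz]. *)
Definition sinz (y : R) : R := (y - sin y) / y ^+ 2.

Definition ramp (x : R) : R := if -1 <= x <= 0 then 1 + x else 0.

Lemma ramp_ge0 x : 0 <= ramp x.
Proof. by rewrite /ramp; case: ifP => // /andP[h _]; lra. Qed.

Lemma ramp_le1 x : ramp x <= 1.
Proof. by rewrite /ramp; case: ifP => // /andP[_ h]; lra. Qed.

Lemma measurable_ramp : measurable_fun [set: R] ramp.
Proof.
apply: measurable_fun_ifT => //; last exact: measurable_funD.
by apply: measurable_and; exact: measurable_fun_ler.
Qed.

Lemma continuous_mulr (y : R) : continuous (fun x : R => x * y).
Proof. by move=> x; apply: cvgM; [exact: cvg_id|exact: cvg_cst]. Qed.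

Lemma continuous_cosM (y : R) : continuous (fun x : R => cos (x * y)).
Proof.
move=> x; apply: (@continuous_comp _ _ _ (fun x : R => x * y) cos x).
  exact: continuous_mulr.
exact: continuous_cos.
Qed.

Lemma continuous_sinM (y : R) : continuous (fun x : R => sin (x * y)).
Proof.
move=> x; apply: (@continuous_comp _ _ _ (fun x : R => x * y) sin x).
  exact: continuous_mulr.
exact: continuous_sin.
Qed.

Lemma continuous_add1 : continuous (fun x : R => 1 + x).
Proof. by move=> x; apply: cvgD; [exact: cvg_cst|exact: cvg_id]. Qed.

Lemma ramp_integral (u : R -> R) :
  (\int[leb]_x (ramp x * u x)%:E = \int[leb]_(x in `[(-1)%R, 0%R]) ((1 + x) * u x)%:E)%E.
Proof.
rewrite [RHS]integral_mkcond; apply: eq_integral => x _.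
rewrite patchE mem_setE /= in_itv /= /ramp.
by case: ifP => _ //; rewrite mul0r.
Qed.

Lemma is_derive_mulr (x y : R) : is_derive x 1 (fun z : R => z * y) y.
Proof.
have := is_deriveZ y (is_derive_id x (1 : R)).
rewrite (_ : y \*: id = fun z => z * y); last by apply/funext => z; rewrite /= /GRing.scale /= mulrC.
by rewrite /GRing.scale /= mulr1.
Qed.

Lemma is_derive_sinM (x y : R) : is_derive x 1 (fun z => sin (z * y)) (cos (x * y) * y).
Proof. exact: is_derive1_comp (is_derive_sin _) (is_derive_mulr x y). Qed.

Lemma is_derive_cosM (x y : R) : is_derive x 1 (fun z => cos (z * y)) (- sin (x * y) * y).
Proof. exact: is_derive1_comp (is_derive_cos _) (is_derive_mulr x y). Qed.

Lemma is_derive_add1 (x : R) : is_derive x 1 (fun z : R => 1 + z) 1.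
Proof.
have := is_deriveD (is_derive_cst (1 : R) x (1 : R)) (is_derive_id x (1 : R)).
by rewrite add0r.
Qed.

Lemma ramp_cos y : (\int[leb]_x (ramp x * cos (x * y))%:E = (fejz y)%:E)%E.
Proof.
rewrite ramp_integral /fejz; have [->|y0] := eqVneq y 0.
  under eq_integral do rewrite mulr0 cos0 mulr1.
  pose F (x : R) := x + 2^-1 * (x * x).
  have dF (x : R) : is_derive x (1 : R) F (1 + x).
    have h := is_deriveM (is_derive_id x (1 : R)) (is_derive_id x (1 : R)).
    have h' := is_deriveD (is_derive_id x (1 : R)) (is_deriveZ (2^-1) h).
    have E : 1 + 2^-1 * (x * 1 + x * 1) = 1 + x :> R by field.
    exact: is_derive_eq h' E.
  apply: etrans (FTC_everywhere (a := -1) (b := 0) _ dF continuous_add1) _.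
    by rewrite oppr_lt0.
  by rewrite /F; congr EFin; field.
pose F (x : R) := (1 + x) * (y^-1 * sin (x * y)) + y^-1 ^+ 2 * cos (x * y).
have dF (x : R) : is_derive x (1 : R) F ((1 + x) * cos (x * y)).
  have h := is_deriveM (is_derive_add1 x) (is_deriveZ (y^-1) (is_derive_sinM x y)).
  have h' := is_deriveD h (is_deriveZ (y^-1 ^+ 2) (is_derive_cosM x y)).
  have E : (1 + x) * (y^-1 * (cos (x * y) * y)) + y^-1 * sin (x * y) * 1 +
      y^-1 ^+ 2 * (- sin (x * y) * y) = (1 + x) * cos (x * y) :> R by field.
  exact: is_derive_eq h' E.
have cf : continuous (fun x : R => (1 + x) * cos (x * y)).
  by move=> x; apply: cvgM; [exact: continuous_add1|exact: continuous_cosM].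
apply: etrans (FTC_everywhere (a := -1) (b := 0) _ dF cf) _; first by rewrite oppr_lt0.
by rewrite /F mul0r sin0 cos0 mulN1r cosN sinN; congr EFin; field.
Qed.

Lemma ramp_sin y : (\int[leb]_x (ramp x * - sin (x * y))%:E = (sinz y)%:E)%E.
Proof.
rewrite ramp_integral /sinz; have [->|y0] := eqVneq y 0.
  under eq_integral do rewrite mulr0 sin0 oppr0 mulr0.
  by rewrite integral0 sin0 subr0 mul0r.
pose F (x : R) := (1 + x) * (y^-1 * cos (x * y)) + (- y^-1 ^+ 2) * sin (x * y).
have dF (x : R) : is_derive x (1 : R) F ((1 + x) * - sin (x * y)).
  have h := is_deriveM (is_derive_add1 x) (is_deriveZ (y^-1) (is_derive_cosM x y)).
  have h' := is_deriveD h (is_deriveZ (- y^-1 ^+ 2) (is_derive_sinM x y)).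
  have E : (1 + x) * (y^-1 * (- sin (x * y) * y)) + y^-1 * cos (x * y) * 1 +
      - y^-1 ^+ 2 * (cos (x * y) * y) = (1 + x) * - sin (x * y) :> R by field.
  exact: is_derive_eq h' E.
have cf : continuous (fun x : R => (1 + x) * - sin (x * y)).
  move=> x; apply: cvgM; first exact: continuous_add1.
  by apply: cvgN; exact: continuous_sinM.
apply: etrans (FTC_everywhere (a := -1) (b := 0) _ dF cf) _; first by rewrite oppr_lt0.
by rewrite /F mul0r sin0 cos0 mulN1r cosN sinN; congr EFin; field.
Qed.

(** This is [(exp (i y) - 1 - i y) / (i y)^2], the symbol of a second order Taylor remainder. Its
    kernel, the ramp, has norm [1 / 2]; this is the source of the quadratic error in [der]. *)
Definition crampsym (y : R) : R[i] := (fejz y +i* sinz y)%C.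

Lemma int_ramp : (\int[leb]_x (ramp x)%:E = (1 / 2)%:E)%E.
Proof.
have := ramp_cos 0; rewrite /fejz eqxx => <-; apply: eq_integral => x _.
by rewrite mulr0 cos0 mulr1.
Qed.

Lemma cabs_ramp x : cabs ((ramp x)%:C)%C = ramp x.
Proof. by rewrite cabs_real ger0_norm // ramp_ge0. Qed.

Lemma kern1_ramp : kern1 (fun x => ((ramp x)%:C)%C) crampsym (1 / 2).
Proof.
have ri : (\int[leb]_x (cabs ((ramp x)%:C)%C)%:E = (1 / 2)%:E)%E.
  by rewrite -int_ramp; apply: eq_integral => x _; rewrite cabs_ramp.
split.
- split; last by rewrite ri ltry.
  by apply: cmeas_real; exact: measurable_ramp.
- by exists 1 => x; rewrite cabs_ramp ramp_le1.
- by rewrite ri.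
- move=> y; rewrite /four1 /cint /crampsym; congr Complex.
    rewrite /Rintegral -[RHS]/(fine (fejz y)%:E) -ramp_cos; congr fine.
    by apply: eq_integral => x _; rewrite ReM /= mul0r subr0 cosN.
  rewrite /Rintegral -[RHS]/(fine (sinz y)%:E) -ramp_sin; congr fine.
  by apply: eq_integral => x _; rewrite ImM /= mul0r addr0 sinN.
Qed.

Lemma fejz_ge0 y : 0 <= fejz y.
Proof.
rewrite /fejz; case: ifP => _; first by rewrite divr_ge0.
by rewrite divr_ge0 ?sqr_ge0 // subr_ge0 cos_le1.
Qed.

Lemma fejz_le y : fejz y <= 1 / 2.
Proof.
rewrite -lee_fin -ramp_cos -int_ramp.
have mc : measurable_fun [set: R] (fun x : R => cos (x * y)).
  by apply: continuous_measurable_fun; exact: continuous_cosM.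
apply: le_trans (lee_abs _) _; apply: le_trans (le_abse_integral _ _ _) _ => //.
  by apply/measurable_EFinP; apply: measurable_funM => //; exact: measurable_ramp.
apply: ge0_le_integral => //.
- apply: measurableT_comp => //; apply/measurable_EFinP.
  by apply: measurable_funM => //; exact: measurable_ramp.
- by apply/measurable_EFinP; exact: measurable_ramp.
- move=> x _; rewrite lee_fin normrM (ger0_norm (ramp_ge0 x)) ler_piMr ?ramp_ge0 //.
  exact: cos_max.
Qed.

Lemma measurable_fejz : measurable_fun [set: R] fejz.
Proof.
rewrite /fejz; apply: measurable_fun_ifT => //.
  by apply: measurable_fun_eqr.
apply: measurable_funM.
  apply: measurable_funB => //; apply: continuous_measurable_fun; exact: continuous_cos.
rewrite (_ : (fun _ => _) = fun x => (x ^+ 2) `^ (-1)); last first.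
  by apply/funext => x; rewrite powR_inv1 // sqr_ge0.
by apply: (measurableT_comp (measurable_powR _)); exact: measurable_funX.
Qed.

Lemma oneDsqrV_int : (\int[leb]_x ((oneDsqr x)^-1)%:E < +oo)%E.
Proof.
rewrite (ge0_symfun_integralT (f := fun x => (oneDsqr x)^-1)).
- rewrite -set_itvcy integral0y_oneDsqr -EFinM ltry //.
- by move=> x; rewrite invr_ge0; apply: le_trans (oneDsqr_ge1 x).
- exact: continuous_oneDsqrV.
- by move=> x; rewrite /= /oneDsqr sqrrN.
Qed.

Lemma fejz_bound y : fejz y <= 5 / 2 * (oneDsqr y)^-1.
Proof.
have h1 := oneDsqr_ge1 y.
rewrite ler_pdivlMr; last by lra.
rewrite /oneDsqr mulrDr mulr1.
suff : fejz y * y ^+ 2 <= 2 by have := fejz_le y; lra.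
rewrite /fejz; case: ifP => [/eqP->|y0]; first by rewrite expr0n mulr0.
rewrite divfK ?expf_neq0 ?y0 //.
by have := cos_geN1 y; lra.
Qed.

Lemma fejz_lty : (\int[leb]_x (fejz x)%:E < +oo)%E.
Proof.
apply: (@le_lt_trans _ _ (\int[leb]_x ((5 / 2)%:E * ((oneDsqr x)^-1)%:E))%E).
  apply: ge0_le_integral => //.
  - by move=> x _; rewrite lee_fin fejz_ge0.
  - by apply/measurable_EFinP; exact: measurable_fejz.
  - apply/measurable_EFinP; apply: measurable_funM => //.
    by apply: continuous_measurable_fun; exact: continuous_oneDsqrV.
  - by move=> x _; rewrite -EFinM lee_fin fejz_bound.
rewrite ge0_integralZl //.
- by rewrite lte_mul_pinfty ?oneDsqrV_int // lee_fin; lra.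
- apply/measurable_EFinP; apply: continuous_measurable_fun; exact: continuous_oneDsqrV.
Qed.

Lemma integrable_fejz : leb.-integrable setT (EFin \o fejz).
Proof.
apply/integrableP; split; first by apply/measurable_EFinP; exact: measurable_fejz.
rewrite (_ : (\int[leb]_x _ = \int[leb]_x (fejz x)%:E)%E); first exact: fejz_lty.
by apply: eq_integral => x _ /=; rewrite ger0_norm // fejz_ge0.
Qed.

Definition fejZ : R := \int[leb]_x fejz x.

Lemma fejZE : (\int[leb]_x (fejz x)%:E = fejZ%:E)%E.
Proof. by rewrite fineK // integrable_fin_num //; exact: integrable_fejz. Qed.

Lemma fejZ_gt0 : 0 < fejZ.
Proof.
have pi0 := pi_gt0 R.
rewrite -lte_fin -fejZE.
(* On [[pi / 2, pi]] the cosine is nonpositive, so [fejz] is at least [1 / pi ^ 2] there. *)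
apply: (@lt_le_trans _ _ (\int[leb]_(x in `[(pi / 2)%R, pi]) cst ((pi ^+ 2)^-1)%:E x)%E).
  rewrite integral_cst //= lebesgue_measure_itv /= lte_fin ifT; last by lra.
  rewrite -EFinB -EFinM lte_fin mulr_gt0 //; last by lra.
  by rewrite invr_gt0 exprn_gt0.
apply: (@le_trans _ _ (\int[leb]_(x in `[(pi / 2)%R, pi]) (fejz x)%:E)%E).
  apply: ge0_le_integral => //.
  - by move=> x _; rewrite lee_fin invr_ge0 exprn_ge0 // ltW.
  - by apply/measurable_EFinP; apply: measurable_funTS; exact: measurable_fejz.
  - move=> x /=; rewrite in_itv /= => /andP[h1 h2]; rewrite lee_fin /fejz.
    have x0 : 0 < x by lra.
    rewrite gt_eqF // -[leLHS]mul1r ler_pM //.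
    + by rewrite invr_ge0 exprn_ge0 // ltW.
    + suff : cos x <= 0 by lra.
      rewrite -cos_pihalf leNgt ltr_cos ?in_itv /=; [by rewrite -leNgt|..].
      * by apply/andP; split; lra.
      * by apply/andP; split; lra.
    + by rewrite lef_pV2 ?posrE ?exprn_gt0 // ler_pXn2r // ?nnegrE; lra.
apply: ge0_subset_integral => //.
- by apply/measurable_EFinP; exact: measurable_fejz.
- by move=> x _; rewrite lee_fin fejz_ge0.
Qed.

Definition fejsc (a x : R) : R := a ^+ 2 * fejz (a * x).

Lemma integrable_fejsc a : leb.-integrable setT (EFin \o fejsc a).
Proof.
have [->|a0] := eqVneq a 0.
  rewrite (_ : _ \o _ = cst 0%E); first exact: integrable0.
  by apply/funext => x /=; rewrite /fejsc expr0n mul0r.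
have := integrableZl measurableT (a ^+ 2) (integrable_affine 0 a0 integrable_fejz).
by apply: eq_integrable => // x _ /=; rewrite addr0 EFinM.
Qed.

Lemma int_fejsc a : \int[leb]_x fejsc a x = `|a| * fejZ.
Proof.
have [->|a0] := eqVneq a 0.
  rewrite normr0 mul0r /Rintegral (_ : (\int[leb]_x _ = 0)%E) //.
  by apply: integral0_eq => x _; rewrite /fejsc expr0n mul0r.
have E := integral_affine 0 a0 integrable_fejz.
rewrite RintegralZl //; last first.
  have := integrable_affine 0 a0 integrable_fejz.
  by apply: eq_integrable => // x _ /=; rewrite addr0.
rewrite /Rintegral (_ : (\int[leb]_x _ = (`|a|^-1)%:E * \int[leb]_x (EFin \o fejz) x)%E); last first.
  by rewrite -E; apply: eq_integral => x _ /=; rewrite addr0.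
rewrite fejZE -EFinM /= mulrA; congr (_ * _).
by rewrite -real_normK ?num_real // expr2 mulfK // normr_eq0.
Qed.

(** The addition formulas write the integrand of the cosine transform as a second difference in [a]
    of [fejsc a x], whose integral is [|a| fejZ] by scaling. Since the second difference of the
    absolute value is the tent [phi_hat], the transform follows from a change of variables. *)
Lemma fejz_cos (l x : R) : fejz x * cos (x * l) =
  1 / 2 * fejsc (1 + l) x + 1 / 2 * fejsc (1 - l) x - fejsc l x.
Proof.
have fscE a : x != 0 -> fejsc a x = (1 - cos (a * x)) / x ^+ 2.
  move=> x0; rewrite /fejsc /fejz mulf_eq0 (negbTE x0) orbF.
  have [->|a0] := eqVneq a 0; first by rewrite mul0r cos0 subrr mul0r expr0n mul0r.
  by rewrite exprMn; field; rewrite x0 a0.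
have [->|x0] := eqVneq x 0.
  by rewrite /fejsc !mulr0 mul0r /fejz eqxx cos0; field.
rewrite !fscE // /fejz (negbTE x0).
have -> : cos ((1 + l) * x) = cos x * cos (x * l) - sin x * sin (x * l).
  by rewrite mulrDl mul1r cosD (mulrC l).
have -> : cos ((1 - l) * x) = cos x * cos (x * l) + sin x * sin (x * l).
  by rewrite mulrBl mul1r cosB (mulrC l).
by rewrite (mulrC l x); field.
Qed.

Lemma phi_hatE (l : R) : phi_hat l = 1 / 2 * `|1 + l| + 1 / 2 * `|1 - l| - `|l|.
Proof.
rewrite /phi_hat; case: (lerP (1 - `|l|) 0); case: (ger0P l) => h0 h3;
  case: (ger0P (1 + l)) => h1; case: (ger0P (1 - l)) => h2; lra.
Qed.

Lemma fejz_int_cos (l : R) : \int[leb]_x (fejz x * cos (x * l)) = fejZ * phi_hat l.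
Proof.
have Zl (c : R) (h : R -> R) : leb.-integrable setT (EFin \o h) ->
    leb.-integrable setT (EFin \o (fun x => c * h x)).
  by move=> hi; apply: eq_integrable (integrableZl measurableT c hi).
have Z1 (c a : R) : \int[leb]_x (c * fejsc a x) = c * (`|a| * fejZ).
  by rewrite RintegralZl ?int_fejsc //; exact: integrable_fejsc.
under eq_Rintegral do rewrite fejz_cos.
have i1 := Zl (1 / 2) _ (integrable_fejsc (1 + l)).
have i2 := Zl (1 / 2) _ (integrable_fejsc (1 - l)).
rewrite RintegralB //; last 2 first.
- by apply: eq_integrable (integrableD measurableT i1 i2).
- exact: integrable_fejsc.
rewrite RintegralD // !Z1 int_fejsc phi_hatE; ring.
Qed.

Lemma fejzN x : fejz (- x) = fejz x.
Proof. by rewrite /fejz oppr_eq0 cosN sqrrN. Qed.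

Lemma integrable_fejz_mul (u : R -> R) : measurable_fun setT u -> (forall x, `|u x| <= 1) ->
  leb.-integrable setT (EFin \o (fun x => fejz x * u x)).
Proof.
move=> mu u1; apply: le_integrable integrable_fejz => //.
  by apply/measurable_EFinP; apply: measurable_funM => //; exact: measurable_fejz.
by move=> x _ /=; rewrite lee_fin normrM ler_piMr.
Qed.

Lemma fejz_int_sin (l : R) : \int[leb]_x (fejz x * sin (x * l)) = 0.
Proof.
have i : leb.-integrable setT (EFin \o (fun x => fejz x * sin (x * l))).
  apply: integrable_fejz_mul; first by apply: continuous_measurable_fun; exact: continuous_sinM.
  by move=> x; exact: sin_max.
have N10 : (-1 : R) != 0 by rewrite oppr_eq0 oner_eq0.
have := integral_affine 0 N10 i; rewrite normrN normr1 invr1 mul1e /=.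
rewrite (_ : (\int[leb]_x _ = - \int[leb]_x (fejz x * sin (x * l))%:E)%E); last first.
  rewrite -integralN; last by apply: integrable_add_def i.
  by apply: eq_integral => x _ /=; rewrite addr0 mulN1r fejzN mulNr sinN mulrN EFinN.
have := integrable_fin_num measurableT i; rewrite /Rintegral /=.
by case: (\int[leb]_x _)%E => [v| |] //= _ [h]; lra.
Qed.

Definition fejer (x : R) : R := fejZ^-1 * fejz x.

Lemma fejer_ge0 x : 0 <= fejer x.
Proof. by rewrite mulr_ge0 ?fejz_ge0 // invr_ge0 ltW // fejZ_gt0. Qed.

Lemma cabs_fejer x : cabs ((fejer x)%:C)%C = fejer x.
Proof. by rewrite cabs_real ger0_norm // fejer_ge0. Qed.

Lemma measurable_fejer : measurable_fun [set: R] fejer.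
Proof. by apply: measurable_funM => //; exact: measurable_fejz. Qed.

Lemma int_fejer : (\int[leb]_x (fejer x)%:E = 1)%E.
Proof.
under eq_integral do rewrite EFinM.
have Z0 := fejZ_gt0; rewrite ge0_integralZl //.
- by rewrite fejZE -EFinM mulVf // gt_eqF.
- by apply/measurable_EFinP; exact: measurable_fejz.
- by move=> x _; rewrite lee_fin fejz_ge0.
- by rewrite lee_fin invr_ge0 ltW.
Qed.

Lemma kern1_fejer1 : kern1 (fun x => ((fejer x)%:C)%C) (fun y => ((phi_hat y)%:C)%C) 1.
Proof.
have Z0 := fejZ_gt0.
have ri : (\int[leb]_x (cabs ((fejer x)%:C)%C)%:E = 1)%E.
  by rewrite -int_fejer; apply: eq_integral => x _; rewrite cabs_fejer.
split.
- split; last by rewrite ri ltry.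
  by apply: cmeas_real; exact: measurable_fejer.
- exists (fejZ^-1 * (1 / 2)) => x; rewrite cabs_fejer ler_wpM2l ?fejz_le // invr_ge0 ltW //.
- by rewrite ri.
- have mc y : measurable_fun [set: R] (fun x : R => cos (x * y)).
    by apply: continuous_measurable_fun; exact: continuous_cosM.
  have ms y : measurable_fun [set: R] (fun x : R => sin (x * y)).
    by apply: continuous_measurable_fun; exact: continuous_sinM.
  move=> y; rewrite /four1 /cint; congr Complex.
    under eq_Rintegral do rewrite ReM /= mul0r subr0 cosN -mulrA.
    rewrite RintegralZl //; last by apply: integrable_fejz_mul => // x; exact: cos_max.
    by rewrite fejz_int_cos mulrA mulVf ?mul1r // gt_eqF.
  have -> : \int[leb]_x complex.Im ((fejer x)%:C%C * expi (- (x * y))) =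
      \int[leb]_x ((- fejZ^-1) * (fejz x * sin (x * y))).
    by apply: eq_Rintegral => x _; rewrite ImM /= mul0r addr0 sinN /fejer; ring.
  rewrite RintegralZl //; last by apply: integrable_fejz_mul => // x; exact: sin_max.
  by rewrite fejz_int_sin mulr0.
Qed.

End one_dim.

(** * Tensor products of one-dimensional kernels *)

Section tensor.
Variable R : realType.
Local Notation leb := (@lebesgue_measure R).
Implicit Types f g : R -> R[i].

Definition tens d (f : 'I_d -> R -> R[i]) (t : d.-tuple R) : R[i] :=
  \prod_(k < d) f k (tnth t k).

Lemma tens_cons n (f : 'I_n.+1 -> R -> R[i]) x t :
  tens f (tcons (x, t)) = f ord0 x * tens (fun k => f (lift ord0 k)) t.
Proof.
rewrite /tens big_ord_recl tnth0; congr (_ * _).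
by apply: eq_bigr => k _; rewrite tnthS.
Qed.

Lemma cmeas_tens d (f : 'I_d -> R -> R[i]) : (forall k, cmeas (f k)) -> cmeas (tens f).
Proof.
move=> mf; apply: cmeas_prod => k; have [m1 m2] := mf k.
by split; [exact: (measurableT_comp m1 (measurable_tnth k))|
           exact: (measurableT_comp m2 (measurable_tnth k))].
Qed.

Lemma cmeas_tcons n (h : n.+1.-tuple R -> R[i]) : cmeas h -> cmeas (fun p => h (@tcons R n p)).
Proof.
case=> h1 h2; split; [exact: (measurableT_comp h1 (@measurable_tcons R n))|
  exact: (measurableT_comp h2 (@measurable_tcons R n))].
Qed.

Lemma int_cons n (h : n.+1.-tuple R -> R[i]) : cmeas h ->
  (\int[Rd_measure R n.+1]_t (cabs (h t))%:E =
   \int[leb]_x \int[Rd_measure R n]_t (cabs (h (tcons (x, t))))%:E)%E.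
Proof.
move=> mh; rewrite (ge0_integral_tcons (f := fun t => (cabs (h t))%:E)); last 2 first.
- exact: cmeas_cabsE.
- by move=> t; rewrite lee_fin cabs_ge0.
rewrite (fubini_tonelli1 (fun p => (cabs (h (tcons p)))%:E)) //.
- by apply: cmeas_cabsE; exact: cmeas_tcons.
- by move=> p; rewrite lee_fin cabs_ge0.
Qed.

Lemma int_mul_cons n (u : R -> R[i]) (v : n.-tuple R -> R[i]) : cmeas u -> cmeas v ->
  (\int[leb]_x \int[Rd_measure R n]_t (cabs (u x * v t))%:E =
   \int[leb]_x (cabs (u x))%:E * \int[Rd_measure R n]_t (cabs (v t))%:E)%E.
Proof.
move=> mu mv.
under eq_integral => x _.
  under eq_integral do rewrite cabsM EFinM.
  rewrite ge0_integralZl //; first over.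
  - exact: cmeas_cabsE.
  - by move=> t _; rewrite lee_fin cabs_ge0.
  - by rewrite lee_fin cabs_ge0.
rewrite ge0_integralZr //.
- exact: cmeas_cabsE.
- by move=> x _; rewrite lee_fin cabs_ge0.
- by apply: integral_ge0 => t _; rewrite lee_fin cabs_ge0.
Qed.

Lemma int_tens d (f : 'I_d -> R -> R[i]) : (forall k, cmeas (f k)) ->
  (\int[Rd_measure R d]_t (cabs (tens f t))%:E =
   \prod_(k < d) \int[leb]_x (cabs (f k x))%:E)%E.
Proof.
elim: d f => [|n IH] f mf.
  rewrite big_ord0 /= integral_dirac //; last by apply: cmeas_cabsE; exact: cmeas_tens.
  by rewrite diracT mul1e /tens big_ord0 cabs1.
rewrite int_cons; last exact: cmeas_tens.
under eq_integral => x _ do under eq_integral => t _ do rewrite tens_cons.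
by rewrite int_mul_cons ?big_ord_recl ?IH //; exact: cmeas_tens.
Qed.

Lemma cintegrable_tens d (f : 'I_d -> R -> R[i]) : (forall k, cintegrable leb (f k)) ->
  cintegrable (Rd_measure R d) (tens f).
Proof.
move=> fi; have mf k : cmeas (f k) by case: (fi k).
split; first exact: cmeas_tens.
rewrite int_tens //.
suff : (\prod_(k < d) \int[leb]_x (cabs (f k x))%:E)%E \is a fin_num by rewrite ltey_eq => ->.
apply: (big_ind (fun x => x \is a fin_num)) => //; first by move=> x y; exact: fin_numM.
move=> k _; rewrite ge0_fin_numE; first by case: (fi k).
by apply: integral_ge0 => x _; rewrite lee_fin cabs_ge0.
Qed.

Lemma cint_tens d (f : 'I_d -> R -> R[i]) : (forall k, cintegrable leb (f k)) ->
  cint (Rd_measure R d) (tens f) = \prod_(k < d) cint leb (f k).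
Proof.
elim: d f => [|n IH] f fi.
  rewrite big_ord0 /cint /Rintegral /= !integral_dirac // ?diracT ?mul1e /tens ?big_ord0 //.
  - by under eq_fun do rewrite big_ord0; exact: measurable_cst.
  - by under eq_fun do rewrite big_ord0; exact: measurable_cst.
have ti := cintegrable_tens fi.
pose H (p : measurableTypeR R * n.-tuple R) := f ord0 p.1 * tens (fun k => f (lift ord0 k)) p.2.
have HE p : H p = tens f (tcons p) by case: p => x t; rewrite tens_cons.
have Hi : cintegrable (leb \x Rd_measure R n)%E H.
  have [mt tif] := ti; split.
    by rewrite (_ : H = fun p => tens f (tcons p)); [exact: cmeas_tcons|exact/funext].
  apply: le_lt_trans tif; rewrite (ge0_integral_tcons (f := fun t => (cabs (tens f t))%:E)).
  - by under eq_integral do rewrite HE.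
  - exact: cmeas_cabsE.
  - by move=> t; rewrite lee_fin cabs_ge0.
have ti' : cintegrable (Rd_measure R n) (tens (fun k => f (lift ord0 k))).
  by apply: cintegrable_tens => k; exact: fi.
transitivity (cint (leb \x Rd_measure R n)%E H).
  rewrite /cint /Rintegral; congr Complex; congr fine.
    rewrite (integral_tcons (cintegrable_Re ti)).
    by apply: eq_integral => p _; rewrite HE.
  rewrite (integral_tcons (cintegrable_Im ti)).
  by apply: eq_integral => p _; rewrite HE.
rewrite -(cint_prod1 Hi (fun x => cintegrableZ (f ord0 x) ti')).
rewrite big_ord_recl -IH //.
transitivity (cint leb (fun x => cint (Rd_measure R n) (tens (fun k => f (lift ord0 k))) * f ord0 x)).
  by apply: eq_cint => x; rewrite /H /= (cintZ _ ti') mulrC.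
by rewrite (cintZ _ (fi ord0)) mulrC.
Qed.

Lemma expi_sum (I : Type) (s : seq I) (F : I -> R) :
  expi (\sum_(i <- s) F i) = \prod_(i <- s) expi (F i).
Proof.
by elim: s => [|i s IH]; rewrite ?big_nil ?expi0 // !big_cons expiD IH.
Qed.

Lemma fourier_tens d (f : 'I_d -> R -> R[i]) l : (forall k, cintegrable leb (f k)) ->
  fourier (tens f) l = \prod_(k < d) four1 (f k) (tnth l k).
Proof.
move=> fi; rewrite fourierE; last by apply/L1P; exact: cintegrable_tens.
rewrite -(cint_tens (f := fun k x => f k x * expi (- (x * tnth l k)))); last first.
  by move=> k; exact: cintegrable_mod1.
apply: eq_cint => t; rewrite /tens big_split /=; congr (_ * _).
by rewrite /tdot -sumrN expi_sum.
Qed.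

Definition upd d (f : 'I_d -> R -> R[i]) j (u : R -> R[i]) : 'I_d -> R -> R[i] :=
  fun k => if k == j then u else f k.

Lemma tens_updE d (f : 'I_d -> R -> R[i]) j u t :
  tens (upd f j u) t = u (tnth t j) * \prod_(k < d | k != j) f k (tnth t k).
Proof.
rewrite /tens (bigD1 j) //= /upd eqxx; congr (_ * _).
by apply: eq_bigr => k /negbTE ->.
Qed.

Lemma tens_updB d (f : 'I_d -> R -> R[i]) j u v t :
  tens (upd f j u) t - tens (upd f j v) t = tens (upd f j (fun x => u x - v x)) t.
Proof. by rewrite !tens_updE mulrBl. Qed.

Lemma cabs_prod (I : Type) (r : seq I) (F : I -> R[i]) :
  cabs (\prod_(i <- r) F i) = \prod_(i <- r) cabs (F i).
Proof. by elim: r => [|i r IH]; rewrite ?big_nil ?cabs1 // !big_cons cabsM IH. Qed.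

Definition kern d (f : d.-tuple R -> R[i]) (s : d.-tuple R -> R[i]) :=
  [/\ L1 f, exists M, forall t, cabs (f t) <= M & forall l, fourier f l = s l].

Lemma kern_tens d (f s : 'I_d -> R -> R[i]) (C : 'I_d -> R) :
  (forall k, kern1 (f k) (s k) (C k)) ->
  kern (tens f) (fun l => \prod_(k < d) s k (tnth l k)) /\ L1norm (tens f) <= \prod_(k < d) C k.
Proof.
move=> fk; have fi k : cintegrable leb (f k) by case: (fk k).
have ti := cintegrable_tens fi.
have /choice[M fM] : forall k, exists M, forall x, cabs (f k x) <= M by move=> k; case: (fk k).
split; first split.
- exact/L1P.
- exists (\prod_(k < d) M k) => t; rewrite /tens cabs_prod.
  by apply: ler_prod => k _; rewrite cabs_ge0 fM.
- by move=> l; rewrite fourier_tens //; apply: eq_bigr => k _; case: (fk k).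
have c0 k : (0 <= \int[leb]_x (cabs (f k x))%:E)%E.
  by apply: integral_ge0 => x _; rewrite lee_fin cabs_ge0.
have cf k : (\int[leb]_x (cabs (f k x))%:E)%E \is a fin_num.
  by rewrite ge0_fin_numE //; case: (fi k).
rewrite -lee_fin L1normE; last exact/L1P.
rewrite int_tens; last by move=> k; case: (fi k).
rewrite (eq_bigr (fun k => (fine (\int[leb]_x (cabs (f k x))%:E))%:E)); last first.
  by move=> k _; rewrite fineK.
rewrite prodEFin lee_fin; apply: ler_prod => k _; rewrite fine_ge0 //=.
by rewrite -lee_fin fineK //; case: (fk k).
Qed.

Lemma kern_lin d c (f g s r : d.-tuple R -> R[i]) : kern f s -> kern g r ->
  kern (fun t => c * f t + g t) (fun l => c * s l + r l).
Proof.
move=> [fi [M fM] fs] [gi [L gL] gr]; split.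
- exact: L1_lin.
- exists (cabs c * M + L) => t; apply: le_trans (cabsD _ _) _.
  by rewrite cabsM lerD // ler_wpM2l ?cabs_ge0.
- by move=> l; rewrite fourier_lin // fs gr.
Qed.

Lemma kern_conv d (f g s r : d.-tuple R -> R[i]) : kern f s -> kern g r ->
  kern (Defs.conv f g) (fun l => s l * r l).
Proof.
move=> [fi [M fM] fs] [gi [L gL] gr]; split.
- exact: L1_conv gL.
- by exists (2 * (L * L1norm f)) => t; exact: conv_bounded.
- by move=> l; rewrite (fourier_conv fi gi gL) fs gr.
Qed.

Lemma kern_shift d (f s : d.-tuple R -> R[i]) a : kern f s ->
  kern (fun t => f (tadd t a)) (fun l => expi (tdot a l) * s l).
Proof.
move=> [fi [M fM] fs]; split.
- exact: L1_shift.
- by exists M.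
- by move=> l; rewrite fourier_shift // fs.
Qed.

Definition fejk (N c x : R) : R[i] := (N%:C)%C * ((fejer (N * x))%:C)%C * expi (x * c).

Lemma kern1_fejk (N c : R) : 0 < N ->
  kern1 (fejk N c) (fun y => ((phi_hat ((y - c) / N))%:C)%C) 1.
Proof. by move=> N0; have := kern1_dilate c N0 (@kern1_fejer1 R). Qed.

Definition tri d (N c : 'I_d -> R) (l : d.-tuple R) : R[i] :=
  \prod_(k < d) ((phi_hat ((tnth l k - c k) / N k))%:C)%C.

Lemma kern_tri d (N c : 'I_d -> R) : (forall k, 0 < N k) ->
  kern (tens (fun k => fejk (N k) (c k))) (tri N c) /\ L1norm (tens (fun k => fejk (N k) (c k))) <= 1.
Proof.
move=> N0; have [h1 h2] := kern_tens (fun k => kern1_fejk (c k) (N0 k)).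
by split => //; apply: le_trans h2 _; rewrite prodr_const expr1n.
Qed.

(** The tensor Fejer kernel shows that the choice defining [phid] is not vacuous. Nothing but the
    Fourier transform of the chosen kernel is known, hence the role of [actL_fourier_eq]. *)
Lemma phid_spec d (N : R) (a : d.-tuple R) : 0 < N ->
  L1 (phid N a) /\ forall l, fourier (phid N a) l = tri (fun=> N) (fun k => N * tnth a k) l.
Proof.
move=> N0; rewrite /phid; set P := (X in ClassicalEpsilon.epsilon _ X).
have Pex : exists f : d.-tuple R -> R[i], P f.
  have [[fi _ fs] _] := @kern_tri d (fun=> N) (fun k => N * tnth a k) (fun=> N0).
  exists (tens (fun k => fejk N (N * tnth a k))); split => // l.
  by rewrite fs /tri rmorph_prod.
have [h1 h2] := ClassicalEpsilon.epsilon_spec (inhabits (fun=> 0)) P Pex.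
by split => // l; rewrite h2 /tri rmorph_prod.
Qed.

End tensor.

(** * Box indicators as limits of Fejer means *)

Section indicator_approximation.
Variable R : realType.
Local Notation leb := (@lebesgue_measure R).
Variables a b : R.

Definition oc_ind (x : R) : R := if a < x <= b then 1 else 0.

Lemma oc_ind01 x : 0 <= oc_ind x <= 1.
Proof. by rewrite /oc_ind; case: ifP; rewrite ?ler01 lexx. Qed.

Lemma measurable_oc_ind : measurable_fun [set: R] oc_ind.
Proof.
apply: measurable_fun_ifT => //; apply: measurable_and.
  exact: measurable_fun_ltr.
exact: measurable_fun_ler.
Qed.

Lemma int_oc_ind : (\int[leb]_x (oc_ind x)%:E = (Num.max (b - a) 0)%:E)%E.
Proof.
rewrite (_ : (\int[leb]_x _ = \int[leb]_(x in `]a, b]) cst 1 x)%E); last first.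
  rewrite [RHS]integral_mkcond; apply: eq_integral => x _.
  by rewrite patchE mem_setE /= in_itv /= /oc_ind; case: ifP.
rewrite integral_cst //= mul1e lebesgue_measure_itv /= lte_fin.
case: ifPn; rewrite -?leNgt => h; first by rewrite -EFinB max_l // subr_ge0 ltW.
by rewrite max_r // subr_le0.
Qed.

Definition oc_fej (M x : R) : R := \int[leb]_s (oc_ind s * (M * fejer (M * (x - s)))).

Let rho (x v : R) : R := `|oc_ind x - oc_ind (x - v)|.

Let mrho : measurable_fun setT (fun p : measurableTypeR R * measurableTypeR R => rho p.1 p.2).
Proof.
apply: measurableT_comp => //; apply: measurable_funB.
  exact: measurableT_comp measurable_oc_ind _.
apply: measurableT_comp measurable_oc_ind _.
exact: measurable_funB.
Qed.

Lemma integrable_oc_fej (M x : R) : 0 < M ->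
  leb.-integrable setT (EFin \o (fun s => oc_ind s * (M * fejer (M * (x - s))))).
Proof.
move=> M0.
have fejI : leb.-integrable setT (EFin \o @fejer R).
  apply/integrableP; split; first by apply/measurable_EFinP; exact: measurable_fejer.
  rewrite (_ : (\int[leb]_x _ = \int[leb]_x (fejer x)%:E)%E); first by rewrite int_fejer ltry.
  by apply: eq_integral => u _ /=; rewrite ger0_norm // fejer_ge0.
have fejM (h : R -> R) : measurable_fun setT h -> (forall u, `|h u| <= 1) ->
    leb.-integrable setT (EFin \o (fun u => h u * fejer u)).
  move=> mh h1; apply: le_integrable fejI => //.
    by apply/measurable_EFinP; apply: measurable_funM => //; exact: measurable_fejer.
  by move=> u _ /=; rewrite lee_fin normrM ler_piMl.
have mpre : measurable_fun [set: R] (fun u : R => oc_ind (x - u / M)).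
  apply: (measurableT_comp measurable_oc_ind).
  by apply: measurable_funB => //; exact: measurable_funM.
have oi1 y : `|oc_ind y| <= 1 by have /andP[h1 h2] := oc_ind01 y; rewrite ger0_norm.
have i1 : leb.-integrable setT (EFin \o (fun u => oc_ind (x - u / M) * fejer u)) by exact: fejM.
have NM0 : - M != 0 by rewrite oppr_eq0 gt_eqF.
have := integrable_affine (M * x) NM0 i1.
move=> /(integrableZl measurableT M); apply: eq_integrable => // s _ /=.
rewrite -EFinM; congr EFin.
have -> : x - (- M * s + M * x) / M = s by field; rewrite gt_eqF.
have -> : - M * s + M * x = M * (x - s) by ring.
by ring.
Qed.

(** Substituting [u = M (x - s)] and using that [fejer] has mass one turns the error into an average
    of the translation differences [rho]. *)
Lemma oc_fejE (M x : R) : 0 < M ->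
  (`|oc_ind x - oc_fej M x|%:E <= \int[leb]_u (fejer u * rho x (u / M))%:E)%E.
Proof.
move=> M0.
have Mi0 : - M^-1 != 0 by rewrite oppr_eq0 invr_eq0 gt_eqF.
have fejI : leb.-integrable setT (EFin \o @fejer R).
  apply/integrableP; split; first by apply/measurable_EFinP; exact: measurable_fejer.
  rewrite (_ : (\int[leb]_x _ = \int[leb]_x (fejer x)%:E)%E); first by rewrite int_fejer ltry.
  by apply: eq_integral => u _ /=; rewrite ger0_norm // fejer_ge0.
have fejM (h : R -> R) : measurable_fun setT h -> (forall u, `|h u| <= 1) ->
    leb.-integrable setT (EFin \o (fun u => h u * fejer u)).
  move=> mh h1; apply: le_integrable fejI => //.
    by apply/measurable_EFinP; apply: measurable_funM => //; exact: measurable_fejer.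
  by move=> u _ /=; rewrite lee_fin normrM ler_piMl.
have mpre : measurable_fun [set: R] (fun u : R => oc_ind (x - u / M)).
  apply: (measurableT_comp measurable_oc_ind).
  by apply: measurable_funB => //; exact: measurable_funM.
have oi1 y : `|oc_ind y| <= 1 by have /andP[h1 h2] := oc_ind01 y; rewrite ger0_norm.
have i1 : leb.-integrable setT (EFin \o (fun u => oc_ind (x - u / M) * fejer u)) by exact: fejM.
have i2 : leb.-integrable setT (EFin \o (fun u => oc_ind x * fejer u)) by exact: fejM.
have hI := integrable_oc_fej x M0.
have -> : oc_fej M x = \int[leb]_u (oc_ind (x - u / M) * fejer u).
  have := integral_affine x Mi0 hI.
  rewrite normrN ger0_norm ?invr_ge0 ?(ltW M0) // invrK => E.
  apply: (mulfI (lt0r_neq0 M0)); rewrite /oc_fej /Rintegral.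
  have fI := integrable_fin_num measurableT hI.
  rewrite -[M in LHS]/(fine M%:E) -fineM // -E -RintegralZl //.
  congr fine; apply: eq_integral => u _ /=; congr EFin.
  have -> : x - (- M^-1 * u + x) = u / M by field; rewrite gt_eqF.
  have -> : - M^-1 * u + x = x - u / M by field; rewrite gt_eqF.
  have -> : M * (u / M) = u by field; rewrite gt_eqF.
  by ring.
have -> : oc_ind x = \int[leb]_u (oc_ind x * fejer u).
  by rewrite RintegralZl // /Rintegral int_fejer mulr1.
rewrite -RintegralB // EFin_normr_Rintegral //; last first.
  have := integrableB measurableT i2 i1.
  by apply: eq_integrable => // u _ /=.
apply: le_trans (le_abse_integral _ _ _) _ => //.
  apply/measurable_EFinP; apply: measurable_funB.
    by apply: measurable_funM => //; exact: measurable_fejer.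
  by apply: measurable_funM => //; exact: measurable_fejer.
rewrite le_eqVlt; apply/orP; left; apply/eqP; apply: eq_integral => u _ /=; congr EFin.
by rewrite -mulrBl normrM mulrC (ger0_norm (fejer_ge0 _)).
Qed.

Lemma int_rho_le (v : R) : (\int[leb]_x (rho x v)%:E <= (2 * Num.max (b - a) 0)%:E)%E.
Proof.
have m1 : measurable_fun [set: R] (fun x : R => oc_ind (x - v)).
  by apply: (measurableT_comp measurable_oc_ind); exact: measurable_funB.
apply: (@le_trans _ _ (\int[leb]_x ((oc_ind x)%:E + (oc_ind (1 * x + (- v)))%:E))%E).
  apply: ge0_le_integral => //.
  - by move=> x _; rewrite lee_fin normr_ge0.
  - by apply/measurable_EFinP; exact: (measurableT_comp mrho (measurable_pair2 v)).
  - apply/measurable_EFinP; apply: measurable_funD; first exact: measurable_oc_ind.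
    by under eq_fun do rewrite mul1r.
  - move=> x _; rewrite -EFinD lee_fin /rho mul1r.
    have /andP[h1 h2] := oc_ind01 x; have /andP[h3 h4] := oc_ind01 (x - v).
    by apply: le_trans (ler_normB _ _) _; rewrite !ger0_norm.
have o0 y : (0 <= (oc_ind y)%:E)%E by rewrite lee_fin; case/andP: (oc_ind01 y).
rewrite ge0_integralD //; last 2 first.
- by apply/measurable_EFinP; exact: measurable_oc_ind.
- by apply/measurable_EFinP; under eq_fun do rewrite mul1r.
rewrite (ge0_integral_affine (- v) (oner_neq0 R) (f := EFin \o oc_ind)); last 2 first.
- by apply/measurable_EFinP; exact: measurable_oc_ind.
- by move=> x; exact: o0.
by rewrite normr1 invr1 mul1e /= int_oc_ind -EFinD lee_fin; lra.
Qed.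

(** The indicator and its translate differ only within [|v|] of an endpoint, so two intervals of
    length [2 |v|] cover the difference. *)
Lemma int_rho_small (v : R) : (\int[leb]_x (rho x v)%:E <= (4 * `|v|)%:E)%E.
Proof.
have v0 := normr_ge0 v.
pose I (c x : R) : \bar R := ((fun=> 1%E) \_ `[c - `|v|, c + `|v|]) x.
have mI c : measurable_fun [set: R] (I c).
  by apply/(measurable_restrictT _ _).1.
have intI c : (\int[leb]_x I c x = (2 * `|v|)%:E)%E.
  rewrite /I -integral_mkcond integral_cst //= mul1e lebesgue_measure_itv /= lte_fin.
  case: ifPn => h; first by rewrite -EFinB; congr EFin; ring.
  by congr EFin; move: h; rewrite -leNgt; lra.
have I0 c x : (0 <= I c x)%E by rewrite /I patchE; case: ifP.
apply: (@le_trans _ _ (\int[leb]_x (I a x + I b x))%E).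
  apply: ge0_le_integral => //.
  - by move=> x _; rewrite lee_fin normr_ge0.
  - by apply/measurable_EFinP; exact: (measurableT_comp mrho (measurable_pair2 v)).
  - by apply: emeasurable_funD; exact: mI.
  - move=> x _; rewrite /I !patchE !mem_setE /= !in_itv /= /rho /oc_ind.
    case: (ger0P v) => hv; do ?[case: ifPn => /=]; rewrite ?subrr ?normr0 ?subr0 ?sub0r ?normrN ?normr1 ?adde0 ?add0e ?lee_fin // -?EFinD ?lee_fin; try lra.
have -> : (\int[leb]_x (I a x + I b x) = \int[leb]_x I a x + \int[leb]_x I b x)%E.
  by apply: ge0_integralD => //; exact: mI.
by rewrite !intI -EFinD lee_fin; lra.
Qed.

Lemma oc_fej_ge0 (M x : R) : 0 < M -> 0 <= oc_fej M x.
Proof.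
move=> M0; apply: Rintegral_ge0 => s _; rewrite mulr_ge0 //; first by case/andP: (oc_ind01 s).
by rewrite mulr_ge0 ?fejer_ge0 // ltW.
Qed.

Lemma measurable_oc_fej (M : R) : 0 < M -> measurable_fun [set: R] (oc_fej M).
Proof.
move=> M0; apply/measurable_EFinP.
pose h (p : measurableTypeR R * measurableTypeR R) : \bar R :=
  (oc_ind p.2 * (M * fejer (M * (p.1 - p.2))))%:E.
have mh : measurable_fun setT h.
  apply/measurable_EFinP; apply: measurable_funM.
    exact: (measurableT_comp measurable_oc_ind).
  apply: measurable_funM => //.
  apply: (measurableT_comp (@measurable_fejer R)).
  by apply: measurable_funM => //; exact: measurable_funB.
have h0 p : (0 <= h p)%E.
  rewrite lee_fin mulr_ge0 //; first by case/andP: (oc_ind01 p.2).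
  by rewrite mulr_ge0 ?fejer_ge0 // ltW.
rewrite (_ : EFin \o _ = fubini_F leb h); first exact: measurable_fun_fubini_tonelli_F.
apply/funext => x; rewrite /fubini_F /= /oc_fej fineK //.
by apply: (integrable_fin_num measurableT); exact: integrable_oc_fej.
Qed.

(** By Tonelli the error is bounded by the average over [u] of the [L^1] modulus of translation at
    [u / n.+1]. It tends to zero for each [u] by [int_rho_small] and is dominated by
    [int_rho_le]. *)
Lemma oc_fej_cvg :
  (\int[leb]_x `|oc_ind x - oc_fej n.+1%:R x|%:E)%E @[n --> \oo] --> 0%E.
Proof.
pose L := Num.max (b - a) 0.
have L0 : 0 <= L by rewrite le_max lexx orbT.
pose D n (p : measurableTypeR R * measurableTypeR R) : \bar R :=
  (fejer p.2 * rho p.1 (p.2 / n.+1%:R))%:E.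
have mD n : measurable_fun setT (D n).
  apply/measurable_EFinP; apply: measurable_funM.
    exact: (measurableT_comp (@measurable_fejer R)).
  have mp : measurable_fun setT (fun p : measurableTypeR R * measurableTypeR R =>
      (p.1, p.2 / n.+1%:R) : measurableTypeR R * measurableTypeR R).
    by apply: measurable_fun_pair => //=; exact: measurable_funM.
  exact: (measurableT_comp mrho mp).
have D0 n p : (0 <= D n p)%E by rewrite lee_fin mulr_ge0 ?fejer_ge0 // normr_ge0.
pose G n u := (\int[leb]_x D n (x, u))%E.
have GE n u : G n u = ((fejer u)%:E * \int[leb]_x (rho x (u / n.+1%:R))%:E)%E.
  rewrite -ge0_integralZl //.
  - by apply/measurable_EFinP; exact: (measurableT_comp mrho (measurable_pair2 _)).
  - by move=> x _; rewrite lee_fin normr_ge0.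
  - by rewrite lee_fin fejer_ge0.
have G0 n u : (0 <= G n u)%E by apply: integral_ge0.
have mG n : measurable_fun setT (G n) by exact: measurable_fun_fubini_tonelli_G.
have fejI : leb.-integrable setT (EFin \o @fejer R).
  apply/integrableP; split; first by apply/measurable_EFinP; exact: measurable_fejer.
  rewrite (_ : (\int[leb]_x _ = \int[leb]_x (fejer x)%:E)%E); first by rewrite int_fejer ltry.
  by apply: eq_integral => u _ /=; rewrite ger0_norm // fejer_ge0.
have Gcvg u : G n u @[n --> \oo] --> 0%E.
  apply: (@squeeze_cvge _ _ _ _ (cst 0%E) _ (fun n => ((fejer u * (4 * `|u|))%:E * (harmonic n)%:E)%E)).
  - apply: nearW => n; apply/andP; split; first exact: G0.
    rewrite GE (EFinM (fejer u)) -muleA; apply: lee_wpmul2l; first by rewrite lee_fin fejer_ge0.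
    apply: le_trans (int_rho_small _) _; rewrite -EFinM lee_fin normrM mulrA.
    by rewrite (@ger0_norm _ (_^-1)) // invr_ge0.
  - exact: cvg_cst.
  - rewrite -[X in _ --> X](mule0 (fejer u * (4 * `|u|))%:E).
    by apply: cvgeZl => //; exact: cvge_harmonic.
have dom : \forall u \ae leb, forall n, [set: measurableTypeR R] u ->
    (`|G n u| <= (2 * L)%:E * (fejer u)%:E)%E.
  apply: aeW => u n _; rewrite gee0_abs // GE muleC lee_wpmul2r ?lee_fin ?fejer_ge0 //.
  exact: int_rho_le.
have cvgae : \forall u \ae leb, [set: measurableTypeR R] u -> G n u @[n --> \oo] --> cst 0%E u.
  by apply: aeW => u _; exact: Gcvg.
have [_ _ H] := dominated_convergence measurableT mG (measurable_cst _) cvgae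
  (integrableZl measurableT (2 * L) fejI) dom.
rewrite integral0 in H.
apply: (@squeeze_cvge _ _ _ _ (cst 0%E) _ (fun n => (\int[leb]_u G n u)%E)); last 2 first.
- exact: cvg_cst.
- exact: H.
apply: nearW => n; apply/andP; split; first by apply: integral_ge0.
have M0 : 0 < n.+1%:R :> R by rewrite ltr0n.
rewrite /G -(fubini_tonelli (D n) (mD n) (D0 n)).
apply: ge0_le_integral => //.
- apply/measurable_EFinP; apply: measurableT_comp => //; apply: measurable_funB.
    exact: measurable_oc_ind.
  exact: measurable_oc_fej.
- exact: (measurable_fun_fubini_tonelli_F _ (mD n)).
- by move=> x _; exact: oc_fejE.
Qed.

End indicator_approximation.

(** * Density in L^1 of smoothed boxes *)

Section density.
Import HBSimple.
Variables (R : realType) (d : nat).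
Local Notation mu := (Rd_measure R d).
Local Notation leb := (@lebesgue_measure R).
Implicit Types (f g : d.-tuple R -> R[i]) (E : set (d.-tuple R)).

Lemma cintegrable_oc_ind (a b : R) : cintegrable leb (fun x => ((oc_ind a b x)%:C)%C).
Proof.
split; first by apply: cmeas_real; exact: measurable_oc_ind.
rewrite (_ : (\int[leb]_x _ = \int[leb]_x (oc_ind a b x)%:E)%E); first by rewrite int_oc_ind ltry.
by apply: eq_integral => x _; rewrite cabs_real ger0_norm //; case/andP: (oc_ind01 a b x).
Qed.

Definition hbox (a b : 'I_d -> R) : set (d.-tuple R) :=
  [set t | forall i, a i < tnth t i <= b i].

Definition cind E (t : d.-tuple R) : R[i] := ((\1_E t : R)%:C)%C.

Lemma tens_hbox (a b : 'I_d -> R) :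
  tens (fun k x => ((oc_ind (a k) (b k) x)%:C)%C) = cind (hbox a b).
Proof.
apply/funext => t; rewrite /tens /cind indicE.
have [h|h] := boolP (t \in hbox a b).
  rewrite big1 // => k _; rewrite /oc_ind ifT //.
  by move: h; rewrite inE => /(_ k).
have [k hk] : exists k, ~~ (a k < tnth t k <= b k).
  apply: contrapT => /forallNP h'; move/negP: h; apply; rewrite inE => k.
  by have /negP := h' k; rewrite negbK.
by rewrite (bigD1 k) //= /oc_ind (negbTE hk) mul0r.
Qed.

Lemma measurable_hbox a b : measurable (hbox a b).
Proof.
rewrite (_ : hbox a b = \bigcap_(i in [set: 'I_d]) ((fun t => tnth t i) @^-1` `]a i, b i]%classic)).
  apply: fin_bigcap_measurable => // i _.
  by rewrite -[X in measurable X]setTI; apply: measurable_tnth.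
by apply/seteqP; split => t /= h i => [_|]; have := h i; rewrite /= in_itv //=; apply.
Qed.

Lemma hboxI a b a' b' : hbox a b `&` hbox a' b' =
  hbox (fun k => Num.max (a k) (a' k)) (fun k => Num.min (b k) (b' k)).
Proof.
apply/seteqP; split => t /=.
  by move=> [h1 h2] i; rewrite gt_max le_min; have /andP[-> ->] := h1 i; have /andP[-> ->] := h2 i.
by move=> h; split => i; have := h i; rewrite gt_max le_min => /andP[/andP[h1 h2] /andP[h3 h4]];
  apply/andP.
Qed.

Lemma cabs_cind E t : cabs (cind E t) = \1_E t.
Proof. by rewrite cabs_real ger0_norm // indicE. Qed.

Lemma L1_cind E : measurable E -> (mu E < +oo)%E -> L1 (cind E).
Proof.
move=> mE Efin; apply/L1P; split; first by apply: cmeas_real.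
by under eq_integral do rewrite cabs_cind; rewrite integral_indic // setIT.
Qed.

Lemma hbox_fin a b : (mu (hbox a b) < +oo)%E.
Proof.
have [_] := @cintegrable_tens R d _ (fun k => cintegrable_oc_ind (a k) (b k)).
rewrite tens_hbox; under eq_integral do rewrite cabs_cind.
by rewrite integral_indic ?setIT //; exact: measurable_hbox.
Qed.

Lemma tuple_bound (t : d.-tuple R) : exists m, forall n, (m <= n)%N -> forall i, `|tnth t i| < n%:R.
Proof.
pose S := \sum_(k < d) `|tnth t k|.
have S0 : 0 <= S by rewrite sumr_ge0.
exists (Num.bound S) => n mn i; apply: (@le_lt_trans _ _ S).
  by rewrite /S (bigD1 i) //= lerDl sumr_ge0.
by apply: lt_le_trans (archi_boundP S0) _; rewrite ler_nat.
Qed.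

Lemma measurable_hbox_gen E : measurable E -> <<s [set X | exists a b, X = hbox a b] >> E.
Proof.
set G := [set X | _].
move=> mE; apply: (smallest_sub _ _ mE); first exact: smallest_sigma_algebra.
move=> A; rewrite -bigcup_seq => -[i _ [B mB <-]].
have sub : (@measurable _ (measurableTypeR R)) `<=`
    image_set_system setT (fun t : d.-tuple R => tnth t i) <<s G >>.
  apply: smallest_sub; first by apply: sigma_algebra_image; exact: smallest_sigma_algebra.
  move=> _ [[a b]] _ <- /=; rewrite /image_set_system /= setTI.
  rewrite (_ : _ @^-1` _ = \bigcup_m hbox (fun k => if k == i then a else - m%:R)
      (fun k => if k == i then b else m%:R)); last first.
    apply/seteqP; split => t /=.
      rewrite in_itv /= => h.
      have [m hm] := tuple_bound t; exists m => // k.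
      case: eqP => [->//|_].
      by have := hm m (leqnn m) k; rewrite ltr_norml => /andP[-> /ltW ->].
    by move=> [m _] /(_ i); rewrite eqxx in_itv.
  have [_ _ h] := smallest_sigma_algebra setT G.
  by apply: h => m; apply: sub_sigma_algebra; eexists; eexists.
exact: sub.
Qed.

Variable K : (d.-tuple R -> R[i]) -> Prop.
Hypothesis K_lin : forall c f g, L1 f -> L1 g -> K f -> K g -> K (fun t => c * f t + g t).
Hypothesis K_lim : forall f (g : nat -> d.-tuple R -> R[i]), L1 f -> (forall n, L1 (g n)) ->
  (forall n, K (g n)) ->
  (\int[mu]_t (cabs (f t - g n t))%:E)%E @[n --> \oo] --> 0%E -> K f.

Section boxes.
Hypothesis K_box : forall a b, K (cind (hbox a b)).

Let Q (m : nat) := hbox (fun=> - m%:R) (fun=> m%:R).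

Let mQ m : measurable (Q m). Proof. exact: measurable_hbox. Qed.

Let L1Q E m : measurable E -> L1 (cind (E `&` Q m)).
Proof.
move=> mE; apply: L1_cind; first exact: measurableI.
apply: le_lt_trans (hbox_fin (fun=> - m%:R) (fun=> m%:R)).
by apply: le_measure; [apply/mem_set; exact: measurableI|exact: mem_set (mQ m)|exact: subIsetr].
Qed.

Let K_cst0 : K (fun=> 0).
Proof.
have h := L1_cind (measurable_hbox (fun=> 0) (fun=> 0)) (hbox_fin (fun=> 0) (fun=> 0)).
have := K_lin (-1) h h (K_box _ _) (K_box _ _).
by congr K; apply/funext => t; rewrite mulN1r addNr.
Qed.

(** Lambda-system argument inside the fixed box [Q m]: boxes are stable under intersection, and the
    finite measure of [Q m] turns monotone limits of sets into [L^1] limits of indicators. *)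
Let K_set m E : measurable E -> K (cind (E `&` Q m)).
Proof.
move=> mE; suff : [set X | measurable X /\ K (cind (X `&` Q m))] E by case.
apply: (@lambda_system_subset _ [set X | exists a b, X = hbox a b] _ setT _ _ _ _ _ (measurable_hbox_gen mE)).
- move=> _ _ [a [b ->]] [a' [b' ->]].
  by rewrite hboxI; eexists; eexists.
- split => //.
  + by split => //; rewrite setTI; exact: K_box.
  + move=> A B BA [mA KA] [mB KB]; split; first exact: measurableD.
    have := K_lin (-1) (L1Q m mB) (L1Q m mA) KB KA; congr K; apply/funext => t.
    rewrite /cind !indicE [t \in (A `\` B) `&` _]in_setI in_setD !in_setI; have [tB|] := boolP (t \in B).
      by rewrite (_ : t \in A) /= ?mulN1r ?addNr //; apply/mem_set/BA/set_mem.
    by rewrite /= mulr0 add0r andbT.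
  + move=> F ndF HF; have mF i : measurable (F i) by case: (HF i).
    have mU : measurable (\bigcup_i F i) by exact: bigcup_measurable.
    split => //.
    apply: (K_lim (g := fun n => cind (F n `&` Q m))) => //.
    * exact: L1Q.
    * by move=> n; exact: L1Q.
    * by move=> n; case: (HF n).
    pose C n := (\bigcup_i F i `\` F n) `&` Q m.
    have mC n : measurable (C n) by apply: measurableI => //; exact: measurableD.
    rewrite (_ : (fun n => _) = mu \o C); last first.
      apply/funext => n /=; rewrite -[in RHS](setIT (C n)) -integral_indic //.
      apply: eq_integral => t _; congr EFin.
      rewrite /cind !indicE -rmorphB /= cabs_real [t \in C n]in_setI in_setD !in_setI.
      have [tF|_] := boolP (t \in F n); last by rewrite /= subr0 ger0_norm // andbT.
      rewrite (_ : t \in \bigcup_i F i) ?subrr ?normr0 //.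
      by apply/mem_set; exists n => //; exact: set_mem.
    have <- : mu (\bigcap_n C n) = 0%E.
      rewrite (_ : \bigcap_n C n = set0) ?measure0 // -subset0 => t h.
      have [[[n _ Fn] _] _] := h 0%N I.
      by have [[_]] := h n I.
    apply: nonincreasing_cvg_mu => //.
    * apply: le_lt_trans (hbox_fin (fun=> - m%:R) (fun=> m%:R)).
      by apply: le_measure; [exact: mem_set (mC 0%N)|exact: mem_set (mQ m)|exact: subIsetr].
    * exact: bigcap_measurable.
    * move=> i j ij; apply/subsetPset => t [[tU nF] tQ]; split => //; split => // Fi.
      by apply: nF; move: t Fi {tU tQ}; exact/subsetPset/ndF.
- by move=> _ [a [b ->]]; split; [exact: measurable_hbox|rewrite /Q hboxI; exact: K_box].
- by [].
Qed.

Let K_sum n (c : 'I_n -> R[i]) (F : 'I_n -> d.-tuple R -> R[i]) :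
  (forall i, L1 (F i)) -> (forall i, K (F i)) ->
  L1 (fun t => \sum_(i < n) c i * F i t) /\ K (fun t => \sum_(i < n) c i * F i t).
Proof.
elim: n c F => [|n IH] c F L1F KF.
  under eq_fun do rewrite big_ord0; split => //; exact: L1_cst0.
have [h1 h2] := IH (fun i => c (lift ord0 i)) (fun i => F (lift ord0 i))
  (fun i => L1F _) (fun i => KF _).
under eq_fun do rewrite big_ord_recl.
by split; [exact: L1_lin|exact: K_lin].
Qed.

Let K_sfun (h : {sfun (d.-tuple R) >-> R}) m :
  L1 (fun t => ((h t * \1_(Q m) t)%:C)%C) /\ K (fun t => ((h t * \1_(Q m) t)%:C)%C).
Proof.
pose s := finmap.enum_fset (fset_set (range h)).
pose c (i : 'I_(size s)) : R[i] := ((s`_i)%:C)%C.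
pose F (i : 'I_(size s)) := cind (h @^-1` [set s`_i] `&` Q m).
have mS (i : 'I_(size s)) : measurable (h @^-1` [set s`_i]) by exact: measurable_sfunP.
have -> : (fun t => ((h t * \1_(Q m) t)%:C)%C) = fun t => \sum_(i < size s) c i * F i t.
  apply/funext => t; rewrite (fimfunEord h t) -/s mulr_suml rmorph_sum; apply: eq_bigr => i _.
  by rewrite /c /F /cind -rmorphM /= indicI /= mulrA.
by apply: K_sum => i; [exact: L1Q|exact: K_set].
Qed.

Let Q_cover t : exists m, forall n, (m <= n)%N -> Q n t.
Proof.
have [m hm] := tuple_bound t; exists m => n mn i.
by have := hm n mn i; rewrite ltr_norml => /andP[-> /ltW ->].
Qed.

(** Two errors add up: truncation to [Q n], which vanishes by dominated convergence, and
    approximation by simple functions. *)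
Let K_real (u : d.-tuple R -> R) : mu.-integrable setT (EFin \o u) ->
  K (fun t => ((u t)%:C)%C).
Proof.
move=> ui.
have mu_ : measurable_fun setT u by apply/measurable_EFinP; exact: measurable_int ui.
have [h [hi _ hl]] := approximation_sfun_integrable measurableT ui.
have L1u : L1 (fun t => ((u t)%:C)%C).
  apply/L1P; split; first exact: cmeas_real.
  move/integrableP : ui => [_]; apply: le_lt_trans.
  rewrite le_eqVlt; apply/orP; left; apply/eqP; apply: eq_integral => t _ /=.
  by rewrite cabs_real.
apply: (K_lim (g := fun n t => ((h n t * \1_(Q n) t)%:C)%C)) => //.
- by move=> n; case: (K_sfun (h n) n).
- by move=> n; case: (K_sfun (h n) n).
have mh n : measurable_fun setT (h n : d.-tuple R -> R) by exact: measurable_funP.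
pose T n t := `|u t - u t * \1_(Q n) t|%:E : \bar R.
have mT n : measurable_fun setT (T n).
  apply/measurable_EFinP; apply: measurableT_comp => //.
  by apply: measurable_funB => //; apply: measurable_funM.
have Tae : \forall t \ae mu, [set: d.-tuple R] t -> T n t @[n --> \oo] --> cst 0%E t.
  apply: aeW => t _; apply: cvg_near_cst; have [m hm] := Q_cover t.
  exists m => // n /= mn; rewrite /T indicE mem_set ?mulr1 ?subrr ?normr0 //.
  exact: hm.
have dom : \forall t \ae mu, forall n, [set: d.-tuple R] t -> (`|T n t| <= `|(EFin \o u) t|)%E.
  apply: aeW => t n _; rewrite /T /= lee_fin normr_id indicE.
  by case: (t \in Q n); rewrite ?mulr1 ?mulr0 ?subrr ?subr0 ?normr0.
have [_ _ HT] := dominated_convergence measurableT mT (measurable_cst _) Tae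
  (integrable_abse ui) dom.
rewrite integral0 in HT.
have hsum : (\int[mu]_t T n t + \int[mu]_t `|(EFin \o u) t - (h n t)%:E|)%E @[n --> \oo] --> 0%E.
  by rewrite -[X in _ --> X](adde0 0%E); exact: cvgeD.
apply: (@squeeze_cvge _ _ _ _ (cst 0%E) _ (fun n => (\int[mu]_t T n t +
    \int[mu]_t `|(EFin \o u) t - (h n t)%:E|)%E)); [|exact: cvg_cst|exact: hsum].
apply: nearW => n; apply/andP; split.
  by apply: integral_ge0 => t _; rewrite lee_fin cabs_ge0.
have mhl : measurable_fun setT (fun t => `|(EFin \o u) t - (h n t)%:E|%E).
  apply: measurableT_comp => //; apply: emeasurable_funB; first exact/measurable_EFinP.
  exact/measurable_EFinP.
rewrite -ge0_integralD //.
apply: ge0_le_integral => //.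
- by move=> t _; rewrite lee_fin cabs_ge0.
- apply: cmeas_cabsE; rewrite (_ : (fun _ => _) = fun t => ((u t - h n t * \1_(Q n) t)%:C)%C).
    apply: cmeas_real; apply: measurable_funB => //; exact: measurable_funM.
  by apply/funext => t; rewrite rmorphB.
- exact: emeasurable_funD.
- move=> t _; rewrite -rmorphB cabs_real /T /= -EFinD lee_fin indicE.
  case: (t \in Q n); rewrite ?mulr1 ?mulr0 ?subrr ?subr0 ?normr0 ?add0r //.
  by rewrite lerDl.
- by move=> t _; rewrite lee_fin.
Qed.

Lemma K_L1 f : L1 f -> K f.
Proof.
move=> fi; have /L1P fi' := fi.
have kr := K_real (cintegrable_Re fi'); have ki := K_real (cintegrable_Im fi').
have [[m1 m2] fl] := fi'.
have L1r (u : d.-tuple R -> R) : measurable_fun setT u -> (forall t, `|u t| <= cabs (f t)) ->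
    L1 (fun t => ((u t)%:C)%C).
  move=> mu' uf; apply/L1P; apply: (cintegrable_le (g := fun t => cabs (f t))) => //.
  - by move=> t; rewrite cabs_real.
  - exact: cmeas_cabs.
have := K_lin ('i)%C (L1r _ m2 (fun t => cabs_ge_Im (f t))) (L1r _ m1 (fun t => cabs_ge_Re (f t))) ki kr.
by congr K; apply/funext => t; rewrite [RHS]complexE addrC mulrC.
Qed.

End boxes.

Hypothesis K_fej : forall (a b : 'I_d -> R) (M : 'I_d -> nat),
  K (tens (fun k x => ((oc_fej (a k) (b k) (M k).+1%:R x)%:C)%C)).

Lemma cintegrable_oc_fej (a b : R) (n : nat) : cintegrable leb (fun x => ((oc_fej a b n.+1%:R x)%:C)%C).
Proof.
have n0 : 0 < n.+1%:R :> R by rewrite ltr0n.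
split; first by apply: cmeas_real; exact: measurable_oc_fej.
pose h (p : measurableTypeR R * measurableTypeR R) : \bar R :=
  (oc_ind a b p.2 * (n.+1%:R * fejer (n.+1%:R * (p.1 - p.2))))%:E.
have mh : measurable_fun setT h.
  apply/measurable_EFinP; apply: measurable_funM.
    exact: (measurableT_comp (measurable_oc_ind a b)).
  apply: measurable_funM => //.
  apply: (measurableT_comp (@measurable_fejer R)).
  by apply: measurable_funM => //; exact: measurable_funB.
have h0 p : (0 <= h p)%E.
  rewrite lee_fin mulr_ge0 //; first by case/andP: (oc_ind01 a b p.2).
  by rewrite mulr_ge0 ?fejer_ge0 // ltW.
rewrite (_ : (\int[leb]_x _ = \int[leb]_x \int[leb]_s h (x, s))%E); last first.
  apply: eq_integral => x _; rewrite cabs_real ger0_norm ?oc_fej_ge0 // /oc_fej fineK //.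
  by apply: (integrable_fin_num measurableT); exact: integrable_oc_fej.
rewrite (fubini_tonelli h mh h0).
rewrite (_ : (\int[leb]_s _ = \int[leb]_s (oc_ind a b s)%:E)%E); first by rewrite int_oc_ind ltry.
apply: eq_integral => s _; rewrite /h /=.
under eq_integral do rewrite EFinM.
rewrite ge0_integralZl //; last 3 first.
- apply/measurable_EFinP; apply: measurable_funM => //.
  apply: (measurableT_comp (@measurable_fejer R)).
  by apply: measurable_funM => //; exact: measurable_funB.
- by move=> x _; rewrite lee_fin mulr_ge0 ?fejer_ge0 // ltW.
- by rewrite lee_fin; case/andP: (oc_ind01 a b s).
rewrite (_ : (\int[leb]_x _ = 1)%E) ?mule1 //.
have n0' : n.+1%:R != 0 :> R by rewrite gt_eqF.
under eq_integral do rewrite EFinM mulrBr.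
rewrite ge0_integralZl //; last 2 first.
- apply/measurable_EFinP; apply: (measurableT_comp (@measurable_fejer R)).
  by apply: measurable_funB => //; exact: measurable_funM.
- by move=> x _; rewrite lee_fin fejer_ge0.
rewrite (ge0_integral_affine (- (n.+1%:R * s)) n0' (f := EFin \o @fejer R)); last 2 first.
- by apply/measurable_EFinP; exact: measurable_fejer.
- by move=> x /=; rewrite lee_fin fejer_ge0.
by rewrite /= int_fejer mule1 gtr0_norm // -EFinM divff.
Qed.

(** Sharp boxes are reached from smoothed ones one coordinate at a time: replacing a single factor
    of a tensor product makes an error equal to the one-dimensional error times a finite
    constant. *)
Lemma K_fej_L1 f : L1 f -> K f.
Proof.
apply: K_L1 => a b; rewrite -tens_hbox.
pose ind k : R -> R[i] := fun x => ((oc_ind (a k) (b k) x)%:C)%C.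
pose fj (M : 'I_d -> nat) k : R -> R[i] := fun x => ((oc_fej (a k) (b k) (M k).+1%:R x)%:C)%C.
suff P j (M : 'I_d -> nat) : (j <= d)%N -> K (tens (fun k => if (k < j)%N then ind k else fj M k)).
  have := P d (fun=> 0%N) (leqnn d); congr K; congr tens.
  by apply/funext => k; rewrite ltn_ord.
elim: j M => [|j IH] M jd.
  by have := K_fej a b M; congr K.
pose jo := Ordinal jd.
pose f0 (k : 'I_d) := if (k < j)%N then ind k else fj M k.
have fi0 k : cintegrable leb (f0 k).
  by rewrite /f0; case: ifP => _; [exact: cintegrable_oc_ind|exact: cintegrable_oc_fej].
have -> : (fun k : 'I_d => if (k < j.+1)%N then ind k else fj M k) = upd f0 jo (ind jo).
  apply/funext => k; rewrite /upd /f0; have [->|kj] := eqVneq k jo; first by rewrite /= ltnSn.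
  by rewrite ltnS leq_eqVlt -[k == j :> nat]/(k == jo) (negbTE kj).
have fiu u k : cintegrable leb u -> cintegrable leb (upd f0 jo u k).
  by move=> ui; rewrite /upd; case: ifP.
pose g n := upd f0 jo (fj (fun=> n) jo).
have cB (u v : R -> R[i]) : cintegrable leb u -> cintegrable leb v -> cintegrable leb (fun x => u x - v x).
  move=> ui vi; have := cintegrableD ui (cintegrableZ (-1) vi).
  by under eq_fun do rewrite mulN1r.
apply: (K_lim (g := fun n => tens (g n))).
- by apply/L1P; apply: cintegrable_tens => k; apply: fiu; exact: cintegrable_oc_ind.
- by move=> n; apply/L1P; apply: cintegrable_tens => k; apply: fiu; exact: cintegrable_oc_fej.
- move=> n; have := IH (fun k => if k == jo then n else M k) (ltnW jd); congr K; congr tens.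
  apply/funext => k; rewrite /g /upd /f0; have [->|kj] := eqVneq k jo.
    by rewrite /= ltnn /fj eqxx.
  by rewrite /fj (negbTE kj).
pose C := (\prod_(k < d | k != jo) \int[leb]_x (cabs (f0 k x))%:E)%E.
rewrite (_ : (fun n => _) = fun n => (\int[leb]_x `|oc_ind (a jo) (b jo) x -
     oc_fej (a jo) (b jo) n.+1%:R x|%:E * C)%E); last first.
  apply/funext => n; rewrite (_ : (\int[mu]_t _ = \int[mu]_t
      (cabs (tens (upd f0 jo (fun x => ind jo x - fj (fun=> n) jo x)) t))%:E)%E); last first.
    by apply: eq_integral => t _; rewrite tens_updB.
  rewrite int_tens; last first.
    by move=> k; case: (fiu (fun x => ind jo x - fj (fun=> n) jo x) k) => //;
      apply: cB; [exact: cintegrable_oc_ind|exact: cintegrable_oc_fej].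
  rewrite (bigD1 jo) //=; congr (_ * _)%E.
    by apply: eq_integral => x _; rewrite /upd eqxx /ind /fj -rmorphB cabs_real.
  by apply: eq_bigr => k /negbTE kj; rewrite /upd kj.
have Cfin : C \is a fin_num.
  apply: (big_ind (fun x => x \is a fin_num)) => //; first by move=> x y; exact: fin_numM.
  move=> k _; rewrite ge0_fin_numE; first by case: (fi0 k).
  by apply: integral_ge0 => x _; rewrite lee_fin cabs_ge0.
rewrite -[X in _ --> X](mul0e C); apply: cvgeZr => //; exact: oc_fej_cvg.
Qed.

End density.

(** * Bounded operators *)

Section rnorm.
Variables (R : realType) (V : normedModType R[i]).
Implicit Types (v w : V).

Lemma rnormE v : `|v| = ((rnorm v)%:C)%C.
Proof.
have := normr_ge0 v; rewrite /rnorm; case: `|v| => a b.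
by rewrite lecE /= => /andP[/eqP -> _].
Qed.

Lemma rnorm_ge0 v : 0 <= rnorm v.
Proof. by have := normr_ge0 v; rewrite rnormE lecR. Qed.

Lemma rnorm0 : rnorm (0 : V) = 0.
Proof. by rewrite /rnorm normr0. Qed.

Lemma rnorm_eq0 v : rnorm v = 0 -> v = 0.
Proof. by move=> h; apply/eqP; rewrite -normr_eq0 rnormE h. Qed.

Lemma rnormD v w : rnorm (v + w) <= rnorm v + rnorm w.
Proof. by have := ler_normD v w; rewrite !rnormE -rmorphD lecR. Qed.

Lemma rnormZ (c : R[i]) v : rnorm (c *: v) = cabs c * rnorm v.
Proof. by have := normrZ c v; rewrite cabsE !rnormE -rmorphM => -[]. Qed.

Lemma cvg_rnormP (u : nat -> V) v : u @ \oo --> v <->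
  forall e : R, 0 < e -> exists n0, forall n, (n0 <= n)%N -> rnorm (v - u n) < e.
Proof.
split.
  move=> /cvgrPdist_lt h e e0; have [|n0 _ hn] := h (e%:C)%C; first by rewrite ltcR.
  by exists n0 => n /hn; rewrite rnormE ltcR.
move=> h; apply/cvgrPdist_lt => -[a b]; rewrite ltcE /= => /andP[/eqP -> a0].
have [n0 hn] := h _ a0; exists n0 => // n /hn.
by rewrite /= rnormE ltcE /= eqxx.
Qed.

End rnorm.

Lemma bounded_sums_tail (R : realType) (a : nat -> R) (C : R) :
  (forall k, 0 <= a k) -> (forall n, \sum_(k < n) a k <= C) ->
  forall e, 0 < e -> exists n0, forall m n, (n0 <= m)%N -> \sum_(m <= k < n) a k <= e.
Proof.
move=> a0 aC e e0.
pose S := [set \sum_(k < n) a k | n in [set: nat]].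
have hS : has_sup S.
  split; first by exists (\sum_(k < 0) a k); exists 0%N.
  by exists C => _ [n _ <-].
have [_ [n0 _ <-] hn] := sup_adherent e0 hS.
exists n0 => m n nm; have [mn|/ltnW nm'] := leqP m n; last by rewrite big_geq // ltW.
have h : \sum_(k < n) a k <= sup S by apply: sup_upper_bound => //; exists n.
have E : \sum_(0 <= k < n) a k = \sum_(0 <= k < n0) a k + \sum_(n0 <= k < m) a k + \sum_(m <= k < n) a k.
  by rewrite -!big_cat_nat //= ?(leq_trans nm mn).
have p : 0 <= \sum_(n0 <= k < m) a k by apply: sumr_ge0.
by move: h hn; rewrite -!(big_mkord xpredT) E; lra.
Qed.

Section bl.
Variables (R : realType) (U V : normedModType R[i]).

Lemma bounded_linearP (A : U -> V) : bounded_linear A ->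
  exists2 M, 0 <= M & forall x, rnorm (A x) <= M * rnorm x.
Proof.
move=> [_ [M hM]]; exists `|M| => // x; apply: le_trans (hM x) _.
by rewrite ler_wpM2r ?rnorm_ge0 // ler_norm.
Qed.

Lemma bounded_linear0 : bounded_linear (0 : U -> V).
Proof. by split => [c x y|]; rewrite ?scaler0 ?addr0 //; exists 0 => x; rewrite rnorm0 mul0r. Qed.

Lemma bounded_linear_lin (c : R[i]) (A B : U -> V) :
  bounded_linear A -> bounded_linear B -> bounded_linear (c *: A + B).
Proof.
move=> hA hB; have [MA MA0 bA] := bounded_linearP hA; have [MB MB0 bB] := bounded_linearP hB.
split => [e x y|].
  rewrite !fctE hA.1 hB.1 !scalerDr !scalerA (mulrC c e) -!addrA; congr (_ + _).
  by rewrite addrCA.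
exists (cabs c * MA + MB) => x; rewrite !fctE.
apply: le_trans (rnormD _ _) _; rewrite rnormZ mulrDl lerD // -mulrA.
by rewrite ler_wpM2l ?cabs_ge0.
Qed.

Lemma bounded_linear_A0 (A : U -> V) : bounded_linear A -> A 0 = 0.
Proof.
by move=> [h _]; have := h (-1) 0 0; rewrite scaler0 addr0 scaleN1r addNr.
Qed.

Lemma bounded_linear_Z (A : U -> V) c x : bounded_linear A -> A (c *: x) = c *: A x.
Proof. by move=> h; have := h.1 c x 0; rewrite (bounded_linear_A0 h) !addr0. Qed.

Lemma opnorm_has_sup (A : U -> V) : bounded_linear A ->
  has_sup [set rnorm (A x) | x in [set x : U | rnorm x <= 1]].
Proof.
move=> /bounded_linearP[M M0 h]; split.
  by exists (rnorm (A 0)); exists 0 => //=; rewrite rnorm0.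
exists M => _ [x /= x1 <-]; apply: le_trans (h x) _.
by rewrite -[leRHS]mulr1 ler_wpM2l.
Qed.

Lemma opnorm_ge (A : U -> V) x : bounded_linear A -> rnorm (A x) <= opnorm A * rnorm x.
Proof.
move=> h; have [/rnorm_eq0 ->|x0] := eqVneq (rnorm x) 0.
  by rewrite (bounded_linear_A0 h) !rnorm0 mulr0.
have xp : 0 < rnorm x by rewrite lt_neqAle eq_sym x0 rnorm_ge0.
pose y := (((rnorm x)^-1)%:C)%C *: x.
have Ay : rnorm (A y) = rnorm (A x) / rnorm x.
  by rewrite bounded_linear_Z // rnormZ cabs_real ger0_norm ?invr_ge0 ?rnorm_ge0 // mulrC.
rewrite -ler_pdivrMr // -Ay; apply: (sup_upper_bound (opnorm_has_sup h)).
by exists y => //=; rewrite rnormZ cabs_real ger0_norm ?invr_ge0 ?rnorm_ge0 // mulVf.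
Qed.

Lemma opnorm_le (A : U -> V) (M : R) : 0 <= M -> (forall x, rnorm (A x) <= M * rnorm x) -> opnorm A <= M.
Proof.
move=> M0 h; apply: ge_sup.
  by exists (rnorm (A 0)); exists 0 => //=; rewrite rnorm0.
move=> _ [x /= x1 <-]; apply: le_trans (h x) _.
by rewrite -[leRHS]mulr1 ler_wpM2l.
Qed.

Lemma opnorm_ge0 (A : U -> V) : bounded_linear A -> 0 <= opnorm A.
Proof.
move=> h; apply: le_trans (rnorm_ge0 (A 0)) _.
by apply: (sup_upper_bound (opnorm_has_sup h)); exists 0 => //=; rewrite rnorm0.
Qed.

Definition blpred : {pred (U -> V)} := fun A => `[< bounded_linear A >].

Lemma blpred_closed : submod_closed blpred.
Proof.
split => [|c A B /asboolP hA /asboolP hB]; first by apply/asboolP; exact: bounded_linear0.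
by apply/asboolP; exact: bounded_linear_lin.
Qed.

HB.instance Definition _ := GRing.isSubmodClosed.Build R[i] (U -> V) blpred blpred_closed.

(** Bundled operators carry the module structure that [bmod] asks for, whereas [act] and [T] are
    given on the space of all functions. *)
Record BL := MkBL { blf :> U -> V; blP : blf \in blpred }.

HB.instance Definition _ := [isSub for blf].
HB.instance Definition _ := [Choice of BL by <:].
HB.instance Definition _ := [SubChoice_isSubLmodule of BL by <:].

Definition toBL (A : U -> V) (h : bounded_linear A) : BL := MkBL (asboolT h).

Lemma blprop (A : BL) : bounded_linear A.
Proof. exact: (asboolW (blP A)). Qed.

Lemma bl_inj (A B : BL) : (A : U -> V) = B -> A = B.
Proof. by move=> h; apply/val_inj. Qed.

Definition nmL (A : BL) : R := opnorm A.

Lemma nmL_ge0 A : 0 <= nmL A. Proof. exact: opnorm_ge0 (blprop A). Qed.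

Lemma nmLP (A : BL) x : rnorm (A x) <= nmL A * rnorm x.
Proof. exact: opnorm_ge (blprop A). Qed.

Lemma nmLD (A B : BL) : nmL (A + B) <= nmL A + nmL B.
Proof.
apply: opnorm_le => [|x]; first by rewrite addr_ge0 ?nmL_ge0.
by apply: le_trans (rnormD _ _) _; rewrite mulrDl lerD ?nmLP.
Qed.

Lemma nmL0 : nmL 0 = 0.
Proof.
apply/eqP; rewrite eq_le nmL_ge0 andbT; apply: opnorm_le => // x.
by rewrite mul0r rnorm0.
Qed.

Lemma nmL_eq0 A : nmL A = 0 -> A = 0.
Proof.
move=> h; apply: bl_inj; apply/funext => x /=; apply: rnorm_eq0.
by apply/eqP; rewrite eq_le rnorm_ge0 andbT -(mul0r (rnorm x)) -h nmLP.
Qed.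

Lemma nmLZ (c : R[i]) A : nmL (c *: A) = cabs c * nmL A.
Proof.
have le (e : R[i]) (B : BL) : nmL (e *: B) <= cabs e * nmL B.
  apply: opnorm_le => [|x]; first by rewrite mulr_ge0 ?nmL_ge0 ?cabs_ge0.
  by rewrite [X in rnorm X](_ : _ = e *: B x) // rnormZ -mulrA ler_wpM2l ?cabs_ge0 ?nmLP.
have [->|c0] := eqVneq c 0; first by rewrite scale0r nmL0 cabs0 mul0r.
apply/eqP; rewrite eq_le le /=.
have := le c^-1 (c *: A); rewrite scalerA mulVf // scale1r => h.
have cc : cabs c * cabs c^-1 = 1 by rewrite -cabsM divff // cabs1.
by have := ler_wpM2l (cabs_ge0 c) h; rewrite mulrA cc mul1r.
Qed.

Lemma bl_sumE (I : Type) (s : seq I) (F : I -> BL) x : (\sum_(i <- s) F i) x = \sum_(i <- s) F i x.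
Proof. by elim/big_rec2: _ => // i y z _ <-. Qed.

End bl.

Section bl_complete.
Variables (R : realType) (U : normedModType R[i]) (V : completeNormedModType R[i]).

(** The limit is taken pointwise in [V]; the tail of the series of norms bounds the error uniformly
    on the unit ball. *)
Lemma nmL_complete (x : nat -> BL U V) (C : R) : (forall n, \sum_(k < n) nmL (x k) <= C) ->
  exists y : BL U V, forall e, 0 < e -> exists n0, forall n, (n0 <= n)%N ->
    nmL (y - \sum_(k < n) x k) <= e.
Proof.
move=> hC; have tail := bounded_sums_tail (fun k => nmL_ge0 (x k)) hC.
pose w u n := (\sum_(k < n) x k) u.
have wB u m n : (m <= n)%N -> rnorm (w u n - w u m) <= (\sum_(m <= k < n) nmL (x k)) * rnorm u.
  move=> mn; rewrite /w !bl_sumE -!(big_mkord xpredT (fun k => x k u)) (big_cat_nat (leq0n m) mn) /=.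
  rewrite addrAC subrr add0r mulr_suml.
  elim/big_rec2: _ => [|k a b _ h]; first by rewrite rnorm0.
  by apply: le_trans (rnormD _ _) _; rewrite lerD ?nmLP.
have cw u : cvg (w u @ \oo).
  apply: cauchy_cvg; apply: cauchy_exP => -[a b]; rewrite ltcE /= => /andP[/eqP -> a0].
  have u1 : 0 < rnorm u + 1 by rewrite ltr_pwDr ?rnorm_ge0.
  have [n0 hn] := tail _ (divr_gt0 a0 u1).
  exists (w u n0); exists n0 => // n /= nn; rewrite -ball_normE /=.
  rewrite distrC rnormE ltcE /= eqxx /=; apply: le_lt_trans (wB _ _ _ nn) _.
  apply: (@le_lt_trans _ _ (a / (rnorm u + 1) * rnorm u)).
    by apply: ler_wpM2r (hn _ _ (leqnn _)); exact: rnorm_ge0.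
  by rewrite -mulrA gtr_pMr // mulrC ltr_pdivrMr // mul1r ltrDl.
pose y u := lim (w u @ \oo).
have yw u m e : 0 < e -> (forall n, \sum_(m <= k < n) nmL (x k) <= e) ->
    rnorm (y u - w u m) <= e * rnorm u.
  move=> e0 he; apply/ler_addgt0Pr => e' e'0.
  have /cvg_rnormP/(_ _ e'0)[n1 hn1] := cw u.
  pose n := maxn n1 m.
  have -> : y u - w u m = (y u - w u n) + (w u n - w u m) by rewrite subrKA.
  apply: le_trans (rnormD _ _) _; rewrite addrC lerD //.
    apply: le_trans (wB _ _ _ (leq_maxr _ _)) _.
    by rewrite ler_wpM2r ?rnorm_ge0.
  by apply: ltW; apply: hn1; exact: leq_maxl.
have ylin c u v : y (c *: u + v) = c *: y u + y v.
  apply: cvg_lim => //.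
  rewrite (_ : w (c *: u + v) = fun n => c *: w u n + w v n); last first.
    by apply/funext => n; rewrite /w (blprop (\sum_(k < n) x k)).1.
  apply: cvgD; last exact: cw.
  by apply: cvgZr; exact: cw.
have [n0 hn0] := tail 1 ltr01.
have yb : bounded_linear y.
  split => //; exists (1 + nmL (\sum_(k < n0) x k)) => u.
  have -> : y u = (y u - w u n0) + w u n0 by rewrite subrK.
  apply: le_trans (rnormD _ _) _; rewrite mulrDl lerD ?nmLP //.
  by apply: yw => // n; exact: hn0.
exists (toBL yb) => e e0; have [m0 hm0] := tail e e0.
exists m0 => n nn; apply: opnorm_le => [|u]; first exact: ltW.
by apply: (yw u n e e0) => k; exact: hm0.
Qed.

End bl_complete.

Section bl_comp.
Variables (R : realType).
Implicit Types (U V W : normedModType R[i]).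

Lemma bounded_linear_comp U V W (B : V -> W) (A : U -> V) :
  bounded_linear B -> bounded_linear A -> bounded_linear (B \o A).
Proof.
move=> hB hA; have [MA MA0 bA] := bounded_linearP hA; have [MB MB0 bB] := bounded_linearP hB.
split => [c x y|]; first by rewrite /= hA.1 hB.1.
exists (MB * MA) => x /=; apply: le_trans (bB _) _.
by rewrite -mulrA ler_wpM2l.
Qed.

Definition blcomp U V W (B : BL V W) (A : BL U V) : BL U W :=
  toBL (bounded_linear_comp (blprop B) (blprop A)).

Lemma blcompA U V W Z (C : BL W Z) (B : BL V W) (A : BL U V) :
  blcomp C (blcomp B A) = blcomp (blcomp C B) A.
Proof. exact: bl_inj. Qed.

Lemma nmL_comp U V W (B : BL V W) (A : BL U V) : nmL (blcomp B A) <= nmL B * nmL A.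
Proof.
apply: opnorm_le => [|x]; first by rewrite mulr_ge0 ?nmL_ge0.
by apply: le_trans (nmLP B (A x)) _; rewrite -mulrA ler_wpM2l ?nmL_ge0 ?nmLP.
Qed.

Lemma blcomp_linl U V W c (B B' : BL V W) (A : BL U V) :
  blcomp (c *: B + B') A = c *: blcomp B A + blcomp B' A.
Proof. exact: bl_inj. Qed.

Lemma blcomp_linr U V W c (B : BL V W) (A A' : BL U V) :
  blcomp B (c *: A + A') = c *: blcomp B A + blcomp B A'.
Proof. by apply: bl_inj; apply/funext => x; exact: (blprop B).1. Qed.

Lemma bounded_linear_id U : bounded_linear (@id U).
Proof. by split => //; exists 1 => x; rewrite mul1r. Qed.

Definition bl1 U : BL U U := toBL (@bounded_linear_id U).

Lemma blcomp1l U V (A : BL U V) : blcomp (@bl1 V) A = A. Proof. exact: bl_inj. Qed.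
Lemma blcomp1r U V (A : BL U V) : blcomp A (@bl1 U) = A. Proof. exact: bl_inj. Qed.

End bl_comp.

Lemma kern1_eq (R : realType) (f s r : R -> R[i]) C : kern1 f s C -> s =1 r -> kern1 f r C.
Proof. by move=> + /funext <-. Qed.

(** * Multiplier calculus *)

Section fourier_uniqueness.
Variables (R : realType) (d : nat).
Local Notation mu := (Rd_measure R d).
(* The multiplication formula: if [F] is itself a Fourier transform, Fubini turns [F * h] into an
   integral of the Fourier transform of [h]. *)
Lemma conv_fourier0 (F g h : d.-tuple R -> R[i]) (M : R) t : L1 F -> (forall s, cabs (F s) <= M) ->
  L1 g -> (forall s, fourier g s = F s) -> L1 h -> (forall l, fourier h l = 0) ->
  Defs.conv F h t = 0.
Proof.
move=> FL FM gL gF hL h0.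
have N1 : `|-1| = 1 :> R by rewrite normrN normr1.
have tt (s : d.-tuple R) : tsub t (tsub t s) = s.
  by apply: eq_from_tnth => i; rewrite !tnth_mktuple subKr.
have /L1P FL' := FL; have /L1P hL' := hL; have /L1P gL' := gL.
have sec : L1 (fun s => F s * h (tsub t s)).
  apply/L1P; under eq_fun do rewrite mulrC.
  by apply: (cintegrable_bM _ FL'.1 FM); apply/L1P; exact: L1_tsubl.
rewrite /Defs.conv cintRdE //.
have /L1P secc := sec.
rewrite -(cint_taff t N1 secc.1) /=.
pose H (p : d.-tuple R * d.-tuple R) : R[i] := h p.1 * (g p.2 * expi (- tdot p.2 (tsub t p.1))).
have mtd : measurable_fun setT (fun p : d.-tuple R * d.-tuple R => - tdot p.2 (tsub t p.1)).
  apply: measurableT_comp => //; rewrite /tdot; apply: measurable_sum => i.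
  apply: measurable_funM; first exact: (measurableT_comp (measurable_tnth i)).
  under eq_fun do rewrite tnth_mktuple.
  by apply: measurable_funB => //; exact: (measurableT_comp (measurable_tnth i)).
have mH : cmeas H.
  apply: cmeasM; first exact: (cmeas_fst hL'.1).
  apply: cmeasM; first exact: (cmeas_snd gL'.1).
  exact: cmeas_expi.
have Hi : cintegrable (mu \x mu)%E H.
  apply: cintegrable_tonelli => //.
  rewrite (_ : (\int[mu]_s _ = \int[mu]_s ((cabs (h s))%:E * (L1norm g)%:E))%E).
    rewrite ge0_integralZr //; last 3 first.
    - exact: cmeas_cabsE hL'.1.
    - by move=> s _; rewrite lee_fin cabs_ge0.
    - by rewrite lee_fin L1norm_ge0.
    by rewrite -(L1normE hL) -EFinM ltry.
  apply: eq_integral => s _; rewrite (L1normE gL) -ge0_integralZl //; last 3 first.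
  - exact: cmeas_cabsE gL'.1.
  - by move=> u _; rewrite lee_fin cabs_ge0.
  - by rewrite lee_fin cabs_ge0.
  by apply: eq_integral => u _; rewrite /H /= !cabsM cabs_expi mulr1 EFinM.
have Hx s : cintegrable mu (fun u => H (s, u)).
  apply: (cintegrableZ (h s) (f := fun u => g u * expi (- tdot u (tsub t s)))).
  by apply/L1P; exact: L1_mod.
pose opp (u : d.-tuple R) := taff (-1) (tzero R d) u.
have E u s : H (s, u) = (g u * expi (- tdot u t)) * (h s * expi (- tdot s (opp u))).
  rewrite /H /= [RHS]mulrACA [g u * h s]mulrC -mulrA -expiD; congr (_ * (_ * expi _)).
  rewrite /tdot -opprD -big_split /=; congr (- _).
  by apply: eq_bigr => i _; rewrite !tnth_mktuple; ring.
have Hy u : cintegrable mu (fun s => H (s, u)).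
  under eq_fun do rewrite E.
  apply: (cintegrableZ (g u * expi (- tdot u t)) (f := fun s => h s * expi (- tdot s (opp u)))).
  by apply/L1P; exact: L1_mod.
transitivity (cint mu (fun s => cint mu (fun u => H (s, u)))).
  apply: eq_cint => s; rewrite -tsubE tt mulrC -gF fourierE // -cintZ //.
  by apply/L1P; exact: L1_mod.
rewrite cint_prod1 // -cint_prod2 //.
rewrite -[RHS](cint0 mu); apply: eq_cint => u.
under eq_cint do rewrite E.
rewrite cintZ; last by apply/L1P; exact: L1_mod.
by rewrite -fourierE // h0 mulr0.
Qed.

(** The ramp plus its mirror image is the tent, whose symbol is twice [fejz] because the odd
    imaginary parts cancel. Fejer kernels are thus themselves Fourier transforms, as [conv_fourier0]
    requires. *)
Lemma fejk0_fourier (M : R) : 0 < M -> exists g C, kern1 g (fejk M 0) C.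
Proof.
move=> M0; have r := kern1_ramp R.
have k2 := kern1_lin 1 r (kern1_opp r).
have Mi : 0 < M^-1 by rewrite invr_gt0.
have k3 := kern1_dilate 0 Mi k2.
pose a : R[i] := ((M / (2 * fejZ R))%:C)%C.
(* The combination [(a - 1) k3 + k3] is the scaling of [k3] by [a]. *)
have k4 := kern1_lin (a - 1) k3 k3.
eexists; eexists; apply: (kern1_eq k4) => y.
rewrite mul1r subr0 invrK /fejk mulr0 expi0 mulr1 mulrBl mul1r subrK /crampsym fejzN.
have -> : sinz (- (y * M)) = - sinz (y * M).
  by rewrite /sinz sinN sqrrN; ring.
rewrite -rmorphM /= /fejer /a (mulrC y M); apply/eqP; rewrite eq_complex /=.
have Z0 : fejZ R != 0 by rewrite gt_eqF ?fejZ_gt0.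
by apply/andP; split; apply/eqP; [field|ring].
Qed.

Lemma fejk_tens_fourier (M : 'I_d -> R) : (forall k, 0 < M k) ->
  exists2 g, L1 g & forall l, fourier g l = tens (fun k => fejk (M k) 0) l.
Proof.
move=> M0.
have h k : exists g, cintegrable (@lebesgue_measure R) g /\ forall y, four1 g y = fejk (M k) 0 y.
  by have [g [C [gi _ _ gE]]] := fejk0_fourier (M0 k); exists g.
have [g gP] := choice h.
exists (tens g); first by apply/L1P; apply: cintegrable_tens => k; case: (gP k).
move=> l; rewrite fourier_tens; last by move=> k; case: (gP k).
by apply: eq_bigr => k _; case: (gP k).
Qed.

Lemma conv_fej0 (M : 'I_d -> R) (h : d.-tuple R -> R[i]) : (forall k, 0 < M k) -> L1 h -> (forall l, fourier h l = 0) ->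
  Defs.conv (tens (fun k => fejk (M k) 0)) h = fun=> 0.
Proof.
move=> M0 hL h0; have [[FL [C FC] _] _] := kern_tri (fun=> 0) M0.
have [g gL gF] := fejk_tens_fourier M0.
by apply/funext => t; exact: (conv_fourier0 t FL FC gL gF hL h0).
Qed.

Lemma conv_oc_fej (a b : 'I_d -> R) (M : 'I_d -> R) : (forall k, 0 < M k) ->
  Defs.conv (tens (fun k x => ((oc_ind (a k) (b k) x)%:C)%C)) (tens (fun k => fejk (M k) 0)) =
  tens (fun k x => ((oc_fej (a k) (b k) (M k) x)%:C)%C).
Proof.
move=> M0; have [[FL [C FC] _] _] := kern_tri (fun=> 0) M0.
have oL : L1 (tens (fun k x => ((oc_ind (a k) (b k) x)%:C)%C : R[i])).
  by apply/L1P; apply: cintegrable_tens => k; exact: cintegrable_oc_ind.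
apply/funext => t; rewrite (conv_cint oL FL FC).
pose p k (x : R) : R[i] := ((oc_ind (a k) (b k) x)%:C)%C * fejk (M k) 0 (tnth t k - x).
have E k x : p k x = ((oc_ind (a k) (b k) x * (M k * fejer (M k * (tnth t k - x))))%:C)%C.
  by rewrite /p /fejk mulr0 expi0 mulr1 !rmorphM.
rewrite (_ : cint _ _ = cint mu (tens p)); last first.
  apply: eq_cint => s; rewrite /tens -big_split /=; apply: eq_bigr => k _.
  by rewrite tnth_mktuple.
rewrite cint_tens.
  apply: eq_bigr => k _; rewrite /cint.
  under [X in (X +i* _)%C]eq_Rintegral do rewrite E /=.
  under [X in (_ +i* X)%C]eq_Rintegral do rewrite E /=.
  rewrite /oc_fej; congr Complex.
  by rewrite /Rintegral integral0.
move=> k; have [ki [B kB] _ _] := kern1_fejk 0 (M0 k).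
apply: (cintegrable_bM (cintegrable_oc_ind _ _) (M := B)); last by move=> x; exact: kB.
have := cintegrable_affine (tnth t k) (_ : -1 != 0) ki; rewrite oppr_eq0 oner_eq0 => /(_ isT)[+ _].
by under eq_fun do rewrite mulN1r addrC.
Qed.

End fourier_uniqueness.

(** * The action of L^1 on bounded operators *)

Section action.
Variables (R : realType) (d : nat) (U V : normedModType R[i]).
Variables (act : (d.-tuple R -> R[i]) -> (U -> V) -> (U -> V)) (T : d.-tuple R -> (U -> V) -> (U -> V)).
Hypothesis Hm : banach_module act T.
Implicit Types (f g : d.-tuple R -> R[i]) (A B : BL U V).

Let act_bl f A : L1 f -> bounded_linear (act f A).
Proof. by move: Hm => [_ [_ [_ [_ [h _]]]]] fL; exact: h (blprop A). Qed.

Let T_bl t A : bounded_linear (T t A).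
Proof. by have [h _] := Hm.1 t A (blprop A). Qed.

Definition actL f A : BL U V :=
  if pselect (L1 f) is left h then toBL (act_bl A h) else 0.

Definition trL t A : BL U V := toBL (T_bl t A).

Lemma actLE f A : L1 f -> (actL f A : U -> V) = act f A.
Proof. by move=> fL; rewrite /actL; case: pselect. Qed.

Lemma actL_linf c f g A : L1 f -> L1 g ->
  actL (fun t => c * f t + g t) A = c *: actL f A + actL g A.
Proof.
move: Hm => [_ [_ [_ [_ [_ [h _]]]]]] fL gL; apply: bl_inj.
rewrite actLE; last exact: L1_lin.
rewrite h //; last exact: blprop.
by rewrite -!actLE.
Qed.

Lemma actL_linx f c A B : L1 f -> actL f (c *: A + B) = c *: actL f A + actL f B.
Proof.
move: Hm => [_ [_ [_ [_ [_ [_ [h _]]]]]]] fL; apply: bl_inj.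
rewrite actLE //.
rewrite (h f c A B fL (blprop A) (blprop B)).
by rewrite -!actLE.
Qed.

Lemma actL_conv f g A : L1 f -> L1 g -> L1 (Defs.conv f g) ->
  actL (Defs.conv f g) A = actL f (actL g A).
Proof.
move: Hm => [_ [_ [_ [_ [_ [_ [_ [h _]]]]]]]] fL gL cL; apply: bl_inj.
by rewrite !actLE // h //; exact: blprop.
Qed.

Lemma nm_actL f A : L1 f -> nmL (actL f A) <= L1norm f * nmL A.
Proof.
move: Hm => [_ [_ [_ [_ [_ [_ [_ [_ [h _]]]]]]]]] fL.
by rewrite /nmL actLE //; apply: h => //; exact: blprop.
Qed.

Lemma trL_actL t f A : L1 f -> trL t (actL f A) = actL (fun s => f (tadd s t)) A.
Proof.
move: Hm => [_ [_ [_ [_ [_ [_ [_ [_ [_ [h _]]]]]]]]]] fL; apply: bl_inj.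
have [h1 _] := h t f A fL (blprop A).
by rewrite /= actLE //= h1 actLE //; exact: L1_shift.
Qed.

Lemma actL_trL t f A : L1 f -> actL f (trL t A) = actL (fun s => f (tadd s t)) A.
Proof.
move: Hm => [_ [_ [_ [_ [_ [_ [_ [_ [_ [h _]]]]]]]]]] fL; apply: bl_inj.
have [_ h1] := h t f A fL (blprop A).
by rewrite !actLE //; exact: L1_shift.
Qed.

Lemma actL_nondeg A : (forall f, L1 f -> actL f A = 0) -> A = 0.
Proof.
move: Hm => [_ [_ [_ [_ [_ [_ [_ [_ [_ [_ h]]]]]]]]]] h0; apply: bl_inj.
by apply: h => [|f fL]; [exact: blprop|rewrite -actLE // h0].
Qed.

Lemma trL_lin t c A B : trL t (c *: A + B) = c *: trL t A + trL t B.
Proof.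
move: Hm => [_ [h _]]; apply: bl_inj.
exact: (h t c A B (blprop A) (blprop B)).
Qed.

Lemma nm_trL t A : nmL (trL t A) = nmL A.
Proof. by have [_ h] := Hm.1 t A (blprop A). Qed.

Lemma actL0 f : L1 f -> actL f 0 = 0.
Proof. by move=> fL; have := actL_linx (-1) 0 0 fL; rewrite scaler0 addr0 scaleN1r addNr. Qed.

Lemma actL_cst0 A : actL (fun=> 0) A = 0.
Proof.
have := actL_linf (-1) A (@L1_cst0 R d) (@L1_cst0 R d).
by rewrite scaleN1r addNr => <-; congr actL; apply/funext => t; rewrite mulr0 addr0.
Qed.

Lemma actLB f g A : L1 f -> L1 g -> actL (fun t => f t - g t) A = actL f A - actL g A.
Proof.
move=> fL gL; have := actL_linf (-1) A gL fL; rewrite scaleN1r addrC => <-.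
by congr actL; apply/funext => t; rewrite mulN1r addrC.
Qed.

Lemma L1B f g : L1 f -> L1 g -> L1 (fun t => f t - g t).
Proof.
move=> fL gL; have := L1_lin (-1) gL fL; congr L1.
by apply/funext => t; rewrite mulN1r addrC.
Qed.

(* Fejer means separate points: their convolutions with box indicators are total in L^1. *)
Lemma actL_fejer_sep A :
  (forall M : 'I_d -> nat, actL (tens (fun k => fejk (M k).+1%:R 0)) A = 0) -> A = 0.
Proof.
move=> h; apply: actL_nondeg => f.
have M0 (M : 'I_d -> nat) k : 0 < (M k).+1%:R :> R by rewrite ltr0n.
apply: (K_fej_L1 (K := fun f => actL f A = 0)) => {f}.
- by move=> c f g fL gL f0 g0; rewrite actL_linf // f0 g0 scaler0 addr0.
- move=> f g fL gL g0 cv; apply: nmL_eq0; apply/eqP; rewrite eq_le nmL_ge0 andbT.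
  have le n : ((nmL (actL f A))%:E <= \int[Rd_measure R d]_t (cabs (f t - g n t))%:E * (nmL A)%:E)%E.
    have fgL := L1B fL (gL n).
    rewrite -L1normE // -EFinM lee_fin; apply: le_trans (nm_actL A fgL).
    by rewrite actLB // g0 subr0.
  have cv' : (\int[Rd_measure R d]_t (cabs (f t - g n t))%:E * (nmL A)%:E)%E @[n --> \oo] --> 0%E.
    by rewrite -[X in _ --> X](mul0e (nmL A)%:E); apply: cvgeZr.
  rewrite -lee_fin; apply: (lee_cvg_to (@cvg_cst _ (nmL (actL f A))%:E _ \oo _) cv').
  exact: nearW.
- move=> a b M; rewrite -(conv_oc_fej a b (M0 M)).
  have [[FL [C FC] _] _] := kern_tri (fun=> 0) (M0 M).
  have oL : L1 (tens (fun k x => ((oc_ind (a k) (b k) x)%:C)%C : R[i])).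
    by apply/L1P; apply: cintegrable_tens => k; exact: cintegrable_oc_ind.
  by rewrite actL_conv // ?h ?actL0 //; exact: L1_conv FL FC.
Qed.

(** Non-degeneracy of the module stands in for injectivity of the Fourier transform: convolution
    with any Fejer kernel annihilates [f], so every Fejer mean of [actL f A] vanishes. *)
Lemma actL_fourier0 f A : L1 f -> (forall l, fourier f l = 0) -> actL f A = 0.
Proof.
move=> fL f0; apply: actL_fejer_sep => M.
have M0 k : 0 < (M k).+1%:R :> R by rewrite ltr0n.
have [[FL _ _] _] := kern_tri (fun=> 0) M0.
rewrite -actL_conv //; rewrite (conv_fej0 M0 fL f0); [exact: actL_cst0|exact: L1_cst0].
Qed.

Lemma actL_fourier_eq f g A : L1 f -> L1 g -> (forall l, fourier f l = fourier g l) ->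
  actL f A = actL g A.
Proof.
move=> fL gL fg; apply/eqP; rewrite -subr_eq0 -actLB //; apply/eqP.
apply: actL_fourier0; first exact: L1B.
move=> l; have := fourier_lin (-1) l gL fL; rewrite fg mulN1r addNr => <-.
by congr fourier; apply/funext => t; rewrite mulN1r addrC.
Qed.

Definition kernel_of (s : d.-tuple R -> R[i]) : d.-tuple R -> R[i] :=
  ClassicalEpsilon.epsilon (inhabits (fun=> 0)) (fun f => kern f s).

Definition multL s A := actL (kernel_of s) A.

Lemma kernel_ofP f s : kern f s -> kern (kernel_of s) s.
Proof. by move=> h; apply: (ClassicalEpsilon.epsilon_spec (inhabits (fun=> 0)) (fun f => kern f s)); exists f. Qed.

Lemma multLE f s A : L1 f -> (forall l, fourier f l = s l) -> (exists g, kern g s) -> multL s A = actL f A.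
Proof.
move=> fL fs [g /kernel_ofP[kL _ ks]]; apply: actL_fourier_eq => // l.
by rewrite ks fs.
Qed.

End action.

Section multiplier_module.
Variables (R : realType) (d : nat).

Definition sym (s : d.-tuple R -> R[i]) (C : R) := exists2 f, kern f s & L1norm f <= C.

Definition tej (j : 'I_d) (t : R) : d.-tuple R := [tuple if i == j then t else 0 | i < d].

Lemma tdot_tej j t l : tdot (tej j t) l = t * tnth l j.
Proof.
rewrite /tdot (bigD1 j) //= big1 ?addr0 => [|i /negbTE ij]; rewrite tnth_mktuple ?eqxx //.
by rewrite ij mul0r.
Qed.

(* [mult s] is the action of any L^1 kernel with Fourier transform [s]; [tr j t] is the action of the
   representation at the vector with [j]-th coordinate [t] and other coordinates [0]. *)
Structure bmod := BMod {
  bsort :> lmodType R[i];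
  nm : bsort -> R;
  mult : (d.-tuple R -> R[i]) -> bsort -> bsort;
  tr : 'I_d -> R -> bsort -> bsort;
  nm_eq0 : forall x, nm x = 0 -> x = 0;
  nm_ge0 : forall x, 0 <= nm x;
  nmD : forall x y, nm (x + y) <= nm x + nm y;
  nmZ : forall c x, nm (c *: x) = cabs c * nm x;
  nm_complete : forall (x : nat -> bsort) (C : R), (forall n, \sum_(k < n) nm (x k) <= C) ->
    exists y : bsort, forall e, 0 < e -> exists n0, forall n, (n0 <= n)%N ->
      nm (y - \sum_(k < n) x k) <= e;
  mult_lin : forall s r C D c x, sym s C -> sym r D ->
    mult (fun l => c * s l + r l) x = c *: mult s x + mult r x;
  mult_linx : forall s C c x y, sym s C -> mult s (c *: x + y) = c *: mult s x + mult s y;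
  multM : forall s r C D x, sym s C -> sym r D -> mult (fun l => s l * r l) x = mult s (mult r x);
  nm_mult : forall s C x, sym s C -> nm (mult s x) <= C * nm x;
  mult_tr : forall s C j t x, sym s C -> mult s (tr j t x) = mult (fun l => expi (t * tnth l j) * s l) x;
  tr_mult : forall s C j t x, sym s C -> tr j t (mult s x) = mult (fun l => expi (t * tnth l j) * s l) x;
  tr_lin : forall j t c x y, tr j t (c *: x + y) = c *: tr j t x + tr j t y;
  nm_tr : forall j t x, nm (tr j t x) = nm x;
  mult_sep : forall x, (forall M : 'I_d -> nat, mult (tri (fun k => (M k).+1%:R) (fun=> 0)) x = 0) -> x = 0
}.

Variables (U : normedModType R[i]) (V : completeNormedModType R[i]).
Variables (act : (d.-tuple R -> R[i]) -> (U -> V) -> (U -> V)) (T : d.-tuple R -> (U -> V) -> (U -> V)).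
Hypothesis Hm : banach_module act T.

Program Definition op_bmod : bmod := @BMod (BL U V : lmodType R[i]) (@nmL R U V) (multL Hm)
  (fun j t A => trL Hm (tej j t) A) (@nmL_eq0 R U V) (@nmL_ge0 R U V) (@nmLD R U V) (@nmLZ R U V)
  (@nmL_complete R U V) _ _ _ _ _ _ _ _ _.
Next Obligation.
move=> s r C D c x [f fs _] [g gr _]; have fg := kern_lin c fs gr.
have [fL _ fE] := fs; have [gL _ gE] := gr; have [fgL _ fgE] := fg.
rewrite (multLE Hm x fgL fgE); last by exists (fun t => c * f t + g t).
rewrite actL_linf // -(multLE Hm x fL fE) -?(multLE Hm x gL gE) //; [by exists g|by exists f].
Qed.
Next Obligation.
move=> s C c x y [f /kernel_ofP[fL _ _] _]; exact: actL_linx.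
Qed.
Next Obligation.
move=> s r C D x [f fs _] [g gr _]; have fg := kern_conv fs gr.
have [fL _ fE] := fs; have [gL _ gE] := gr; have [fgL _ fgE] := fg.
rewrite (multLE Hm x fgL fgE); last by exists (Defs.conv f g).
rewrite actL_conv // -(multLE Hm x gL gE) -?(multLE Hm _ fL fE) //; [by exists f|by exists g].
Qed.
Next Obligation.
move=> s C x [f fs fC]; have [fL _ fE] := fs.
rewrite (multLE Hm x fL fE); last by exists f.
apply: le_trans (nm_actL Hm x fL) _; rewrite ler_wpM2r // nmL_ge0 //.
Qed.
Next Obligation.
move=> s C j t x [f fs fC]; have [fL _ fE] := fs; have fsh := kern_shift (tej j t) fs.
rewrite (multLE Hm _ fL fE); last by exists f.
have [fhL _ fhE] := fsh.
rewrite actL_trL // -(multLE Hm _ fhL fhE); last by eexists; exact: fsh.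
by congr multL; apply/funext => l; rewrite tdot_tej.
Qed.
Next Obligation.
move=> s C j t x [f fs fC]; have [fL _ fE] := fs; have fsh := kern_shift (tej j t) fs.
rewrite (multLE Hm _ fL fE); last by exists f.
have [fhL _ fhE] := fsh.
rewrite trL_actL // -(multLE Hm _ fhL fhE); last by eexists; exact: fsh.
by congr multL; apply/funext => l; rewrite tdot_tej.
Qed.
Next Obligation. by move=> j t c x y; exact: trL_lin. Qed.
Next Obligation. by move=> j t x; exact: nm_trL. Qed.
Next Obligation.
move=> x h; apply: (actL_fejer_sep (Hm := Hm)) => M; rewrite -(h M).
have M0 k : 0 < (M k).+1%:R :> R by rewrite ltr0n.
have [fs _] := kern_tri (fun=> 0) M0; have [fL _ fE] := fs.
by rewrite (multLE Hm _ fL fE) //; eexists; exact: fs.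
Qed.

Lemma act_phid (N : R) (a : d.-tuple R) (A : op_bmod) : 0 < N ->
  act (phid N a) (A : BL U V) = (mult (tri (fun=> N) (fun k => N * tnth a k)) A : BL U V).
Proof.
move=> N0; have [pL pE] := phid_spec a N0.
have [fs _] := kern_tri (fun k => N * tnth a k) (fun _ : 'I_d => N0).
by rewrite /= (multLE Hm _ pL pE) ?actLE //; eexists; exact: fs.
Qed.

End multiplier_module.

(** * Cut-off symbols in one coordinate *)

Section symbols.
Variables (R : realType) (d : nat).
Implicit Types (s r : d.-tuple R -> R[i]).

Definition issym s := exists C, sym s C.

Lemma sym_issym s C : sym s C -> issym s. Proof. by move=> h; exists C. Qed.

Lemma issym_eq s r : issym s -> (forall l, s l = r l) -> issym r.
Proof. by move=> + /funext <-. Qed.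

Lemma sym_ge0 s C : sym s C -> 0 <= C.
Proof. by move=> [f [fL _ _] fC]; apply: le_trans fC; exact: L1norm_ge0. Qed.

Lemma issym_lin c s r : issym s -> issym r -> issym (fun l => c * s l + r l).
Proof. by move=> [C [f fs _]] [D [g gr _]]; eexists; eexists; [exact: kern_lin fs gr|exact: lexx]. Qed.

Lemma issymM s r : issym s -> issym r -> issym (fun l => s l * r l).
Proof. by move=> [C [f fs _]] [D [g gr _]]; eexists; eexists; [exact: kern_conv fs gr|exact: lexx]. Qed.

Lemma issymB s r : issym s -> issym r -> issym (fun l => s l - r l).
Proof.
move=> hs hr; apply: (issym_eq (issym_lin (-1) hr hs)) => l.
by rewrite mulN1r addrC.
Qed.

Lemma issymZ c s : issym s -> issym (fun l => c * s l).
Proof.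
move=> h; apply: (issym_eq (issym_lin c h (issymB h h))) => l.
by rewrite subrr addr0.
Qed.

Lemma issym_shift s j t : issym s -> issym (fun l => expi (t * tnth l j) * s l).
Proof.
move=> [C [f fs _]]; exists (L1norm (fun u => f (tadd u (tej j t)))); eexists; last exact: lexx.
have := kern_shift (tej j t) fs; congr kern; apply/funext => l.
by rewrite tdot_tej.
Qed.

Lemma sym_tri (N c : 'I_d -> R) : (forall k, 0 < N k) -> sym (tri N c) 1.
Proof. by move=> N0; have [h1 h2] := kern_tri c N0; eexists; [exact: h1|]. Qed.

Lemma phi_hat_gt0 (x : R) : (phi_hat x != 0) = (`|x| < 1).
Proof.
rewrite /phi_hat; case: (ltP `|x| 1) => h.
  by rewrite max_l ?gt_eqF //; lra.
by rewrite max_r ?eqxx //; lra.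
Qed.

Lemma tri_neq0 (N c : 'I_d -> R) l : (forall k, 0 < N k) -> tri N c l != 0 ->
  forall k, `|tnth l k - c k| < N k.
Proof.
move=> N0 + k; rewrite /tri => /prodf_neq0 /(_ k isT).
rewrite fmorph_eq0 phi_hat_gt0 normrM normfV (gtr0_norm (N0 k)).
by rewrite ltr_pdivrMr // mul1r.
Qed.

Lemma kern1_0 : kern1 (fun _ : R => 0) (fun=> 0) (0 : R).
Proof.
split.
- split; first exact: cmeas_cst.
  by under eq_integral do rewrite cabs0; rewrite integral0.
- by exists 0 => x; rewrite cabs0.
- by under eq_integral do rewrite cabs0; rewrite integral0.
- by move=> y; rewrite /four1; under eq_cint do rewrite mul0r; rewrite cint0.
Qed.

Lemma kern1_comb (a b : R[i]) (f g s r : R -> R[i]) (C D : R) : kern1 f s C -> kern1 g r D ->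
  kern1 (fun x => a * f x + (b * g x + 0)) (fun y => a * s y + b * r y) (cabs a * C + cabs b * D).
Proof.
move=> h1 h2; have := kern1_lin a h1 (kern1_lin b h2 kern1_0).
by rewrite addr0 => h; apply: (kern1_eq h) => y; rewrite addr0.
Qed.

(** The difference of two tents of half-width [r] is linear between their peaks [c - r] and [c + r].
    Two kernels of norm [r] each give [2 r], the constant of all Bernstein inequalities below. *)
Lemma kern1_lincut (c r : R) : 0 < r -> exists f u, kern1 f u (2 * r) /\
  forall y, `|y - c| <= r -> u y = (0 +i* (y - c))%C.
Proof.
move=> r0; have h1 := kern1_fejk (c + r) r0; have h2 := kern1_fejk (c - r) r0.
have := kern1_comb (0 +i* r)%C (- (0 +i* r)%C) h1 h2.
rewrite cabsN /cabs /= expr0n add0r sqrtr_sqr gtr0_norm // !mulr1.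
have -> : r + r = 2 * r by ring.
move=> h; eexists; eexists; split; first exact: h.
move=> y yc /=.
have rr : r^-1 * r = 1 by rewrite mulVf ?gt_eqF.
have ri : 0 < r^-1 by rewrite invr_gt0.
have -> : (y - (c + r)) / r = (y - c) / r - 1 by rewrite opprD addrA mulrBl divff ?gt_eqF.
have -> : (y - (c - r)) / r = (y - c) / r + 1 by field; rewrite gt_eqF.
set z := (y - c) / r.
have zE : z * r = y - c by rewrite mulfVK ?gt_eqF.
have : -1 <= z <= 1.
  by move: yc; rewrite ler_norml /z ler_pdivlMr // ler_pdivrMr // mulN1r mul1r.
move=> /andP[z1 z2]; rewrite /phi_hat -zE; apply/eqP; rewrite eq_complex /= !(mul0r, mulr0, oppr0, addr0, add0r) eqxx /= /Num.max.
apply/eqP; case: (ger0P (z - 1)) => h1'; case: (ger0P (z + 1)) => h2'; case: ltP => h3; case: ltP => h4;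
  first [ring | exfalso; lra | idtac].
all: try (have -> : z = 1 by lra); try (have -> : z = -1 by lra); try (have -> : z = 0 by lra); try ring.
Qed.

(** The de la Vallee Poussin kernel: the slope of a narrow tent cancels that of a wide one over the
    base of the narrow one. The norm bound tends to 1 as [rho] grows. *)
Lemma kern1_plateau (rho S : R) : 1 < rho -> 0 < S -> exists f u, kern1 f u ((rho + 1) / (rho - 1)) /\
  forall y, `|y| <= S -> u y = 1.
Proof.
move=> r1 S0; have r0 : 0 < rho by lra.
have rS : 0 < rho * S by rewrite mulr_gt0.
have rm : 0 < rho - 1 by lra.
have h1 := kern1_fejk 0 rS; have h2 := kern1_fejk 0 S0.
have := kern1_comb ((rho / (rho - 1))%:C)%C ((- (rho - 1)^-1)%:C)%C h1 h2.
rewrite !cabs_real normrN !ger0_norm ?invr_ge0 ?divr_ge0 ?(ltW rm) ?(ltW r0) // !mulr1.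
have -> : rho / (rho - 1) + (rho - 1)^-1 = (rho + 1) / (rho - 1) by rewrite mulrDl mul1r.
move=> h; eexists; eexists; split; first exact: h.
move=> y yS /=; rewrite !subr0 -!rmorphM -rmorphD /= -[RHS]/((1%:C)%C); congr (_%:C)%C.
have y1 : `|y / S| <= 1 by rewrite normrM normfV (gtr0_norm S0) ler_pdivrMr // mul1r.
have -> : y / (rho * S) = y / S / rho by field; apply/andP; split; rewrite gt_eqF.
rewrite /phi_hat [`|_ / rho|]normrM normfV (gtr0_norm r0).
have le : `|y / S| / rho <= 1 by rewrite ler_pdivrMr // mul1r; lra.
rewrite !max_l; [|lra..].
by field; apply/andP; split; rewrite gt_eqF.
Qed.

Lemma exp1D_le (eta : R) n : 0 <= eta <= 1 -> (1 + eta) ^+ n <= 1 + 3 ^+ n * eta.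
Proof.
move=> /andP[e0 e1]; elim: n => [|n IH]; first by rewrite !expr0 mul1r lerDl.
rewrite !exprS.
have h : (1 + eta) * (1 + eta) ^+ n <= (1 + eta) * (1 + 3 ^+ n * eta) by rewrite ler_wpM2l //; lra.
apply: le_trans h _.
have p : 1 <= 3 ^+ n :> R by rewrite exprn_ege1 // ler1n.
have ee : eta * eta <= eta by rewrite -[leRHS]mulr1 ler_wpM2l.
set q := 3 ^+ n in p *.
have : q * (eta * eta) <= q * eta by rewrite ler_wpM2l //; lra.
have : eta <= q * eta by rewrite ler_peMl.
lra.
Qed.

Definition insupp s (S : R) := forall l, s l != 0 -> forall k, `|tnth l k| <= S.

(** In general a symbol of one coordinate alone has no integrable kernel on R^d. The other
    coordinates are therefore cut off by plateaus that equal 1 on the cube under consideration. *)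
Lemma sym_coord (j : 'I_d) (f u : R -> R[i]) (C rho S : R) : kern1 f u C -> 0 <= C -> 1 < rho -> 0 < S ->
  exists2 p, sym p (C * ((rho + 1) / (rho - 1)) ^+ d) &
    forall l, (forall k, `|tnth l k| <= S) -> p l = u (tnth l j).
Proof.
move=> fu C0 r1 S0; have [g [v [gv v1]]] := kern1_plateau r1 S0.
pose c := (rho + 1) / (rho - 1).
have c1 : 1 <= c by rewrite /c ler_pdivlMr; lra.
have h k : kern1 (if k == j then f else g) (if k == j then u else v) (if k == j then C else c).
  by case: ifP.
have [h1 h2] := kern_tens h.
eexists; first eexists; first exact: h1.
  apply: le_trans h2 _; rewrite (bigD1 j) //= eqxx ler_wpM2l //.
  under eq_bigr => k /negbTE -> do [].
  rewrite prodr_const; apply: ler_weXn2l => //.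
  by rewrite (leq_trans (max_card _)) // card_ord.
move=> l lS /=; rewrite (bigD1 j) //= eqxx big1 ?mulr1 // => k /negbTE ->.
exact: v1.
Qed.

Lemma issym_coord (j : 'I_d) (f u : R -> R[i]) (C S : R) s : kern1 f u C -> 0 <= C -> 0 < S ->
  insupp s S -> issym s -> issym (fun l => u (tnth l j) * s l).
Proof.
move=> fu C0 S0 sS hs; have [p /sym_issym hp pE] := sym_coord j fu C0 (ltr1n R 2) S0.
apply: (issym_eq (issymM hp hs)) => l.
by have [->|/sS/pE ->//] := eqVneq (s l) 0; rewrite !mulr0.
Qed.

End symbols.

Lemma normc_id (R : realType) (x : R) : cabs (0 +i* x)%C = `|x|.
Proof. by rewrite /cabs /= expr0n add0r sqrtr_sqr. Qed.

(** * Derivatives and Bernstein inequalities *)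

Section bmod_theory.
Variables (R : realType) (d : nat) (E : bmod R d).
Implicit Types (x y z : E) (s : d.-tuple R -> R[i]).

Lemma nm0 : nm (0 : E) = 0.
Proof. by rewrite -(scale0r 0) nmZ cabs0 mul0r. Qed.

Lemma nmN x : nm (- x) = nm x.
Proof. by rewrite -scaleN1r nmZ cabsN cabs1 mul1r. Qed.

Lemma nmB x y : nm (x - y) <= nm x + nm y.
Proof. by rewrite -(nmN y) nmD. Qed.

Lemma nm_sum (I : Type) (t : seq I) (P : pred I) (F : I -> E) : nm (\sum_(i <- t | P i) F i) <= \sum_(i <- t | P i) nm (F i).
Proof.
elim/big_rec2: _ => [|i a b _ h]; first by rewrite nm0.
by apply: le_trans (nmD _ _) _; rewrite lerD2l.
Qed.

Lemma nm_le0 x : nm x <= 0 -> x = 0.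
Proof. by move=> h; apply: nm_eq0; apply/eqP; rewrite eq_le h nm_ge0. Qed.

Lemma nm_le_lim x (K : R) : (forall e, 0 < e -> nm x <= K * e) -> x = 0.
Proof.
move=> h; apply: nm_le0; apply/ler_addgt0Pr => e e0; rewrite add0r.
have K1 : 0 < `|K| + 1 by rewrite ltr_pwDr.
apply: le_trans (h (e / (`|K| + 1)) (divr_gt0 e0 K1)) _.
rewrite mulrCA ger_pMr // ler_pdivrMr // mul1r.
by rewrite (le_trans (ler_norm K)) // lerDl.
Qed.

Lemma mult_eq s (r : d.-tuple R -> R[i]) x : (forall l, s l = r l) -> mult s x = mult r x.
Proof. by move=> /funext ->. Qed.

Lemma multZD s c x y : issym s -> mult s (c *: x + y) = c *: mult s x + mult s y.
Proof. by move=> [C h]; exact: mult_linx h. Qed.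

Lemma multr0 s : issym s -> mult s (0 : E) = 0.
Proof. by move=> h; have := multZD (-1) 0 0 h; rewrite scaler0 addr0 scaleN1r addNr. Qed.

Lemma multDr s x y : issym s -> mult s (x + y) = mult s x + mult s y.
Proof. by move=> h; rewrite -{1}(scale1r x) multZD // scale1r. Qed.

Lemma multZr s c x : issym s -> mult s (c *: x) = c *: mult s x.
Proof. by move=> h; rewrite -{1}(addr0 (c *: x)) multZD // multr0 // addr0. Qed.

Lemma multBr s x y : issym s -> mult s (x - y) = mult s x - mult s y.
Proof. by move=> h; rewrite multDr // -scaleN1r multZr // scaleN1r. Qed.

Lemma mult_sumr s (I : Type) (t : seq I) (P : pred I) (F : I -> E) : issym s ->
  mult s (\sum_(i <- t | P i) F i) = \sum_(i <- t | P i) mult s (F i).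
Proof.
move=> h; elim/big_rec2: _ => [|i a b _ <-]; first exact: multr0.
exact: multDr.
Qed.

Lemma mult_syml c s r x : issym s -> issym r ->
  mult (fun l => c * s l + r l) x = c *: mult s x + mult r x.
Proof. by move=> [C h1] [D h2]; exact: mult_lin h1 h2. Qed.

Lemma mult_sym0 x : mult (fun=> 0) x = 0 :> E.
Proof.
have h : issym (fun _ : d.-tuple R => 0 : R[i]).
  have h1 := sym_issym (@sym_tri R d (fun=> 1) (fun=> 0) (fun=> ltr01)).
  by apply: (issym_eq (issymB h1 h1)) => l; rewrite subrr.
have := mult_syml (-1) x h h; rewrite scaleN1r addNr => <-; apply: mult_eq => l.
by rewrite mulr0 addr0.
Qed.

Lemma mult_symZ c s x : issym s -> mult (fun l => c * s l) x = c *: mult s x.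
Proof.
move=> h; have h0 : issym (fun _ : d.-tuple R => 0 : R[i]) by apply: (issym_eq (issymB h h)) => l; rewrite subrr.
have := mult_syml c x h h0; rewrite mult_sym0 addr0 => <-; apply: mult_eq => l.
by rewrite addr0.
Qed.

Lemma mult_symB s (r : d.-tuple R -> R[i]) x : issym s -> issym r -> mult (fun l => s l - r l) x = mult s x - mult r x.
Proof.
move=> h1 h2; have := mult_syml (-1) x h2 h1; rewrite scaleN1r addrC => <-; apply: mult_eq => l.
by rewrite mulN1r addrC.
Qed.

Lemma issym_sum (I : Type) (t : seq I) (c : I -> R[i]) (s : I -> d.-tuple R -> R[i]) :
  (forall i, issym (s i)) -> issym (fun l => \sum_(i <- t) c i * s i l).
Proof.
move=> h; elim: t => [|i t IH].
  have h1 := sym_issym (@sym_tri R d (fun=> 1) (fun=> 0) (fun=> ltr01)).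
  by apply: (issym_eq (issymB h1 h1)) => l; rewrite subrr big_nil.
by apply: (issym_eq (issym_lin (c i) (h i) IH)) => l; rewrite big_cons.
Qed.

Lemma mult_sym_sum (I : Type) (t : seq I) (c : I -> R[i]) (s : I -> d.-tuple R -> R[i]) x :
  (forall i, issym (s i)) ->
  mult (fun l => \sum_(i <- t) c i * s i l) x = \sum_(i <- t) c i *: mult (s i) x.
Proof.
move=> h; elim: t => [|i t IH].
  by rewrite big_nil -[RHS](mult_sym0 x); apply: mult_eq => l; rewrite big_nil.
rewrite big_cons -IH -mult_syml //; last exact: issym_sum.
by apply: mult_eq => l; rewrite big_cons.
Qed.

Lemma multMl s r x : issym s -> issym r -> mult (fun l => s l * r l) x = mult s (mult r x).
Proof. by move=> [C h1] [D h2]; exact: multM h1 h2. Qed.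

Lemma multCr s r x : issym s -> issym r -> mult s (mult r x) = mult r (mult s x).
Proof. by move=> h1 h2; rewrite -!multMl //; apply: mult_eq => l; rewrite mulrC. Qed.

Lemma nm_tri (N c : 'I_d -> R) x : (forall k, 0 < N k) -> nm (mult (tri N c) x) <= nm x.
Proof. by move=> N0; rewrite -[leRHS]mul1r; apply: nm_mult; exact: sym_tri. Qed.

(* The plateau width ratio [rho] tends to infinity, so its norm contributes a factor 1. *)
Lemma nm_mult_coord (j : 'I_d) (f u : R -> R[i]) (C S : R) s x : kern1 f u C -> 0 <= C -> 0 < S ->
  insupp s S -> issym s -> nm (mult (fun l => u (tnth l j) * s l) x) <= C * nm (mult s x).
Proof.
move=> fu C0 S0 sS hs; apply/ler_addgt0Pr => e e0.
have b (eta : R) : 0 < eta <= 1 -> nm (mult (fun l => u (tnth l j) * s l) x) <= (1 + 3 ^+ d * eta) * (C * nm (mult s x)).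
  move=> /andP[t0 t1]; pose rho : R := 1 + 2 / eta.
  have te : 0 < 2 / eta by rewrite divr_gt0.
  have r1 : 1 < rho by rewrite /rho ltrDl.
  have [p hp pE] := sym_coord j fu C0 r1 S0.
  rewrite (_ : mult _ x = mult p (mult s x)); last first.
    rewrite -multMl //; last exact: sym_issym hp.
    by apply: mult_eq => l; have [->|/sS/pE ->//] := eqVneq (s l) 0; rewrite !mulr0.
  apply: le_trans (nm_mult _ hp) _; rewrite mulrAC mulrC ler_wpM2r ?mulr_ge0 ?nm_ge0 //.
  have -> : (rho + 1) / (rho - 1) = 1 + eta.
    have -> : rho - 1 = 2 / eta by rewrite /rho; ring.
    by rewrite /rho; field; rewrite gt_eqF.
  by apply: exp1D_le; rewrite (ltW t0).
pose K := 3 ^+ d * (C * nm (mult s x)).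
have K0 : 0 <= K by rewrite !mulr_ge0 ?nm_ge0 // exprn_ge0.
pose eta := Num.min 1 (e / (K + 1)).
have K1 : 0 < K + 1 by rewrite ltr_pwDr.
have ek : 0 < e / (K + 1) by rewrite divr_gt0.
apply: le_trans (b eta _) _.
  by rewrite /eta lt_min ltr01 ek ge_min lexx.
rewrite mulrDl mul1r lerD2l mulrAC -/K.
apply: (@le_trans _ _ (K * (e / (K + 1)))); first by rewrite ler_wpM2l // /eta ge_min lexx orbT.
by rewrite mulrCA ger_pMr // ler_pdivrMr // mul1r lerDl.
Qed.

Lemma tr_multC j t s x : issym s -> tr j t (mult s x) = mult s (tr j t x).
Proof. by move=> [C h]; rewrite (tr_mult j t x h) (mult_tr j t x h). Qed.

(* A quadratic remainder holds for band-limited elements and is stable under products and inverses. *)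
Definition der j x y := exists2 C : R, 0 <= C & forall t : R, 0 < t <= 1 ->
  nm (tr j t x - x - (t%:C)%C *: y) <= C * t ^+ 2.

Lemma der_uniq j x y z : der j x y -> der j x z -> y = z.
Proof.
move=> [C C0 hC] [D D0 hD]; apply/eqP; rewrite -subr_eq0; apply/eqP.
apply: (@nm_le_lim _ (C + D)) => e e0; pose t := Num.min 1 e.
have t0 : 0 < t by rewrite /t lt_min ltr01.
have t1 : 0 < t <= 1 by rewrite t0 /t ge_min lexx.
have : nm ((t%:C)%C *: (y - z)) <= (C + D) * t ^+ 2.
  have -> : (t%:C)%C *: (y - z) = (tr j t x - x - (t%:C)%C *: z) - (tr j t x - x - (t%:C)%C *: y).
    
    have H (a b e' : E) : (a - b) - (a - e') = e' - b by rewrite opprB addrC subrKA.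
    by rewrite H scalerBr.
  by apply: le_trans (nmB _ _) _; rewrite addrC mulrDl lerD ?hC ?hD.
rewrite nmZ cabs_real gtr0_norm // expr2 mulrCA ler_pM2l // => h; apply: le_trans h _.
by rewrite ler_wpM2l ?addr_ge0 // /t ge_min lexx orbT.
Qed.

Lemma der_lin j c x y x' y' : der j x y -> der j x' y' -> der j (c *: x + x') (c *: y + y').
Proof.
move=> [C C0 hC] [D D0 hD]; exists (cabs c * C + D); first by rewrite addr_ge0 ?mulr_ge0 ?cabs_ge0.
move=> t t01; rewrite tr_lin.
have -> : c *: tr j t x + tr j t x' - (c *: x + x') - t%:C%C *: (c *: y + y') =
   c *: (tr j t x - x - t%:C%C *: y) + (tr j t x' - x' - t%:C%C *: y').
  have H (a a' b b' e e' : E) : a + a' - (b + b') - (e + e') = (a - b - e) + (a' - b' - e').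
    by rewrite (opprD b) (opprD e) (addrACA a) (addrACA (a - b)).
  by rewrite scalerDr H !scalerBr !scalerA (mulrC t%:C%C).
apply: le_trans (nmD _ _) _; rewrite nmZ mulrDl -mulrA lerD ?hD //.
by rewrite ler_wpM2l ?cabs_ge0 ?hC.
Qed.

Lemma der_0 j : der j 0 0.
Proof.
exists 0 => // t _; rewrite scaler0 !subr0.
by have := tr_lin j t (-1) (0 : E) 0; rewrite scaler0 addr0 scaleN1r addNr => ->; rewrite nm0 mul0r.
Qed.

Lemma derZ j c x y : der j x y -> der j (c *: x) (c *: y).
Proof. by move=> h; have := der_lin c h (der_0 j); rewrite !addr0. Qed.

Lemma derD j x y x' y' : der j x y -> der j x' y' -> der j (x + x') (y + y').
Proof. by move=> h1 h2; have := der_lin 1 h1 h2; rewrite !scale1r. Qed.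

Lemma der_sum j n (x y : nat -> E) : (forall i, (i < n)%N -> der j (x i) (y i)) ->
  der j (\sum_(i < n) x i) (\sum_(i < n) y i).
Proof.
elim: n => [|n IH] h; first by rewrite !big_ord0; exact: der_0.
rewrite !big_ord_recr /=; apply: derD; last exact: h.
by apply: IH => i /ltnW; exact: h.
Qed.

Lemma der_mult j s x y : issym s -> der j x y -> der j (mult s x) (mult s y).
Proof.
move=> hs [C C0 hC]; have [D hD] := hs; have D0 := sym_ge0 hD.
exists (D * C) => [|t t01]; first by rewrite mulr_ge0.
rewrite tr_multC // -multZr // -!multBr //.
by apply: le_trans (nm_mult _ hD) _; rewrite -mulrA ler_wpM2l ?hC.
Qed.

(* The spectrum of [x] is compact and lies in the slab [`|l_j - c| <= r]. *)
Definition insp (j : 'I_d) (c r : R) x := exists S s z, [/\ 0 < S, issym s, insupp s S,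
  (forall l, s l != 0 -> `|tnth l j - c| <= r) & x = mult s z].

(** Read on the symbol side, the ramp kernel applied to a second derivative is the remainder of the
    first order Taylor expansion of the representation. *)
Lemma cramp_id (y t : R) : (t%:C)%C ^+ 2 * (crampsym (t * y) * ((0 +i* y)%C * (0 +i* y)%C)) =
  expi (t * y) - 1 - (t%:C)%C * (0 +i* y)%C.
Proof.
rewrite /crampsym /expi /fejz /sinz.
have [e|e] := eqVneq (t * y) 0.
  rewrite e cos0 sin0 expr2; apply/eqP; rewrite eq_complex /=; apply/andP; split; apply/eqP.
    by rewrite !(mul0r, mulr0, subr0, sub0r, addr0, add0r, subrr, oppr0);
       rewrite -[LHS]opprK; nra.
  by rewrite !(mul0r, mulr0, subr0, sub0r, addr0, add0r, subrr, oppr0) e oppr0.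
rewrite expr2; apply/eqP; rewrite eq_complex /=.
move: e; rewrite mulf_eq0 negb_or => /andP[t0 y0].
by apply/andP; split; apply/eqP; field; rewrite t0 y0.
Qed.

(** The element [x'] is [D_j x - i c x]: on the slab the symbol [i (y - c)] agrees with the cut-off
    of [kern1_lincut], whose kernel has norm at most [2 r]. *)
Lemma bernstein j (c r : R) x : 0 < r -> insp j c r x -> exists x',
  [/\ insp j c r x', der j x ((0 +i* c)%C *: x + x') & nm x' <= 2 * r * nm x].
Proof.
move=> r0 [S [s [z [S0 hs sS sc ->]]]].
have [f [u [fu uE]]] := kern1_lincut c r0.
have r20 : 0 <= 2 * r by lra.
(* The cut-off [v] represents [i y] on the whole support cube; [s1] carries the derivative itself,
   and a second application, [s2], controls the quadratic remainder. *)
have [f0 [v [fv vE]]] := kern1_lincut 0 S0.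
have S20 : 0 <= 2 * S by lra.
pose s' := fun l => u (tnth l j) * s l.
have hs' : issym s' by exact: issym_coord fu r20 S0 sS hs.
pose s1 := fun l => v (tnth l j) * s l.
have hs1 : issym s1 by exact: issym_coord fv S20 S0 sS hs.
have supp1 : insupp s1 S by move=> l; rewrite mulf_eq0 negb_or => /andP[_ /sS].
pose s2 := fun l => v (tnth l j) * s1 l.
have hs2 : issym s2 by exact: issym_coord fv S20 S0 supp1 hs1.
have supp2 : insupp s2 S by move=> l; rewrite mulf_eq0 negb_or => /andP[_ /supp1].
exists (mult s' z); split.
- exists S, s', z; split => //; first by move=> l; rewrite mulf_eq0 negb_or => /andP[_ /sS].
  by move=> l; rewrite mulf_eq0 negb_or => /andP[_ /sc].
- have -> : (0 +i* c)%C *: mult s z + mult s' z = mult s1 z.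
    rewrite -mult_syml //; apply: mult_eq => l; rewrite /s' /s1.
    have [->|sl] := eqVneq (s l) 0; first by rewrite !mulr0 addr0.
    rewrite uE ?sc // vE ?subr0 ?sS // -mulrDl; congr (_ * _).
    by apply/eqP; rewrite eq_complex /= addr0 eqxx /= addrC subrK.
  exists (1 / 2 * nm (mult s2 z)) => [|t /andP[t0 t1]]; first by rewrite mulr_ge0 ?nm_ge0.
  have ti : 0 < t^-1 by rewrite invr_gt0.
  (* Dilation keeps the norm bound [1 / 2], so the constant of the remainder does not depend on
     [t]. *)
  have kr := kern1_dilate 0 ti (kern1_ramp R).
  have h2 : 0 <= 1 / 2 :> R by lra.
  have hw : issym (fun l => crampsym ((tnth l j - 0) / t^-1) * s2 l).
    exact: (@issym_coord R d j _ _ _ _ _ kr h2 S0 supp2 hs2).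
  have hle := nm_mult_coord j z kr h2 S0 supp2 hs2.
  have -> : tr j t (mult s z) - mult s z - t%:C%C *: mult s1 z =
      (t%:C)%C ^+ 2 *: mult (fun l => crampsym ((tnth l j - 0) / t^-1) * s2 l) z.
    have [C hC] := hs; rewrite (tr_mult j t z hC).
    have hsh := issym_shift j t hs; have hts := issymZ (t%:C)%C hs1.
    have hB := issymB hsh hs.
    rewrite -(mult_symZ _ z hs1) -(mult_symZ _ z hw) -(mult_symB z hsh hs) -(mult_symB z hB hts).
    apply: mult_eq => l; rewrite subr0 invrK /s2 /s1 (mulrC (tnth l j) t).
    have [->|sl] := eqVneq (s l) 0; first by rewrite !mulr0 !subrr.
    rewrite vE ?subr0 ?sS // [X in _ ^+ 2 * (_ * X)]mulrA [crampsym _ * _]mulrA [RHS]mulrA cramp_id.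
    by ring.
  rewrite nmZ expr2 cabsM cabs_real gtr0_norm // -expr2 mulrC ler_wpM2r //.
  by rewrite exprn_ge0 // ltW.
- exact: nm_mult_coord fu r20 S0 sS hs.
Qed.

(* Says that [F k = (D_j - i c)^k (F 0) / k!], where [D_j] is the generator of [tr j]. *)
Definition tower j (c : R) (F : nat -> E) :=
  forall k, der j (F k) ((0 +i* c)%C *: F k + (k.+1)%:R *: F k.+1).

(** [bernstein] returns an element of the same slab, so it can be iterated, each derivative costing
    [2 r]; division by [k!] normalises to Taylor coefficients. *)
Lemma insp_tower j (c r : R) x : 0 < r -> insp j c r x -> exists F, [/\ F 0%N = x, tower j c F &
  forall k, nm (F k) <= (2 * r) ^+ k / (k`!)%:R * nm x].
Proof.
move=> r0 hx.
have [g gP] : exists g : E -> E, forall y, insp j c r y ->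
    [/\ insp j c r (g y), der j y ((0 +i* c)%C *: y + g y) & nm (g y) <= 2 * r * nm y].
  have h y : exists y', insp j c r y ->
    [/\ insp j c r y', der j y ((0 +i* c)%C *: y + y') & nm y' <= 2 * r * nm y].
    have [yi|] := pselect (insp j c r y); last by exists 0.
    by have [y' hy] := bernstein r0 yi; exists y'.
  by have [g gP] := choice h; exists g.
have iP k : insp j c r (iter k g x) by elim: k => //= k IH; case: (gP _ IH).
have kf0 k : (k`!)%:R != 0 :> R[i] by rewrite pnatr_eq0 -lt0n fact_gt0.
exists (fun k => ((k`!)%:R)^-1 *: iter k g x); split.
- by rewrite fact0 /= invr1 scale1r.
- move=> k; have [_ h _] := gP _ (iP k).
  have := derZ ((k`!)%:R)^-1 h; congr der; rewrite scalerDr !scalerA mulrC; congr (_ + _ *: _).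
  by rewrite factS natrM invfM mulrA mulfV ?mul1r // pnatr_eq0.
- move=> k; rewrite nmZ.
  have -> : cabs (((k`!)%:R)^-1 : R[i]) = ((k`!)%:R)^-1.
    have -> : ((k`!)%:R)^-1 = ((((k`!)%:R)^-1 : R)%:C)%C :> R[i] by rewrite fmorphV rmorph_nat.
    by rewrite cabs_real ger0_norm // invr_ge0.
  rewrite mulrAC [leRHS]mulrC ler_wpM2l ?invr_ge0 //.
  elim: k => [|k IH]; first by rewrite expr0 mul1r.
  have [_ _ h] := gP _ (iP k); apply: le_trans h _.
  by rewrite exprS -[leRHS]mulrA ler_wpM2l //; lra.
Qed.

(* Bernstein's inequality from below: [D_j - i c] is expansive on spectra far from [c]. *)
Lemma tower_lower j (c c' r S : R) s F : 0 < r -> 0 < S -> issym s -> insupp s S ->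
  (forall l, s l != 0 -> `|tnth l j - c'| <= r) -> tower j c F -> 0 <= `|c' - c| - 2 * r ->
  forall k, (`|c' - c| - 2 * r) ^+ k / (k`!)%:R * nm (mult s (F 0%N)) <= nm (mult s (F k)).
Proof.
move=> r0 S0 hs sS sc Ft g0; set g := _ - 2 * r.
have step k : g * nm (mult s (F k)) <= (k.+1)%:R * nm (mult s (F k.+1)).
  have hi : insp j c' r (mult s (F k)) by exists S, s, (F k).
  have [y [_ h1 h2]] := bernstein r0 hi.
  have := der_mult hs (Ft k); rewrite multZD // multZr // => h3.
  have E1 := der_uniq h1 h3.
  have E2 : (k.+1)%:R *: mult s (F k.+1) = (0 +i* (c' - c))%C *: mult s (F k) + y.
    apply: (addrI ((0 +i* c)%C *: mult s (F k))); rewrite -E1 addrA -scalerDl.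
    congr (_ *: _ + _); apply/eqP; rewrite eq_complex /= addr0 eqxx /= addrCA subrr addr0 //.
  have : nm ((0 +i* (c' - c))%C *: mult s (F k)) <= nm ((k.+1)%:R *: mult s (F k.+1)) + nm y.
    have -> : (0 +i* (c' - c))%C *: mult s (F k) = (k.+1)%:R *: mult s (F k.+1) - y by rewrite E2 addrK.
    exact: nmB.
  rewrite !nmZ normc_id.
  have -> : cabs ((k.+1)%:R : R[i]) = (k.+1)%:R.
    have -> : (k.+1)%:R = (((k.+1)%:R : R)%:C)%C :> R[i] by rewrite rmorph_nat.
    by rewrite cabs_real ger0_norm.
  by rewrite /g mulrBl; lra.
elim=> [|k IH]; first by rewrite expr0 fact0 divr1 mul1r.
have k0 : 0 < (k.+1)%:R :> R by rewrite ltr0n.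
rewrite -(ler_pM2l k0); apply: le_trans (step k).
apply: le_trans (ler_wpM2l g0 IH); rewrite le_eqVlt; apply/orP; left; apply/eqP.
rewrite -/g factS natrM exprS; field.
by rewrite pnatr_eq0 -lt0n fact_gt0 /= gt_eqF.
Qed.

(** The bookkeeping of the Leibniz rule for Taylor coefficients: the weights [i] and [n - i] of the
    two factors add up to [n]. *)
Lemma sum_shift n (a : nat -> E) : \sum_(i < n) (i.+1)%:R *: a i.+1 + \sum_(i < n) (n - i)%:R *: a i =
  n%:R *: \sum_(i < n.+1) a i.
Proof.
have -> : \sum_(i < n) (i.+1)%:R *: a i.+1 = \sum_(i < n.+1) i%:R *: a i.
  by rewrite big_ord_recl scale0r add0r.
have -> : \sum_(i < n) (n - i)%:R *: a i = \sum_(i < n.+1) (n - i)%:R *: a i.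
  by rewrite big_ord_recr /= subnn scale0r addr0.
rewrite -big_split /= scaler_sumr; apply: eq_bigr => i _.
by rewrite -scalerDl -natrD subnKC // -ltnS.
Qed.

End bmod_theory.

(** * Products of elements and the Leibniz rule *)

Record bcomp (R : realType) (d : nat) (E1 E2 E3 : bmod R d) (comp : E2 -> E1 -> E3) : Prop := BComp {
  bc_linl : forall c y y' x, comp (c *: y + y') x = c *: comp y x + comp y' x;
  bc_linr : forall c y x x', comp y (c *: x + x') = c *: comp y x + comp y x';
  bc_nm : forall y x, nm (comp y x) <= nm y * nm x;
  bc_tr : forall j t y x, tr j t (comp y x) = comp (tr j t y) (tr j t x)
}.

Section composition.
Variables (R : realType) (d : nat) (E1 E2 E3 : bmod R d) (comp : E2 -> E1 -> E3).
Hypothesis Hc : bcomp comp.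
Let comp_linl := bc_linl Hc.
Let comp_linr := bc_linr Hc.
Let nm_comp := bc_nm Hc.
Let comp_tr := bc_tr Hc.

Lemma compDl y y' x : comp (y + y') x = comp y x + comp y' x.
Proof. by have := comp_linl 1 y y' x; rewrite !scale1r. Qed.

Lemma compDr y x x' : comp y (x + x') = comp y x + comp y x'.
Proof. by have := comp_linr 1 y x x'; rewrite !scale1r. Qed.

Lemma comp0l x : comp 0 x = 0.
Proof. by have := comp_linl (-1) 0 0 x; rewrite scaler0 addr0 scaleN1r addNr. Qed.

Lemma comp0r y : comp y 0 = 0.
Proof. by have := comp_linr (-1) y 0 0; rewrite scaler0 addr0 scaleN1r addNr. Qed.

Lemma compZl c y x : comp (c *: y) x = c *: comp y x.
Proof. by have := comp_linl c y 0 x; rewrite comp0l !addr0. Qed.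

Lemma compZr c y x : comp y (c *: x) = c *: comp y x.
Proof. by have := comp_linr c y x 0; rewrite comp0r !addr0. Qed.

Lemma compNl y x : comp (- y) x = - comp y x.
Proof. by rewrite -scaleN1r compZl scaleN1r. Qed.

Lemma compNr y x : comp y (- x) = - comp y x.
Proof. by rewrite -scaleN1r compZr scaleN1r. Qed.

Lemma compBl y y' x : comp (y - y') x = comp y x - comp y' x.
Proof. by rewrite compDl compNl. Qed.

Lemma compBr y x x' : comp y (x - x') = comp y x - comp y x'.
Proof. by rewrite compDr compNr. Qed.

Lemma comp_suml (I : Type) (t : seq I) (P : pred I) (F : I -> E2) x :
  comp (\sum_(i <- t | P i) F i) x = \sum_(i <- t | P i) comp (F i) x.
Proof. by elim/big_rec2: _ => [|i a b _ <-]; [exact: comp0l|exact: compDl]. Qed.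

Lemma comp_sumr (I : Type) (t : seq I) (P : pred I) (F : I -> E1) y :
  comp y (\sum_(i <- t | P i) F i) = \sum_(i <- t | P i) comp y (F i).
Proof. by elim/big_rec2: _ => [|i a b _ <-]; [exact: comp0r|exact: compDr]. Qed.

Lemma der_comp j y y' x x' : der j y y' -> der j x x' -> der j (comp y x) (comp y' x + comp y x').
Proof.
move=> [C C0 hC] [D D0 hD].
exists (C * nm x + nm y * D + nm y' * (D + nm x')).
  by rewrite !addr_ge0 ?mulr_ge0 ?addr_ge0 ?nm_ge0.
move=> t t01; rewrite comp_tr.
have /andP[t0 t1] := t01.
have H (a b c e f g : E3) : (a - b - c) + (b - e - f) + (c - g) = a - e - (g + f).
  by rewrite (addrAC a (- b)) -(addrA b) subrKA addrAC subrKA addrACA -opprD.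
have -> : comp (tr j t y) (tr j t x) - comp y x - (t%:C)%C *: (comp y' x + comp y x') =
    comp (tr j t y - y - (t%:C)%C *: y') (tr j t x) + comp y (tr j t x - x - (t%:C)%C *: x') +
    (t%:C)%C *: comp y' (tr j t x - x).
  by rewrite !compBl !compBr compZl compZr scalerBr H scalerDr.
apply: le_trans (nmD _ _) _; rewrite mulrDl lerD //.
  apply: le_trans (nmD _ _) _; rewrite mulrDl lerD //.
    apply: le_trans (nm_comp _ _) _; rewrite nm_tr mulrAC ler_wpM2r ?nm_ge0 //; exact: hC.
  by apply: le_trans (nm_comp _ _) _; rewrite -mulrA ler_wpM2l ?nm_ge0 //; exact: hD.
rewrite nmZ cabs_real gtr0_norm //.
have h1 : nm (tr j t x - x) <= (D + nm x') * t.
  rewrite -(subrK ((t%:C)%C *: x') (tr j t x - x)); apply: le_trans (nmD _ _) _.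
  rewrite nmZ cabs_real gtr0_norm // mulrDl (mulrC t) lerD2r.
  apply: le_trans (hD _ t01) _; rewrite ler_wpM2l // expr2.
  by rewrite ger_pMr.
apply: (@le_trans _ _ (t * (nm y' * ((D + nm x') * t)))).
  rewrite ler_wpM2l ?(ltW t0) //; apply: le_trans (nm_comp _ _) _.
  by rewrite ler_wpM2l ?nm_ge0.
by rewrite le_eqVlt; apply/orP; left; apply/eqP; ring.
Qed.

Lemma tower_comp j (c1 c2 : R) (G : nat -> E2) (F : nat -> E1) : tower j c2 G -> tower j c1 F ->
  tower j (c1 + c2) (fun k => \sum_(i < k.+1) comp (G i) (F (k - i)%N)).
Proof.
move=> hG hF k.
have h i : (i < k.+1)%N -> der j (comp (G i) (F (k - i)%N))
    (comp ((0 +i* c2)%C *: G i + i.+1%:R *: G i.+1) (F (k - i)%N) +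
     comp (G i) ((0 +i* c1)%C *: F (k - i)%N + (k - i).+1%:R *: F (k - i).+1)).
  by move=> _; apply: der_comp; [exact: hG|exact: hF].
have := der_sum (x := fun i => comp (G i) (F (k - i)%N)) h; congr der.
have E i : (i < k.+1)%N -> comp ((0 +i* c2)%C *: G i + i.+1%:R *: G i.+1) (F (k - i)%N) +
     comp (G i) ((0 +i* c1)%C *: F (k - i)%N + (k - i).+1%:R *: F (k - i).+1) =
   (0 +i* (c1 + c2))%C *: comp (G i) (F (k - i)%N) +
   (i.+1%:R *: comp (G i.+1) (F (k.+1 - i.+1)%N) + (k.+1 - i)%:R *: comp (G i) (F (k.+1 - i)%N)).
  rewrite ltnS => ik; rewrite comp_linl comp_linr compZl compZr subSS subSn //.
  rewrite addrACA -scalerDl; congr (_ *: _ + _).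
  by apply/eqP; rewrite eq_complex /= addr0 eqxx /= addrC.
under eq_bigr => i _ do rewrite E //.
by rewrite !big_split /= -scaler_sumr (sum_shift k.+1 (fun i => comp (G i) (F (k.+1 - i)%N))).
Qed.

(** The Cauchy product of two exponential majorants is the binomial expansion of
    [(r + r)^k / k!]. *)
Lemma nm_tower_comp (G : nat -> E2) (F : nat -> E1) (r : R) (a b : R) k : 0 <= r ->
  0 <= a -> 0 <= b -> (forall i, nm (G i) <= r ^+ i / (i`!)%:R * a) ->
  (forall i, nm (F i) <= r ^+ i / (i`!)%:R * b) ->
  nm (\sum_(i < k.+1) comp (G i) (F (k - i)%N)) <= (2 * r) ^+ k / (k`!)%:R * (a * b).
Proof.
move=> r0 a0 b0 hG hF; apply: le_trans (nm_sum _ _ _) _.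
have fn0 m : (m`!)%:R != 0 :> R by rewrite pnatr_eq0 -lt0n fact_gt0.
have -> : (2 * r) ^+ k / (k`!)%:R * (a * b) =
    \sum_(i < k.+1) (r ^+ i / (i`!)%:R * a) * (r ^+ (k - i) / ((k - i)`!)%:R * b).
  have -> : 2 * r = r + r by ring.
  rewrite exprDn !mulr_suml; apply: eq_bigr => -[i /=]; rewrite ltnS => ik _.
  rewrite -mulr_natr.
  have -> : 'C(k, i)%:R = (k`!)%:R / ((i`!)%:R * ((k - i)`!)%:R) :> R.
    by rewrite -(bin_fact ik) -natrM [in RHS]natrM mulfK // natrM mulf_neq0.
  by field; rewrite !fn0.
apply: ler_sum => i _; apply: le_trans (nm_comp _ _) _.
by apply: ler_pM; rewrite ?nm_ge0.
Qed.

(** From above, Taylor coefficients of the product grow at most like [(4 r)^k / k!]; from below,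
    once localised near [c3], at least like [g^k / k!] with [g = |c3 - (c1 + c2)| - 2 r]. Since
    [g > 4 r], the localised product is zero. The threshold [6 r] is twice the natural [3 r];
    [comp_spectrum] removes this loss. *)
Lemma comp_spectrum_far j (c1 c2 c3 r S : R) s (x : E1) (y : E2) : 0 < r -> 0 < S -> issym s -> insupp s S ->
  (forall l, s l != 0 -> `|tnth l j - c3| <= r) -> insp j c1 r x -> insp j c2 r y ->
  6 * r < `|c3 - (c1 + c2)| -> mult s (comp y x) = 0.
Proof.
move=> r0 S0 hs sS sc hx hy far.
have [F [F0 hF Fb]] := insp_tower r0 hx; have [G [G0 hG Gb]] := insp_tower r0 hy.
have hX := tower_comp hG hF.
have g0 : 0 <= `|c3 - (c1 + c2)| - 2 * r by lra.
have low := tower_lower r0 S0 hs sS sc hX g0.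
have [C hC] := hs; have C0 := sym_ge0 hC.
set g := _ - 2 * r in g0 low.
have r20 : 0 <= 2 * r by lra.
have up k := nm_tower_comp k r20 (nm_ge0 y) (nm_ge0 x) Gb Fb.
set z := mult s (comp y x).
have zE : mult s (\sum_(i < 1) comp (G i) (F (0 - i)%N)) = z by rewrite big_ord1 F0 G0.
have key k : g ^+ k * nm z <= (4 * r) ^+ k * (C * (nm y * nm x)).
  have := low k; rewrite zE => h.
  have := le_trans h (le_trans (nm_mult _ hC) (ler_wpM2l C0 (up k))).
  have fk : 0 < (k`!)%:R :> R by rewrite ltr0n fact_gt0.
  have -> : 2 * (2 * r) = 4 * r by ring.
  rewrite mulrAC ler_pdivrMr // => h'; apply: le_trans h' _.
  rewrite le_eqVlt; apply/orP; left; apply/eqP; field.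
  by rewrite gt_eqF.
apply: nm_le0; rewrite leNgt; apply/negP => z0.
pose q := g / (4 * r) - 1; have r40 : 0 < 4 * r by lra.
have q0 : 0 < q by rewrite /q subr_gt0 ltr_pdivlMr // mul1r /g; lra.
have gq : g = (1 + q) * (4 * r) by rewrite /q addrC subrK mulfVK // gt_eqF.
have key' k : (1 + q) ^+ k * nm z <= C * (nm y * nm x).
  have := key k; by rewrite gq exprMn mulrAC mulrC ler_pM2l // exprn_gt0.
set K := C * (nm y * nm x) in key'.
have K0 : 0 <= K by rewrite !mulr_ge0 ?nm_ge0.
pose n := Num.bound (K / (q * nm z)).
have qz : 0 < q * nm z by rewrite mulr_gt0.
have hn : K / (q * nm z) < n%:R by apply: archi_boundP; rewrite divr_ge0 // ltW.
have := key' n; apply/negP; rewrite -ltNge.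
apply: (@lt_le_trans _ _ ((1 + n%:R * q) * nm z)).
  by move: hn; rewrite ltr_pdivrMr //; set m := n%:R; nra.
rewrite ler_pM2r //; elim: (n) => [|m IH]; first by rewrite mul0r addr0 expr0.
rewrite exprS -natr1.
have : (1 + q) * (1 + m%:R * q) <= (1 + q) * (1 + q) ^+ m by rewrite ler_wpM2l //; lra.
have : 0 <= m%:R * q ^+ 2 by rewrite mulr_ge0 // sqr_ge0.
lra.
Qed.

End composition.

(** * Spectrum of products *)

Section hats.
Variable R : realType.

Definition clamp (x : R) : R := Num.min (Num.max x 0) 1.

Lemma clampP (x : R) : [\/ clamp x = 0 /\ x <= 0, clamp x = x /\ 0 <= x <= 1 | clamp x = 1 /\ 1 <= x].
Proof.
rewrite /clamp /Num.min /Num.max; case: (ltP x 0) => h0.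
  by rewrite ltr01; apply: Or31; split => //; exact: ltW.
by case: (ltP x 1) => h1; [apply: Or32; rewrite ltW|apply: Or33].
Qed.

(** As a difference of consecutive clamped ramps, the tent has integer translates whose sums
    telescope. *)
Lemma phi_hat_clamp (x : R) : phi_hat x = clamp (x + 1) - clamp x.
Proof.
rewrite /phi_hat /Num.max; case: (clampP (x + 1)) => -[-> h1]; case: (clampP x) => -[-> h2];
  case: (ger0P x) => h3; case: ltP => h4; lra.
Qed.

Lemma sum_phi_hat (Y : R) n : \sum_(i < n) phi_hat (Y - i%:R) = clamp (Y + 1) - clamp (Y + 1 - n%:R).
Proof.
elim: n => [|n IH]; first by rewrite big_ord0 subr0 subrr.
rewrite big_ord_recr /= IH phi_hat_clamp -natr1.
have -> : Y + 1 - (n%:R + 1) = Y - n%:R by ring.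
have -> : Y - n%:R + 1 = Y + 1 - n%:R by ring.
by ring.
Qed.

Lemma phi_hat_unity (X : R) m : `|X| <= m%:R -> \sum_(i < (2 * m).+1) phi_hat (X - (i%:R - m%:R)) = 1.
Proof.
rewrite ler_norml => /andP[h1 h2].
under eq_bigr do rewrite opprB addrA.
rewrite sum_phi_hat -natr1 natrM.
by case: (clampP (X + m%:R + 1)) => -[-> ?]; case: (clampP (X + m%:R + 1 - (2 * m%:R + 1))) => -[-> ?]; lra.
Qed.

Lemma tent_step (p X : R) : 0 <= p -> Num.max (p + 1 - `|X|) 0 =
  Num.max (p - `|X|) 0 + (clamp (X + p + 1) - clamp (X + p + 1 - (2 * p + 1))).
Proof.
move=> p0; have -> : X + p + 1 - (2 * p + 1) = X - p by ring.
rewrite /Num.max; case: (ger0P X) => h3.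
  have -> : clamp (X + p + 1) = 1 by case: (clampP (X + p + 1)) => -[-> h1]; lra.
  by case: (clampP (X - p)) => -[-> h2]; case: (ltP (p + 1 - _) 0) => h4; case: (ltP (p - _) 0) => h5; lra.
have -> : clamp (X - p) = 0 by case: (clampP (X - p)) => -[-> h1]; lra.
by case: (clampP (X + p + 1)) => -[-> h2]; case: (ltP (p + 1 - _) 0) => h4; case: (ltP (p - _) 0) => h5; lra.
Qed.

(** Linear interpolation at integer nodes. Raising the half-width from [P] to [P + 1] adds the
    trapezoid of [tent_step], which [sum_phi_hat] identifies with a sum of [2 P + 1] unit tents. *)
Lemma tent_sum (P : nat) (X : R) : Num.max (P%:R - `|X|) 0 =
  \sum_(i < (2 * P).+1) (P%:R - `|i%:R - P%:R|) * phi_hat (X - (i%:R - P%:R)).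
Proof.
elim: P => [|P IH].
  by rewrite muln0 big_ord1 !subr0 normr0 subrr mul0r max_r // sub0r oppr_le0.
have -> : (2 * P.+1).+1 = (2 * P).+3 by rewrite mulnS.
rewrite big_ord_recl big_ord_recr /=.
have bmp i : (bump 0 i)%:R = i%:R + 1 :> R by rewrite /bump leq0n natr1.
have -> : (bump 0 (2 * P).+1)%:R = 2 * P%:R + 1 + 1 :> R by rewrite bmp -natr1 natrM.
rewrite -natr1.
have p0 : 0 <= P%:R :> R by [].
have -> : P%:R + 1 - `|0 - (P%:R + 1)| = 0 :> R by rewrite sub0r normrN ger0_norm ?subrr //; lra.
have -> : P%:R + 1 - `|2 * P%:R + 1 + 1 - (P%:R + 1)| = 0 :> R.
  by rewrite ger0_norm; lra.
rewrite !mul0r add0r addr0.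
transitivity (\sum_(i < (2 * P).+1) (P%:R - `|i%:R - P%:R|) * phi_hat (X - (i%:R - P%:R)) +
    \sum_(i < (2 * P).+1) phi_hat (X - (i%:R - P%:R))).
  rewrite -IH; under eq_bigr do rewrite opprB addrA.
  by rewrite sum_phi_hat -natr1 natrM tent_step.
rewrite -big_split /=; apply: eq_bigr => i _; rewrite bmp.
have -> : i%:R + 1 - (P%:R + 1) = i%:R - P%:R :> R by ring.
by ring.
Qed.

Lemma phi_hat_refine (P : nat) (x : R) : (0 < P)%N -> phi_hat x =
  \sum_(i < (2 * P).+1) (P%:R - `|i%:R - P%:R|) / P%:R * phi_hat (P%:R * x - (i%:R - P%:R)).
Proof.
move=> P0; have p0 : 0 < P%:R :> R by rewrite ltr0n.
under eq_bigr do rewrite mulrAC; rewrite -mulr_suml -tent_sum normrM (ger0_norm (ltW p0)).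
rewrite /phi_hat -[X in _ = Num.max (X - _) _ / _]mulr1 -mulrBr -[X in _ = Num.max _ X / _](mulr0 P%:R).
by rewrite -maxr_pMr ?(ltW p0) // mulrAC divff ?mul1r // gt_eqF.
Qed.

End hats.

(** * The sharp threshold for the spectrum of a product *)

Section sharp_spectrum.
Variables (R : realType) (d : nat).

(** Only coordinate [j], the one in which the spectra are separated, is refined. *)
Definition rad (j : 'I_d) (N : R) (P : nat) (k : 'I_d) : R := if k == j then N / P%:R else N.

Definition cen (j : 'I_d) (N : R) (P : nat) (c : 'I_d -> R) (p : R) (k : 'I_d) : R :=
  if k == j then c k + p * (N / P%:R) else c k.

Definition wgt (P i : nat) : R := (P%:R - `|i%:R - P%:R|) / P%:R.

Lemma rad_gt0 j N P k : 0 < N -> (0 < P)%N -> 0 < rad j N P k.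
Proof. by move=> N0 P0; rewrite /rad; case: ifP => // _; rewrite divr_gt0 // ltr0n. Qed.

Lemma tri_refine j (N : R) (P : nat) (c : 'I_d -> R) l : 0 < N -> (0 < P)%N ->
  tri (fun=> N) c l = \sum_(0 <= i < (2 * P).+1)
    ((wgt P i)%:C)%C * tri (rad j N P) (cen j N P c (i%:R - P%:R)) l.
Proof.
move=> N0 P0; rewrite /tri (bigD1 j) //= (phi_hat_refine _ P0) rmorph_sum /= mulr_suml big_mkord.
apply: eq_bigr => i _; rewrite [X in _ = _ * X](bigD1 j) //= /rad /cen /wgt eqxx rmorphM -mulrA; congr (_ * (_ * _)).
  congr (phi_hat _)%:C%C; have p0 : P%:R != 0 :> R by rewrite pnatr_eq0 -lt0n.
  by field; rewrite p0 gt_eqF.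
by apply: eq_bigr => k /negbTE ->.
Qed.

Lemma wgt_ge0 P i : (i < (2 * P).+1)%N -> 0 <= wgt P i.
Proof.
rewrite ltnS => iP; rewrite /wgt divr_ge0 // subr_ge0 ler_norml.
rewrite lerBrDr addNr ler0n /= lerBlDr -natrD ler_nat addnn -mul2n //.
Qed.

Lemma insupp_tri (N c : 'I_d -> R) : (forall k, 0 < N k) -> exists2 S, 0 < S & insupp (tri N c) S.
Proof.
move=> N0; exists (1 + \sum_k (N k + `|c k|)).
  by rewrite ltr_pwDl // sumr_ge0 // => k _; rewrite addr_ge0 // ltW.
move=> l /(tri_neq0 N0) h k; apply: (@le_trans _ _ (N k + `|c k|)).
  rewrite -(subrK (c k) (tnth l k)); apply: le_trans (ler_normD _ _) _.
  by rewrite lerD2r ltW.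
rewrite (bigD1 k) //= addrCA lerDl addr_ge0 // sumr_ge0 // => i _.
by rewrite addr_ge0 // ltW.
Qed.

Section split.
Variables (E : bmod R d) (j : 'I_d) (N : R) (N0 : 0 < N).

(* The tent of half-width [N] is a sum of tents of half-width [N / P]; [core] drops those near its
   edge, which shrinks the spectrum at the cost of an error [O(1 / P)]. *)
Definition core (P : nat) (c : 'I_d -> R) (x : E) : E := \sum_(4 <= i < (2 * P - 3)%N)
  ((wgt P i)%:C)%C *: mult (tri (rad j N P) (cen j N P c (i%:R - P%:R))) x.

(** Four indices are dropped at each end, each of weight at most [4 / P], so the loss is at most [8]
    times [4 / P]. *)
Lemma nm_core P c x : (4 <= P)%N -> nm (mult (tri (fun=> N) c) x - core P c x) <= 32 / P%:R * nm x.
Proof.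
move=> P4; have P0 : (0 < P)%N by exact: leq_trans P4.
have p0 : 0 < P%:R :> R by rewrite ltr0n.
have hs i : issym (tri (rad j N P) (cen j N P c (i%:R - P%:R))).
  by apply: sym_issym; apply: sym_tri => k; exact: rad_gt0.
have -> : mult (tri (fun=> N) c) x = \sum_(0 <= i < (2 * P).+1)
    ((wgt P i)%:C)%C *: mult (tri (rad j N P) (cen j N P c (i%:R - P%:R))) x.
  by rewrite -mult_sym_sum //; apply: mult_eq => l; exact: tri_refine.
have l1 : (4 <= (2 * P).+1)%N by lia.
have l2 : (4 <= 2 * P - 3)%N by lia.
have l3 : (2 * P - 3 <= (2 * P).+1)%N by lia.
rewrite (big_cat_nat (leq0n 4) l1) /= (big_cat_nat l2 l3) /=.
rewrite -/(core P c x) [core P c x + _]addrC addrA addrK.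
have term i : (i < (2 * P).+1)%N -> (i < 4)%N || (2 * P - 3 <= i)%N ->
    nm (((wgt P i)%:C)%C *: mult (tri (rad j N P) (cen j N P c (i%:R - P%:R))) x) <= 4 / P%:R * nm x.
  move=> iP ib; rewrite nmZ cabs_real ger0_norm ?wgt_ge0 //.
  apply: ler_pM; rewrite ?wgt_ge0 ?nm_ge0 //; last by apply: nm_tri => k; exact: rad_gt0.
  rewrite /wgt ler_pM2r ?invr_gt0 // lerBlDr -lerBlDl.
  case/orP: ib => ib.
    apply: (@le_trans _ _ (P%:R - i%:R)); last by rewrite distrC ler_norm.
    by rewrite lerD2l lerN2 ler_nat; lia.
  apply: (@le_trans _ _ (i%:R - P%:R)); last by rewrite ler_norm.
  have : (P + P <= i + 4)%N by lia.
  by rewrite -(ler_nat R) !natrD; lra.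
apply: le_trans (nmD _ _) _.
have -> : 32 / P%:R * nm x = 4 / P%:R * nm x *+ 4 + 4 / P%:R * nm x *+ 4 by rewrite -(mulr_natr (4 / P%:R * nm x) 4); ring.
apply: lerD; apply: le_trans (nm_sum _ _ _) _.
  rewrite -[X in _ <= _ *+ X](subn0 4) -sumr_const_nat.
  by rewrite !big_seq; apply: ler_sum => i; rewrite mem_index_iota => /andP[_ i4]; apply: term; rewrite ?i4 //; lia.
have -> : 4 / P%:R * nm x *+ 4 = 4 / P%:R * nm x *+ ((2 * P).+1 - (2 * P - 3)) by congr (_ *+ _); lia.
rewrite -sumr_const_nat !big_seq; apply: ler_sum => i; rewrite mem_index_iota => /andP[i1 i2].
by apply: term; rewrite ?i1 ?orbT.
Qed.

Lemma nm_core_le P c x : (4 <= P)%N -> nm (core P c x) <= 9 * nm x.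
Proof.
move=> P4; have h := nm_core c x P4.
have -> : core P c x = mult (tri (fun=> N) c) x - (mult (tri (fun=> N) c) x - core P c x) by rewrite subKr.
apply: le_trans (nmB _ _) _.
have h1 := @nm_tri R d E (fun=> N) c x (fun=> N0).
have p4 : 4 <= P%:R :> R by rewrite ler_nat.
have : 32 / P%:R * nm x <= 8 * nm x.
  rewrite ler_wpM2r ?nm_ge0 // ler_pdivrMr; first by lra.
  by lra.
lra.
Qed.

Lemma coreB P c x y : (0 < P)%N -> core P c (x - y) = core P c x - core P c y.
Proof.
move=> P0; rewrite /core -sumrB; apply: eq_bigr => i _; rewrite -scalerBr multBr //.
by apply: sym_issym; apply: sym_tri => k; exact: rad_gt0.
Qed.

End split.

Section comp.
Variables (E1 E2 E3 : bmod R d) (comp : E2 -> E1 -> E3).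
Hypothesis Hc : bcomp comp.

(** With [D = N / P], the retained centres have [|p| <= P - 4], so three of them reduce the distance
    [3 N = 3 P D] to no less than [12 D], which exceeds the threshold [6 D] of
    [comp_spectrum_far]. *)
Lemma core_comp0 j (N : R) P (c1 c2 c3 : 'I_d -> R) (x : E1) (y : E2) : 0 < N -> (4 <= P)%N ->
  3 * N <= `|c3 j - (c1 j + c2 j)| -> core j N P c3 (comp (core j N P c2 y) (core j N P c1 x)) = 0.
Proof.
move=> N0 P4 far; have P0 : (0 < P)%N by exact: leq_trans P4.
have p0 : 0 < P%:R :> R by rewrite ltr0n.
pose D := N / P%:R; have D0 : 0 < D by rewrite divr_gt0.
have ND : N = P%:R * D by rewrite mulrCA divff ?mulr1 // gt_eqF.
have r0 k : 0 < rad j N P k by exact: rad_gt0.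
have hs c : issym (tri (rad j N P) c) by apply: sym_issym; exact: sym_tri.
have ri (E : bmod R d) c (z : E) : insp j (c j) D (mult (tri (rad j N P) c) z).
  have [S S0 hS] := insupp_tri c r0; exists S, (tri (rad j N P) c), z; split => //.
  move=> l /(tri_neq0 r0)/(_ j)/ltW; by rewrite /rad eqxx.
have pb i : (4 <= i < 2 * P - 3)%N -> `|i%:R - P%:R| <= P%:R - 4 :> R.
  move=> /andP[i1 i2]; have : (i + 4 <= P + P)%N by lia.
  by move: i1; rewrite -!(ler_nat R) !natrD ler_norml; lra.
rewrite /core big_seq big1 // => i; rewrite mem_index_iota => i4.
rewrite (comp_suml Hc) mult_sumr // big_seq big1 ?scaler0 // => i'; rewrite mem_index_iota => i'4.
rewrite (comp_sumr Hc) mult_sumr // big_seq big1 // => i''; rewrite mem_index_iota => i''4.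
rewrite (compZl Hc) (compZr Hc) !multZr //.
have [S S0 hS] := insupp_tri (cen j N P c3 (i%:R - P%:R)) r0.
have sc l : tri (rad j N P) (cen j N P c3 (i%:R - P%:R)) l != 0 ->
    `|tnth l j - cen j N P c3 (i%:R - P%:R) j| <= D.
  by move=> /(tri_neq0 r0)/(_ j)/ltW; rewrite /rad eqxx.
rewrite (comp_spectrum_far Hc D0 S0 (hs _) hS sc (ri _ _ _) (ri _ _ _)) ?scaler0 //.
rewrite /cen eqxx -/D.
have := pb _ i4; have := pb _ i'4; have := pb _ i''4.
set p := i%:R - P%:R; set p' := i'%:R - P%:R; set p'' := i''%:R - P%:R => h'' h' h.
have -> : c3 j + p * D - (c1 j + p'' * D + (c2 j + p' * D)) = (c3 j - (c1 j + c2 j)) - (p'' + p' - p) * D by ring.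
apply: (@lt_le_trans _ _ (3 * N - `|(p'' + p' - p) * D|)); last first.
  by apply: le_trans (lerB_dist _ _); rewrite lerD2r.
rewrite normrM (gtr0_norm D0).
have : `|p'' + p' - p| <= 3 * (P%:R - 4).
  by apply: le_trans (ler_normB _ _) _; have := ler_normD p'' p'; lra.
move=> hp; have := ler_wpM2r (ltW D0) hp; rewrite [in 3 * N]ND; lra.
Qed.

(** As [P] grows the threshold becomes [3 N], the sum of the three half-widths. Equality is allowed,
    so on the lattice [|n_j - k_j - l_j| >= 3] already forces zero; this is what makes the count
    [5 ^ d]. *)
Lemma comp_spectrum j (N : R) (c1 c2 c3 : 'I_d -> R) (x : E1) (y : E2) : 0 < N ->
  3 * N <= `|c3 j - (c1 j + c2 j)| ->
  mult (tri (fun=> N) c3) (comp (mult (tri (fun=> N) c2) y) (mult (tri (fun=> N) c1) x)) = 0.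
Proof.
(* Here [91 = 1 + 9 + 81]: one error from the outer tent, and two inner errors in which the bound 9
   of [nm_core_le] enters once and twice. *)
move=> N0 far; apply: (@nm_le_lim _ _ _ _ (91 * (nm y * nm x))) => e e0.
pose P := maxn 4 (Num.bound (32 / e)).
have P4 : (4 <= P)%N by rewrite leq_maxl.
have P0 : (0 < P)%N by exact: leq_trans P4.
have p0 : 0 < P%:R :> R by rewrite ltr0n.
have Pe : 32 / P%:R <= e.
  rewrite ler_pdivrMr // mulrC -ler_pdivrMr //; apply/ltW.
  apply: lt_le_trans (archi_boundP _) _; first by rewrite divr_ge0 // ltW.
  by rewrite ler_nat leq_maxr.
set G := mult _ y; set F := mult _ x.
pose Gc := core j N P c2 y; pose Fc := core j N P c1 x.
have hG : nm (G - Gc) <= e * nm y by apply: le_trans (nm_core _ _ _ _ P4) _ => //; rewrite ler_wpM2r ?nm_ge0.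
have hF : nm (F - Fc) <= e * nm x by apply: le_trans (nm_core _ _ _ _ P4) _ => //; rewrite ler_wpM2r ?nm_ge0.
have nG : nm G <= nm y by exact: nm_tri.
have nF : nm F <= nm x by exact: nm_tri.
have nFc : nm Fc <= 9 * nm x by exact: nm_core_le.
have y0 := nm_ge0 y; have x0 := nm_ge0 x.
have := core_comp0 x y N0 P4 far; rewrite -/Gc -/Fc => c0.
set w := comp G F.
have Ew : core j N P c3 w = core j N P c3 (comp G (F - Fc)) + core j N P c3 (comp (G - Gc) Fc).
  by rewrite (compBr Hc) (compBl Hc) !coreB // c0 subr0 subrK.
rewrite -(subrK (core j N P c3 w) (mult _ w)) Ew.
apply: le_trans (nmD _ _) _; apply: (@le_trans _ _ (e * nm w + (9 * nm (comp G (F - Fc)) + 9 * nm (comp (G - Gc) Fc)))).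
  rewrite lerD //.
    by rewrite -Ew; apply: le_trans (nm_core _ _ _ _ P4) _ => //; rewrite ler_wpM2r ?nm_ge0.
  by apply: le_trans (nmD _ _) _; rewrite lerD //; exact: nm_core_le.
have b1 : nm w <= nm y * nm x by apply: le_trans (bc_nm Hc _ _) _; apply: ler_pM; rewrite ?nm_ge0.
have b2 : nm (comp G (F - Fc)) <= nm y * (e * nm x).
  by apply: le_trans (bc_nm Hc _ _) _; apply: ler_pM; rewrite ?nm_ge0.
have b3 : nm (comp (G - Gc) Fc) <= e * nm y * (9 * nm x).
  by apply: le_trans (bc_nm Hc _ _) _; apply: ler_pM; rewrite ?nm_ge0.
have := ler_wpM2l (ltW e0) b1; lra.
Qed.

End comp.
End sharp_spectrum.

(** * Lattice sums *)

Section finite_sums.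
Variable R : realType.

(** For nonnegative [a] this bounds the unordered sum while every computation stays with finite real
    sums; [esum_sumle] links it to the extended sums of the statement. *)
Definition sumle (I : eqType) (a : I -> R) (C : R) := forall t : seq I, uniq t -> \sum_(i <- t) a i <= C.

Lemma sum_subset_le (I : eqType) (u v : seq I) (a : I -> R) : (forall i, 0 <= a i) -> uniq u ->
  {subset u <= v} -> \sum_(i <- u) a i <= \sum_(i <- v) a i.
Proof.
move=> a0; elim: u v => [|i u IH] v /=; first by rewrite big_nil sumr_ge0.
move=> /andP[iu uu] uv; have iv : i \in v by apply: uv; rewrite mem_head.
rewrite (perm_big _ (perm_to_rem iv)) /= !big_cons lerD2l; apply: IH => // k ku.
have : k \in v by apply: uv; rewrite inE ku orbT.
rewrite (perm_mem (perm_to_rem iv)) inE => /orP[/eqP ki|//].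
by rewrite -ki ku in iu.
Qed.

Lemma sumle_ge0 (I : eqType) (a : I -> R) C : sumle a C -> 0 <= C.
Proof. by move=> /(_ [::] isT); rewrite big_nil. Qed.

(** Double counting: each [a i] is charged to finitely many [b j], and each [j] is charged by at
    most [W] indices [i]. *)
Lemma sumle_cover (I J : eqType) (a : I -> R) (b : J -> R) (cond : I -> J -> Prop) (W : nat) (C : R) :
  (forall j, 0 <= b j) -> sumle b C ->
  (forall i, exists t : seq J, [/\ uniq t, (forall j, j \in t -> cond i j) & a i <= \sum_(j <- t) b j]) ->
  (forall j (u : seq I), uniq u -> (forall i, i \in u -> cond i j) -> (size u <= W)%N) ->
  sumle a (W%:R * C).
Proof.
move=> b0 bC /choice[t tP] cnt s us.
pose T := undup (flatten [seq t i | i <- s]).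
have step i : i \in s -> a i <= \sum_(j <- T | j \in t i) b j.
  move=> si; have [ut _ h] := tP i; apply: le_trans h _; rewrite -[leRHS]big_filter.
  apply: sum_subset_le => // j jt; rewrite mem_filter jt mem_undup.
  by apply/flattenP; exists (t i) => //; exact: map_f.
apply: (@le_trans _ _ (\sum_(i <- s) \sum_(j <- T | j \in t i) b j)).
  by rewrite big_seq [leRHS]big_seq; apply: ler_sum.
under eq_bigr do rewrite big_mkcond /=; rewrite exchange_big /=.
apply: (@le_trans _ _ (\sum_(j <- T) W%:R * b j)); last first.
  by rewrite -mulr_sumr ler_wpM2l // bC // undup_uniq.
apply: ler_sum => j _; rewrite -big_mkcond -big_filter big_const_seq iter_addr addr0 count_predT.
rewrite -[leLHS]mulr_natl ler_wpM2r // ler_nat; apply: (cnt j); first exact: filter_uniq.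
by move=> i; rewrite mem_filter => /andP[ji _]; have [_ h _] := tP i; exact: h.
Qed.

Lemma absz_box (a c : int) (m : nat) : (absz (a - c)%R <= m)%N ->
  (c - m%:Z <= a < c - m%:Z + (2 * m).+1%:Z)%R.
Proof. by lia. Qed.

Lemma box_count d (t : seq (d.-tuple int)) (lo : 'I_d -> int) (w : nat) : uniq t ->
  (forall n, n \in t -> forall k, (lo k <= tnth n k < lo k + w%:Z)%R) -> (size t <= w ^ d)%N.
Proof.
move=> ut ht; case: w ht => [|w] ht.
  case: t ut ht => [//|n t] ut ht; case: d n t lo ut ht => [n t lo /= /andP[nt ut] _|d n t lo _ /(_ n (mem_head _ _) ord0)].
    case: t nt ut => [//|m t]; rewrite inE negb_or => /andP[/eqP h _] _.
    by case: h; apply: eq_from_tnth => -[].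
  by lia.
pose f (n : d.-tuple int) : {ffun 'I_d -> 'I_w.+1} := [ffun k => inord `|tnth n k - lo k|%N].
have fi : {in t &, injective f}.
  move=> n m nt mt /ffunP h; apply: eq_from_tnth => k; have := h k; rewrite !ffunE => /(congr1 val) /=.
  have := ht n nt k; have := ht m mt k; move: (tnth n k : int) (tnth m k : int) (lo k) => a b c h1 h2.
  have h3 : (absz (a - c)%R < w.+1)%N by lia.
  have h4 : (absz (b - c)%R < w.+1)%N by lia.
  by rewrite !inordK //; lia.
have : uniq (map f t) by rewrite map_inj_in_uniq.
move/card_uniqP; rewrite size_map => <-.
by apply: leq_trans (max_card _) _; rewrite card_ffun !card_ord.
Qed.

End finite_sums.

(** * Partitions of unity over shifted lattices *)

Section cells.
Variables (R : realType) (d : nat).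

Lemma normr_intr (z : int) : `|z%:~R| = (absz z)%:R :> R.
Proof. by rewrite -intr_norm -abszE -pmulrn. Qed.

Definition ibox (m : nat) : seq (d.-tuple int) :=
  [seq [tuple ((f k : nat)%:Z - m%:Z)%R | k < d] | f : {ffun 'I_d -> 'I_(2 * m).+1}].

Lemma ibox_uniq m : uniq (ibox m).
Proof.
rewrite /ibox map_inj_uniq ?enum_uniq // => f g /(congr1 (fun t => tnth t)) h.
apply/ffunP => k; have := congr1 (@^~ k) h; rewrite !tnth_mktuple => e.
by apply: val_inj => /=; lia.
Qed.

Lemma mem_ibox m (n : d.-tuple int) : n \in ibox m <-> forall k, (`|tnth n k| <= m)%N.
Proof.
split=> [/mapP[f _ ->] k|h].
  rewrite tnth_mktuple; have := ltn_ord (f k); move: (nat_of_ord (f k)) => i ik.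
  by lia.
apply/mapP; exists [ffun k => inord (absz (tnth n k + m%:Z)%R)]; first by rewrite mem_enum.
apply: eq_from_tnth => k; rewrite tnth_mktuple ffunE; have := h k.
move: (tnth n k : int) => a ha; have h1 : (absz (a + m%:Z)%R < (2 * m).+1)%N by lia.
by rewrite inordK //; lia.
Qed.

(** The offset [b] lets the lattice float: offset zero gives the cells of the lattice norm, and
    averaging over offsets in the unit cube gives the comparison with the integral norm. *)
Definition cel (N : R) (b : 'I_d -> R) (n : d.-tuple int) : d.-tuple R -> R[i] :=
  tri (fun=> N) (fun k => b k + N * (tnth n k)%:~R).

Lemma issym_cel N b n : 0 < N -> issym (cel N b n).
Proof. by move=> N0; apply: sym_issym; exact: sym_tri. Qed.

Lemma cel_neq0 N b n l : 0 < N -> cel N b n l != 0 ->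
  forall k, `|tnth l k - (b k + N * (tnth n k)%:~R)| < N.
Proof. by move=> N0; exact: (tri_neq0 (fun=> N0)). Qed.

(** A sum of products over a cube of indices factors into one-dimensional sums, each equal to 1 by
    [phi_hat_unity]. Cells outside [ibox m] vanish at [l]. *)
Lemma cel_unity (N : R) (b : 'I_d -> R) (m : nat) (u : seq (d.-tuple int)) l : 0 < N -> uniq u ->
  {subset ibox m <= u} -> (forall k, `|tnth l k - b k| <= N * m%:R) -> \sum_(n <- u) cel N b n l = 1.
Proof.
move=> N0 uu su hl.
transitivity (\sum_(n <- ibox m) cel N b n l).
  rewrite (bigID (mem (ibox m))) /= [X in _ + X]big1_seq ?addr0; last first.
    move=> n /andP[nb _]; apply/eqP; apply: contraNT nb => /(cel_neq0 N0) h.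
    apply/mem_ibox => k; rewrite leqNgt; apply/negP => kn.
    have hk := h k; have hlk := hl k.
    have : N * (absz (tnth n k))%:R < N * (m%:R + 1).
      rewrite -normr_intr -[N in N * `|_|](gtr0_norm N0) -normrM mulrDr mulr1.
      have -> : N * (tnth n k)%:~R = (tnth l k - b k) - (tnth l k - (b k + N * (tnth n k)%:~R)) by ring.
      by apply: le_lt_trans (ler_normB _ _) _; rewrite ler_ltD.
    by rewrite ltr_pM2l // natr1 ltr_nat ltnS leqNgt kn.
  rewrite -big_filter; apply: perm_big; apply: uniq_perm; rewrite ?filter_uniq ?ibox_uniq //.
  by move=> n; rewrite mem_filter andb_idr // => /su.
rewrite /ibox big_image /=.
under eq_bigr do rewrite /cel /tri.
pose F k (i : 'I_(2 * m).+1) : R[i] := ((phi_hat ((tnth l k - b k) / N - (i%:R - m%:R)))%:C)%C.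
transitivity (\sum_(f : {ffun 'I_d -> 'I_(2 * m).+1}) \prod_k F k (f k)).
  apply: eq_bigr => f _; apply: eq_bigr => k _; rewrite tnth_mktuple /F; congr (phi_hat _)%:C%C.
  by rewrite rmorphB /= !pmulrn; field; rewrite gt_eqF.
rewrite -bigA_distr_bigA big1 // => k _.
rewrite /F -rmorph_sum /= phi_hat_unity // normrM normfV (gtr0_norm N0).
by rewrite ler_pdivrMr // mulrC.
Qed.

Section mod.
Variables (E : bmod R d).
Implicit Types x : E.

(* The element [phi^d_{N,n} x] of the paper. *)
Definition fi (N : R) (n : d.-tuple int) x := mult (cel N (fun=> 0) n) x.

Lemma nm_cel N b n x : 0 < N -> nm (mult (cel N b n) x) <= nm x.
Proof. by move=> N0; exact: nm_tri. Qed.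

(** Inserts the partition of unity of scale [N] into [mult s x] and discards the cells that miss the
    support of [s]. *)
Lemma nm_refine s (N : R) (b c r : 'I_d -> R) x : sym s 1 -> 0 < N ->
  (forall l, s l != 0 -> forall k, `|tnth l k - c k| < r k) ->
  exists t : seq (d.-tuple int), [/\ uniq t,
    (forall n, n \in t -> forall k, `|c k - (b k + N * (tnth n k)%:~R)| < r k + N) &
    nm (mult s x) <= \sum_(n <- t) nm (mult (cel N b n) x)].
Proof.
move=> hs N0 sc; have hs' := sym_issym hs.
pose S := \sum_k (`|r k| + `|c k - b k|).
pose m := Num.bound (S / N).
have Sm : S <= N * m%:R.
  rewrite mulrC -ler_pdivrMr //; apply/ltW/archi_boundP.
  apply: divr_ge0; last exact: ltW.
  by apply: sumr_ge0 => k _; exact: addr_ge0.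
pose P n := [forall k, `|c k - (b k + N * (tnth n k)%:~R)| < r k + N].
exists [seq n <- ibox m | P n]; split; first by rewrite filter_uniq ?ibox_uniq.
  by move=> n; rewrite mem_filter => /andP[/forallP].
have E1 : mult s x = \sum_(n <- [seq n <- ibox m | P n]) mult (fun l => s l * cel N b n l) x.
  under eq_bigr => n _ do rewrite -[mult _ x]scale1r.
  rewrite -mult_sym_sum; last by move=> n; apply: issymM => //; exact: issym_cel.
  apply: mult_eq => l; have [s0|sl] := eqVneq (s l) 0.
    by rewrite s0 big1 // => n _; rewrite mul0r mulr0.
  under eq_bigr do rewrite mul1r.
  rewrite -[LHS]mulr1 -(cel_unity (u := ibox m) (m := m) (l := l) (b := b) N0 (ibox_uniq m)) //; last first.
    move=> k; apply: le_trans Sm; rewrite /S (bigD1 k) //=.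
    have : `|tnth l k - b k| <= `|r k| + `|c k - b k|.
      rewrite -(subrKA (c k)); apply: le_trans (ler_normD _ _) _; rewrite lerD2r.
      by apply: le_trans (ltW (sc l sl k)) (ler_norm _).
    move=> h; apply: le_trans h _; rewrite lerDl sumr_ge0 // => i _; exact: addr_ge0.
  rewrite mulr_sumr big_filter (bigID P) /= [X in _ + X]big1 ?addr0 //.
  move=> n; rewrite negb_forall => /existsP[k]; rewrite -leNgt => hk; apply/eqP.
  rewrite mulf_eq0 (negbTE sl) /=; apply: contraLR hk => /(cel_neq0 N0)/(_ k) h.
  rewrite -ltNge; rewrite -(subrKA (tnth l k)); apply: le_lt_trans (ler_normD _ _) _.
  by rewrite ltrD // distrC sc.
rewrite E1; apply: le_trans (nm_sum _ _ _) _; apply: ler_sum => n _.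
rewrite multMl //; last exact: issym_cel.
by apply: le_trans (nm_mult _ hs) _; rewrite mul1r.
Qed.

(** The enumerated series converges absolutely to some [z]. After any Fejer multiplier, whose symbol
    has compact support, the partition of unity is a finite sum, so [x] and [z] have the same Fejer
    means, and these separate points. *)
Lemma expansion (N C : R) x : 0 < N -> sumle (fun n => nm (fi N n x)) C -> forall e, 0 < e ->
  exists2 t, uniq t & nm (x - \sum_(n <- t) fi N n x) <= e.
Proof.
move=> N0 hC.
pose en m : seq (d.-tuple int) := pmap (@pickle_inv (d.-tuple int)) (iota 0 m).
have en_uniq m : uniq (en m).
  apply: (@pmap_uniq _ _ _ (@pickle (d.-tuple int))); last exact: iota_uniq.
  by move=> i; have := @pickle_invK (d.-tuple int) i; case: pickle_inv.
have en_mem n m : (pickle n < m)%N -> n \in en m.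
  move=> nm; rewrite mem_pmap; apply/mapP; exists (pickle n); first by rewrite mem_iota.
  by rewrite pickleK_inv.
pose y i : E := if pickle_inv i is Some n then fi N n x else 0.
have en_sum m : \sum_(i < m) y i = \sum_(n <- en m) fi N n x.
  rewrite -(big_mkord xpredT y) /en /index_iota subn0; elim: (iota 0 m) => [|i s IH] /=; first by rewrite !big_nil.
  by rewrite big_cons IH {1}/y; case: pickle_inv => [n|] /=; rewrite ?big_cons ?add0r.
have en_nsum m : \sum_(i < m) nm (y i) = \sum_(n <- en m) nm (fi N n x).
  rewrite -(big_mkord xpredT (fun i => nm (y i))) /en /index_iota subn0; elim: (iota 0 m) => [|i s IH] /=; first by rewrite !big_nil.
  by rewrite big_cons IH {1}/y; case: pickle_inv => [n|] /=; rewrite ?big_cons ?nm0 ?add0r.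
have [z hz] : exists z : E, forall e, 0 < e -> exists n0, forall n, (n0 <= n)%N ->
      nm (z - \sum_(k < n) y k) <= e.
  by apply: (nm_complete (C := C)) => n; rewrite en_nsum; exact: hC.
suff xz : x = z.
  move=> e e0; have [n0 /(_ n0 (leqnn _))] := hz e e0; rewrite en_sum => h.
  by exists (en n0); rewrite // {1}xz.
apply/eqP; rewrite -subr_eq0; apply/eqP; apply: mult_sep => M.
set s := tri _ _.
have M0 k : 0 < (M k).+1%:R :> R by rewrite ltr0n.
have hs1 : sym s 1 by exact: sym_tri.
have hs := sym_issym hs1.
have [S S0 sS] := insupp_tri (fun=> 0) M0; rewrite -/s in sS.
pose m := Num.bound (S / N).
have Sm : S <= N * m%:R.
  by rewrite mulrC -ler_pdivrMr //; apply/ltW/archi_boundP; rewrite divr_ge0 // ltW.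
pose q := \max_(n <- ibox m) (pickle n).+1.
have qP u : (q <= u)%N -> mult s (\sum_(n <- en u) fi N n x) = mult s x.
  move=> qu; rewrite mult_sumr //.
  under eq_bigr => n _.
    rewrite -multMl //; last exact: issym_cel.
    rewrite -[mult _ x]scale1r; over.
  rewrite -mult_sym_sum; last by move=> n; apply: issymM => //; exact: issym_cel.
  apply: mult_eq => l; have [s0|sl] := eqVneq (s l) 0.
    by rewrite s0 big1 // => n _; rewrite mul0r mulr0.
  under eq_bigr do rewrite mul1r.
  rewrite -mulr_sumr (cel_unity (m := m) N0 (en_uniq u)) ?mulr1 //.
    move=> n nb; apply: en_mem; apply: leq_trans qu.
    by rewrite /q (big_rem n nb) /= leq_maxl.
  by move=> k; rewrite subr0; apply: le_trans (sS l sl k) Sm.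
apply: (@nm_le_lim _ _ _ _ 1) => e e0; have [n0 h] := hz e e0.
pose u := maxn n0 q.
rewrite multBr // -(qP u (leq_maxr _ _)) -multBr // -en_sum mul1r.
apply: le_trans (nm_mult _ hs1) _; rewrite mul1r -nmN opprB.
by apply: h; exact: leq_maxl.
Qed.

Lemma nm_le_sumle (N C : R) x : 0 < N -> sumle (fun n => nm (fi N n x)) C -> nm x <= C.
Proof.
move=> N0 h; apply/ler_addgt0Pr => e e0; have [t ut ht] := expansion N0 h e0.
rewrite -(subrK (\sum_(n <- t) fi N n x) x); apply: le_trans (nmD _ _) _.
rewrite addrC lerD //; apply: le_trans (nm_sum _ _ _) _; exact: h.
Qed.

End mod.

(** By [comp_spectrum] at most [5 ^ d] cells [n] see the product of given cells [l] and [k]. Both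
    factors are first replaced by finite sums, with an error [e] small against the number of terms
    of the partial sum under test. *)
Lemma sumle_comp (E1 E2 E3 : bmod R d) (comp : E2 -> E1 -> E3) (N C1 C2 : R) (x : E1) (y : E2) :
  bcomp comp -> 0 < N -> sumle (fun n => nm (fi N n x)) C1 -> sumle (fun n => nm (fi N n y)) C2 ->
  sumle (fun n => nm (fi N n (comp y x))) (5 ^+ d * (C2 * C1)).
Proof.
move=> Hc N0 h1 h2 s us; apply/ler_addgt0Pr => e0 e0p.
pose K := (size s)%:R * (nm x + nm y + 1).
have K0 : 0 <= K by rewrite mulr_ge0 // !addr_ge0 ?nm_ge0.
pose e := Num.min 1 (e0 / (K + 1)).
have K1 : 0 < K + 1 by rewrite ltr_pwDr.
have ep : 0 < e by rewrite /e lt_min ltr01 divr_gt0.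
have e1 : e <= 1 by rewrite /e ge_min lexx.
have eK : e * K <= e0.
  apply: (@le_trans _ _ (e0 / (K + 1) * K)); first by rewrite ler_wpM2r // /e ge_min lexx orbT.
  by rewrite -mulrA ger_pMr // mulrC ler_pdivrMr // mul1r lerDl.
have [t1 ut1 ht1] := expansion N0 h1 ep; have [t2 ut2 ht2] := expansion N0 h2 ep.
set x' := \sum_(n <- t1) _ in ht1; set y' := \sum_(n <- t2) _ in ht2.
have hs n : issym (cel N (fun=> 0) n) by exact: issym_cel.
have ny' : nm y' <= nm y + e.
  by rewrite -[y'](subKr y); apply: le_trans (nmB _ _) _; rewrite lerD2l.
have diff : nm (comp y x - comp y' x') <= e * (nm x + nm y + 1).
  have -> : comp y x - comp y' x' = comp (y - y') x + comp y' (x - x').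
    by rewrite (compBl Hc) (compBr Hc) subrKA.
  apply: le_trans (nmD _ _) _.
  have b1 : nm (comp (y - y') x) <= e * nm x.
    by apply: le_trans (bc_nm Hc _ _) _; rewrite ler_wpM2r ?nm_ge0.
  have b2 : nm (comp y' (x - x')) <= (nm y + 1) * e.
    by apply: le_trans (bc_nm Hc _ _) _; apply: ler_pM; rewrite ?nm_ge0 //; lra.
  lra.
pose near (n l k : d.-tuple int) := [forall j, (absz (tnth n j - (tnth k j + tnth l j))%R <= 2)%N].
have term n l k : nm (fi N n (comp (fi N l y) (fi N k x))) <=
    if near n l k then nm (fi N l y) * nm (fi N k x) else 0.
  case: ifP => [_|/negbT].
    by apply: le_trans (nm_cel _ _ _ N0) _; exact: (bc_nm Hc).
  rewrite negb_forall => /existsP[j hj].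
  rewrite /fi /cel (comp_spectrum Hc (j := j)) ?nm0 // !add0r -!mulrDr -mulrBr normrM (gtr0_norm N0).
  by rewrite mulrC ler_pM2l // -intrD -intrB normr_intr ler_nat ltnNge.
have main n : nm (fi N n (comp y' x')) <=
    \sum_(l <- t2) \sum_(k <- t1) if near n l k then nm (fi N l y) * nm (fi N k x) else 0.
  rewrite /y' (comp_suml Hc) {1}/fi mult_sumr //; apply: le_trans (nm_sum _ _ _) _; apply: ler_sum => l _.
  rewrite /x' (comp_sumr Hc) mult_sumr //; apply: le_trans (nm_sum _ _ _) _; apply: ler_sum => k _.
  exact: term.
apply: (@le_trans _ _ (\sum_(n <- s) (nm (fi N n (comp y' x')) + e * (nm x + nm y + 1)))).
  apply: ler_sum => n _.
  rewrite -(subrK (comp y' x') (comp y x)) /fi multDr // addrC; apply: le_trans (nmD _ _) _.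
  by rewrite lerD2l; apply: le_trans (nm_cel _ _ _ N0) _.
rewrite big_split /= lerD //; last first.
  rewrite big_const_seq count_predT iter_addr addr0 -mulr_natl.
  by rewrite mulrCA.
apply: (@le_trans _ _ (\sum_(n <- s) \sum_(l <- t2) \sum_(k <- t1)
    if near n l k then nm (fi N l y) * nm (fi N k x) else 0)); first by apply: ler_sum => n _; exact: main.
rewrite exchange_big /=.
apply: (@le_trans _ _ (\sum_(l <- t2) \sum_(k <- t1) 5 ^+ d * (nm (fi N l y) * nm (fi N k x)))).
  apply: ler_sum => l _; rewrite exchange_big /=; apply: ler_sum => k _.
  rewrite -big_mkcond -big_filter big_const_seq iter_addr addr0 count_predT -[leLHS]mulr_natl.
  rewrite ler_wpM2r ?mulr_ge0 ?nm_ge0 // -natrX ler_nat.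
  apply: (@box_count d _ (fun j => tnth k j + tnth l j - 2%:Z)); first exact: filter_uniq.
  by move=> n; rewrite mem_filter => /andP[/forallP h _] j; exact: (absz_box (h j)).
under eq_bigr => l _ do rewrite -mulr_sumr -mulr_sumr.
rewrite -mulr_sumr ler_wpM2l ?exprn_ge0 // -mulr_suml.
apply: ler_pM; [by rewrite sumr_ge0 // => *; exact: nm_ge0|by rewrite sumr_ge0 // => *; exact: nm_ge0|exact: h2|exact: h1].
Qed.

End cells.

(** * Geometric sums over the integer lattice *)

Section lattice_sums.
Variable R : realType.

Lemma binom_geo_rec (q : R) d M : (1 - q) * \sum_(m < M) 'C(m + d.+1, d.+1)%:R * q ^+ m =
  \sum_(m < M) 'C(m + d, d)%:R * q ^+ m - q ^+ M * 'C(M + d, d.+1)%:R.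
Proof.
elim: M => [|M IH]; first by rewrite !big_ord0 mulr0 sub0r add0n bin_small // mulr0 oppr0.
by rewrite !big_ord_recr /= mulrDr IH addnS addSn !binS natrD exprS; ring.
Qed.

(** Multiplication by [1 - q] lowers [d] by one through Pascal's rule, which drives the
    induction. *)
Lemma binom_geo_le (q : R) d M : 0 <= q < 1 ->
  \sum_(m < M) 'C(m + d, d)%:R * q ^+ m <= (1 - q) ^- d.+1.
Proof.
move=> /andP[q0 q1]; have p : 0 < 1 - q by rewrite subr_gt0.
elim: d => [|d IH].
  rewrite expr1 -[leRHS]mul1r ler_pdivlMr // mulrC.
  have -> : (1 - q) * \sum_(m < M) 'C(m + 0, 0)%:R * q ^+ m = 1 - q ^+ M.
    elim: (M) => [|k IHk]; first by rewrite big_ord0 mulr0 expr0 subrr.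
    by rewrite big_ord_recr /= mulrDr IHk bin0 mul1r exprS; ring.
  by rewrite gerBl exprn_ge0.
rewrite exprS invfM -[_^-1 * _]mulrC ler_pdivlMr // mulrC binom_geo_rec.
by apply: le_trans IH; rewrite gerBl mulr_ge0 // exprn_ge0.
Qed.

Definition inorm d (n : d.-tuple int) : nat := \max_(k < d) absz (tnth n k).

(** Cube counts are majorised by binomial coefficients, the form that [binom_geo_le] can sum. *)
Lemma expn_le_binom d m : ((2 * m + 1) ^ d <= 2 ^ d * (d`! * 'C(m + d, d)))%N.
Proof.
rewrite [(d`! * _)%N]mulnC bin_ffact.
have h : (m.+1 ^ d <= (m + d) ^_ d)%N.
  elim: d => [|d IH]; first by rewrite expn0 ffactn0.
  by rewrite addnS ffactSS expnS leq_mul // ltnS leq_addr.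
apply: leq_trans (leq_mul (leqnn _) h); rewrite -expnMn.
by case: d {h} => // d; rewrite leq_exp2r //; lia.
Qed.

(** Abel summation: [q ^ inorm n] is a sum of increments [q ^ m - q ^ m.+1] over [m >= inorm n] up
    to a final term, which replaces the count of spheres by that of cubes. *)
Lemma sum_inorm d (q : R) (t : seq (d.+1.-tuple int)) : 0 < q < 1 -> uniq t ->
  \sum_(n <- t) q ^+ inorm n <= 2 ^+ d.+1 * (d.+1)`!%:R / (1 - q) ^+ d.+1.
Proof.
move=> /andP[q0 q1] ut; have p : 0 < 1 - q by rewrite subr_gt0.
pose M := \max_(n <- t) inorm n.
have tM n : n \in t -> (inorm n <= M)%N by move=> nt; rewrite /M (big_rem n nt) /= leq_maxl.
have tel (h : nat) k : (h <= k)%N ->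
    q ^+ h = \sum_(m < k) (if (h <= m)%N then q ^+ m - q ^+ m.+1 else 0) + q ^+ k.
  elim: k => [|k IH] hk; first by rewrite big_ord0 add0r; move: hk; rewrite leqn0 => /eqP ->.
  rewrite big_ord_recr /=; case: leqP => hk'; first by rewrite [LHS](IH hk'); ring.
  have -> : h = k.+1 by apply/eqP; rewrite eqn_leq hk hk'.
  by rewrite big1 ?add0r ?add0r // => m _; rewrite ifF //; apply/negbTE; rewrite -leqNgt ltnW.
pose c m : R := 2 ^+ d.+1 * (d.+1)`!%:R * 'C(m + d.+1, d.+1)%:R.
have cnt m : (size [seq n <- t | (inorm n <= m)%N])%:R <= c m.
  rewrite /c -natrX -!natrM ler_nat -mulnA; apply: leq_trans (expn_le_binom _ _).
  apply: (@leq_trans ((2 * m).+1 ^ d.+1)); last by rewrite addn1.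
  apply: (@box_count _ _ (fun=> 0 - m%:Z)); first exact: filter_uniq.
  move=> n; rewrite mem_filter => /andP[nm _] k; apply: absz_box; rewrite subr0.
  by apply: leq_trans nm; exact: (leq_bigmax k).
have -> : \sum_(n <- t) q ^+ inorm n = \sum_(m < M) (q ^+ m - q ^+ m.+1) *
    (size [seq n <- t | (inorm n <= m)%N])%:R + q ^+ M * (size t)%:R.
  rewrite big_seq.
  under eq_bigr => n nt do rewrite (tel _ _ (tM n nt)).
  rewrite -big_seq big_split /= exchange_big /=; congr (_ + _); last first.
    by rewrite big_const_seq count_predT iter_addr addr0 mulr_natr.
  apply: eq_bigr => m _.
  by rewrite -big_mkcond -big_filter big_const_seq count_predT iter_addr addr0 mulr_natr.
have sz : (size t)%:R <= c M.
  apply: le_trans (cnt M); rewrite ler_nat size_filter leq_eqVlt; apply/orP; left.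
  by rewrite eq_sym -all_count; apply/allP.
apply: (@le_trans _ _ (\sum_(m < M) (q ^+ m - q ^+ m.+1) * c m + q ^+ M * c M)).
  rewrite lerD //; last by rewrite ler_wpM2l // exprn_ge0 // ltW.
  apply: ler_sum => m _; rewrite ler_wpM2l // exprS -{1}[q ^+ m]mul1r -mulrBl mulr_ge0 // ?ltW //.
  exact: exprn_gt0.
have -> : \sum_(m < M) (q ^+ m - q ^+ m.+1) * c m + q ^+ M * c M =
    2 ^+ d.+1 * (d.+1)`!%:R * \sum_(m < M.+1) 'C(m + d, d)%:R * q ^+ m.
  have -> : \sum_(m < M) (q ^+ m - q ^+ m.+1) * c m =
     2 ^+ d.+1 * (d.+1)`!%:R * ((1 - q) * \sum_(m < M) 'C(m + d.+1, d.+1)%:R * q ^+ m).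
    rewrite [X in _ = _ * X]mulr_sumr [RHS]mulr_sumr; apply: eq_bigr => m _; rewrite /c exprS; ring.
  by rewrite binom_geo_rec big_ord_recr /= /c addnS binS natrD; ring.
rewrite ler_wpM2l ?mulr_ge0 ?exprn_ge0 //.
by apply: binom_geo_le; rewrite ltW.
Qed.

(** The induction rests on [(1 + 1 / n)^n >= 9 / 4 > 19 / 9] for [n >= 2]; since this fails for
    [n = 1], dimensions one and two are checked directly. The number [19 / 9] is twice the factor
    [19 / 18] of [geo_factor]. *)
Lemma fact_pow_le d : (0 < d)%N -> d`!%:R * (19 / 9) ^+ d <= 9 / 4 * d%:R ^+ d :> R.
Proof.
case: d => // d _; elim: d => [|d IH]; first by rewrite factS fact0 !expr1; lra.
have [->|d0] := posnP d; first by rewrite (_ : 2`! = 2)%N // !expr2; lra.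
have d1 : 0 < d.+1%:R :> R by rewrite ltr0n.
have key : 19 / 9 * d.+1%:R ^+ d.+1 <= d.+2%:R ^+ d.+1 :> R.
  have -> : d.+2%:R = d.+1%:R * (1 + d.+1%:R^-1) :> R.
    by rewrite mulrDr mulr1 divff ?gt_eqF // natr1.
  rewrite exprMn mulrC ler_wpM2l ?exprn_ge0 ?(ltW d1) //.
  set x := d.+1%:R^-1; have x0 : 0 < x by rewrite invr_gt0.
  (* The binomial expansion to second order; for [n x = 1] and [x <= 1 / 2] it gives [9 / 4]. *)
  have bin n : 1 + n%:R * x + (n%:R * (n%:R - 1) / 2) * x ^+ 2 <= (1 + x) ^+ n.
    elim: n => [|n IHn]; first by rewrite expr0 !mul0r !addr0.
    rewrite [leRHS]exprS; have h := ler_wpM2l (_ : 0 <= 1 + x) IHn.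
    apply: le_trans (h _); last by lra.
    rewrite -natr1; have n0 : 0 <= n%:R :> R by [].
    have : 0 <= (n%:R * (n%:R - 1) / 2) * x ^+ 3.
      apply: mulr_ge0; last by rewrite exprn_ge0 // (ltW x0).
      rewrite divr_ge0 //.
      by case: (n) => [|k]; rewrite ?mul0r // mulr_ge0 // -natr1 addrK.
    rewrite !exprS expr0; lra.
  have := bin d.+1; have dx : d.+1%:R * x = 1 by rewrite divff ?gt_eqF.
  have -> : d.+1%:R * (d.+1%:R - 1) / 2 * x ^+ 2 = (1 - x) / 2.
    by rewrite /x; field; rewrite gt_eqF.
  rewrite dx; apply: le_trans.
  have d2 : 2 <= d.+1%:R :> R by rewrite ler_nat.
  have := ler_wpM2r (ltW x0) d2; rewrite dx; lra.
rewrite factS natrM exprS [X in _ <= _ * X]exprS.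
have h := ler_wpM2l (ltW d1) IH.
have h2 := ler_wpM2l (_ : 0 <= 19 / 9 * d.+2%:R) IH.
apply: (@le_trans _ _ (19 / 9 * d.+2%:R * (9 / 4 * d.+1%:R ^+ d.+1))).
  apply: le_trans (h2 _); last by rewrite mulr_ge0.
  by rewrite le_eqVlt; apply/orP; left; apply/eqP; ring.
have c0 : 0 <= 9 / 4 * d.+2%:R :> R by rewrite mulr_ge0.
by have := ler_wpM2l c0 key; lra.
Qed.

End lattice_sums.

(** * The constants of the theorem *)

Section constants.
Variables (R : realType) (d : nat) (kap : R).
Hypotheses (d0 : (0 < d)%N) (k1 : 1 <= kap).

Let delta : R := deltaA d kap.
Let rho : R := (4 * kap + 3) / (4 * kap + 2).
Let u : R := (delta - 1)^-1.
Let G : R := ((2 * delta - 1) / (delta - 1)) ^+ d.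

Let dr0 : 0 < d%:R :> R. Proof. by rewrite ltr0n. Qed.

Let rhoE : rho = 1 + (4 * kap + 2)^-1.
Proof. by rewrite /rho; field; rewrite gt_eqF //; move: k1; lra. Qed.

Let rho1 : 1 < rho. Proof. by rewrite rhoE ltrDl invr_gt0; move: k1; lra. Qed.

Lemma delta_pow : delta ^+ (3 * d) = rho.
Proof.
have r0 : 0 <= rho by move: rho1; lra.
rewrite /delta /deltaA -/rho -powR_mulrn ?powR_ge0 // -powRrM natrM.
by rewrite div1r mulVf ?powRr1 // mulf_neq0 // gt_eqF.
Qed.

Lemma delta_gt1 : 1 < delta.
Proof.
rewrite ltNge; apply/negP => h.
have : delta ^+ (3 * d) <= 1 by rewrite exprn_ile1 // /delta /deltaA powR_ge0.
by rewrite delta_pow leNgt rho1.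
Qed.

Lemma bernoulli (x : R) n : 0 <= x -> 1 + n%:R * x <= (1 + x) ^+ n.
Proof.
move=> x0; elim: n => [|n IH]; first by rewrite mul0r addr0 expr0.
rewrite exprS -natr1; have := ler_wpM2l (_ : 0 <= 1 + x) IH.
move=> /(_ (addr_ge0 ler01 x0)); apply: le_trans.
have : 0 <= n%:R * (x * x) by rewrite !mulr_ge0.
lra.
Qed.

Let u0 : 0 < u. Proof. by rewrite invr_gt0 subr_gt0 delta_gt1. Qed.

Let dE : delta = 1 + u^-1. Proof. by rewrite invrK; ring. Qed.

(** Bernoulli's inequality for [delta = 1 + 1 / u], whose power [3 d] is
    [rho = 1 + 1 / (4 kap + 2)]. *)
Lemma u_lower : 3 * d%:R * (4 * kap + 2) <= u.
Proof.
have := bernoulli (3 * d) (_ : 0 <= u^-1); rewrite invr_ge0 (ltW u0) => /(_ isT).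
rewrite -dE delta_pow rhoE lerD2l natrM.
have kk : 0 < 4 * kap + 2 by move: k1; lra.
rewrite ler_pdivrMr // => h.
by rewrite -ler_pdivlMr // [u / _]mulrC.
Qed.

Let u18 : 18 * d%:R <= u.
Proof.
apply: le_trans u_lower.
have : 0 <= d%:R * (kap - 1) by rewrite mulr_ge0 ?subr_ge0 // ltW.
lra.
Qed.

Lemma GE : G = (2 + u) ^+ d.
Proof.
rewrite /G; congr (_ ^+ _); rewrite /u; field.
by rewrite gt_eqF // subr_gt0 delta_gt1.
Qed.

Lemma G_lower : 2 + u <= G.
Proof.
rewrite GE; case: d d0 => // n _; rewrite exprS ler_peMr //; first by have := u0; lra.
by rewrite exprn_ege1 //; have := u0; lra.
Qed.

Let d1 : 1 <= d%:R :> R. Proof. by rewrite ler1n. Qed.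

Lemma G20 : 20 <= G.
Proof. by apply: le_trans G_lower; have := u18; have := d1; lra. Qed.

(** From [kap >= 1] one has [rho <= 7 / 6], which is below [(19 / 18) ^ 3]. *)
Lemma delta_d_le : delta ^+ d <= 19 / 18.
Proof.
have : (delta ^+ d) ^+ 3 <= 7 / 6.
  rewrite -exprM mulnC delta_pow rhoE.
  have : (4 * kap + 2)^-1 <= 6^-1 by rewrite lef_pV2 ?posrE //; move: k1; lra.
  lra.
set x := delta ^+ d => h; rewrite leNgt; apply/negP => hx.
have : (19 / 18) ^+ 3 < x ^+ 3 by rewrite ltrXn2r //; lra.
rewrite !exprS expr0; move: h; rewrite !exprS expr0; lra.
Qed.

Lemma delta_d_gt1 : 1 < delta ^+ d.
Proof. by rewrite exprn_egt1 ?delta_gt1 // -lt0n. Qed.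

(** With [x = delta ^ d] the left side is [1 + 1 / (x - 1)]. Bernoulli bounds the second summand by
    [u / d], and [u >= 18 d] bounds the first by [u / (18 d)]. *)
Lemma geo_factor (q : R) : q = (delta ^+ d)^-1 -> (1 - q)^-1 <= 19 / 18 * (u / d%:R).
Proof.
move=> ->; have x1 := delta_d_gt1; set x := delta ^+ d in x1 *.
have -> : (1 - x^-1)^-1 = 1 + (x - 1)^-1.
  by field; rewrite !gt_eqF //= ?subr_gt0 //; lra.
have h1 : (x - 1)^-1 <= u / d%:R.
  have -> : u / d%:R = (d%:R / u)^-1 by rewrite invf_div.
  rewrite lef_pV2 ?posrE ?divr_gt0 ?subr_gt0 //.
  rewrite lerBrDl /x dE; apply: bernoulli; rewrite invr_ge0; exact: ltW.
have h2 : 1 <= 1 / 18 * (u / d%:R).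
  by rewrite mulrA ler_pdivlMr // mul1r; have := u18; lra.
lra.
Qed.

(** The left side bounds the lattice sum of the decay [2 q ^ (|n| - 2)] of the inverse. The constant
    comes from [2 (19 / 18)^2 * 9 / 4 < 126 / 25]. *)
Lemma series_bound (q : R) : q = (delta ^+ d)^-1 ->
  2 * q ^- 2 * (2 ^+ d * d`!%:R / (1 - q) ^+ d) <= 126 / 25 * G.
Proof.
move=> qE; have x1 := delta_d_gt1; have x2 := delta_d_le.
have qx : q^-1 = delta ^+ d by rewrite qE invrK.
have q1 : 0 < 1 - q by rewrite subr_gt0 qE invf_lt1 //; lra.
have gf := geo_factor qE.
rewrite -exprVn qx; set x := delta ^+ d in x1 x2 *.
have hx : 2 * x ^+ 2 <= 2 * (19 / 18) ^+ 2.
  by rewrite ler_wpM2l // lerXn2r // nnegrE; lra.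
have ud : 0 <= u / d%:R by rewrite divr_ge0 ?ltW.
have h1 : 2 ^+ d * d`!%:R / (1 - q) ^+ d <= 9 / 4 * u ^+ d.
  rewrite -exprVn.
  have h2 : (1 - q)^-1 ^+ d <= (19 / 18 * (u / d%:R)) ^+ d.
    by rewrite lerXn2r // nnegrE ?invr_ge0 ?(ltW q1) // mulr_ge0.
  have h3 := ler_wpM2l (_ : 0 <= 2 ^+ d * d`!%:R) h2.
  apply: le_trans (h3 _) _; first by rewrite mulr_ge0 // exprn_ge0.
  have -> : 2 ^+ d * d`!%:R * (19 / 18 * (u / d%:R)) ^+ d = d`!%:R * (19 / 9) ^+ d * (u ^+ d / d%:R ^+ d).
    have E (a : R) : 2 ^+ d * d`!%:R * (a * (u / d%:R)) ^+ d = d`!%:R * (2 * a) ^+ d * (u ^+ d / d%:R ^+ d).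
      by rewrite !exprMn (exprVn d%:R); ring.
    by rewrite E; congr (_ * _ ^+ _ * _); lra.
  rewrite mulrA ler_pdivrMr ?exprn_gt0 //.
  have := ler_wpM2r (exprn_ge0 d (ltW u0)) (fact_pow_le R d0).
  by rewrite [9 / 4 * u ^+ d * _]mulrAC.
have uG : u ^+ d <= G.
  rewrite GE lerXn2r // ?nnegrE; have := u0; lra.
have ud0 : 0 <= u ^+ d by rewrite exprn_ge0 // ltW.
have x20 : 0 <= 2 * x ^+ 2 by rewrite mulr_ge0 // exprn_ge0 //; lra.
have h10 : 0 <= 2 ^+ d * d`!%:R / (1 - q) ^+ d.
  by rewrite divr_ge0 ?mulr_ge0 ?exprn_ge0 // ltW.
have := ler_pM x20 h10 hx h1.
set y := 2 ^+ d * _ / _; set z := u ^+ d in uG ud0 *.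
rewrite !expr2 => h; apply: le_trans h _; lra.
Qed.

Lemma epsE : 5 ^+ d * epsA d kap = (16 * G - 12)^-1.
Proof.
by rewrite /epsA -/delta -/G mulrA divff ?mul1r // gt_eqF // exprn_gt0.
Qed.

Lemma eps_gt0 : 0 < epsA d kap.
Proof.
have p5 : 0 < 5 ^+ d :> R by rewrite exprn_gt0.
by rewrite -(pmulr_rgt0 _ p5) epsE invr_gt0; have := G20; lra.
Qed.

(* [eta] bounds both the relative perturbation [||E|| ||B||] and its effect on the condition number. *)
Lemma eta_bound (eta : R) : 0 <= eta -> eta <= epsA d kap / 5 ^+ d ->
  [/\ eta <= 1 / 1000, (kap + eta) * (rho ^+ 2 - 1) <= (1 - eta) / 2 &
      (126 / 25 * G) <= (1 - eta) * (8 * G - 6)].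
Proof.
move=> e0 he; have p5 : 5 <= 5 ^+ d :> R.
  by case: d d0 => // n _; rewrite exprS ler_peMr // exprn_ege1 //; lra.
have p50 : 0 < 5 ^+ d :> R by lra.
have g20 := G20; have gl := G_lower; have ul := u_lower.
have ul2 : 12 * kap + 6 <= u.
  apply: le_trans ul; have : 0 <= (d%:R - 1) * (4 * kap + 2).
    by rewrite mulr_ge0 ?subr_ge0 //; move: k1; lra.
  lra.
have e1 : eta * (25 * (16 * G - 12)) <= 1.
  have := epsE; have : 0 < 16 * G - 12 by lra.
  set g := 16 * G - 12; set p := 5 ^+ d in p5 p50 he *; move=> g0 epE.
  have h : eta <= (p * p * g)^-1.
    apply: le_trans he _; rewrite invfM -epE invfM le_eqVlt; apply/orP; left; apply/eqP.
    by field; rewrite gt_eqF.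
  have h1 : eta * (p * p * g) <= 1 by rewrite -ler_pdivlMr ?div1r // !mulr_gt0.
  apply: le_trans h1; rewrite ler_wpM2l // ler_wpM2r ?(ltW g0) //.
  by have := sqr_ge0 (p - 5); rewrite expr2; lra.
have e2 : eta <= 1 / 1000.
  have : eta * 308 <= eta * (16 * G - 12) by rewrite ler_wpM2l //; lra.
  lra.
have ek : eta * (25 * (192 * kap + 84)) <= 1.
  apply: le_trans e1; rewrite ler_wpM2l // ler_wpM2l //; lra.
split => //.
- rewrite rhoE; set w := (4 * kap + 2)^-1.
  have kk : 0 < 4 * kap + 2 by move: k1; lra.
  have w0 : 0 < w by rewrite invr_gt0.
  have wk : w * (4 * kap + 2) = 1 by rewrite mulVf ?gt_eqF.
  have -> : (1 + w) ^+ 2 - 1 = w * w * ((4 * kap + 2) * 2 + 1).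
    have -> : w * w * ((4 * kap + 2) * 2 + 1) = w * (2 * (w * (4 * kap + 2)) + w) by ring.
    by rewrite wk expr2; ring.
  have -> : (1 - eta) / 2 = w * w * ((1 - eta) / 2 * ((4 * kap + 2) * (4 * kap + 2))).
    have -> : w * w * ((1 - eta) / 2 * ((4 * kap + 2) * (4 * kap + 2))) =
      (1 - eta) / 2 * (w * (4 * kap + 2)) * (w * (4 * kap + 2)) by ring.
    by rewrite wk !mulr1.
  rewrite mulrCA ler_pM2l ?mulr_gt0 //.
  (* After clearing denominators the inequality at [eta = 0] has slack [6 kap + 4], and this slack
     must absorb all terms in [eta]. *)
  have : eta * (16 * kap ^+ 2 + 32 * kap + 14) <= 6 * kap + 4.
    have : 16 * kap ^+ 2 + 32 * kap + 14 <= (25 * (192 * kap + 84)) * (6 * kap + 4).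
      have : 0 <= kap * kap by rewrite mulr_ge0; move: k1; lra.
      rewrite expr2; move: k1; lra.
    move=> h; have := ler_wpM2l e0 h.
    have k6 : 0 <= 6 * kap + 4 by move: k1; lra.
    have := ler_wpM2r k6 ek; lra.
  rewrite expr2; lra.
- have : eta * (8 * G) <= 1 / 1000 * (8 * G) by rewrite ler_wpM2r //; lra.
  lra.
Qed.

End constants.

(** * Inverses of band-limited operators *)

Section exponential.
Variable R : realType.

Lemma expR_series (x : R) : series (exp_coeff x) n @[n --> \oo] --> expR x.
Proof.
have -> : expR x = limn (series (exp_coeff x)) by rewrite expRE exp_coeffE /pseries.
exact: is_cvg_series_exp_coeff.
Qed.

Lemma exp_partial_le (x : R) n : 0 <= x -> \sum_(k < n) x ^+ k / k`!%:R <= expR x.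
Proof.
move=> x0; have h := @nondecreasing_cvgn_le R (series (exp_coeff x)).
have E : expR x = limn (series (exp_coeff x)) by apply/esym/cvg_lim => //; exact: expR_series.
rewrite E -(big_mkord xpredT (fun k => x ^+ k / k`!%:R)); apply: h.
  by apply/nondecreasing_seqP => m; rewrite /series /= big_nat_recr //= lerDl; exact: exp_coeff_ge0.
exact: is_cvg_series_exp_coeff.
Qed.

Lemma exp_mul_le (x a b : R) : (forall n, a * \sum_(k < n) x ^+ k / k`!%:R <= b) -> a * expR x <= b.
Proof.
move=> h; have cv : a * series (exp_coeff x) n @[n --> \oo] --> a * expR x.
  by apply: cvgMr; exact: expR_series.
apply: (ler_cvg_to cv (@cvg_cst _ b _ \oo _)); apply: nearW => n.
by have := h n; rewrite -(big_mkord xpredT (fun k => x ^+ k / k`!%:R)).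
Qed.

Lemma cauchy_sum_le (u v : nat -> R) K : (forall i, 0 <= u i) -> (forall i, 0 <= v i) ->
  \sum_(k < K) \sum_(i < k.+1) u i * v (k - i)%N <= (\sum_(i < K) u i) * \sum_(k < K) v k.
Proof.
move=> u0 v0; rewrite mulr_suml.
have -> : \sum_(k < K) \sum_(i < k.+1) u i * v (k - i)%N =
    \sum_(k < K) \sum_(i < K) if (i <= k)%N then u i * v (k - i)%N else 0.
  apply: eq_bigr => k _.
  rewrite -(big_mkord xpredT (fun i => u i * v (k - i)%N)).
  rewrite -(big_mkord xpredT (fun i => if (i <= k)%N then u i * v (k - i)%N else 0)).
  rewrite (big_cat_nat (leq0n k.+1) (ltn_ord k)) /= [X in _ + X]big_nat_cond [X in _ + X]big1 ?addr0.
    by apply: eq_big_nat => i /andP[_]; rewrite ltnS => ->.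
  by move=> i /andP[/andP[ki _] _]; rewrite leqNgt ki.
rewrite exchange_big /=; apply: ler_sum => i _; rewrite mulr_sumr.
have iK : (i <= K)%N by exact: ltnW.
rewrite -(big_mkord xpredT (fun k => if (i <= k)%N then u i * v (k - i)%N else 0)).
rewrite -(big_mkord xpredT (fun k => u i * v k)).
rewrite (big_cat_nat (leq0n i) iK) /= big_nat_cond big1 ?add0r; last first.
  by move=> k /andP[/andP[_ ki] _]; rewrite leqNgt ki.
rewrite -{1}[nat_of_ord i]add0n big_addn (big_cat_nat (leq0n (K - i)) (leq_subr _ _)) /=.
rewrite -[leLHS]addr0 lerD //; last by apply: sumr_ge0 => k _; rewrite mulr_ge0.
by apply: ler_sum => k _; rewrite leq_addl addnK.
Qed.

End exponential.

(** * Change of scale *)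

Section scales.
Variables (R : realType) (d : nat) (E : bmod R d).
Implicit Types x : E.

Lemma fi_refine (N M : nat) x (n : d.-tuple int) : (0 < N)%N -> (0 < M)%N ->
  exists t : seq (d.-tuple int), [/\ uniq t,
    (forall m, m \in t -> forall k, (absz (N%:Z * tnth n k - M%:Z * tnth m k)%R < N + M)%N) &
    nm (fi N%:R n x) <= \sum_(m <- t) nm (fi M%:R m x)].
Proof.
move=> N0 M0; have n0 : 0 < N%:R :> R by rewrite ltr0n.
have m0 : 0 < M%:R :> R by rewrite ltr0n.
have [t [ut ht le]] := @nm_refine R d E (cel N%:R (fun=> 0) n) M%:R (fun=> 0)
  (fun k => 0 + N%:R * (tnth n k)%:~R) (fun=> N%:R) x (sym_tri _ (fun=> n0)) m0
  (fun l => cel_neq0 n0 (l := l)).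
exists t; split => // m mt k; have := ht m mt k; rewrite !add0r.
by rewrite !pmulrn -!intrM -intrB -intrD normr_intr pmulrn ltr_int ltz_nat.
Qed.

(** A unit cell [n] involves only cells [m] of scale [N] with [|n - N m|_oo <= N], and each [m]
    serves at most [(2 N + 1)^d] unit cells. *)
Lemma scale_change (N : nat) C x : (0 < N)%N -> sumle (fun n => nm (fi N%:R n x)) C ->
  sumle (fun n => nm (fi 1 n x)) (((2 * N + 1) ^ d)%:R * C).
Proof.
move=> N0 hC; apply: (sumle_cover (cond := fun n m => forall k, (absz (tnth n k - N%:Z * tnth m k)%R <= N)%N) _ hC).
- by move=> m; exact: nm_ge0.
- move=> n; have [t [ut ht le]] := fi_refine x n (ltn0Sn 0) N0.
  by exists t; split => // m mt k; have := ht m mt k; rewrite mul1r add1n ltnS.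
- move=> m u uu hu; rewrite addn1; apply: (box_count (lo := fun k => N%:Z * tnth m k - N%:Z)) => // n nu k.
  exact: (absz_box (hu n nu k)).
Qed.

Lemma sumle_tail (a : d.-tuple int -> R) C : (forall n, 0 <= a n) -> sumle a C -> forall e, 0 < e ->
  exists m, forall t, uniq t -> (forall n, n \in t -> n \notin ibox d m) -> \sum_(n <- t) a n <= e.
Proof.
move=> a0 hC e e0.
pose S := [set \sum_(n <- t) a n | t in [set t : seq (d.-tuple int) | uniq t]].
have hS : has_sup S.
  split; first by exists (\sum_(n <- [::]) a n); exists [::].
  by exists C => _ [t /= ut <-]; exact: hC.
have [_ [s /= us <-] hs] := sup_adherent e0 hS.
pose m := \max_(n <- s) inorm n.
exists m => t ut ht.
have st : uniq (s ++ t).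
  rewrite cat_uniq us ut andbT /=; apply/hasPn => n nt; apply/negP => ns.
  have /negP := ht n nt; apply; apply/mem_ibox => k.
  apply: (@leq_trans (inorm n)); first exact: (leq_bigmax k).
  by rewrite /m (big_rem n ns) /= leq_maxl.
have : \sum_(n <- s ++ t) a n <= sup S by apply: sup_upper_bound => //; exists (s ++ t).
by rewrite big_cat /=; move: hs; lra.
Qed.

Lemma ibox_notin m (n : d.-tuple int) : n \notin ibox d m -> exists k, (m < absz (tnth n k))%N.
Proof.
move=> h; apply: contrapT => /forallNP h'; move/negP: h; apply; apply/mem_ibox => k.
by rewrite leqNgt; apply/negP => /h'.
Qed.

Lemma cover_count (K : nat) (c a : int) : (0 < K)%N -> (absz (K%:Z * a - c)%R <= K)%N ->
  ((c %/ K%:Z)%Z - 1 <= a < (c %/ K%:Z)%Z - 1 + 3%:Z)%R.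
Proof.
move=> K0 h; have := divz_eq c K%:Z; have := modz_ge0 c (_ : K%:Z != 0); have := ltz_pmod c (_ : 0 < K%:Z).
move: (c %/ K)%Z (c %% K)%Z => q r /(_ _)/wrap[|]; first by lia.
move=> rK /(_ _)/wrap[|]; first by lia.
move=> r0 cE; apply/andP; split; nia.
Qed.

Definition core2 (K : nat) x : E := \sum_(k <- ibox d 2) fi K%:R k x.

Lemma nm_fi_core2 (K : nat) (n : d.-tuple int) x : (0 < K)%N ->
  nm (fi K%:R n (x - core2 K x)) <= (1 + (size (ibox d 2))%:R) * nm (fi K%:R n x).
Proof.
move=> K0; have k0 : 0 < K%:R :> R by rewrite ltr0n.
have hs m : issym (cel K%:R (fun=> 0) m : d.-tuple R -> R[i]) by exact: issym_cel.
rewrite /core2 /fi multBr // mult_sumr //; apply: le_trans (nmB _ _) _.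
rewrite mulrDl mul1r lerD2l; apply: le_trans (nm_sum _ _ _) _.
rewrite -sum1_size natr_sum mulr_suml; apply: ler_sum => k _; rewrite mul1r multCr //.
exact: nm_cel.
Qed.

(** For [|n|_oo <= 1] the cell is supported in [|l|_oo <= 2 K], where the tents with [|k|_oo <= 2]
    already sum to one. *)
Lemma fi_core2_0 (K : nat) (n : d.-tuple int) x : (0 < K)%N -> n \in ibox d 1 ->
  fi K%:R n (x - core2 K x) = 0.
Proof.
move=> K0 /mem_ibox hn; have k0 : 0 < K%:R :> R by rewrite ltr0n.
have hs m : issym (cel K%:R (fun=> 0) m : d.-tuple R -> R[i]) by exact: issym_cel.
rewrite /core2 /fi multBr // mult_sumr //; apply/eqP; rewrite subr_eq0; apply/eqP.
under eq_bigr => k _ do rewrite -multMl // -[mult _ x]scale1r.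
rewrite -mult_sym_sum; last by move=> k; exact: issymM.
apply: mult_eq => l; under eq_bigr do rewrite mul1r; rewrite -mulr_sumr.
have [->|cl] := eqVneq (cel K%:R (fun=> 0) n l) 0; first by rewrite mul0r.
rewrite (cel_unity (m := 2)) ?mulr1 ?ibox_uniq // => k; rewrite subr0.
have := cel_neq0 k0 cl k; rewrite add0r => h.
rewrite -(subrK (K%:R * (tnth n k)%:~R) (tnth l k)); apply: le_trans (ler_normD _ _) _.
have : `|K%:R * (tnth n k)%:~R| <= K%:R :> R.
  by rewrite normrM normr_intr ger0_norm // ler_piMr // lern1 hn.
by move: h; lra.
Qed.

(** Makes the set that defines [psi_A] nonempty. Cells with [|n|_oo <= 1] are cancelled by [core2];
    the remaining ones are covered by unit cells far from the origin, each used at most [3 ^ d]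
    times, so a tail of the convergent unit-scale sum controls them. *)
Lemma core2_small C x : sumle (fun n => nm (fi 1 n x)) C -> forall e, 0 < e ->
  exists2 K, (0 < K)%N & sumle (fun n => nm (fi K%:R n (x - core2 K x))) e.
Proof.
move=> hC e e0; pose W : R := 1 + (size (ibox d 2))%:R.
have W0 : 0 < W by rewrite ltr_pwDl.
have D0 : 0 < W * (3 ^ d)%:R by rewrite mulr_gt0 // ltr0n expn_gt0.
have [m hm] := sumle_tail (fun n => nm_ge0 (fi 1 n x)) hC (divr_gt0 e0 D0).
(* If [|n_i| >= 2], the unit cells [k] that cover cell [n] of scale [m + 1] have [|k_i| >= m + 1],
   hence lie outside [ibox m]. *)
exists m.+1 => //.
pose b n := if n \in ibox d m then 0 else nm (fi 1 n x).
have b0 n : 0 <= b n by rewrite /b; case: ifP => // _; exact: nm_ge0.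
have hb : sumle b (e / (W * (3 ^ d)%:R)).
  move=> t ut; rewrite (bigID (mem (ibox d m))) /= big1 ?add0r => [|n]; last by rewrite /b => ->.
  rewrite -big_filter; apply: le_trans (hm [seq n <- t | n \notin ibox d m] _ _).
  - by rewrite !big_seq; apply: ler_sum => n; rewrite mem_filter /b => /andP[/negbTE -> _].
  - exact: filter_uniq.
  - by move=> n; rewrite mem_filter => /andP[].
pose a n := if n \in ibox d 1 then 0 else nm (fi m.+1%:R n x).
have ha : sumle a ((3 ^ d)%:R * (e / (W * (3 ^ d)%:R))).
  apply: (sumle_cover (cond := fun n k => forall i, (absz (m.+1%:Z * tnth n i - tnth k i)%R <= m.+1)%N) b0 hb).
    move=> n; rewrite /a; case: ifPn => [_|/ibox_notin[i hi]]; first by exists [::]; rewrite big_nil.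
    have [t [ut ht le]] := fi_refine x n (ltn0Sn m) (ltn0Sn 0).
    exists t; split => //.
      by move=> k kt j; have := ht k kt j; rewrite mul1r addn1 ltnS.
    apply: le_trans le _; rewrite !big_seq; apply: ler_sum => k kt; rewrite /b ifF //.
    apply/negP => /mem_ibox/(_ i) ki; have := ht k kt i; rewrite mul1r addn1 ltnS.
    by move: hi ki; move: (tnth n i) (tnth k i) => p q; nia.
  move=> k s us hsn; apply: (box_count (lo := fun i => (tnth k i %/ m.+1%:Z)%Z - 1)) => // n ns i.
  by apply: cover_count => //; exact: hsn.
move=> t ut; apply: (@le_trans _ _ (W * \sum_(n <- t) a n)).
  rewrite mulr_sumr; apply: ler_sum => n _; rewrite /a; case: ifPn => nb.
    by rewrite fi_core2_0 // nm0 mulr0.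
  exact: nm_fi_core2.
apply: le_trans (ler_wpM2l (ltW W0) (ha t ut)) _.
rewrite le_eqVlt; apply/orP; left; apply/eqP; field.
by rewrite gt_eqF //= gt_eqF // ltr0n expn_gt0.
Qed.

End scales.

(** * Taylor coefficients and decay of the inverse *)

Section inverse.
Variables (R : realType) (d : nat) (EXY EYX EYY : bmod R d).
Variables (c1 : EXY -> EYX -> EYY) (c2 : EYX -> EYY -> EYX) (one : EYY).
Hypotheses (Hc1 : bcomp c1) (Hc2 : bcomp c2).
Hypothesis c2A : forall b a b' s, c2 (c2 b (c1 a b')) s = c2 b (c1 a (c2 b' s)).

Section inverse_pair.
Variables (a : EXY) (b : EYX).
Hypothesis ab : c1 a b = one.
Hypothesis trba : forall j t z, c2 (tr j t b) (c1 (tr j t a) z) = z.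
Hypothesis trb_one : forall j t, c2 (tr j t b) one = tr j t b.

(** The translated inverse relation [trba] gives [tr b - b = - tr b (tr a - a) b], from which the
    derivative and its quadratic remainder are read off. *)
Lemma der_inv j a' : der j a a' -> der j b (- c2 b (c1 a' b)).
Proof.
move=> [C C0 hC]; pose nb := nm b.
have nb0 : 0 <= nb by exact: nm_ge0.
exists (nb * (C * nb) + nb * ((C + nm a') * nb) * (nm a' * nb)).
  by rewrite !(addr_ge0, mulr_ge0) ?nm_ge0.
move=> t t01; have /andP[t0 t1] := t01.
set Tb := tr j t b; set Ta := tr j t a.
have nTb : nm Tb = nb by exact: nm_tr.
have E1 z : c2 Tb (c1 (Ta - a) z) = z - c2 Tb (c1 a z) by rewrite (compBl Hc1) (compBr Hc2) trba.
have E2 : Tb - b = - c2 Tb (c1 (Ta - a) b) by rewrite E1 ab trb_one opprB.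
have hd : nm (Ta - a) <= (C + nm a') * t.
  rewrite -(subrK ((t%:C)%C *: a') (Ta - a)); apply: le_trans (nmD _ _) _.
  rewrite nmZ cabs_real gtr0_norm // mulrDl (mulrC t) lerD2r.
  by apply: le_trans (hC _ t01) _; rewrite ler_wpM2l // expr2 ger_pMr.
have hTb : nm (Tb - b) <= nb * ((C + nm a') * nb) * t.
  rewrite E2 nmN; apply: le_trans (bc_nm Hc2 _ _) _; rewrite nTb -mulrA ler_wpM2l //.
  by apply: le_trans (bc_nm Hc1 _ _) _; rewrite mulrAC ler_wpM2r.
have -> : Tb - b - (t%:C)%C *: (- c2 b (c1 a' b)) =
    - c2 Tb (c1 (Ta - a - (t%:C)%C *: a') b) - (t%:C)%C *: c2 (Tb - b) (c1 a' b).
  rewrite {1}E2 scalerN opprK (compBl Hc1 (Ta - a)) (compBr Hc2) (compZl Hc1) (compZr Hc2) (compBl Hc2).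
  have D (p q r : EYX) : - p + q = - (p - r) - (r - q) by rewrite -opprD subrKA opprB addrC.
  by rewrite scalerBr; exact: D.
apply: le_trans (nmB _ _) _; rewrite nmN mulrDl lerD //.
  apply: le_trans (bc_nm Hc2 _ _) _; rewrite nTb -mulrA ler_wpM2l //.
  by apply: le_trans (bc_nm Hc1 _ _) _; rewrite mulrAC ler_wpM2r ?hC.
rewrite nmZ cabs_real gtr0_norm //.
apply: (@le_trans _ _ (t * ((nb * ((C + nm a') * nb) * t) * (nm a' * nb)))).
  rewrite ler_wpM2l ?(ltW t0) //; apply: le_trans (bc_nm Hc2 _ _) _.
  by apply: ler_pM; rewrite ?nm_ge0 //; exact: (bc_nm Hc1).
by rewrite le_eqVlt; apply/orP; left; apply/eqP; ring.
Qed.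

(** The recursion uses all earlier coefficients. The list keeps them in reverse order: entry [i] of
    the list for [k'] is the coefficient of index [k' - i]. *)
Fixpoint hist (A : nat -> EXY) k : seq EYX := if k is k'.+1 then
  (- c2 b (\sum_(i < k) c1 (A i.+1) (nth 0 (hist A k') i))) :: hist A k' else [:: b].

Lemma inv_rec (A : nat -> EXY) : exists f : nat -> EYX, f 0%N = b /\
  forall k, f k.+1 = - c2 b (\sum_(i < k.+1) c1 (A i.+1) (f (k - i)%N)).
Proof.
exists (fun k => head 0 (hist A k)); split => // k /=; congr (- c2 b _).
apply: eq_bigr => -[i /= ik] _; congr (c1 _ _).
elim: k i ik => [|k IH] [|i] //= ik.
by rewrite IH // subSS.
Qed.

(** Strong induction: the recursion expresses [f k.+1] through coefficients already differentiated,
    and the product rule together with the recursion at [k.+1] collects the result into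
    [k.+2 f k.+2]. *)
Lemma inv_tower j (A : nat -> EXY) (f : nat -> EYX) : A 0%N = a -> tower j 0 A -> f 0%N = b ->
  (forall k, f k.+1 = - c2 b (\sum_(i < k.+1) c1 (A i.+1) (f (k - i)%N))) -> tower j 0 f.
Proof.
move=> A0 hA f0 fS.
have hA' k : der j (A k) (k.+1%:R *: A k.+1).
  by have := hA k; rewrite [X in X *: _](_ : _ = 0) // scale0r add0r.
suff P k : der j (f k) (k.+1%:R *: f k.+1).
  by move=> k; rewrite [X in X *: _](_ : _ = 0) // scale0r add0r.
have f1 : f 1%N = - c2 b (c1 (A 1%N) b) by rewrite fS big_ord1 f0.
have db : der j b (f 1%N).
  by rewrite f1; apply: der_inv; have := hA' 0%N; rewrite scale1r A0.
elim/ltn_ind: k => -[_|k IH]; first by rewrite scale1r f0.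
pose S m := \sum_(i < m.+1) c1 (A i.+1) (f (m - i)%N).
(* The term subtracted here, composed with [b], cancels against the derivative of the outer factor
   [b]. *)
have dS : der j (S k) (k.+2%:R *: S k.+1 - c1 (A 1%N) (f k.+1)).
  have h i : (i < k.+1)%N -> der j (c1 (A i.+1) (f (k - i)%N))
      (c1 (i.+2%:R *: A i.+2) (f (k - i)%N) + c1 (A i.+1) ((k - i).+1%:R *: f (k - i).+1)).
    move=> ik; apply: (der_comp Hc1); first exact: hA'.
    by apply: IH; rewrite ltnS leq_subr.
  have := der_sum (x := fun i => c1 (A i.+1) (f (k - i)%N)) h; congr der.
  pose g i := c1 (A i.+1) (f (k.+1 - i)%N).
  under eq_bigr => i _.
    have ik : (i <= k)%N by rewrite -ltnS.
    rewrite (compZl Hc1) (compZr Hc1) -subSn // -[(k - i)%N]/(k.+1 - i.+1)%N -/(g i.+1) -/(g i).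
    rewrite -[i.+2%:R]natr1 scalerDl scale1r addrAC; over.
  rewrite big_split /= big_split /= (sum_shift k.+1 g) -[in RHS]natr1 scalerDl scale1r -addrA; congr (_ + _).
  by rewrite {1}/S -/(g 0%N) [in RHS]big_ord_recl /= addrAC subrr add0r.
have := derZ (-1) (der_comp Hc2 db dS).
rewrite scaleN1r -fS => h; have := h; congr der.
rewrite scaleN1r (compBr Hc2) (compZr Hc2) f1 (compNl Hc2) c2A.
have -> : c2 b (S k) = - f k.+1 by rewrite fS opprK.
have -> : c2 b (S k.+1) = - f k.+2 by rewrite fS opprK.
by rewrite (compNr Hc1) (compNr Hc2) opprK addrCA subrr addr0 scalerN opprK.
Qed.

(** Majorant argument: the partial sums satisfy [V_{K+1} <= ||b|| + theta V_K] with
    [theta <= 1 / 2], hence never exceed [2 ||b||]. *)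
Lemma inv_series (A : nat -> EXY) (f : nat -> EYX) (al r H : R) : 0 <= r -> 0 <= H ->
  (forall k, nm (A k) <= r ^+ k / k`!%:R * al) -> f 0%N = b ->
  (forall k, f k.+1 = - c2 b (\sum_(i < k.+1) c1 (A i.+1) (f (k - i)%N))) ->
  nm b * (al * (expR (r * H) - 1)) <= 1 / 2 ->
  forall K, \sum_(k < K) nm (f k) * H ^+ k <= 2 * nm b.
Proof.
move=> r0 H0 hA f0 fS th.
have al0 : 0 <= al.
  by have := hA 0%N; rewrite expr0 fact0 divr1 mul1r; apply: le_trans; exact: nm_ge0.
have nb0 := nm_ge0 b.
pose u i := nm (A i.+1) * H ^+ i.+1; pose v k := nm (f k) * H ^+ k.
have u0 i : 0 <= u i by rewrite mulr_ge0 ?nm_ge0 ?exprn_ge0.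
have v0 i : 0 <= v i by rewrite mulr_ge0 ?nm_ge0 ?exprn_ge0.
have us K : \sum_(i < K) u i <= al * (expR (r * H) - 1).
  have h := exp_partial_le K.+1 (mulr_ge0 r0 H0).
  rewrite big_ord_recl /= expr0 fact0 divr1 in h.
  apply: (@le_trans _ _ (al * \sum_(i < K) (r * H) ^+ i.+1 / i.+1`!%:R)).
    rewrite mulr_sumr; apply: ler_sum => i _; rewrite /u.
    apply: le_trans (ler_wpM2r (exprn_ge0 _ H0) (hA i.+1)) _.
    by rewrite exprMn le_eqVlt; apply/orP; left; apply/eqP; ring.
  by rewrite ler_wpM2l //; move: h; rewrite /bump /=; under eq_bigr do rewrite add1n; lra.
elim=> [|K IH]; first by rewrite big_ord0 mulr_ge0.
rewrite big_ord_recl expr0 mulr1 f0 /=.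
have step k : nm (f k.+1) * H ^+ k.+1 <= nm b * \sum_(i < k.+1) u i * v (k - i)%N.
  rewrite fS nmN; apply: (@le_trans _ _ (nm b * (\sum_(i < k.+1) nm (A i.+1) * nm (f (k - i)%N)) * H ^+ k.+1)).
    rewrite ler_wpM2r ?exprn_ge0 //; apply: le_trans (bc_nm Hc2 _ _) _; rewrite ler_wpM2l //.
    apply: le_trans (nm_sum _ _ _) _; apply: ler_sum => i _; exact: (bc_nm Hc1).
  rewrite -mulrA ler_wpM2l // mulr_suml; apply: ler_sum => -[i /= ik] _; rewrite /u /v.
  have -> : H ^+ k.+1 = H ^+ i.+1 * H ^+ (k - i) by rewrite -exprD addSn subnKC.
  by rewrite mulrACA.
have : \sum_(i < K) nm (f (bump 0 i)) * H ^+ bump 0 i <= nm b * (al * (expR (r * H) - 1)) * (2 * nm b).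
  apply: (@le_trans _ _ (nm b * \sum_(k < K) \sum_(i < k.+1) u i * v (k - i)%N)).
    by rewrite mulr_sumr; apply: ler_sum => k _; exact: step.
  rewrite -mulrA ler_wpM2l //; apply: le_trans (cauchy_sum_le K u0 v0) _.
  by apply: ler_pM; rewrite ?sumr_ge0.
have := ler_wpM2r (_ : 0 <= 2 * nm b) th; rewrite mulr_ge0 // => /(_ isT); lra.
Qed.

(* Compares the convergence of [sum_k nm (D_j^k b) H^k / k!] with [tower_lower] at the frequency
   [N n_j], for the coordinate [j] that realizes [inorm n]. *)
Lemma inverse_decay (N : nat) (H : R) (n : d.-tuple int) : (0 < d)%N -> (0 < N)%N -> 0 <= H ->
  (forall j, insp j 0 (3 * N%:R) a) -> nm b * (nm a * (expR (6 * N%:R * H) - 1)) <= 1 / 2 ->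
  nm (fi N%:R n b) <= 2 * nm b * expR (N%:R * H) ^+ 2 * (expR (N%:R * H))^-1 ^+ inorm n.
Proof.
move=> d0 N0 H0 ha th; have n0 : 0 < N%:R :> R by rewrite ltr0n.
set x := expR (N%:R * H); have x0 : 0 < x by exact: expR_gt0.
have x1 : 1 <= x by apply: le_trans (expR_ge1Dx _); rewrite lerDl mulr_ge0.
have nb0 := nm_ge0 b.
have c0 : (0 < #|'I_d|)%N by rewrite card_ord.
have [j jE] := @bigop.eq_bigmax _ (fun k : 'I_d => absz (tnth n k)) c0; rewrite -/(inorm n) in jE.
(* For [inorm n < 2] the factor [x ^ (2 - inorm n)] is at least 1 and the trivial bound suffices;
   otherwise [N (inorm n - 2)] is the distance that [tower_lower] asks to be nonnegative. *)
have [small|big] := ltnP (inorm n) 2.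
  apply: le_trans (nm_cel _ _ _ n0) _.
  have h : 1 <= x ^+ 2 * x^-1 ^+ inorm n.
    rewrite exprVn ler_pdivlMr ?exprn_gt0 // mul1r; apply: ler_weXn2l => //; exact: ltnW.
  have := ler_wpM2l nb0 h; rewrite mulr1 => h'; apply: le_trans h' _.
  have -> : 2 * nm b * x ^+ 2 * x^-1 ^+ inorm n = 2 * (nm b * (x ^+ 2 * x^-1 ^+ inorm n)) by ring.
  by have := mulr_ge0 nb0 (le_trans ler01 h); lra.
have r30 : 0 < 3 * N%:R :> R by lra.
have [A [A0 hA Ab]] := insp_tower r30 (ha j).
have [f [f0 fS]] := inv_rec A.
have ft := inv_tower A0 hA f0 fS.
have r60 : 0 <= 2 * (3 * N%:R) :> R by lra.
have th' : nm b * (nm a * (expR (2 * (3 * N%:R) * H) - 1)) <= 1 / 2.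
  by have -> : 2 * (3 * N%:R) * H = 6 * N%:R * H by ring.
have ser := inv_series r60 H0 Ab f0 fS th'.
have hs : sym (cel (N%:R : R) (fun=> 0) n) 1 by apply: sym_tri => k.
have [S S0 sS] := insupp_tri (fun k => 0 + N%:R * (tnth n k)%:~R) (fun _ : 'I_d => n0).
have sc (l : d.-tuple R) : cel (N%:R : R) (fun=> 0) n l != 0 -> `|tnth l j - N%:R * (tnth n j)%:~R| <= N%:R.
  by move=> /(cel_neq0 n0)/(_ j)/ltW; rewrite add0r.
have gE : `|N%:R * (tnth n j)%:~R - 0| - 2 * N%:R = N%:R * (inorm n - 2)%:R :> R.
  by rewrite subr0 normrM normr_intr -jE ger0_norm // natrB //; ring.
have low := tower_lower n0 S0 (sym_issym hs) sS sc ft; rewrite gE in low.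
have {}low := low (mulr_ge0 (ltW n0) (ler0n _ _)).
have key : nm (fi N%:R n b) * expR (N%:R * (inorm n - 2)%:R * H) <= 2 * nm b.
  apply: exp_mul_le => K; apply: le_trans (ser K); rewrite mulr_sumr; apply: ler_sum => k _.
  have h2 : nm (mult (cel (N%:R : R) (fun=> 0) n) (f k)) <= nm (f k).
    by rewrite -[leRHS]mul1r; exact: nm_mult.
  have h1 := low k; rewrite f0 in h1.
  have -> : nm (fi N%:R n b) * ((N%:R * (inorm n - 2)%:R * H) ^+ k / k`!%:R) =
      (N%:R * (inorm n - 2)%:R) ^+ k / k`!%:R * nm (fi N%:R n b) * H ^+ k.
    by rewrite [(_ * H) ^+ k]exprMn; ring.
  by rewrite ler_wpM2r ?exprn_ge0 //; exact: le_trans h1 h2.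
have -> : 2 * nm b * x ^+ 2 * x^-1 ^+ inorm n = 2 * nm b * (x ^+ (inorm n - 2))^-1.
  have xe : x ^+ inorm n = x ^+ (inorm n - 2) * x ^+ 2 by rewrite -exprD subnK.
  have y0 : x ^+ (inorm n - 2) != 0 by rewrite expf_neq0 // gt_eqF.
  rewrite exprVn xe; move: y0; set y := x ^+ (_ - _) => y0.
  by field; rewrite y0 gt_eqF.
rewrite ler_pdivlMr ?exprn_gt0 //.
have <- : expR (N%:R * (inorm n - 2)%:R * H) = x ^+ (inorm n - 2).
  by rewrite /x -expRM_natl; congr expR; ring.
exact: key.
Qed.

End inverse_pair.

(* Neumann series [B = sum_j (- b e)^j b] of the perturbed inverse, estimated termwise in the
   weighted lattice sums. *)
Lemma perturb_sum (e : EXY) (B b : EYX) (N be s : R) : 0 < N -> B = b - c2 b (c1 e B) ->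
  sumle (fun n => nm (fi N n b)) be -> sumle (fun n => nm (fi N n e)) s ->
  (5 ^+ d) ^+ 2 * (s * be) <= 1 / 2 -> sumle (fun n => nm (fi N n B)) (2 * be).
Proof.
move=> N0 BE hb he small.
have be0 := sumle_ge0 hb; have s0 := sumle_ge0 he.
have p5 : 1 <= (5 ^+ d) ^+ 2 :> R by rewrite -exprM exprn_ege1 //; lra.
pose L z := - c2 b (c1 e z).
have Lsum z C : sumle (fun n => nm (fi N n z)) C -> sumle (fun n => nm (fi N n (L z))) (C / 2).
  move=> hz; have C0 := sumle_ge0 hz.
  have h := sumle_comp Hc2 N0 (sumle_comp Hc1 N0 hz he) hb.
  move=> t ut; have := h t ut; rewrite /L /fi.
  under eq_bigr => n _.
    rewrite -nmN -scaleN1r -multZr; last exact: issym_cel.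
    rewrite scaleN1r; over.
  move=> h'; apply: le_trans h' _.
  have := ler_wpM2r C0 small; rewrite expr2; lra.
have Lnm z : nm (L z) <= nm z / 2.
  rewrite /L nmN; apply: le_trans (bc_nm Hc2 _ _) _.
  apply: (@le_trans _ _ (be * (s * nm z))).
    apply: ler_pM; rewrite ?nm_ge0 //; first exact: nm_le_sumle hb.
    by apply: le_trans (bc_nm Hc1 _ _) _; rewrite ler_wpM2r ?nm_ge0 //; exact: nm_le_sumle he.
  have sb : s * be <= 1 / 2.
    apply: le_trans small; rewrite ler_peMl // mulr_ge0 //.
  have := ler_wpM2r (nm_ge0 z) sb; lra.
have LD z w : L (z + w) = L z + L w by rewrite /L (compDr Hc1) (compDr Hc2) opprD.
(* [P k] is a term of the series and [Q k] its remainder. The remainder is controlled in the plain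
   norm only, which suffices on a finite set of cells. *)
pose P k := iter k L b; pose Q k := iter k L B.
have Bsum k : B = \sum_(i < k) P i + Q k.
  elim: k => [|k IH]; first by rewrite big_ord0 add0r.
  rewrite big_ord_recr /= -addrA {1}IH; congr (_ + _).
  elim: (k) => [|m IHm] /=; first by rewrite {1}BE.
  by rewrite {1}IHm LD.
have Ps k : sumle (fun n => nm (fi N n (P k))) (be / 2 ^+ k).
  elim: k => [|k IH]; first by rewrite expr0 divr1.
  by have := Lsum _ _ IH; rewrite exprSr invfM mulrA.
have Qn k : nm (Q k) <= nm B / 2 ^+ k.
  elim: k => [|k IH]; first by rewrite expr0 divr1.
  apply: le_trans (Lnm _) _; rewrite exprSr invfM mulrA ler_wpM2r //.
have geo k : \sum_(i < k) be / 2 ^+ i <= 2 * be.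
  have -> : \sum_(i < k) be / 2 ^+ i = 2 * be * (1 - (2 ^+ k)^-1).
    elim: k => [|k IH]; first by rewrite big_ord0 expr0 invr1 subrr mulr0.
    rewrite big_ord_recr /= IH exprS invfM; field.
    by rewrite expf_neq0.
  have : 0 <= (2 ^+ k)^-1 :> R by rewrite invr_ge0 exprn_ge0.
  by move=> h; have := mulr_ge0 be0 h; lra.
move=> t ut; apply/ler_addgt0Pr => eps eps0.
pose K := (size t)%:R * nm B.
have K0 : 0 <= K by rewrite mulr_ge0 ?nm_ge0.
pose k := Num.bound (K / eps).
have kb : K / 2 ^+ k <= eps.
  rewrite ler_pdivrMr ?exprn_gt0 // mulrC -ler_pdivrMr //.
  apply: le_trans (ltW (archi_boundP (divr_ge0 K0 (ltW eps0)))) _.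
  by rewrite -natrX ler_nat ltnW // ltn_expl.
apply: (@le_trans _ _ (\sum_(n <- t) (\sum_(i < k) nm (fi N n (P i)) + nm B / 2 ^+ k))).
  apply: ler_sum => n _; rewrite {1}(Bsum k) /fi multDr ?mult_sumr; [|exact: issym_cel..].
  apply: le_trans (nmD _ _) _; rewrite lerD ?nm_sum //.
  by apply: le_trans (nm_cel _ _ _ N0) (Qn k).
rewrite big_split /= exchange_big /= lerD //.
  by apply: le_trans (geo k); apply: ler_sum => i _; exact: Ps.
by rewrite big_const_seq count_predT iter_addr addr0 -[leLHS]mulr_natl mulrA.
Qed.

End inverse.

(** * Lattice sums and integrals *)

Section modulus.
Variables (R : realType) (d : nat).
Local Notation mu := (Rd_measure R d).

(** The square of the left side is [2 (1 - cos v)], and [1 - cos v <= v^2 / 2] is the bound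
    [fejz <= 1 / 2]. *)
Lemma cabs_expi1 (v : R) : cabs (expi v - 1) <= `|v|.
Proof.
have h : 1 - cos v <= v ^+ 2 / 2.
  have [->|v0] := eqVneq v 0; first by rewrite cos0 subrr expr0n mul0r.
  have := fejz_le v; rewrite /fejz (negbTE v0) ler_pdivrMr; first by rewrite mulrC mulrA mulr1.
  by rewrite exprn_even_gt0 //= v0.
rewrite /cabs /= -[leRHS]sqrtr_sqr ler_sqrt ?sqr_ge0 // subr0.
have := cos2Dsin2 v; rewrite !expr2 in h *; lra.
Qed.

Let F (a : d.-tuple R) : d.-tuple R -> R[i] := tens (fun k => fejk 1 (tnth a k)).

Let F0 t : R := cabs (F (tzero R d) t).

Let FE a t : F a t = F (tzero R d) t * expi (tdot t a).
Proof.
rewrite /F /tens /tdot expi_sum -big_split /=; apply: eq_bigr => k _.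
by rewrite /fejk tnth_mktuple mulr0 expi0 mulr1.
Qed.

Let hF a : kern (F a) (tri (fun=> 1) (tnth a)).
Proof. by have [] := kern_tri (tnth a) (fun _ : 'I_d => @ltr01 R). Qed.

Let mF0 : measurable_fun setT F0.
Proof. by have [/L1P[h _] _ _] := hF (tzero R d); exact: cmeas_cabs. Qed.

(** Bounds the difference of two modulated kernels whose centres are within [1 / n.+1] in each
    coordinate: [2] by the triangle inequality, the other term by the phase difference. *)
Let om n t : R := F0 t * Num.min 2 ((\sum_(k < d) `|tnth t k|) / n.+1%:R).

Let S_ge0 (t : d.-tuple R) : 0 <= \sum_(k < d) `|tnth t k|. Proof. exact: sumr_ge0. Qed.

Let om_ge0 n t : 0 <= om n t.
Proof. by rewrite mulr_ge0 ?cabs_ge0 // le_min ler0n divr_ge0. Qed.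

Let om_le n t : om n t <= 2 * F0 t.
Proof. by rewrite /om mulrC ler_wpM2r ?cabs_ge0 // ge_min lexx. Qed.

Let mom n : measurable_fun setT (om n).
Proof.
apply: measurable_funM => //; apply: measurable_minr => //; apply: measurable_funM => //.
by apply: measurable_sum => k; apply: measurableT_comp => //; exact: measurable_tnth.
Qed.

Let F0_lty : (\int[mu]_t (2 * F0 t)%:E < +oo)%E.
Proof.
have [/L1P[h hl] _ _] := hF (tzero R d).
under eq_integral do rewrite EFinM.
rewrite ge0_integralZl // ?lte_mul_pinfty //; first exact: cmeas_cabsE.
by move=> t _; rewrite lee_fin cabs_ge0.
Qed.

Let om_cvg : (\int[mu]_t (om n t)%:E)%E @[n --> \oo] --> 0%E.
Proof.
have mo n : measurable_fun setT (EFin \o om n) by apply/measurable_EFinP.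
have cv : {ae mu, forall t, setT t -> (EFin \o om n) t @[n --> \oo] --> (cst 0%E : d.-tuple R -> \bar R) t}.
  apply: aeW => t _; apply: cvg_EFin; first exact: nearW.
  rewrite -[X in _ --> X](mulr0 (F0 t)); apply: cvgMr.
  have h0 : (\sum_(k < d) `|tnth t k|) * (n.+1%:R)^-1 @[n --> \oo] --> (0 : R).
    by rewrite -[X in _ --> X](mulr0 (\sum_(k < d) `|tnth t k|)); apply: cvgMr; exact: cvg_harmonic.
  apply: (squeeze_cvgr _ (@cvg_cst _ (0 : R) _ \oo _) h0).
  by apply: nearW => n; rewrite le_min ler0n divr_ge0 //= ge_min lexx orbT.
have i2 : mu.-integrable setT (fun t => (2 * F0 t)%:E).
  apply/integrableP; split; first by apply/measurable_EFinP; exact: measurable_funM.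
  by under eq_integral do rewrite gee0_abs ?lee_fin ?mulr_ge0 ?cabs_ge0 //.
have dom : {ae mu, forall t n, setT t -> (`|(EFin \o om n) t| <= (2 * F0 t)%:E)%E}.
  by apply: aeW => t n _; rewrite gee0_abs ?lee_fin ?om_ge0 ?om_le.
have [_ _ H] := dominated_convergence measurableT mo (measurable_cst _) cv i2 dom.
by rewrite integral0 in H.
Qed.

(** Kernels with different centres differ by a modulation only, so dominated convergence gives a
    modulus of continuity that is uniform in the centre. *)
Lemma tri_modulus : exists2 w : nat -> R, w n @[n --> \oo] --> 0 &
  forall n (a b : d.-tuple R), (forall k, `|tnth a k - tnth b k| <= n.+1%:R^-1) ->
    sym (fun l => tri (fun=> 1) (tnth a) l - tri (fun=> 1) (tnth b) l) (w n).
Proof.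
have omi n : (\int[mu]_t (om n t)%:E)%E \is a fin_num.
  rewrite ge0_fin_numE; last by apply: integral_ge0 => t _; rewrite lee_fin.
  apply: le_lt_trans F0_lty; apply: ge0_le_integral => //.
  - by move=> t _; rewrite lee_fin.
  - exact/measurable_EFinP.
  - by apply/measurable_EFinP; exact: measurable_funM.
  - by move=> t _; rewrite lee_fin.
exists (fun n => fine (\int[mu]_t (om n t)%:E)).
  by rewrite -[X in _ --> X]/(fine 0%E); apply: fine_cvg; exact: om_cvg.
move=> n a b ab; have kl := kern_lin (-1) (hF b) (hF a).
exists (fun t => -1 * F b t + F a t).
  by have := kl; congr kern; apply/funext => l; rewrite mulN1r addrC.
have [L _ _] := kl.
rewrite -lee_fin (fineK (omi n)) (L1normE L); apply: ge0_le_integral => //.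
- by move=> t _; rewrite lee_fin cabs_ge0.
- by have /L1P[h _] := L; exact: cmeas_cabsE.
- exact/measurable_EFinP.
move=> t _; rewrite lee_fin /om FE (FE a) mulN1r addrC -mulrBr cabsM ler_wpM2l ?cabs_ge0 //.
rewrite le_min; apply/andP; split.
  apply: le_trans (cabsD _ _) _; rewrite cabsN !cabs_expi; lra.
have -> : expi (tdot t a) - expi (tdot t b) = expi (tdot t b) * (expi (tdot t a - tdot t b) - 1).
  by rewrite mulrBr mulr1 -expiD addrCA subrr addr0.
rewrite cabsM cabs_expi mul1r; apply: le_trans (cabs_expi1 _) _.
rewrite /tdot -sumrB mulr_suml; apply: le_trans (ler_norm_sum _ _ _) _; apply: ler_sum => k _.
by rewrite -mulrBr normrM ler_wpM2l.
Qed.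

Lemma measurable_comp_countable (G : d.-tuple int -> R) (f : d.-tuple R -> d.-tuple int) :
  (forall m, measurable (f @^-1` [set m])) -> measurable_fun setT (fun t => G (f t)).
Proof.
move=> mf _ B mB; rewrite setTI.
rewrite (_ : _ @^-1` _ = \bigcup_i (if pickle_inv i is Some m then
    (if G m \in B then f @^-1` [set m] else set0) else set0)).
  apply: bigcup_measurable => i _; case: pickle_inv => [m|]; last exact: measurable0.
  by case: ifP => _; [exact: mf|exact: measurable0].
apply/seteqP; split => t /=.
  move=> tB; exists (pickle (f t)) => //; rewrite pickleK_inv.
  by rewrite (_ : G (f t) \in B) // inE.
by move=> [i _]; case: pickle_inv => [m|] //; case: ifP => //; rewrite inE => h /= ->.
Qed.

Variable E : bmod R d.

Definition gabor (x : E) (a : d.-tuple R) : R := nm (mult (tri (fun=> 1) (tnth a)) x).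

Lemma gabor_ge0 x a : 0 <= gabor x a. Proof. exact: nm_ge0. Qed.

(** [gabor x] is a limit of functions that are constant on the cells of grids of mesh [1 / n.+1], by
    the modulus of [tri_modulus]. *)
Lemma measurable_gabor x : measurable_fun setT (gabor x).
Proof.
have [w w0 hw] := tri_modulus.
pose fl n (t : d.-tuple R) : d.-tuple int := [tuple Num.floor (n.+1%:R * tnth t k) | k < d].
pose bk n (m : d.-tuple int) : d.-tuple R := [tuple (tnth m k)%:~R / n.+1%:R | k < d].
have n0 n : 0 < n.+1%:R :> R by rewrite ltr0n.
have near n t k : `|tnth (bk n (fl n t)) k - tnth t k| <= n.+1%:R^-1.
  rewrite !tnth_mktuple; set y := tnth t k.
  have h1 := Num.Theory.floor_le (n.+1%:R * y); have h2 := Num.Theory.floorD1_gt (n.+1%:R * y).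
  set z := (Num.floor _)%:~R in h1 h2 *.
  have -> : z / n.+1%:R - y = (z - n.+1%:R * y) / n.+1%:R by field; rewrite gt_eqF.
  rewrite normrM normfV (gtr0_norm (n0 n)) ler_pdivrMr // mulVf ?gt_eqF // ler_norml.
  by move: h1 h2; rewrite intrD -/z; lra.
apply: (@measurable_fun_cvg _ _ _ _ (fun n t => gabor x (bk n (fl n t)))).
  move=> n; apply: (measurable_comp_countable (fun m => gabor x (bk n m))) => m.
  rewrite (_ : _ @^-1` _ = \bigcap_(k in [set: 'I_d]) ((fun t => tnth t k) @^-1`
      `[(tnth m k)%:~R / n.+1%:R, (tnth m k + 1)%:~R / n.+1%:R[%classic)).
    apply: fin_bigcap_measurable => // k _.
    by rewrite -[X in measurable X]setTI; apply: measurable_tnth.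
  apply/seteqP; split => t /=.
    move=> <- k _ /=; rewrite in_itv /= tnth_mktuple ler_pdivrMr // ltr_pdivlMr // mulrC.
    by rewrite Num.Theory.floor_le Num.Theory.floorD1_gt.
  move=> h; apply: eq_from_tnth => k; rewrite tnth_mktuple; apply: Num.Theory.floor_def.
  by have := h k I; rewrite /= in_itv /= ler_pdivrMr // ltr_pdivlMr // mulrC.
move=> t _.
have b n : `|gabor x t - gabor x (bk n (fl n t))| <= w n * nm x.
  have hs := hw n _ _ (near n t).
  have := nm_mult x hs; rewrite mult_symB; [|exact: sym_issym (sym_tri _ (fun=> @ltr01 R))..].
  apply: le_trans; rewrite /gabor; set p := mult _ x; set q := mult _ x.
  rewrite distrC ler_norml; apply/andP; split.
    rewrite lerNl opprB lerBlDr -{1}(subrK q p); apply: le_trans (nmD _ _) _.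
    by rewrite -(nmN (p - q)) opprB.
  by rewrite lerBlDr -{1}(subrK p q); exact: nmD.
apply/cvgrPdist_le => e e0.
have cw : w n * nm x @[n --> \oo] --> 0 by rewrite -(mul0r (nm x)); apply: cvgMl.
have /cvgrPdist_le/(_ e e0) := cw; apply: filterS => n; rewrite sub0r normrN => h.
by apply: le_trans (b n) _; apply: le_trans h; exact: ler_norm.
Qed.

Lemma gaborE x : intRd (fun a => (gabor x a)%:E) = (\int[mu]_a (gabor x a)%:E)%E.
Proof.
apply: ge0_intRdE; first by apply/measurable_EFinP; exact: measurable_gabor.
by move=> a; rewrite lee_fin gabor_ge0.
Qed.

End modulus.

(** * Equivalence of the integral norm and the unit-scale lattice norm *)

Section integral_lattice.
Variables (R : realType) (d : nat) (E : bmod R d).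
Local Notation mu := (Rd_measure R d).
Implicit Types (x : E) (m n : d.-tuple int).

Lemma int_hbox (a b : 'I_d -> R) :
  (\int[mu]_t (\1_(hbox a b) t)%:E = (\prod_(k < d) Num.max (b k - a k) 0)%:E)%E.
Proof.
have := @int_tens R d (fun k y => ((oc_ind (a k) (b k) y)%:C)%C) (fun k => (cintegrable_oc_ind (a k) (b k)).1).
rewrite tens_hbox; under eq_integral do rewrite cabs_cind.
move=> ->; rewrite -prodEFin; apply: eq_bigr => k _; rewrite -int_oc_ind.
by apply: eq_integral => t _; rewrite cabs_real ger0_norm //; case/andP: (oc_ind01 (a k) (b k) t).
Qed.

Definition ucube m : set (d.-tuple R) := hbox (fun k => (tnth m k)%:~R) (fun k => (tnth m k)%:~R + 1).

Lemma ucube_disj m n t : ucube m t -> ucube n t -> m = n.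
Proof.
move=> hm hn; apply: eq_from_tnth => k; have /andP[a1 a2] := hm k; have /andP[b1 b2] := hn k.
apply/eqP; rewrite eq_le; apply/andP; split.
  by rewrite -ltzD1 -(ltr_int R) intrD; apply: lt_le_trans a1 b2.
by rewrite -ltzD1 -(ltr_int R) intrD; apply: lt_le_trans b1 a2.
Qed.

Definition cube_mass x m : R := fine (\int[mu]_t (gabor x t * \1_(ucube m) t)%:E).

Section finite_mass.
Variable x : E.
Hypothesis fin : (\int[mu]_t (gabor x t)%:E < +oo)%E.

Let mg : measurable_fun setT (gabor x). Proof. exact: measurable_gabor. Qed.

Let mcube m : measurable_fun setT (fun t => gabor x t * \1_(ucube m) t).
Proof.
by apply: measurable_funM => //; apply: measurable_indic; exact: measurable_hbox.
Qed.

Let cube_ge0 m t : 0 <= gabor x t * \1_(ucube m) t.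
Proof. by rewrite mulr_ge0 ?gabor_ge0. Qed.

Let massE m : ((cube_mass x m)%:E = \int[mu]_t (gabor x t * \1_(ucube m) t)%:E)%E.
Proof.
rewrite fineK // ge0_fin_numE; last by apply: integral_ge0 => t _; rewrite lee_fin.
apply: le_lt_trans fin; apply: ge0_le_integral => //.
- by move=> t _; rewrite lee_fin.
- exact/measurable_EFinP.
- exact/measurable_EFinP.
- by move=> t _; rewrite lee_fin ler_piMr ?gabor_ge0 // indicE lern1 leq_b1.
Qed.

Lemma sumle_mass : sumle (cube_mass x) (fine (\int[mu]_t (gabor x t)%:E)).
Proof.
move=> s us; rewrite -lee_fin fineK; last first.
  by rewrite ge0_fin_numE //; apply: integral_ge0 => t _; rewrite lee_fin gabor_ge0.
rewrite -sumEFin; under eq_bigr do rewrite massE.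
rewrite -ge0_integral_sum //; last 2 first.
- by move=> m; exact/measurable_EFinP.
- by move=> m t _; rewrite lee_fin.
apply: ge0_le_integral => //.
- by move=> t _; apply: sume_ge0 => m _; rewrite lee_fin.
- by apply: emeasurable_sum => m; exact/measurable_EFinP.
- exact/measurable_EFinP.
move=> t _; rewrite sumEFin lee_fin -mulr_sumr ler_piMr ?gabor_ge0 //.
have [/hasP[m ms hm]|/hasPn h] := boolP (has (fun m => t \in ucube m) s).
  rewrite (bigD1_seq m) //= big1 ?addr0; first by rewrite indicE lern1 leq_b1.
  move=> n nm; rewrite indicE; apply/eqP; rewrite pnatr_eq0 eqb0; apply: contra nm => hn.
  by apply/eqP; apply: (@ucube_disj _ _ t); [rewrite inE in hn|rewrite inE in hm].
by rewrite big_seq big1 // => m /h; rewrite indicE => /negbTE ->.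
Qed.

(** For each offset [a] in the unit cube, [fi 1 n x] is bounded by cells of the lattice shifted by
    [a]; integrating over [a] turns their values into integrals over unit cubes. From
    [|n_k - a_k - m_k| < 2] and [0 < a_k <= 1] follows [|n_k - m_k| <= 2]. *)
Lemma nm_fi_mass n : exists t : seq (d.-tuple int), [/\ uniq t,
  (forall m, m \in t -> forall k, (absz (tnth n k - tnth m k)%R <= 2)%N) &
  nm (fi 1 n x) <= \sum_(m <- t) cube_mass x m].
Proof.
pose Tn := [seq [tuple tnth n k - tnth i k | k < d] | i <- ibox d 2].
have uTn : uniq Tn.
  rewrite map_inj_uniq ?ibox_uniq // => i i' h; apply: eq_from_tnth => k.
  by have := congr1 (fun t => tnth t k) h; rewrite !tnth_mktuple => /addrI/oppr_inj.
have TnP m : m \in Tn <-> forall k, (absz (tnth n k - tnth m k)%R <= 2)%N.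
  split=> [/mapP[i /mem_ibox hi ->] k|h]; first by rewrite tnth_mktuple subKr.
  apply/mapP; exists [tuple tnth n k - tnth m k | k < d].
    by apply/mem_ibox => k; rewrite tnth_mktuple.
  by apply: eq_from_tnth => k; rewrite !tnth_mktuple subKr.
exists Tn; split => //; first by move=> m /TnP.
pose sh m (a : d.-tuple R) : d.-tuple R := taff 1 [tuple (tnth m k)%:~R | k < d] a.
pose z : d.-tuple int := [tuple 0 | k < d].
have Q1 : (\int[mu]_t (\1_(ucube z) t)%:E = 1)%E.
  rewrite int_hbox big1 // => k _; rewrite addrC addKr max_l //.
have mQ : measurable (ucube z) by exact: measurable_hbox.
have pt a : nm (fi 1 n x) * \1_(ucube z) a <= \sum_(m <- Tn) gabor x (sh m a) * \1_(ucube z) a.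
  rewrite indicE; have [aQ|_] := boolP (a \in ucube z); last by rewrite mulr0 big1 // => m _; rewrite mulr0.
  rewrite mulr1; under eq_bigr do rewrite mulr1.
  have h01 := @ltr01 R.
  have [t [ut ht le]] := @nm_refine R d E (cel 1 (fun=> 0) n) 1 (tnth a)
    (fun k => 0 + 1 * (tnth n k)%:~R) (fun=> 1) x (sym_tri _ (fun=> h01)) h01
    (fun l => cel_neq0 h01 (l := l)).
  apply: le_trans le _.
  have -> : \sum_(m <- t) nm (mult (cel 1 (tnth a) m) x) = \sum_(m <- t) gabor x (sh m a).
    apply: eq_bigr => m _; rewrite /gabor /cel; congr (nm (mult (tri _ _) x)).
    by apply/funext => k; rewrite !tnth_mktuple !mul1r.
  apply: sum_subset_le => //; first by move=> m; exact: gabor_ge0.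
  move=> m mt; apply/TnP => k; have := ht m mt k; rewrite add0r !mul1r => hk.
  rewrite inE in aQ; have := aQ k; rewrite tnth_mktuple add0r => /andP[a0 a1].
  rewrite -ltnS -(ltr_nat R) -normr_intr intrB.
  have -> : (tnth n k)%:~R - (tnth m k)%:~R = ((tnth n k)%:~R - (tnth a k + (tnth m k)%:~R)) + tnth a k :> R by ring.
  apply: le_lt_trans (ler_normD _ _) _; rewrite (gtr0_norm a0); lra.
have shm m : measurable_fun setT (fun a => gabor x (sh m a) * \1_(ucube z) a).
  apply: measurable_funM; last by apply: measurable_indic.
  by apply: (measurableT_comp mg); exact: measurable_taff.
have shi m : (\int[mu]_a (gabor x (sh m a) * \1_(ucube z) a)%:E = (cube_mass x m)%:E)%E.
  rewrite massE -(@ge0_integral_taff R d 1 [tuple (tnth m k)%:~R | k < d] (fun t => (gabor x t * \1_(ucube m) t)%:E)); last 3 first.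
  - exact: normr1.
  - exact/measurable_EFinP.
  - by move=> t; rewrite lee_fin.
  apply: eq_integral => a _; congr (_ * _)%:E; rewrite !indicE; congr (nat_of_bool _)%:R.
  apply/idP/idP; rewrite !inE => h k; have := h k; rewrite !tnth_mktuple !mul1r !add0r.
    by rewrite ltrDr [_ + 1]addrC lerD2r.
  by rewrite ltrDr [_ + 1]addrC lerD2r.
rewrite -lee_fin -sumEFin; under eq_bigr do rewrite -shi.
rewrite -ge0_integral_sum //; last 2 first.
- by move=> m; exact/measurable_EFinP.
- by move=> m t _; rewrite lee_fin mulr_ge0 ?gabor_ge0.
have -> : ((nm (fi 1 n x))%:E = \int[mu]_a (nm (fi 1 n x) * \1_(ucube z) a)%:E)%E.
  under eq_integral do rewrite EFinM.
  rewrite ge0_integralZl //; last 2 first.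
  - by apply/measurable_EFinP; apply: measurable_indic.
  - by rewrite lee_fin nm_ge0.
  by rewrite Q1 mule1.
apply: ge0_le_integral => //.
- by move=> a _; rewrite lee_fin mulr_ge0 ?nm_ge0.
- by apply/measurable_EFinP; apply: measurable_funM => //; apply: measurable_indic.
- by apply: emeasurable_sum => m; exact/measurable_EFinP.
- by move=> a _; rewrite sumEFin lee_fin.
Qed.

Lemma sumle_of_gabor : exists C, sumle (fun n => nm (fi 1 n x)) C.
Proof.
exists ((5 ^ d)%:R * fine (\int[mu]_t (gabor x t)%:E)).
apply: (sumle_cover (cond := fun n m => forall k, (absz (tnth n k - tnth m k)%R <= 2)%N) _ sumle_mass).
- by move=> m; rewrite fine_ge0 //; apply: integral_ge0 => t _; rewrite lee_fin.
- exact: nm_fi_mass.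
- move=> m u uu hu; apply: (box_count (lo := fun k => tnth m k - 2%:Z)) => // n nu k.
  exact: (absz_box (hu n nu k)).
Qed.

End finite_mass.

(** The tent centred at [t] meets only unit cells within distance 2, so [gabor x] is dominated by a
    series of constants on cubes of volume [4 ^ d]. *)
Lemma gabor_of_sumle x C : sumle (fun n => nm (fi 1 n x)) C -> (\int[mu]_t (gabor x t)%:E < +oo)%E.
Proof.
move=> hC.
pose D m : set (d.-tuple R) := hbox (fun k => (tnth m k)%:~R - 2) (fun k => (tnth m k)%:~R + 2).
have mD m : measurable (D m) by exact: measurable_hbox.
pose y i (t : d.-tuple R) : \bar R := if pickle_inv i is Some m then (nm (fi 1 m x) * \1_(D m) t)%:E else 0%E.
have y0 i t : (0 <= y i t)%E.
  by rewrite /y; case: pickle_inv => // m; rewrite lee_fin mulr_ge0 ?nm_ge0.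
have my i : measurable_fun setT (y i).
  rewrite /y; case: pickle_inv => [m|]; last exact: measurable_cst.
  by apply/measurable_EFinP; apply: measurable_funM => //; apply: measurable_indic.
pose en q : seq (d.-tuple int) := pmap (@pickle_inv (d.-tuple int)) (iota 0 q).
have en_uniq q : uniq (en q).
  apply: (@pmap_uniq _ _ _ (@pickle (d.-tuple int))); last exact: iota_uniq.
  by move=> i; have := @pickle_invK (d.-tuple int) i; case: pickle_inv.
have en_mem n q : (pickle n < q)%N -> n \in en q.
  move=> nq; rewrite mem_pmap; apply/mapP; exists (pickle n); first by rewrite mem_iota.
  by rewrite pickleK_inv.
have en_sum q (F : d.-tuple int -> \bar R) :
    (\sum_(0 <= i < q) (if @pickle_inv (d.-tuple int) i is Some m then F m else 0) = \sum_(n <- en q) F n)%E.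
  rewrite /en /index_iota subn0; elim: (iota 0 q) => [|i s IH] /=; first by rewrite !big_nil.
  by rewrite big_cons IH; case: pickle_inv => [n|] /=; rewrite ?big_cons ?add0e.
apply: (@le_lt_trans _ _ (\int[mu]_t \sum_(0 <= i <oo) y i t)%E).
  apply: ge0_le_integral => //.
  - by move=> t _; rewrite lee_fin gabor_ge0.
  - by apply/measurable_EFinP; exact: measurable_gabor.
  - by apply: ge0_emeasurable_sum.
  move=> t _; have h01 := @ltr01 R.
  have [s [us hs le]] := @nm_refine R d E (tri (fun=> 1) (tnth t)) 1 (fun=> 0)
    (tnth t) (fun=> 1) x (sym_tri _ (fun=> h01)) h01 (fun l => tri_neq0 (fun=> h01) (l := l)).
  pose q := \max_(n <- s) (pickle n).+1.
  apply: (@le_trans _ _ (\sum_(0 <= i < q) y i t)%E); last exact: nneseries_lim_ge.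
  rewrite (en_sum q (fun m => (nm (fi 1 m x) * \1_(D m) t)%:E)) sumEFin lee_fin.
  apply: le_trans le _.
  have -> : \sum_(n <- s) nm (mult (cel 1 (fun=> 0) n) x) = \sum_(n <- s) nm (fi 1 n x) * \1_(D n) t.
    rewrite !big_seq; apply: eq_bigr => n ns; rewrite indicE mem_set ?mulr1 // => k.
    have := hs n ns k; rewrite add0r mul1r ltr_norml => /andP[h1 h2].
    by apply/andP; split; lra.
  apply: sum_subset_le => //; first by move=> n; rewrite mulr_ge0 ?nm_ge0.
  by move=> n ns; apply: en_mem; rewrite /q (big_rem n ns) /= leq_maxl.
rewrite integral_nneseries //.
apply: (@le_lt_trans _ _ ((4 ^+ d * C)%:E)); last exact: ltry.
apply: lime_le; first by apply: is_cvg_nneseries => i _ _; exact: integral_ge0.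
apply: nearW => q.
have -> : (\sum_(0 <= i < q) \int[mu]_t y i t = \sum_(0 <= i < q)
    (if @pickle_inv (d.-tuple int) i is Some m then (4 ^+ d * nm (fi 1 m x))%:E else 0))%E.
  apply: eq_bigr => i _; rewrite /y; case: pickle_inv => [m|]; last by rewrite integral0.
  under eq_integral do rewrite EFinM.
  rewrite ge0_integralZl //; last 2 first.
  - by apply/measurable_EFinP; apply: measurable_indic.
  - by rewrite lee_fin nm_ge0.
  rewrite int_hbox -EFinM mulrC; congr (_ * _)%:E.
  under eq_bigr => k _.
    have -> : (tnth m k)%:~R + 2 - ((tnth m k)%:~R - 2) = 4 :> R by ring.
    rewrite max_l //; over.
  by rewrite prodr_const card_ord.
rewrite en_sum sumEFin lee_fin -mulr_sumr ler_wpM2l ?exprn_ge0 //.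
exact: hC.
Qed.

End integral_lattice.

(** * The inverse bound *)

Section interface.
Variables (R : realType) (d : nat).

Lemma esum_sumle (T : choiceType) (a : T -> R) (C : R) :
  (\esum_(n in [set: T]) (a n)%:E <= C%:E)%E <-> sumle a C.
Proof.
split=> [h s us|h].
  rewrite -lee_fin -sumEFin; apply: le_trans h; apply: esum_ge.
  exists [set` s]; first by split => //; exact: finite_seq.
  by rewrite fsbig_seq.
apply: ge_ereal_sup => _ [X [fX _] <-].
rewrite fsbig_finite //= sumEFin lee_fin; apply: h.
exact: finmap.fset_uniq.
Qed.

Lemma box2_perm : perm_eq (box2 d) (ibox d 2).
Proof.
apply: uniq_perm; rewrite ?ibox_uniq //.
  rewrite map_inj_uniq ?enum_uniq // => f g h; apply: eq_from_tnth => k.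
  have := congr1 (fun t => tnth t k) h; rewrite !tnth_mktuple => /addIr[e].
  exact: val_inj.
move=> n; apply/idP/idP.
  move=> /mapP[f _ ->]; apply/mem_ibox => k; rewrite tnth_mktuple.
  by have := ltn_ord (tnth f k); move: (nat_of_ord (tnth f k)) => i; lia.
move=> /mem_ibox h; apply/mapP.
exists [tuple inord (absz (tnth n k + 2)%R) | k < d]; first by rewrite mem_enum.
apply: eq_from_tnth => k; rewrite !tnth_mktuple; have := h k.
move: (tnth n k : int) => a ha; have h1 : (absz (a + 2)%R < 5)%N by lia.
by rewrite inordK //; lia.
Qed.

Lemma op_bcomp (U V W : completeNormedModType R[i])
  (act1 : (d.-tuple R -> R[i]) -> (U -> V) -> (U -> V)) T1
  (act2 : (d.-tuple R -> R[i]) -> (V -> W) -> (V -> W)) T2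
  (act3 : (d.-tuple R -> R[i]) -> (U -> W) -> (U -> W)) T3
  (H1 : banach_module act1 T1) (H2 : banach_module act2 T2) (H3 : banach_module act3 T3) :
  rep_compat T1 T2 T3 ->
  @bcomp R d (op_bmod H1) (op_bmod H2) (op_bmod H3) (fun y x => @blcomp R U V W y x).
Proof.
move=> hT; split.
- by move=> c y y' x; exact: blcomp_linl.
- by move=> c y x x'; exact: blcomp_linr.
- by move=> y x; exact: nmL_comp.
- move=> j t y x; apply: bl_inj; exact: (hT _ _ _ (blprop x) (blprop y)).
Qed.

Section module.
Variables (U V : completeNormedModType R[i]).
Variables (act : (d.-tuple R -> R[i]) -> (U -> V) -> (U -> V)) (T : d.-tuple R -> (U -> V) -> (U -> V)).
Hypothesis Hm : banach_module act T.
Local Notation E := (op_bmod Hm).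

Lemma act_fi (N : nat) (n : d.-tuple int) (A : E) : (0 < N)%N ->
  act (phid N%:R (of_int_tuple R n)) (A : BL U V) = (fi N%:R n A : BL U V).
Proof.
move=> N0; rewrite (act_phid _ A) ?ltr0n // /fi /cel.
by congr (blf (mult (tri _ _) A)); apply/funext => k; rewrite tnth_mktuple add0r.
Qed.

Lemma norm1N_esum (N : nat) (A : E) : (0 < N)%N -> norm1N act N (A : BL U V) =
  ((5 ^+ d : R)%:E * \esum_(n in [set: d.-tuple int]) (nm (fi N%:R n A))%:E)%E.
Proof.
by move=> N0; rewrite /norm1N; congr (_ * _)%E; apply: eq_esum => n _; rewrite act_fi.
Qed.

Lemma norm1N_sumle (N : nat) (A : E) (C : R) : (0 < N)%N ->
  (norm1N act N (A : BL U V) <= (5 ^+ d * C)%:E)%E <-> sumle (fun n => nm (fi N%:R n A)) C.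
Proof.
move=> N0; rewrite norm1N_esum // EFinM lee_pmul2l ?lte_fin ?exprn_gt0 //.
exact: esum_sumle.
Qed.

Lemma Wnorm_gabor (A : E) : Wnorm act (A : BL U V) = (\int[Rd_measure R d]_a (gabor A a)%:E)%E.
Proof.
rewrite -gaborE /Wnorm; congr intRd; apply/funext => a; congr (_%:E).
rewrite (act_phid _ A) // /gabor -/(nmL _); congr (nmL (mult (tri _ _) A)).
by apply/funext => k; rewrite mul1r.
Qed.

Lemma blf_sum (I : Type) (s : seq I) (F : I -> BL U V) :
  blf (\sum_(i <- s) F i) = \sum_(i <- s) blf (F i).
Proof. by elim/big_rec2: _ => // i y z _ <-. Qed.

Lemma core2E (K : nat) (A : E) : (0 < K)%N ->
  ((A : BL U V) : U -> V) - \sum_(k <- box2 d) act (phid K%:R (of_int_tuple R k)) (A : BL U V) =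
  (A - core2 K A : BL U V) :> (U -> V).
Proof.
move=> K0; rewrite (perm_big _ box2_perm) /=.
under eq_bigr do rewrite act_fi //.
by rewrite -blf_sum.
Qed.

Lemma psi_sumle (A : E) (t : R) (K : nat) : psi_set act (A : BL U V) t K <->
  (0 < K)%N /\ sumle (fun n => nm (fi K%:R n (A - core2 K A))) (t / 5 ^+ d).
Proof.
have p5 : (5 ^+ d : R) != 0 by rewrite gt_eqF // exprn_gt0.
have tE : t = 5 ^+ d * (t / 5 ^+ d) by rewrite mulrC mulfVK.
by split=> -[K0 h]; split => //; move: h; rewrite core2E // [t in t%:E]tE (norm1N_sumle _ _ K0).
Qed.

(** A tent of half-width [K] with centre at most [2 K] from zero reaches to [3 K]: this is the
    half-side entering [inverse_decay]. *)
Lemma insp_core2 (K : nat) (A : E) j : (0 < K)%N -> insp j 0 (3 * K%:R) (core2 K A).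
Proof.
move=> K0; have k0 : 0 < K%:R :> R by rewrite ltr0n.
pose s (l : d.-tuple R) : R[i] := \sum_(k <- ibox d 2) 1 * cel (K%:R : R) (fun=> 0) k l.
have hc k : issym (cel (K%:R : R) (fun=> 0) k : d.-tuple R -> R[i]) by exact: issym_cel.
have hs : issym s by exact: issym_sum.
have supp l : s l != 0 -> forall k, `|tnth l k| <= 3 * K%:R.
  move=> sl k; have [n nb cl] : exists2 n, n \in ibox d 2 & cel (K%:R : R) (fun=> 0) n l != 0.
    apply: contrapT => h; move/eqP: sl; apply; rewrite /s big_seq big1 // => n nb.
    by rewrite mul1r; apply/eqP/negPn/negP => cl; apply: h; exists n.
  have /mem_ibox/(_ k) nk := nb; have := cel_neq0 k0 cl k; rewrite add0r => h.
  rewrite -(subrK (K%:R * (tnth n k)%:~R) (tnth l k)); apply: le_trans (ler_normD _ _) _.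
  have : `|K%:R * (tnth n k)%:~R| <= 2 * K%:R :> R.
    by rewrite normrM normr_intr ger0_norm // mulrC ler_wpM2r // ler_nat.
  by move: h; lra.
exists (3 * K%:R), s, A; split => //; first by rewrite mulr_gt0.
  by move=> l sl; rewrite subr0; exact: supp.
rewrite /s mult_sym_sum // /core2; apply: eq_bigr => k _.
by rewrite scale1r.
Qed.

End module.
End interface.

(** * Neumann series for the inverse of the truncation *)

Section neumann.
Variables (R : realType) (X Y : completeNormedModType R[i]).
Implicit Types (A D : BL X Y) (B : BL Y X).

Lemma nmLB (U V : normedModType R[i]) (S T : BL U V) : nmL (S - T) <= nmL S + nmL T.
Proof.
by apply: le_trans (nmLD _ _) _; rewrite -scaleN1r nmLZ cabsN cabs1 mul1r.
Qed.

Lemma blcompDr (U V W : normedModType R[i]) (S : BL V W) (P Q : BL U V) :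
  blcomp S (P + Q) = blcomp S P + blcomp S Q.
Proof. by have := blcomp_linr 1 S P Q; rewrite !scale1r. Qed.

Lemma blcompBl (U V W : normedModType R[i]) (S T : BL V W) (P : BL U V) :
  blcomp (S - T) P = blcomp S P - blcomp T P.
Proof. by have := blcomp_linl (-1) T S P; rewrite !scaleN1r addrC [in RHS]addrC. Qed.

Lemma blcompBr (U V W : normedModType R[i]) (S : BL V W) (P Q : BL U V) :
  blcomp S (P - Q) = blcomp S P - blcomp S Q.
Proof. by have := blcomp_linr (-1) S Q P; rewrite !scaleN1r addrC [in RHS]addrC. Qed.

Lemma neumann_inverse A B D : blcomp B A = bl1 X -> blcomp A B = bl1 Y -> nmL B * nmL D <= 1 / 2 ->
  exists b : BL Y X, [/\ blcomp b (A - D) = bl1 X, blcomp (A - D) b = bl1 Y,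
    B = b - blcomp b (blcomp D B) & nmL b * (1 - nmL B * nmL D) <= nmL B].
Proof.
move=> BA AB h.
pose x k := iter k (fun z => blcomp B (blcomp D z)) B.
have nB := nmL_ge0 B; have nD := nmL_ge0 D.
have xb k : nmL (x k) <= nmL B / 2 ^+ k.
  elim: k => [|k IH]; first by rewrite expr0 divr1.
  apply: le_trans (nmL_comp _ _) _; apply: (@le_trans _ _ (nmL B * (nmL D * nmL (x k)))).
    by rewrite ler_wpM2l // nmL_comp.
  rewrite mulrA exprS invfM mulrCA; apply: ler_pM => //; rewrite ?mulr_ge0 ?nmL_ge0 //.
  by rewrite -div1r.
have xs n : \sum_(k < n) nmL (x k) <= 2 * nmL B.
  apply: (@le_trans _ _ (\sum_(k < n) nmL B / 2 ^+ k)); first by apply: ler_sum.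
  have -> : \sum_(k < n) nmL B / 2 ^+ k = 2 * nmL B * (1 - (2 ^+ n)^-1).
    elim: n => [|n IH]; first by rewrite big_ord0 expr0 invr1 subrr mulr0.
    by rewrite big_ord_recr /= IH exprS invfM; field; rewrite expf_neq0.
  have p : 0 <= (2 ^+ n)^-1 :> R by rewrite invr_ge0 exprn_ge0.
  by have := mulr_ge0 nB p; lra.
have [b hb] := nmL_complete xs.
(* The product with a partial sum telescopes, so the limit [b] is a right inverse. *)
have part n : blcomp (A - D) (\sum_(k < n.+1) x k) = bl1 Y - blcomp D (x n).
  elim: n => [|n IH]; first by rewrite big_ord1 blcompBl AB.
  rewrite big_ord_recr /= blcompDr IH blcompBl [blcomp A _]blcompA AB blcomp1l.
  by rewrite subrKA.
have Ab : blcomp (A - D) b = bl1 Y.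
  apply/eqP; rewrite -subr_eq0; apply/eqP; apply: nmL_eq0; apply/eqP; rewrite eq_le nmL_ge0 andbT.
  apply/ler_addgt0Pr => e e0; rewrite add0r.
  pose K := nmL (A - D) + nmL D * nmL B + 1.
  have K0 : 0 < K by rewrite ltr_pwDr // addr_ge0 ?mulr_ge0 ?nmL_ge0.
  have eK : 0 < e / K by rewrite divr_gt0.
  have [n0 hn0] := hb _ eK.
  pose n := maxn n0 (Num.bound (K / e)).
  have n2 : (2 ^+ n)^-1 <= e / K.
    have -> : e / K = (K / e)^-1 by rewrite invf_div.
    rewrite lef_pV2 ?posrE ?exprn_gt0 ?divr_gt0 //.
    apply: le_trans (ltW (archi_boundP (divr_ge0 (ltW K0) (ltW e0)))) _.
    by rewrite -natrX ler_nat; apply: leq_trans (ltnW (ltn_expl n (ltnSn 1))); exact: leq_maxr.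
  have -> : blcomp (A - D) b - bl1 Y = blcomp (A - D) (b - \sum_(k < n.+1) x k) - blcomp D (x n).
    by rewrite blcompBr part opprB addrA addrAC addrK.
  apply: le_trans (nmLB _ _) _; apply: (@le_trans _ _ (nmL (A - D) * (e / K) + nmL D * (nmL B * (e / K)))).
    apply: lerD; apply: le_trans (nmL_comp _ _) _; rewrite ler_wpM2l ?nmL_ge0 //.
      by apply: hn0; rewrite leqW // leq_maxl.
    by apply: le_trans (xb n) _; rewrite ler_wpM2l.
  rewrite [nmL D * _]mulrA -mulrDl mulrCA ger_pMr // ler_pdivrMr // mul1r /K lerDl //.
(* A right inverse is a left inverse because [A - D] is injective: [(A - D) z = 0] gives
   [z = B D z], so the norm of [z] is at most half of itself. *)
have bA : blcomp b (A - D) = bl1 X.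
  apply/eqP; rewrite -subr_eq0; apply/eqP; set z := _ - _.
  have z0 : blcomp (A - D) z = 0 by rewrite blcompBr blcompA Ab blcomp1l blcomp1r subrr.
  have zE : z = blcomp B (blcomp D z).
    have : blcomp A z = blcomp D z by apply/eqP; rewrite -subr_eq0 -blcompBl z0.
    by move=> <-; rewrite blcompA BA blcomp1l.
  apply: nmL_eq0; apply/eqP; rewrite eq_le nmL_ge0 andbT.
  have : nmL z <= 1 / 2 * nmL z.
    rewrite {1}zE; apply: le_trans (nmL_comp _ _) _.
    apply: (@le_trans _ _ (nmL B * (nmL D * nmL z))); first by rewrite ler_wpM2l // nmL_comp.
    by rewrite mulrA ler_wpM2r ?nmL_ge0.
  lra.
exists b; split => //.
  have : blcomp (A - D) B = bl1 Y - blcomp D B by rewrite blcompBl AB.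
  move=> /(congr1 (blcomp b)); rewrite blcompA bA blcomp1l blcompBr blcomp1r.
  by [].
have bE : b = B + blcomp B (blcomp D b).
  have /(congr1 (blcomp B)) := Ab; rewrite blcompBl blcompBr blcompA BA blcomp1l blcomp1r => e.
  by apply/eqP; rewrite -subr_eq; apply/eqP.
rewrite mulrBr mulr1 lerBlDr {1}bE; apply: le_trans (nmLD _ _) _; rewrite lerD2l.
apply: le_trans (nmL_comp _ _) _; apply: (@le_trans _ _ (nmL B * (nmL D * nmL b))).
  by rewrite ler_wpM2l // nmL_comp.
by rewrite mulrA mulrC.
Qed.

End neumann.

(** * The lattice bound at scale N *)

Section main_bound.
Variables (R : realType) (d : nat) (X Y : completeNormedModType R[i]).
Variables (actXY : (d.-tuple R -> R[i]) -> (X -> Y) -> (X -> Y)) (TXY : d.-tuple R -> (X -> Y) -> (X -> Y)).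
Variables (actYX : (d.-tuple R -> R[i]) -> (Y -> X) -> (Y -> X)) (TYX : d.-tuple R -> (Y -> X) -> (Y -> X)).
Variables (actYY : (d.-tuple R -> R[i]) -> (Y -> Y) -> (Y -> Y)) (TYY : d.-tuple R -> (Y -> Y) -> (Y -> Y)).
Hypotheses (HXY : banach_module actXY TXY) (HYX : banach_module actYX TYX) (HYY : banach_module actYY TYY).
Hypotheses (r1 : rep_compat TYX TXY TYY) (r2 : rep_compat TYY TYX TYX).
Hypothesis coup : forall (A : X -> Y) (B : Y -> X), bounded_linear A -> bounded_linear B ->
  mutually_inverse A B -> forall t, mutually_inverse (TXY t A) (TYX t B).
Hypothesis d0 : (0 < d)%N.

Let EXY := op_bmod HXY.
Let EYX := op_bmod HYX.
Let EYY := op_bmod HYY.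
Let c1 (y : EXY) (x : EYX) : EYY := blcomp (y : BL X Y) (x : BL Y X).
Let c2 (y : EYX) (x : EYY) : EYX := blcomp (y : BL Y X) (x : BL Y Y).
Let Hc1 : bcomp c1 := op_bcomp HYX HXY HYY r1.
Let Hc2 : bcomp c2 := op_bcomp HYY HYX HYX r2.

Variables (A : EXY) (B : EYX) (N : nat).
Hypotheses (BA : blcomp (B : BL Y X) (A : BL X Y) = bl1 X) (AB : blcomp (A : BL X Y) (B : BL Y X) = bl1 Y).
Hypotheses (B0 : 0 < nm B) (N0 : (0 < N)%N).

Let kap := nm A * nm B.

Lemma kappa_ge1 : 1 <= kap.
Proof.
have : nm B <= nm B * kap.
  rewrite -{1}[B](blcomp1r (B : BL Y X)) -AB; apply: le_trans (nmL_comp _ _) _.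
  exact: (ler_wpM2l (nmL_ge0 _) (nmL_comp _ _)).
by rewrite ler_pMr.
Qed.

(** The operator [b] is the exact inverse of the band-limited part [a = A - D], and
    [eta = ||B|| ||D||] measures how far the norm of [b] and the condition number of [a] are from
    those of [B] and [A]. *)
Lemma inverse_bound : sumle (fun n => nm (fi N%:R n (A - core2 N A))) (epsA d kap / nm B / 5 ^+ d) ->
  sumle (fun n => nm (fi N%:R n B)) (nm B / epsA d kap / 5 ^+ d).
Proof.
set D := A - core2 N A; set s := _ / 5 ^+ d => hD.
have k1 := kappa_ge1; have n0 : 0 < N%:R :> R by rewrite ltr0n.
have nD : nm D <= s by exact: nm_le_sumle hD.
have p5 : 0 < 5 ^+ d :> R by rewrite exprn_gt0.
have e0 := eps_gt0 d0 k1.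
pose eta := nm B * nm D.
have eta0 : 0 <= eta by rewrite mulr_ge0 ?nm_ge0.
have eta1 : eta <= epsA d kap / 5 ^+ d.
  have -> : epsA d kap / 5 ^+ d = nm B * s.
    by rewrite /s; field; rewrite !gt_eqF.
  by rewrite ler_pM2l.
have [h1 h2 h3] := eta_bound d0 k1 eta0 eta1.
have eh : nm B * nm D <= 1 / 2 by rewrite -/eta; lra.
have [b [bA Ab BE nb]] := neumann_inverse BA AB eh.
have AD : A - D = core2 N A by rewrite /D subKr.
pose a : EXY := core2 N A.
have bA' : blcomp b (a : BL X Y) = bl1 X by rewrite -bA -[LHS]/(blcomp b (core2 N A : EXY)) -AD.
have Ab' : blcomp (a : BL X Y) b = bl1 Y by rewrite -Ab -[LHS]/(blcomp (core2 N A : EXY) b) -AD.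
have minv : mutually_inverse (a : BL X Y) b.
  by split; [have := congr1 (@blf _ _ _) bA'|have := congr1 (@blf _ _ _) Ab'].
(* The coupling of the representations keeps translates of [a] and [b] mutually inverse; this is
   what allows the inverse to be differentiated. *)
have trI j t : blcomp (tr j t (b : EYX) : BL Y X) (tr j t a : BL X Y) = bl1 X.
  have [h _] := coup (blprop a) (blprop b) minv (tej j t).
  exact: bl_inj.
have trba j t (z : EYX) : c2 (tr j t (b : EYX)) (c1 (tr j t a) z) = z.
  by rewrite /c2 /c1 blcompA trI blcomp1l.
pose x := deltaA d kap ^+ d.
have x1 : 1 < x by exact: delta_d_gt1.
pose H := ln x / N%:R.
have NH : N%:R * H = ln x by rewrite /H mulrC mulfVK // gt_eqF.
have xE : expR (N%:R * H) = x by rewrite NH lnK // posrE; lra.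
have H0 : 0 <= H by rewrite /H divr_ge0 // ln_ge0 // ltW.
have nmAb : nm (b : EYX) * nm a <= (kap + eta) / (1 - eta).
  have e1 : 0 < 1 - eta by lra.
  rewrite ler_pdivlMr //.
  have na : nm a <= nm A + nm D by rewrite /a -AD; exact: nmB.
  have := ler_pM (mulr_ge0 (nm_ge0 (b : EYX)) (ltW e1)) (nm_ge0 a) nb na.
  have -> : nm B * (nm A + nm D) = kap + eta by rewrite /kap /eta; ring.
  by rewrite mulrAC.
(* Since [N H = ln (delta ^ d)], this is [delta ^ (6 d)], the square of [delta ^ (3 d) = rho]. *)
have rhoE : expR (6 * N%:R * H) = ((4 * kap + 3) / (4 * kap + 2)) ^+ 2.
  rewrite -(delta_pow d0 k1) -exprM mulnC mulnA -[(2 * 3)%N]/6%N mulnC exprM -/x -xE.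
  by rewrite -expRM_natl; congr expR; ring.
have th : nm (b : EYX) * (nm a * (expR (6 * N%:R * H) - 1)) <= 1 / 2.
  rewrite rhoE; set r := _ ^+ 2 in h2 *.
  have r0 : 0 <= r - 1.
    rewrite /r -rhoE subr_ge0; apply: le_trans (expR_ge1Dx _); rewrite lerDl.
    by apply: mulr_ge0 => //; rewrite mulr_ge0.
  have e1 : 0 < 1 - eta by lra.
  rewrite mulrA; apply: le_trans (ler_wpM2r r0 nmAb) _.
  by rewrite mulrAC ler_pdivrMr //; lra.
have dec n : nm (fi N%:R n (b : EYX)) <= 2 * nm (b : EYX) * x ^+ 2 * x^-1 ^+ inorm n.
  have cA (b1 : EYX) (a1 : EXY) (b2 : EYX) (s1 : EYY) :
      c2 (c2 b1 (c1 a1 b2)) s1 = c2 b1 (c1 a1 (c2 b2 s1)) by rewrite /c1 /c2 !blcompA.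
  have ab : c1 a (b : EYX) = (bl1 Y : EYY) by exact: Ab'.
  have trb1 j u : c2 (tr j u (b : EYX)) (bl1 Y : EYY) = tr j u (b : EYX) by exact: blcomp1r.
  have hin j : insp j 0 (3 * N%:R) a by exact: insp_core2.
  by have := inverse_decay Hc1 Hc2 cA ab trba trb1 n d0 N0 H0 hin th; rewrite xE.
pose G : R := ((2 * deltaA d kap - 1) / (deltaA d kap - 1)) ^+ d.
pose be := nm (b : EYX) * (126 / 25 * G).
have nb0 := nm_ge0 (b : EYX).
have G0 := G20 d0 k1; rewrite -/G in G0.
have x0 : 0 < x by exact: lt_trans ltr01 x1.
have xi : 0 < x^-1 < 1 by rewrite invr_gt0 x0 invf_lt1.
have hb : sumle (fun n => nm (fi N%:R n (b : EYX))) be.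
  move=> t ut; apply: (@le_trans _ _ (2 * nm (b : EYX) * x ^+ 2 * \sum_(n <- t) x^-1 ^+ inorm n)).
    by rewrite mulr_sumr; apply: ler_sum => n _; exact: dec.
  have sb := series_bound d0 k1 (erefl (x^-1)); rewrite -/G in sb.
  have si : \sum_(n <- t) x^-1 ^+ inorm n <= 2 ^+ d * d`!%:R / (1 - x^-1) ^+ d.
    by case: d d0 t ut xi => // d' _ t ut xi; exact: sum_inorm.
  have x20 : 0 <= 2 * nm (b : EYX) * x ^+ 2 by apply: mulr_ge0; [exact: mulr_ge0|rewrite exprn_ge0 // ltW].
  apply: le_trans (ler_wpM2l x20 si) _.
  have := ler_wpM2l nb0 sb; rewrite -/be; apply: le_trans.
  by rewrite exprVn invrK le_eqVlt; apply/orP; left; apply/eqP; move: (x ^+ 2) (_ / _) => u v; ring.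
have beB : be <= nm B * (8 * G - 6).
  apply: (@le_trans _ _ (nm (b : EYX) * ((1 - eta) * (8 * G - 6)))); first by rewrite ler_wpM2l.
  by rewrite mulrA ler_wpM2r //; lra.
have epE := epsE d kap; rewrite -/G in epE.
have g0 : 0 < 16 * G - 12 by lra.
(* The two factors [5 ^ d] of the products cancel against the one in [eps_A] and the one in the
   lattice norm; what remains is [(8 G - 6) / (16 G - 12) = 1 / 2]. *)
have small : (5 ^+ d) ^+ 2 * (s * be) <= 1 / 2.
  have s0 : 0 <= s by rewrite /s !divr_ge0 ?ltW.
  have := ler_wpM2l (mulr_ge0 (exprn_ge0 2 (ltW p5)) s0) beB; rewrite mulrA => h; apply: le_trans h _.
  have -> : (5 ^+ d) ^+ 2 * s * (nm B * (8 * G - 6)) = (5 ^+ d * epsA d kap) * (8 * G - 6).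
    by rewrite /s; field; rewrite !gt_eqF.
  rewrite epE mulrC ler_pdivrMr //; lra.
have hB := perturb_sum Hc1 Hc2 n0 (BE : B = (b : EYX) - c2 b (c1 D B)) hb hD small.
move=> t ut; apply: le_trans (hB t ut) _.
apply: (@le_trans _ _ (nm B * (16 * G - 12))); first by lra.
have -> : 16 * G - 12 = (5 ^+ d * epsA d kap)^-1 by rewrite epE invrK.
by rewrite le_eqVlt; apply/orP; left; apply/eqP; field; rewrite !gt_eqF.
Qed.

End main_bound.

Theorem mainTheorem12 (R : realType) (d : nat) (hd : (0 < d)%N)
  (X Y : completeNormedModType R[i])
  (actXY : (d.-tuple R -> R[i]) -> (X -> Y) -> (X -> Y))
  (TXY : d.-tuple R -> (X -> Y) -> (X -> Y))
  (actYX : (d.-tuple R -> R[i]) -> (Y -> X) -> (Y -> X))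
  (TYX : d.-tuple R -> (Y -> X) -> (Y -> X))
  (actXX : (d.-tuple R -> R[i]) -> (X -> X) -> (X -> X))
  (TXX : d.-tuple R -> (X -> X) -> (X -> X))
  (actYY : (d.-tuple R -> R[i]) -> (Y -> Y) -> (Y -> Y))
  (TYY : d.-tuple R -> (Y -> Y) -> (Y -> Y))
  (hset : operator_setting actXY TXY actYX TYX actXX TXX actYY TYY)
  (A : X -> Y) (B : Y -> X)
  (hA : bounded_linear A) (hB : bounded_linear B)
  (hAB : mutually_inverse A B)
  (hAW : inW actXY A) :
  inW actYX B /\
  exists N : nat,
    (* N = psi_A (eps_A / ||B||) *)
    psi_set actXY A (epsA d (kappa A B) / opnorm B) N /\
    (forall K, psi_set actXY A (epsA d (kappa A B) / opnorm B) K -> (N <= K)%N) /\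
    (norm1N actYX 1 B <= ((2 * N + 1) ^ d)%:R%:E * norm1N actYX N B)%E /\
    (((2 * N + 1) ^ d)%:R%:E * norm1N actYX N B <=
       (opnorm B / epsA d (kappa A B) * (2 * N%:R + 1) ^+ d)%:E)%E.
Proof.
have [[HXY HYX] [_ HYY] [_ [_ [_ [_ [_ [r1 [r2 _]]]]]]] coup] := hset.
pose EXY := op_bmod HXY; pose EYX := op_bmod HYX.
pose A' : EXY := toBL hA; pose B' : EYX := toBL hB.
have BA : blcomp (B' : BL Y X) (A' : BL X Y) = bl1 X by apply: bl_inj; case: hAB.
have AB : blcomp (A' : BL X Y) (B' : BL Y X) = bl1 Y by apply: bl_inj; case: hAB.
have nA : nm A' = opnorm A by []. have nB : nm B' = opnorm B by [].
set t := epsA d (kappa A B) / opnorm B.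
have p5 : 0 < 5 ^+ d :> R by rewrite exprn_gt0.
have finA : exists C, sumle (fun n => nm (fi 1 n A')) C.
  by apply: sumle_of_gabor; rewrite -Wnorm_gabor.
have psiP K : psi_set actXY A t K <-> (0 < K)%N /\ sumle (fun n => nm (fi K%:R n (A' - core2 K A'))) (t / 5 ^+ d).
  exact: (psi_sumle A' t K).
have psi_ex : exists K, psi_set actXY A t K.
  (* If [||B|| = 0], both spaces are trivial and the threshold is [0], a quotient by zero being
     zero; scale 1 then works because [A = 0]. *)
  have [B0|B0] := eqVneq (nm B') 0.
    exists 1%N; apply/psiP; split => // s us.
    have A0 : A' = 0.
      apply: nm_le0; rewrite -[A'](blcomp1r (A' : BL X Y)) -BA blcompA.
      apply: le_trans (nmL_comp _ _) _; apply: le_trans (ler_wpM2r (nm_ge0 A') (nmL_comp _ _)) _.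
      by rewrite -[nmL B']/(nm B') B0 mulr0 mul0r.
    have hs n : issym (cel (1 : R) (fun=> 0) n : d.-tuple R -> R[i]) by exact: issym_cel.
    have c0 : core2 1 A' = 0 by rewrite A0 /core2 big1 // => k _; rewrite /fi multr0.
    rewrite /t -nB B0 invr0 mulr0 mul0r big1 // => n _.
    by rewrite c0 A0 subr0 /fi multr0 // nm0.
  have Bp : 0 < nm B' by rewrite lt_neqAle eq_sym B0 nm_ge0.
  have k1 : 1 <= kappa A B by exact: (kappa_ge1 AB Bp).
  have t0 : 0 < t / 5 ^+ d by apply: divr_gt0 => //; apply: divr_gt0; [exact: eps_gt0 hd k1|exact: Bp].
  have [C hC] := finA; have [K K0 hK] := core2_small hC t0.
  by exists K; apply/psiP.
have psi_exb : exists K, `[< psi_set actXY A t K >] by have [K hK] := psi_ex; exists K; apply/asboolP.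
case: (ex_minnP psi_exb) => N /asboolP hN Nmin.
have /psiP[N0 hNs] := hN.
have n0 : 0 < N%:R :> R by rewrite ltr0n.
have key : sumle (fun n => nm (fi N%:R n B')) (opnorm B / epsA d (kappa A B) / 5 ^+ d).
  have [B0|B0] := eqVneq (nm B') 0.
    move=> s us; rewrite -nB B0 !mul0r big1 // => n _.
    by rewrite (nm_eq0 B0) /fi multr0 ?nm0 //; exact: issym_cel.
  have Bp : 0 < nm B' by rewrite lt_neqAle eq_sym B0 nm_ge0.
  have cp (A1 : X -> Y) (B1 : Y -> X) : bounded_linear A1 -> bounded_linear B1 ->
      mutually_inverse A1 B1 -> forall u, mutually_inverse (TXY u A1) (TYX u B1).
    by move=> h1 h2 h3; apply/(coup _ _ h1 h2).
  exact: (inverse_bound HYY r1 r2 cp hd BA AB Bp N0 hNs).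
have finB : (norm1N actYX N B <= (5 ^+ d * (opnorm B / epsA d (kappa A B) / 5 ^+ d))%:E)%E.
  exact/(norm1N_sumle B' _ N0).
have nonneg : (0 <= norm1N actYX N B)%E.
  rewrite (norm1N_esum B' N0); apply: mule_ge0; first by rewrite lee_fin ltW.
  by apply: esum_ge0 => n _; rewrite lee_fin nm_ge0.
have fin : norm1N actYX N B \is a fin_num.
  by rewrite ge0_fin_numE //; apply: le_lt_trans finB (ltry _).
(* The exact value of the norm at scale [N], and not its upper bound, gives the first inequality of
   the chain. *)
pose S := fine (norm1N actYX N B) / 5 ^+ d.
have SE : norm1N actYX N B = (5 ^+ d * S)%:E by rewrite /S mulrC mulfVK ?gt_eqF // fineK.
have hS : sumle (fun n => nm (fi N%:R n B')) S by apply/(norm1N_sumle B' _ N0); rewrite -SE.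
have h1 := scale_change N0 hS.
have le1 : (norm1N actYX 1 B <= (5 ^+ d * (((2 * N + 1) ^ d)%:R * S))%:E)%E.
  exact/(norm1N_sumle B' _ (ltn0Sn 0)).
split.
  rewrite /inW -[B]/((B' : BL Y X) : Y -> X) (Wnorm_gabor B').
  exact: gabor_of_sumle h1.
exists N; split => //; split; first by move=> K hK; apply: Nmin; apply/asboolP.
split.
  by rewrite SE -EFinM mulrCA.
have c0 : (0 <= (((2 * N + 1) ^ d)%:R : R)%:E)%E by rewrite lee_fin.
apply: le_trans (lee_wpmul2l c0 finB) _.
set q := opnorm B / _; rewrite -EFinM lee_fin.
have -> : 5 ^+ d * (q / 5 ^+ d) = q by rewrite mulrC mulfVK // gt_eqF.
by rewrite natrX natrD natrM mulrC.
Qed.
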